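(* Let $n\ge 1$, let $f$ be a Lipschitz function and let $p_M>0$ be such that $f(p)\le 0$ for all $p\ge p_M$. For each $m$ let $\rho_{in,m}$ be a non-negative function with $\rho_{in,m}\in L^1(\mathbb{R}^n)$ and $p_{in,m}:=\frac{m}{m-1}\rho_{in,m}^{m-1}\le p_M$ a.e. in $\mathbb{R}^n$. Let $(\rho_m,p_m)$ be the solution of $$\partial_t\rho_m-\mathrm{div}(\rho_m\nabla p_m)=\rho_m f(p_m),\quad p_m=\tfrac{m}{m-1}\rho_m^{m-1}\ \text{ in }\mathbb{R}^n\times(0,\infty),\qquad \rho_m(\cdot,0)=\rho_{in,m}.$$ Assume that the initial pressure satisfies $$\Delta p_{in,m}+f(p_{in,m})\chi_{\{p_{in,m}>0\}}\ge 0\quad\text{in }\mathbb{R}^n$$ for $m\ge m_0$. Then $p_m$ and $\rho_m$ are non-decreasing in time and, up to a subsequence, $p_m$ converges as $m\to\infty$ to $p_\infty$ strongly in $L^1_{loc}$ and a.e. in $\mathbb{R}^n\times(0,\infty)$. In particular, along a subsequence with also $\rho_m\rightharpoonup\rho_\infty$ weakly-$*$ in $L^\infty(\mathbb{R}^n\times(0,\infty))$, the weak-$*$ limit $g$ of $f(p_m)$ is $g=f(p_\infty)$; in other words, $(\rho_\infty,p_\infty)$ solves, in the sense of distributions, $$\partial_t\rho_\infty=\Delta p_\infty+\rho_\infty f(p_\infty)\ \text{ in }\mathbb{R}^n\times(0,\infty),\qquad \rho_\infty(\cdot,0)=\rho_{in}\ \text{ in }\mathbb{R}^n,$$ where $\rho_{in}$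 is the limit of $\rho_{in,m}$, together with the Hele-Shaw graph condition $p_\infty\in P_\infty(\rho_\infty)$.
   Context: For $m>1$, the solution of the equation means the unique non-negative weak (distributional) solution of the porous medium equation with reaction $\partial_t\rho=\Delta\rho^m+\rho f(\tfrac{m}{m-1}\rho^{m-1})$ (note $\rho\nabla p=\nabla\rho^m$), obtained as the limit of the smooth positive solutions with regularized initial data bounded below by $1/k$, $k\to\infty$. The comparison principle holds for this equation. The Hele-Shaw graph $P_\infty$ is: $P_\infty(\rho)=\{0\}$ if $\rho<1$, $P_\infty(\rho)=[0,\infty)$ if $\rho=1$, $P_\infty(\rho)=\{\infty\}$ if $\rho>1$; for bounded non-negative functions $p_\infty\in P_\infty(\rho_\infty)$ a.e. means $0\le\rho_\infty\le 1$, $p_\infty\ge 0$, $p_\infty(1-\rho_\infty)=0$ a.e. $\chi_A$ denotes the characteristic function of $A$. *)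

(* Defs.v *)
From HB Require Import structures.
From mathcomp Require Import all_boot all_order all_algebra.
From mathcomp Require Import all_classical all_reals all_analysis.

Set Implicit Arguments.
Unset Strict Implicit.
Unset Printing Implicit Defensive.
Import Order.TTheory GRing.Theory Num.Theory.
Import numFieldNormedType.Exports.
Local Open Scope classical_set_scope.
Local Open Scope ring_scope.

(* R^n is 'rV[R]_n with the sigma-algebra generated by the coordinates, exactly
   as the library does for n.-tuple; it is the Borel sigma-algebra. *)
Section rV_measurable.
Context {R : realType} (n : nat).

Let coor (i : 'I_n) (x : 'rV[R]_n) : R := x 0 i.

Let rV_set0 : g_sigma_preimage coor set0.
Proof. exact: sigma_algebra0. Qed.

Let rV_setC A : g_sigma_preimage coor A -> g_sigma_preimage coor (~` A).
Proof. exact: sigma_algebraC. Qed.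

Let rV_bigcup (F : (set 'rV[R]_n)^nat) :
  (forall i, g_sigma_preimage coor (F i)) ->
  g_sigma_preimage coor (\bigcup_i (F i)).
Proof. exact: sigma_algebra_bigcup. Qed.

HB.instance Definition _ :=
  @isMeasurable.Build (measure_tuple_display default_measure_display)
    'rV[R]_n (g_sigma_preimage coor) rV_set0 rV_setC rV_bigcup.

Lemma measurable_coor (i : 'I_n) : measurable_fun [set: 'rV[R]_n] (coor i).
Proof.
move=> _ Y mY; rewrite setTI; apply: sub_sigma_algebra => /=.
rewrite -bigcup_seq/=; exists i => /=; first by rewrite mem_index_enum.
by exists Y => //; rewrite setTI.
Qed.

Lemma measurable_fun_coorP d (T : measurableType d) (f : T -> 'rV[R]_n) :
  (forall i, measurable_fun [set: T] (fun t => f t 0 i)) ->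
  measurable_fun [set: T] f.
Proof.
move=> mf; have sub : g_sigma_preimage (fun i => coor i \o f) `<=` measurable.
  apply: smallest_sub; first exact: sigma_algebra_measurable.
  by rewrite -bigcup_seq/=; apply: bigcup_sub => i _ A [B mB <-]; exact: mf.
move=> _ A mA; rewrite setTI; apply: sub; rewrite g_sigma_preimage_comp.
by exists A => //; rewrite setTI.
Qed.

End rV_measurable.

Section lebesgue_rV.
Context {R : realType}.

Definition rV_snoc n (z : 'rV[R]_n * R) : 'rV[R]_n.+1 :=
  \row_i (if unlift ord_max i is Some j then z.1 0 j else z.2).

Lemma measurable_rV_snoc n : measurable_fun setT (@rV_snoc n).
Proof.
apply: measurable_fun_coorP => i; rewrite /rV_snoc.
under eq_fun do rewrite mxE.
case: (unliftP ord_max i) => [j|] _.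
  exact: (measurableT_comp (measurable_coor j) measurable_fst).
exact: measurable_snd.
Qed.

Section succ.
Context n (mu : {measure set 'rV[R]_n -> \bar R}).

Definition lebesgue_rVS : set 'rV[R]_n.+1 -> \bar R :=
  pushforward (mu \x @lebesgue_measure R)%E (@rV_snoc n).

Let pf : {measure set 'rV[R]_n.+1 -> \bar R} :=
  measure_function_pushforward__canonical__measure_function_Measure
    (mu \x @lebesgue_measure R)%E (@measurable_rV_snoc n).

HB.instance Definition _ := isMeasure.Build _ _ _ lebesgue_rVS
  (measure0 pf) (measure_ge0 pf) (@measure_semi_sigma_additive _ _ _ pf).

End succ.

Fixpoint lebesgue_rV n : {measure set 'rV[R]_n -> \bar R} :=
  match n with
  | 0%N => @dirac _ _ (0 : 'rV[R]_0) R
  | n'.+1 => lebesgue_rVS (lebesgue_rV n')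
  end.

Lemma lebesgue_rV_box n (a b : 'rV[R]_n) : (forall i, a 0 i <= b 0 i) ->
  lebesgue_rV n [set x : 'rV[R]_n | forall i, a 0 i <= x 0 i <= b 0 i] =
  (\prod_(i < n) (b 0 i - a 0 i))%:E.
Proof.
elim: n a b => [|n IH] a b ab.
  by rewrite big_ord0 /= diracE mem_set// => -[].
pose a' : 'rV[R]_n := \row_i a 0 (lift ord_max i).
pose b' : 'rV[R]_n := \row_i b 0 (lift ord_max i).
have lmE (i : 'I_n) : lift ord_max i = widen_ord (leqnSn n) i.
  by apply/val_inj; rewrite /= /bump leqNgt ltn_ord.
have boxE : @rV_snoc n @^-1` [set x : 'rV[R]_n.+1 | forall i, a 0 i <= x 0 i <= b 0 i] =
    [set x : 'rV[R]_n | forall i, a' 0 i <= x 0 i <= b' 0 i] `*`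
    `[a 0 ord_max, b 0 ord_max]%classic.
  apply/seteqP; split=> [[x t]|[x t]] /=.
    move=> h; split=> [i|]; last first.
      by have := h ord_max; rewrite !mxE unlift_none in_itv.
    by have := h (lift ord_max i); rewrite !mxE liftK.
  move=> [h ht] i; rewrite !mxE; case: unliftP => [j|] -> /=.
    by have := h j; rewrite !mxE.
  by move: ht; rewrite in_itv.
transitivity ((lebesgue_rV n \x @lebesgue_measure R)%E
    ([set x : 'rV[R]_n | forall i, a' 0 i <= x 0 i <= b' 0 i] `*`
    `[a 0 ord_max, b 0 ord_max]%classic)); first by rewrite -boxE.
rewrite product_measure1E//; last first.
  rewrite (_ : [set _ | _] = \bigcap_(i in [set: 'I_n])
      (fun x : 'rV[R]_n => x 0 i) @^-1` `[a' 0 i, b' 0 i]%classic); last first.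
    apply/seteqP; split=> [x h i _|x h i] /=; first by rewrite in_itv/=.
    by have /= := h i I; rewrite in_itv.
  apply: fin_bigcap_measurable; first exact: finite_finset.
  move=> i _; rewrite -[X in measurable X]setTI; apply: measurable_coor => //.
rewrite IH => [|i]; last by rewrite !mxE.
have := lebesgue_measure_itv `[a 0 ord_max, b 0 ord_max].
rewrite /= => ->; rewrite lte_fin big_ord_recr/=.
under eq_bigr do rewrite !mxE lmE.
have := ab ord_max; rewrite le_eqVlt => /predU1P[->|abm].
  by rewrite ltxx mule0 subrr mulr0.
by rewrite abm -EFinB -EFinM.
Qed.

End lebesgue_rV.

Section functions.
Context {R : realType}.

(* 'C^k' for every k: all iterated directional derivatives exist and are
   continuous, which in finite dimension is the usual notion *)
Fixpoint is_Ck (V : normedModType R) (k : nat) (g : V -> R) : Prop :=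
  continuous g /\
  if k is k'.+1 then
    forall v, (forall x, derivable g x v) /\ is_Ck k' ('D_v g)
  else True.

Definition test_function (V : normedModType R) (phi : V -> R) : Prop :=
  (forall k, is_Ck k phi) /\ compact (closure [set x | phi x != 0]).

Section measure.
Context d (T : measurableType d) (mu : {measure set T -> \bar R}).
Implicit Types (D : set T) (u : T -> R).

Definition Linfty D u : Prop :=
  measurable_fun D u /\
  exists M : R, {ae mu, forall x, D x -> `|u x| <= M}.

Definition L1_cvg D (u_ : nat -> T -> R) u : Prop :=
  [/\ forall k, mu.-integrable D (EFin \o u_ k),
      mu.-integrable D (EFin \o u) &
      (\int[mu]_(x in D) `|u_ k x - u x|%:E)%E @[k --> \oo] --> 0%E].

Definition ae_cvg D (u_ : nat -> T -> R) u : Prop :=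
  {ae mu, forall x, D x -> u_ k x @[k --> \oo] --> u x}.

Definition weakstar_cvg D (u_ : nat -> T -> R) u : Prop :=
  [/\ forall k, Linfty D (u_ k), Linfty D u &
      forall psi : T -> R, mu.-integrable D (EFin \o psi) ->
        (\int[mu]_(x in D) (u_ k x * psi x))%R @[k --> \oo] -->
        (\int[mu]_(x in D) (u x * psi x))%R].

End measure.
End functions.

Section porous_medium.
Context {R : realType} {n : nat}.
Notation X := 'rV[R]_n.
(* The time axis is written 'measurableTypeR R', which unfolds to R, because this
   is the measurable type on which 'lebesgue_measure' is defined; norm and
   topology are those of 'rV[R]_n * R. *)
Notation XT := ('rV[R]_n * measurableTypeR R)%type.

Definition space_measure : {measure set X -> \bar R} := lebesgue_rV n.
Definition space_time_measure : {measure set XT -> \bar R} :=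
  (lebesgue_rV n \x @lebesgue_measure R)%E.

Definition space_time : set XT := [set z | 0 < z.2].
Definition space_time_closed : set XT := [set z | 0 <= z.2].

Definition space_laplacian (g : X -> R) (x : X) : R :=
  \sum_(i < n) 'D_(delta_mx 0 i) ('D_(delta_mx 0 i) g) x.

Definition dt (u : XT -> R) : XT -> R := 'D_((0 : X), (1 : R)) u.
Definition dx (i : 'I_n) (u : XT -> R) : XT -> R :=
  'D_((delta_mx 0 i : X), (0 : R)) u.
Definition laplacian (u : XT -> R) (z : XT) : R := \sum_(i < n) dx i (dx i u) z.

Definition L1loc_cvg (u_ : nat -> XT -> R) (u : XT -> R) : Prop :=
  forall K, compact K -> K `<=` space_time -> L1_cvg space_time_measure K u_ u.

(* 'd_t rho = Delta q + s' in the sense of distributions in R^n x (0, oo), with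
   initial value 'rho0': the test functions do not vanish at t = 0. *)
Definition distributional_solution (rho0 : X -> R) (rho q s : XT -> R) : Prop :=
  forall phi : XT -> R, test_function phi ->
    \int[space_time_measure]_(z in space_time)
      (rho z * dt phi z + q z * laplacian phi z + s z * phi z)
    + \int[space_measure]_x (rho0 x * phi (x, 0)) = 0.

Definition pressure (m r : R) : R := m / (m - 1) * r `^ (m - 1).

(* C^{2,1} is the regularity of a smooth solution when f is merely Lipschitz. *)
Definition is_C21 (u : XT -> R) : Prop :=
  forall z, space_time z ->
    [/\ derivable u z ((0 : X), (1 : R)), {for z, continuous (dt u)} &
      forall i, [/\ derivable u z ((delta_mx 0 i : X), (0 : R)),
        {for z, continuous (dx i u)} &
        forall j, derivable (dx i u) z ((delta_mx 0 j : X), (0 : R)) /\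
          {for z, continuous (dx j (dx i u))}]].

Definition smooth_positive_solution (f : R -> R) (m : R) (u : XT -> R) : Prop :=
  [/\ {within space_time_closed, continuous u},
      forall z, space_time_closed z -> 0 < u z,
      is_C21 u &
      forall z, space_time z ->
        dt u z = laplacian (fun y => u y `^ m) z + u z * f (pressure m (u z))].

(* The uniform bound M is what the maximum principle gives for bounded
   regularized data, since f <= 0 beyond p_M; it excludes solutions with growth
   at infinity, for which the Cauchy problem is not well-posed. *)
Definition limit_of_smooth_positive_solutions (f : R -> R) (m : R)
    (rho0 : X -> R) (rho : XT -> R) : Prop :=
  exists (u : nat -> XT -> R) (M : R),
    [/\ forall k, smooth_positive_solution f m (u k),
        forall k z, space_time_closed z -> u k z <= M,
        forall k x, k.+1%:R^-1 <= u k (x, 0),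
        forall K : set X, compact K ->
          L1_cvg space_measure K (fun k x => u k (x, 0)) rho0 &
        L1loc_cvg u rho].

Definition pme_solution (f : R -> R) (m : R) (rho0 : X -> R) (rho : XT -> R) :
    Prop :=
  [/\ Linfty space_time_measure space_time rho,
      {ae space_time_measure, forall z, space_time z -> 0 <= rho z},
      distributional_solution rho0 rho (fun z => rho z `^ m)
        (fun z => rho z * f (pressure m (rho z))) &
      limit_of_smooth_positive_solutions f m rho0 rho].

(* 'Delta p + f(p) chi_{p > 0} >= 0' in the sense of distributions in R^n *)
Definition stationary_pressure_subsolution (f : R -> R) (p : X -> R) : Prop :=
  forall phi : X -> R, test_function phi -> (forall x, 0 <= phi x) ->
    0 <= \int[space_measure]_x
      (p x * space_laplacian phi x + f (p x) * \1_[set y | 0 < p y] x * phi x).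

(* A function on R^n x (0, oo) is an a.e. class, so that 'non-decreasing in
   time' is expressed with time shifts; 'u0' is its value at time 0. *)
Definition nondecreasing_in_time (u0 : X -> R) (u : XT -> R) : Prop :=
  {ae space_time_measure, forall z, space_time z -> u0 z.1 <= u z} /\
  forall h : R, 0 < h ->
    {ae space_time_measure, forall z, space_time z -> u z <= u (z.1, z.2 + h)}.

Definition hele_shaw_graph (r : R) : set (\bar R) :=
  if r < 1 then [set 0%E]
  else if r == 1 then [set y | (0 <= y)%E /\ (y < +oo)%E]
  else [set +oo%E].

Lemma hele_shaw_graphP (r p : R) :
  hele_shaw_graph r p%:E <-> [/\ r <= 1, 0 <= p & p * (1 - r) = 0].
Proof.
rewrite /hele_shaw_graph; case: ltgtP => [r1|r1|->] /=.
- split=> [[->]|[_ _ /eqP]]; first by rewrite mul0r.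
  by rewrite mulf_eq0 subr_eq0 (gt_eqF r1) orbF => /eqP ->.
- by split=> [|[]].
- by rewrite subrr mulr0 ltry lee_fin; split=> [[]|[]].
Qed.

Definition in_hele_shaw_graph (rho p : XT -> R) : Prop :=
  {ae space_time_measure, forall z, space_time z ->
    0 <= rho z /\ hele_shaw_graph (rho z) (p z)%:E}.

End porous_medium.

(* Main.v *)
Require Import Defs.
From HB Require Import structures.
From mathcomp Require Import all_boot all_order all_algebra.
From mathcomp Require Import all_classical all_reals all_analysis.
From mathcomp Require Import measurable_realfun ring lra.

Set Implicit Arguments.
Unset Strict Implicit.
Unset Printing Implicit Defensive.
Import Order.TTheory GRing.Theory Num.Theory.
Import numFieldNormedType.Exports.
Local Open Scope classical_set_scope.
Local Open Scope ring_scope.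

(** Fix m. The hypothesis on the initial pressure makes the initial density a
    stationary subsolution, so comparison gives rho(t) >= rho_in; comparing
    rho(. + h) with rho then gives monotonicity in time. The comparison principle
    is an L^1 estimate for the smooth approximations: with difference quotients
    in place of the Laplacian, Kato's inequality needs no smoothing, and weights
    whose Laplacian they dominate up to a vanishing error absorb the diffusion,
    leaving a Gronwall inequality.

    For compactness, testing d_t p = (m-1) p (Delta p + f(p)) + |grad p|^2 with a
    cut-off bounds |grad p_m|^2 in L^1_loc uniformly in m, while monotonicity and
    the bound p_m <= p_M control the time translations. Hence the p_m are
    equicontinuous under translation in L^1_loc, and for such a family weak-*
    convergence is strong. Then rho_m p_m converges weakly to rho p and, since
    (m-1) p_m (1 - rho_m) <= 1 and sup rho_m tends to 1, also a.e. to p, which is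
    the graph relation; rho_m^m = (m-1)/m rho_m p_m has the same limit. All other
    terms of the equation converge, so the integrals of rho_in,m against test
    functions converge as well, and L^1-duality provides rho_in. *)

(** * Lebesgue measure on boxes and real-valued integrals *)

(** A solution is known only as an $L^1_{loc}$ limit of smooth positive functions with a common
    upper bound; nothing controls their derivatives near infinity or near t = 0, nor a positive
    lower bound uniform in k. Every comparison is therefore localized by a weight phi with Laplacian
    at most phi + delta on a box Q, with constants that depend only on m, f and the upper bound;
    delta |Q| vanishes as Q exhausts the space. As m is fixed there, dependence on m is harmless.
    Uniformity in m comes from the energy identity, whose left side carries the factor m - 2 and
    whose right side grows like m - 1, whence the restriction m >= 3. It is available for the
    approximations only, and their upper bound may exceed p_M; the bound by p_M is used on the limit
    of the right side. Zero-order translation differences pass to that limit, so a gradient of the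
    limit never has to be defined. As f is merely Lipschitz, the equation is not differentiated, and
    time regularity rests on monotonicity alone. The density bound max(1, p_M)^(1/(m-1)) is what
    tends to 1. *)

Section measure_preserving.
Context d d' (T : measurableType d) (T' : measurableType d') (R : realType).
Variables (mu : {measure set T -> \bar R}) (nu : {measure set T' -> \bar R}).
Variables (phi : T -> T') (mphi : measurable_fun setT phi).
Hypothesis mu_phi : forall A, measurable A -> mu (phi @^-1` A) = nu A.

Let pf : {measure set T' -> \bar R} :=
  measure_function_pushforward__canonical__measure_function_Measure mu mphi.

Lemma ge0_integral_mp (f : T' -> \bar R) : measurable_fun setT f ->
  (forall y, 0 <= f y)%E ->
  (\int[nu]_y f y = \int[mu]_x f (phi x))%E.
Proof.
move=> mf f0.
rewrite (@eq_measure_integral _ _ _ _ pf nu)//.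
  by rewrite ge0_integral_pushforward.
by move=> A mA _; rewrite -mu_phi.
Qed.

Lemma integrable_mp (f : T' -> R) : nu.-integrable setT (EFin \o f) ->
  mu.-integrable setT (EFin \o (f \o phi)).
Proof.
move=> /integrableP[mf foo]; apply/integrableP; split.
  exact: (measurableT_comp mf mphi).
by rewrite -(@ge0_integral_mp (fun y => `|(f y)%:E|%E))//; exact: measurableT_comp.
Qed.

Lemma Rintegral_mp (f : T' -> R) : measurable_fun setT f ->
  \int[nu]_y f y = \int[mu]_x f (phi x).
Proof.
move=> mf; rewrite /Rintegral; congr fine.
have mg : measurable_fun setT (EFin \o f) by exact/measurable_EFinP.
rewrite integralE [RHS]integralE; congr (_ - _)%E.
  by rewrite (@ge0_integral_mp ((EFin \o f)^\+)%E)//; [by apply: eq_integral => x _; rewrite ?funeposE ?funenegE|exact: measurable_funepos].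
by rewrite (@ge0_integral_mp ((EFin \o f)^\-)%E)//; [by apply: eq_integral => x _; rewrite ?funeposE ?funenegE|exact: measurable_funeneg].
Qed.

End measure_preserving.

Section boxes.
Context {R : realType}.
Implicit Type n : nat.

Definition cbox n (a b : 'rV[R]_n) : set 'rV[R]_n :=
  [set x | forall i, a 0 i <= x 0 i <= b 0 i].

Definition ball_box n (r : R) : set 'rV[R]_n := cbox (const_mx (- r)) (const_mx r).

Lemma measurable_cbox n (a b : 'rV[R]_n) : measurable (cbox a b).
Proof.
rewrite (_ : cbox a b = \bigcap_(i in [set: 'I_n])
    (fun x : 'rV[R]_n => x 0 i) @^-1` `[a 0 i, b 0 i]%classic); last first.
  apply/seteqP; split=> [x h i _|x h i] /=; first by rewrite in_itv/=.
  by have /= := h i I; rewrite in_itv.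
apply: fin_bigcap_measurable; first exact: finite_finset.
move=> i _; rewrite -[X in measurable X]setTI; exact: measurable_coor.
Qed.

Lemma cboxI n (a b a' b' : 'rV[R]_n) : cbox a b `&` cbox a' b' =
  cbox (\row_i Num.max (a 0 i) (a' 0 i)) (\row_i Num.min (b 0 i) (b' 0 i)).
Proof.
apply/seteqP; split=> [x [h h'] i|x h].
  have /andP[h1 h2] := h i; have /andP[h3 h4] := h' i.
  by rewrite !mxE ge_max le_min h1 h2 h3 h4.
by split=> i; have := h i; rewrite !mxE ge_max le_min =>
  /andP[/andP[h1 h2] /andP[h3 h4]]; apply/andP.
Qed.

Lemma ball_boxP n (r : R) (x : 'rV[R]_n) : ball_box r x <-> forall i, `|x 0 i| <= r.
Proof. by split=> h i; have := h i; rewrite !mxE ler_norml. Qed.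

Lemma ball_box_norm n (r : R) (x : 'rV[R]_n) : `|x| <= r -> ball_box r x.
Proof.
move=> xr; apply/ball_boxP => i; apply: le_trans xr.
rewrite /Num.norm/= mx_normrE.
exact: (le_bigmax _ (fun ij : 'I_1 * 'I_n => `|x ij.1 ij.2|) (0, i)).
Qed.

Lemma norm_ball_box n (r : R) (x : 'rV[R]_n) : 0 <= r -> ball_box r x -> `|x| <= r.
Proof.
move=> r0 /ball_boxP h; rewrite /Num.norm/= mx_normrE; apply/bigmax_leP.
by split=> // -[i j] _ /=; rewrite ord1.
Qed.

Lemma bigcup_ball_box n : \bigcup_k @ball_box n k%:R = setT.
Proof.
apply/seteqP; split=> // x _.
exists (Num.trunc `|x|).+1 => //; apply: ball_box_norm.
by rewrite ltW// truncnS_gt.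
Qed.

Definition cboxes n : set (set 'rV[R]_n) := [set A | exists a b, A = cbox a b].

Lemma cboxes_setI n : setI_closed (@cboxes n).
Proof. by move=> _ _ [a [b ->]] [a' [b' ->]]; rewrite cboxI; do 2 eexists. Qed.

(** Each half-space [x 0 i >= c] is a countable union of closed boxes, and these are stable under
    intersection ([cboxes_setI]). Uniqueness of measures and Dynkin's lemma can thus be applied to
    boxes, whose volume is explicit. *)
Lemma measurable_cboxes n : measurable = <<s @cboxes n >>.
Proof.
apply/seteqP; split; last first.
  apply: smallest_sub; first exact: sigma_algebra_measurable.
  by move=> _ [a [b ->]]; exact: measurable_cbox.
apply: smallest_sub; first exact: smallest_sigma_algebra.
rewrite -bigcup_seq/=; apply: bigcup_sub => i _.
suff mi : measurable_fun (setT : set (g_sigma_algebraType (@cboxes n)))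
    (fun x : 'rV[R]_n => x 0 i).
  by move=> A [B mB <-]; exact: mi.
apply: (measurability _ (@RGenCInfty.measurableE R)).
move=> _ [_ [c ->] <-]; rewrite setTI.
rewrite (_ : _ @^-1` _ = \bigcup_k cbox
    (\row_j (if j == i then c else - k%:R)) (const_mx k%:R)).
  apply: bigcupT_measurable => k; apply: sub_sigma_algebra.
  by do 2 eexists.
apply/seteqP; split=> [x /=|x [k _ /= /(_ i)]].
  rewrite in_itv/= andbT => cx.
  have : (setT : set 'rV[R]_n) x by [].
  rewrite -bigcup_ball_box => -[k _ /ball_boxP h]; exists k => // j.
  rewrite !mxE; have := h j; rewrite ler_norml => /andP[h1 h2].
  by rewrite h2 andbT; case: eqP => [->|_].
by rewrite !mxE eqxx in_itv/= andbT => /andP[].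
Qed.

End boxes.

Section sigma_finite_pack.
Context d (T : measurableType d) (R : realType).
Variables (mu : {measure set T -> \bar R}) (mu_sf : sigma_finite setT mu).

(** Tonelli's theorem and the Radon-Nikodym theorem ask for a sigma-finite measure structure,
    whereas the fixpoint [lebesgue_rV] only carries that of a measure. The copy unfolds to the
    original, so that results transfer by conversion. *)
Definition sigma_finite_copy of sigma_finite setT mu : set T -> \bar R := mu.

HB.instance Definition _ := isMeasure.Build _ _ _ (sigma_finite_copy mu_sf)
  (measure0 mu) (measure_ge0 mu) (@measure_semi_sigma_additive _ _ _ mu).

HB.instance Definition _ :=
  Measure_isSigmaFinite.Build _ _ _ (sigma_finite_copy mu_sf) mu_sf.

End sigma_finite_pack.

Section lebesgue_rV.
Context {R : realType}.
Implicit Type n : nat.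

Lemma lebesgue_cbox n (a b : 'rV[R]_n) : lebesgue_rV n (cbox a b) =
  if [forall i, a 0 i <= b 0 i] then (\prod_(i < n) (b 0 i - a 0 i))%:E else 0%E.
Proof.
case: ifPn => [/forallP|/forallPn[i]].
  exact: lebesgue_rV_box.
rewrite -ltNge => ba; rewrite (_ : cbox a b = set0) ?measure0//.
rewrite -subset0 => x /(_ i) /andP[h1 h2].
by have := le_trans h1 h2; rewrite leNgt ba.
Qed.

Lemma lebesgue_cbox_lty n (a b : 'rV[R]_n) : (lebesgue_rV n (cbox a b) < +oo)%E.
Proof. by rewrite lebesgue_cbox; case: ifP => _; rewrite ltry. Qed.

(** Both sides are measures in [A], and they agree on boxes because a translation preserves the side
    lengths. *)
Lemma lebesgue_rV_translate n (y : 'rV[R]_n) (A : set 'rV[R]_n) : measurable A ->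
  lebesgue_rV n ((fun x => x + y) @^-1` A) = lebesgue_rV n A.
Proof.
have mt : measurable_fun setT (fun x : 'rV[R]_n => x + y).
  apply: measurable_fun_coorP => i; under eq_fun do rewrite mxE.
  by apply: measurable_funD => //; exact: measurable_coor.
pose pf : {measure set 'rV[R]_n -> \bar R} :=
  measure_function_pushforward__canonical__measure_function_Measure
    (lebesgue_rV n) mt.
move=> mA; apply: (measure_unique (@cboxes R n) (fun k => @ball_box R n k%:R)
  (measurable_cboxes n) _ _ _ pf (lebesgue_rV n)) => //.
- exact: cboxes_setI.
- by move=> i; do 2 eexists.
- exact: bigcup_ball_box.
- move=> _ [a [b ->]] /=; rewrite /pushforward.
  rewrite (_ : _ @^-1` _ = cbox (a - y) (b - y)).
    rewrite !lebesgue_cbox; congr (if _ then _ else _).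
      by apply: eq_forallb => i; rewrite !mxE lerD2r.
    by congr EFin; apply: eq_bigr => i _; rewrite !mxE opprB addrA subrK.
  by apply/seteqP; split=> x /= h i; have := h i; rewrite !mxE lerBlDr lerBrDr.
- move=> k /=; rewrite /pushforward.
  rewrite (_ : _ @^-1` _ = cbox (const_mx (- k%:R) - y) (const_mx k%:R - y)).
    exact: lebesgue_cbox_lty.
  by apply/seteqP; split=> x /= h i; have := h i; rewrite !mxE lerBlDr lerBrDr.
Qed.

Lemma lebesgue_rV_sigma_finite n : sigma_finite setT (@lebesgue_rV R n).
Proof.
exists (fun k => @ball_box R n k%:R); first by rewrite bigcup_ball_box.
by move=> k; split; [exact: measurable_cbox|exact: lebesgue_cbox_lty].
Qed.

Definition lebesgue_rV_sf n : {sigma_finite_measure set 'rV[R]_n -> \bar R} :=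
  sigma_finite_copy (@lebesgue_rV_sigma_finite n).

End lebesgue_rV.

Section topology_rV.
Context {R : realType}.
Implicit Type n : nat.

Lemma lipschitz_bound_continuous (V W : normedModType R) (k : R) (g : V -> W) :
  (forall x y, `|g x - g y| <= k * `|x - y|) -> continuous g.
Proof.
move=> gk x; apply/cvgrPdist_lt => e e0.
have k0 : 0 < `|k| + 1 by rewrite ltr_wpDl.
near=> y; apply: le_lt_trans (gk _ _) _.
apply: (@le_lt_trans _ _ ((`|k| + 1) * `|x - y|)).
  by apply: ler_wpM2r => //; rewrite (le_trans (ler_norm _))// lerDl.
rewrite -ltr_pdivlMl//; near: y; apply: cvgr_dist_lt => //.
by rewrite mulr_gt0// invr_gt0.
Unshelve. all: by end_near. Qed.

(** This links the norm topology to the coordinate sigma-algebra: an open set is the union of the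
    countably many boxes with rational corners that it contains. *)
Lemma open_measurable_rV n (U : set 'rV[R]_n) : open U -> measurable U.
Proof.
move=> oU.
pose F (q : 'rV[rat]_n * 'rV[rat]_n) : set 'rV[R]_n :=
  let B := cbox (map_mx ratr q.1) (map_mx ratr q.2) in
  if `[< B `<=` U >] then B else set0.
suff -> : U = \bigcup_q F q.
  apply: countable_bigcupT_measurable => // q; rewrite /F; case: ifP => _ //.
  exact: measurable_cbox.
apply/seteqP; split=> [x Ux|x [q _]]; last first.
  by rewrite /F; case: ifPn => // /asboolP; apply.
have [e/= e0 eU] := (nbhs_ballP _ _).1 (open_nbhs_nbhs (conj oU Ux)).
have qlo i : {q : rat | ratr q \in `]x 0 i - e / 2, x 0 i[}.
  by apply/cid/rat_in_itvoo; rewrite ltrBlDr ltrDl divr_gt0.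
have qhi i : {q : rat | ratr q \in `]x 0 i, x 0 i + e / 2[}.
  by apply/cid/rat_in_itvoo; rewrite ltrDl divr_gt0.
exists (\row_i sval (qlo i), \row_i sval (qhi i)) => //.
rewrite /F; set B := cbox _ _.
have BU : B `<=` U.
  move=> y By; apply: eU; rewrite -ball_normE /=.
  apply: (@le_lt_trans _ _ (e / 2)); last by rewrite ltr_pdivrMr// ltr_pMr// ltr1n.
  apply: norm_ball_box; first by rewrite divr_ge0// ltW.
  apply/ball_boxP => i; rewrite !mxE; have := By i; rewrite !mxE.
  case: (qlo i) => /= p; case: (qhi i) => /= q.
  rewrite !in_itv/= ler_norml => /andP[h1 h2] /andP[h3 h4] /andP[h5 h6].
  by apply/andP; split; lra.
case: asboolP => // _ i; rewrite !mxE.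
case: (qlo i) => /= p; case: (qhi i) => /= q.
by rewrite !in_itv/= => /andP[h1 h2] /andP[h3 h4]; rewrite !ltW.
Qed.

Lemma continuous_measurable_rV n (g : 'rV[R]_n -> R) : continuous g ->
  measurable_fun setT g.
Proof.
move=> cg; apply: (measurability _ (@RGenOpens.measurableE R)).
move=> _ [_ [a [b ->]] <-]; rewrite setTI; apply: open_measurable_rV.
by apply: open_comp; [move=> x _; exact: cg|exact: interval_open].
Qed.

End topology_rV.

Section snoc.
Context {R : realType} {n : nat}.
Notation X := 'rV[R]_n.
Notation XT := ('rV[R]_n * measurableTypeR R)%type.

(** Inverse of [rV_snoc]. Translation invariance, measurability of continuous functions and
    weak-star compactness are proved once for [lebesgue_rV] in every dimension and carried to
    space-time through this identification with dimension n + 1. *)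
Definition rV_unsnoc (w : 'rV[R]_n.+1) : XT :=
  (\row_i w 0 (lift ord_max i), w 0 ord_max).

Lemma rV_snocK (z : XT) : rV_unsnoc (rV_snoc z) = z.
Proof.
case: z => x t; rewrite /rV_unsnoc /rV_snoc; congr pair.
  by apply/rowP => i; rewrite !mxE liftK.
by rewrite mxE unlift_none.
Qed.

Lemma rV_unsnocK (w : 'rV[R]_n.+1) : rV_snoc (rV_unsnoc w) = w.
Proof.
apply/rowP => i; rewrite !mxE /rV_unsnoc.
by case: unliftP => [j|] -> /=; rewrite ?mxE.
Qed.

Lemma measurable_rV_unsnoc : measurable_fun setT rV_unsnoc.
Proof.
apply/measurable_fun_pairP; split; last exact: measurable_coor.
apply: measurable_fun_coorP => i; rewrite /rV_unsnoc /comp/=.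
by under eq_fun do rewrite mxE; exact: measurable_coor.
Qed.

Lemma space_time_unsnoc (A : set XT) : measurable A ->
  lebesgue_rV n.+1 (rV_unsnoc @^-1` A) = space_time_measure A.
Proof.
move=> mA; rewrite /= /lebesgue_rVS /pushforward /space_time_measure/=; congr (_ _).
by apply/seteqP; split=> z /=; rewrite rV_snocK.
Qed.

Lemma space_time_snoc (A : set 'rV[R]_n.+1) :
  space_time_measure (@rV_snoc R n @^-1` A) = lebesgue_rV n.+1 A.
Proof. by []. Qed.

Lemma space_time_translate (y : X) (s : R) (A : set XT) : measurable A ->
  space_time_measure ((fun z : XT => (z.1 + y, z.2 + s)) @^-1` A) =
  space_time_measure A.
Proof.
move=> mA.
have mt : measurable_fun setT (fun z : XT => ((z.1 + y, z.2 + s) : XT)).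
  apply/measurable_fun_pairP; split; rewrite /comp/=; last exact: measurable_funD.
  apply: measurable_fun_coorP => i; under eq_fun do rewrite mxE.
  apply: measurable_funD => //.
  exact: (measurableT_comp (measurable_coor i) measurable_fst).
rewrite -!space_time_unsnoc//; last by rewrite -[X in measurable X]setTI; exact: mt.
rewrite -[RHS](@lebesgue_rV_translate _ _ (rV_snoc (y, s))); last first.
  by rewrite -[X in measurable X]setTI; exact: measurable_rV_unsnoc.
congr (lebesgue_rV n.+1 _); apply/seteqP; split=> w /=; rewrite /rV_unsnoc/=.
  rewrite !mxE unlift_none/= (_ : \row__ _ + y = \row_i (w + rV_snoc (y, s)) 0 (lift ord_max i))//.
  by apply/rowP => i; rewrite !mxE liftK.
rewrite !mxE unlift_none/= (_ : \row__ _ + y = \row_i (w + rV_snoc (y, s)) 0 (lift ord_max i))//.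
by apply/rowP => i; rewrite !mxE liftK.
Qed.

Lemma norm_coor m (x : 'rV[R]_m) i : `|x 0 i| <= `|x|.
Proof. by have /ball_boxP := ball_box_norm (lexx `|x|). Qed.

Lemma rV_unsnoc_continuous : continuous (rV_unsnoc : 'rV[R]_n.+1 -> 'rV[R]_n * R).
Proof.
apply: (@lipschitz_bound_continuous _ _ _ 1) => w w'; rewrite mul1r.
rewrite prod_normE/= ge_max; apply/andP; split.
  apply: norm_ball_box => //; apply/ball_boxP => i; rewrite !mxE.
  by have := norm_coor (w - w') (lift ord_max i); rewrite !mxE.
by have := norm_coor (w - w') ord_max; rewrite !mxE.
Qed.

Lemma continuous_measurable_space_time (g : XT -> R) :
  continuous (g : 'rV[R]_n * R -> R) -> measurable_fun setT g.
Proof.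
move=> cg; rewrite (_ : g = (g \o rV_unsnoc) \o (@rV_snoc R n)); last first.
  by apply/funext => z /=; rewrite rV_snocK.
apply: measurableT_comp; last exact: measurable_rV_snoc.
apply: continuous_measurable_rV => w.
apply: continuous_comp; [exact: rV_unsnoc_continuous|exact: cg].
Qed.

End snoc.

Section real_integral.
Context d (T : measurableType d) (R : realType) (mu : {measure set T -> \bar R}).
Implicit Types f g h : T -> R.

Definition intg f := mu.-integrable setT (EFin \o f).

Lemma intg_measurable f : intg f -> measurable_fun setT f.
Proof. by move=> /(measurable_int mu)/measurable_EFinP. Qed.

Lemma intg_dom g f : measurable_fun setT f -> intg g ->
  (forall x, `|f x| <= g x) -> intg f.
Proof.
move=> mf ig fg; apply: (le_integrable measurableT _ _ ig).
  exact/measurable_EFinP.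
by move=> x _ /=; rewrite lee_fin (le_trans (fg x))// ler_norm.
Qed.

Lemma intgD f g : intg f -> intg g -> intg (fun x => f x + g x).
Proof. by move=> If Ig; exact: (integrableD measurableT If Ig). Qed.

Lemma intgB f g : intg f -> intg g -> intg (fun x => f x - g x).
Proof. by move=> If Ig; exact: (integrableB measurableT If Ig). Qed.

Lemma intgZ c f : intg f -> intg (fun x => c * f x).
Proof. by move=> If; have := integrableZl measurableT c If. Qed.

Lemma intg0 : intg (fun=> 0).
Proof. exact: integrable0. Qed.

Lemma intg_norm f : intg f -> intg (fun x => `|f x|).
Proof. by move=> If; exact: integrable_norm. Qed.

Lemma intg_sum (I : Type) (r : seq I) (F : I -> T -> R) :
  (forall i, intg (F i)) -> intg (fun x => \sum_(i <- r) F i x).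
Proof.
move=> h; elim: r => [|i r IH].
  by under eq_fun do rewrite big_nil; exact: intg0.
by under eq_fun do rewrite big_cons; exact: intgD.
Qed.

Lemma intgM_bounded (M : R) f g : intg f -> measurable_fun setT g ->
  (forall x, `|g x| <= M) -> intg (fun x => g x * f x).
Proof.
move=> If mg gM; apply: (@intg_dom (fun x => M * `|f x|)).
- by apply: measurable_funM => //; exact: intg_measurable.
- by apply: intgZ; exact: intg_norm.
- by move=> x; rewrite normrM ler_wpM2r.
Qed.

Lemma intg_indic A : measurable A -> (mu A < +oo)%E -> intg (\1_A).
Proof.
move=> mA Aoo; apply/integrableP; split; first exact/measurable_EFinP/measurable_indic.
under eq_integral do rewrite /= ger0_norm//.
by rewrite integral_indic// setIT.
Qed.

Lemma intg_supp (M : R) A f : measurable A -> (mu A < +oo)%E ->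
  measurable_fun setT f -> (forall x, `|f x| <= M) ->
  (forall x, ~ A x -> f x = 0) -> intg f.
Proof.
move=> mA Aoo mf fM f0; apply: (@intg_dom (fun x => M * \1_A x)) => //.
  by apply: intgZ; exact: intg_indic.
move=> x; have [Ax|nAx] := pselect (A x).
  by rewrite indicE mem_set// mulr1.
by rewrite indicE memNset//= mulr0 f0// normr0.
Qed.

Lemma int_fineK f : intg f -> (\int[mu]_x (f x)%:E)%E = (\int[mu]_x f x)%:E.
Proof. by move=> If; rewrite /Rintegral fineK//; exact: integrable_fin_num. Qed.

Lemma eq_int g f : (forall x, f x = g x) -> \int[mu]_x f x = \int[mu]_x g x.
Proof. by move=> fg; apply: eq_Rintegral => x _; exact: fg. Qed.

Lemma int_norm_le f : intg f -> `|\int[mu]_x f x| <= \int[mu]_x `|f x|.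
Proof. by move=> If; exact: le_normr_Rintegral. Qed.

Lemma int_le f g : intg f -> intg g -> (forall x, f x <= g x) ->
  \int[mu]_x f x <= \int[mu]_x g x.
Proof. by move=> If Ig fg; apply: le_Rintegral => // x _; exact: fg. Qed.

Lemma int_le_ae f g : intg f -> intg g ->
  {ae mu, forall x, f x <= g x} -> \int[mu]_x f x <= \int[mu]_x g x.
Proof.
move=> If Ig fg; rewrite -lee_fin -!int_fineK//.
have mf := intg_measurable If; have mg := intg_measurable Ig.
(* The minimum of f and g is almost everywhere equal to f and lies below g at every point. *)
have mm : measurable_fun setT (fun x => Num.min (f x) (g x)) by exact: measurable_minr.
have -> : (\int[mu]_x (f x)%:E = \int[mu]_x (Num.min (f x) (g x))%:E)%E.
  apply: ae_eq_integral => //; [exact/measurable_EFinP|exact/measurable_EFinP|].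
  by apply: filterS fg => x fgx _ /=; rewrite min_l.
apply: le_integral => //=.
  apply: (@intg_dom (fun x => `|f x| + `|g x|)) => //.
    by apply: intgD; exact: intg_norm.
  by move=> x; rewrite minElt; case: ifP => _; rewrite (lerDl, lerDr).
by move=> x _; rewrite lee_fin ge_min lexx orbT.
Qed.

Lemma int_eq_ae f g : measurable_fun setT f -> measurable_fun setT g ->
  {ae mu, forall x, f x = g x} -> \int[mu]_x f x = \int[mu]_x g x.
Proof.
move=> mf mg fg; rewrite /Rintegral; congr fine.
apply: ae_eq_integral => //; [exact/measurable_EFinP|exact/measurable_EFinP|].
by apply: filterS fg => x fgx _ /=; rewrite fgx.
Qed.

Lemma intg_ae f g : measurable_fun setT g -> intg f ->
  {ae mu, forall x, f x = g x} -> intg g.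
Proof.
move=> mg /integrableP[mf foo] fg.
have mg' : measurable_fun setT (EFin \o g) by exact/measurable_EFinP.
apply/integrableP; split => //; apply: le_lt_trans foo.
apply: ae_ge0_le_integral => //; [exact: measurableT_comp|exact: measurableT_comp|].
by apply: filterS fg => x fgx _ /=; rewrite fgx.
Qed.

Lemma int_sum (I : Type) (r : seq I) (F : I -> T -> R) :
  (forall i, intg (F i)) ->
  \int[mu]_x (\sum_(i <- r) F i x) = \sum_(i <- r) \int[mu]_x F i x.
Proof.
move=> h; elim: r => [|i r IH].
  rewrite big_nil; under eq_Rintegral do rewrite big_nil.
  by rewrite Rintegral_cst// mul0r.
rewrite big_cons; under eq_Rintegral do rewrite big_cons.
by rewrite RintegralD// ?IH//; [exact: h|exact: (intg_sum r h)].
Qed.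

Lemma int_ge0 f : (forall x, 0 <= f x) -> 0 <= \int[mu]_x f x.
Proof. by move=> f0; exact: Rintegral_ge0. Qed.

Lemma int_indic A : measurable A -> \int[mu]_x \1_A x = fine (mu A).
Proof. by move=> mA; rewrite /Rintegral integral_indic// setIT. Qed.

Lemma int_norm0_ae f : intg f -> \int[mu]_x `|f x| = 0 ->
  {ae mu, forall x, f x = 0}.
Proof.
move=> If f0; have mf := intg_measurable If.
have : (\int[mu]_x `|(f x)%:E| = 0)%E.
  by rewrite (int_fineK (intg_norm If)) f0.
move=> /(ae_eq_integral_abs mu measurableT ((measurable_EFinP _ _).2 mf)).
by apply: filterS => x /(_ I) [].
Qed.

Lemma dominated_cvg_int (F : nat -> T -> R) f g :
  (forall k, measurable_fun setT (F k)) -> measurable_fun setT f -> intg g ->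
  {ae mu, forall x, F k x @[k --> \oo] --> f x} ->
  {ae mu, forall x k, `|F k x| <= g x} ->
  [/\ intg f, \int[mu]_x `|F k x - f x| @[k --> \oo] --> 0 &
      \int[mu]_x F k x @[k --> \oo] --> \int[mu]_x f x].
Proof.
move=> mF mf Ig Ff Fg.
have [|||||] := @dominated_convergence _ _ _ mu setT measurableT
    (fun k => EFin \o F k) (EFin \o f) (EFin \o g).
- by move=> k; exact/measurable_EFinP.
- exact/measurable_EFinP.
- by apply: filterS Ff => x h _; apply: cvg_EFin; [exact: nearW|exact: h].
- exact: Ig.
- by apply: filterS Fg => x h k _ /=; rewrite lee_fin.
move=> If h1 h2; split => //.
  by have /fine_cvgP[_] := h1.
have IF k : intg (F k).
  apply/integrableP; split; first exact/measurable_EFinP.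
  have /integrableP[mg] := Ig; apply: le_lt_trans.
  apply: ae_ge0_le_integral => //.
  - by apply/measurableT_comp => //; exact/measurable_EFinP.
  - exact: measurableT_comp.
  apply: filterS Fg => x h _ /=; rewrite lee_fin (le_trans (h k))//.
  exact: ler_norm.
have := h2; rewrite (_ : (\int[mu]_x (EFin \o f) x)%E = (\int[mu]_x f x)%:E).
  by move=> /fine_cvgP[_].
exact: int_fineK.
Qed.

End real_integral.
Arguments int_ge0 {d T R mu f}.
Arguments eq_int {d T R mu} g {f}.

(** * Density of boxes in L1 and continuity of translations *)

Section L1_induction.
Context {R : realType} {n : nat}.
Notation X := 'rV[R]_n.
Notation mu := (@lebesgue_rV R n).

Lemma cvg_indic_nondecreasing (T : Type) (F : (set T)^nat) x :
  nondecreasing_seq F ->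
  (\1_(F k) x : R) @[k --> \oo] --> (\1_(\bigcup_k F k) x : R).
Proof.
move=> ndF; apply: cvg_near_cst; have [[k _ Fkx]|nFx] := pselect ((\bigcup_k F k) x).
  exists k => // j /= kj; rewrite !indicE !mem_set//; first by exists k.
  by have /subsetPset := ndF _ _ kj; apply.
apply: nearW => k; rewrite !indicE !memNset// => Fkx; apply: nFx.
by exists k.
Qed.

Lemma lebesgue_setI_cbox_lty (A : set X) a b : measurable A ->
  (mu (A `&` cbox a b) < +oo)%E.
Proof.
move=> mA; apply: le_lt_trans (lebesgue_cbox_lty a b).
by apply: le_measure; rewrite ?inE//; [apply: measurableI => //|]; exact: measurable_cbox.
Qed.

Lemma intg_indic_cbox (a b : X) : intg mu \1_(cbox a b).
Proof. by apply: intg_indic; [exact: measurable_cbox|exact: lebesgue_cbox_lty]. Qed.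

Import HBSimple.

(** Dynkin's lemma leads from boxes to measurable subsets of a fixed large box, monotone limits lead
    to sets of finite measure, and density of simple functions to all of L1. It serves as the
    density argument for translations, for weak-star limits and for the representation of
    functionals. *)
Lemma L1_induction (P : (X -> R) -> Prop) :
  (forall a b : X, P \1_(cbox a b)) ->
  (forall f g, intg mu f -> intg mu g -> P f -> P g -> P (fun x => f x + g x)) ->
  (forall c f, intg mu f -> P f -> P (fun x => c * f x)) ->
  (forall f, intg mu f -> (forall e : R, 0 < e -> exists g,
     [/\ intg mu g, P g & \int[mu]_x `|f x - g x| < e]) -> P f) ->
  forall f, intg mu f -> P f.
Proof.
move=> Pbox PD PZ PL.
have P0 : P (fun=> 0).
  rewrite (_ : (fun=> _) = (fun x => 0 * \1_(cbox (0 : X) 0) x)).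
    by apply: PZ => //; exact: intg_indic_cbox.
  by apply/funext => x; rewrite mul0r.
have Plim (F : nat -> X -> R) (f g : X -> R) : (forall k, intg mu (F k)) -> (forall k, P (F k)) ->
    measurable_fun setT f -> intg mu g ->
    (forall x, F k x @[k --> \oo] --> f x) -> (forall x k, `|F k x| <= g x) -> P f.
  move=> IF PF mf Ig Ff Fg.
  have [|If h _] := dominated_cvg_int (fun k => intg_measurable (IF k)) mf Ig (aeW _ Ff).
    exact: aeW.
  apply: PL => // e e0; have /cvgrPdist_lt/(_ _ e0)[k _ /(_ k (leqnn k))] := h.
  rewrite sub0r normrN ger0_norm ?int_ge0// => hk.
  exists (F k); split => //; rewrite (eq_int (fun x => `|F k x - f x|))//.
  by move=> x; rewrite distrC.
(* Dynkin's lemma is run inside a fixed box, so that the indicators and their proper differences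
   remain integrable. *)
have Pcap k (A : set X) : measurable A -> P \1_(A `&` ball_box k%:R).
  set Q := ball_box _; have mQ : measurable Q by exact: measurable_cbox.
  pose H : set (set X) := [set A | measurable A /\ P \1_(A `&` Q)].
  move=> mA; suff : H A by case.
  apply: (@lambda_system_subset X (@cboxes R n) (@cboxes_setI R n) setT H);
    last by rewrite -measurable_cboxes.
  - split => //=.
    + by split => //; rewrite setTI; exact: Pbox.
    + move=> B C CB [mB PB] [mC PC]; split; first exact: measurableD.
      rewrite (_ : \1__ = (fun x => \1_(B `&` Q) x + (-1) * \1_(C `&` Q) x)).
        have iB := intg_indic (measurableI _ _ mB mQ) (lebesgue_setI_cbox_lty _ _ mB).
        have iC := intg_indic (measurableI _ _ mC mQ) (lebesgue_setI_cbox_lty _ _ mC).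
        by apply: PD => //; [exact: intgZ|exact: PZ].
      apply/funext => x; rewrite !indicE (in_setI x (B `\` C)) (classical_sets.in_setD x B) !in_setI.
      have [xC|] := boolP (x \in C); last by rewrite andbT mulr0 addr0.
      have -> : x \in B by rewrite inE; apply: CB; exact/set_mem.
      by rewrite mulN1r subrr.
    + move=> F ndF HF; have mUF : measurable (\bigcup_i F i).
        by apply: bigcupT_measurable => i; have [] := HF i.
      split => //; apply: (@Plim (fun k => \1_(F k `&` Q)) _ \1_Q) => //.
      * move=> i; have [mF _] := HF i.
        by apply: intg_indic; [exact: measurableI|exact: lebesgue_setI_cbox_lty].
      * by move=> i; have [] := HF i.
      * exact/measurable_indic/measurableI.
      * exact: intg_indic_cbox.
      * move=> x; rewrite setI_bigcupl; apply: cvg_indic_nondecreasing.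
        by move=> i j ij; apply/subsetPset; apply: setSI; exact/subsetPset/ndF.
      * move=> x i; rewrite !indicE in_setI ger0_norm//.
        by case: (_ \in F i).
  - move=> _ [a [b ->]]; split; first exact: measurable_cbox.
    by rewrite cboxI; exact: Pbox.
  - by [].
have Pind (A : set X) : measurable A -> (mu A < +oo)%E -> P \1_A.
  move=> mA Aoo; apply: (@Plim (fun k => \1_(A `&` ball_box k%:R)) _ \1_A) => //.
  - move=> k; apply: intg_indic; last exact: lebesgue_setI_cbox_lty.
    by apply: measurableI => //; exact: measurable_cbox.
  - by move=> k; exact: Pcap.
  - exact: intg_indic.
  - move=> x; rewrite -[X in \1_X x]setIT -(bigcup_ball_box n) setI_bigcupr.
    apply: cvg_indic_nondecreasing => i j ij; apply/subsetPset; apply: setIS => y.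
    by move=> /ball_boxP h; apply/ball_boxP => l; rewrite (le_trans (h l))// ler_nat.
  - by move=> x k; rewrite !indicE in_setI normr_nat ler_nat; case: (x \in A) => //=; exact: leq_b1.
move=> f If; apply: PL => // e e0.
have [g [Ig _ fg]] := approximation_sfun_integrable measurableT If.
have /fine_cvgP[_ /cvgrPdist_lt/(_ _ e0)[k _ /(_ k (leqnn k))]] := fg.
rewrite sub0r normrN => /(le_lt_trans (ler_norm _)) hk.
exists (g k); split => //; first exact: Ig.
move: (g k) (Ig k) => {hk fg Ig} s Is.
rewrite (_ : (s : _ -> _) = (fun x => \sum_(y <- finmap.enum_fset (fset_set (range s))) (y * \1_(s @^-1` [set y]) x))); last first.
  by apply/funext => x; rewrite {1}fimfunE fsbig_finite.
have ms (y : R) : measurable (s @^-1` [set y]).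
  exact: measurable_sfunP.
have It (y : R) : intg mu (fun x => y * \1_(s @^-1` [set y]) x).
  apply: (@intg_dom _ _ _ _ (fun x => `|s x|)).
  - by apply: measurable_funM => //; exact: measurable_indic.
  - exact: intg_norm.
  - move=> x; rewrite indicE; have [/set_mem/= ->|_] := boolP (x \in _); first by rewrite mulr1.
    by rewrite mulr0 normr0.
elim: (finmap.enum_fset _) => [|y r IH].
  by under eq_fun do rewrite big_nil.
under eq_fun do rewrite big_cons.
apply: PD => //; first exact: intg_sum.
have [->|y0] := eqVneq y 0; first by under eq_fun do rewrite mul0r.
(* Only the value 0 of an integrable simple function can be taken on a set of infinite measure; for
   [y != 0] the finiteness that [Pind] asks for is read off from the integrability of y times the
   indicator. *)
have Iy : intg mu \1_(s @^-1` [set y]).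
  have := intgZ y^-1 (It y); congr intg; apply/funext => x.
  by rewrite mulrA mulVf// mul1r.
apply: PZ => //; apply: Pind => //.
have /integrableP[_] := Iy; under eq_integral do rewrite /= ger0_norm//.
by rewrite integral_indic// setIT.
Qed.

End L1_induction.

Lemma exists_natSinv_lt (R : realType) (e : R) : 0 < e -> exists k, k.+1%:R^-1 < e.
Proof.
move=> e0; have [k _ /(_ k (leqnn k))] := near_infty_natSinv_lt (PosNum e0).
by exists k.
Qed.

Section translation.
Context {R : realType} {n : nat}.
Notation X := 'rV[R]_n.
Notation mu := (@lebesgue_rV R n).

Lemma measurable_rV_add d (T : measurableType d) (f g : T -> X) :
  measurable_fun setT f -> measurable_fun setT g ->
  measurable_fun setT (fun t => f t + g t).
Proof.
move=> mf mg; apply: measurable_fun_coorP => i; under eq_fun do rewrite mxE.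
by apply: measurable_funD;
  [exact: (measurableT_comp (measurable_coor i) mf)
  |exact: (measurableT_comp (measurable_coor i) mg)].
Qed.

Lemma measurable_translate (y : X) : measurable_fun setT (fun x : X => x + y).
Proof. by apply: measurable_rV_add. Qed.

Lemma int_translate (y : X) (f : X -> R) : measurable_fun setT f ->
  \int[mu]_x f (x + y) = \int[mu]_x f x.
Proof.
move=> mf; apply/esym/(Rintegral_mp (mu := mu) (measurable_translate y) _ mf).
by move=> A mA; exact: lebesgue_rV_translate.
Qed.

Lemma intg_translate (y : X) (f : X -> R) : intg mu f -> intg mu (fun x => f (x + y)).
Proof.
move=> If; apply: (integrable_mp (mu := mu) (measurable_translate y) _ If).
by move=> A mA; exact: lebesgue_rV_translate.
Qed.

(** By [L1_induction] only boxes need a computation; closure under L1 limits costs e/3 three times,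
    as the translated error has the same integral as the original one. *)
Lemma L1_translation_continuous (f : X -> R) : intg mu f ->
  forall e : R, 0 < e -> exists2 r : R, 0 < r & forall y : X, `|y| <= r ->
    \int[mu]_x `|f (x + y) - f x| < e.
Proof.
move: f; apply: L1_induction => [a b|f g If Ig Pf Pg|c f If Pf|f If Pf] e e0.
- have mC a' b' : measurable_fun setT (\1_(cbox a' b') : X -> R).
    by apply: intg_measurable; exact: intg_indic_cbox.
  (* A translate of the box by a vector of norm at most 1/(k+1) stays in this enlarged box, and the
     enlarged boxes decrease to the original one. *)
  pose B k : set X := cbox (a - const_mx k.+1%:R^-1) (b + const_mx k.+1%:R^-1).
  have mB k : measurable (B k) by exact: measurable_cbox.
  have ndB : nonincreasing_seq B.
    move=> i j ij; apply/subsetPset => x h l; have /andP[] := h l; rewrite !mxE => h1 h2.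
    have ij' : (j.+1%:R^-1 : R) <= i.+1%:R^-1 by rewrite lef_pV2 ?posrE ?ltr0n// ler_nat.
    apply/andP; split; first by apply: le_trans h1; rewrite lerD2l lerN2.
    by apply: le_trans h2 _; rewrite lerD2l.
  have BE x : (forall k, B k x) -> cbox a b x.
    move=> h i; apply/andP; split; apply/ler_addgt0Pr => d d0;
      have [k kd] := exists_natSinv_lt d0; have /andP[] := h k i; rewrite !mxE;
      move: (_^-1) kd => p kd h1 h2; lra.
  have BC x : (\1_(B k) x : R) @[k --> \oo] --> (\1_(cbox a b) x : R).
    have [xB|nxB] := pselect (forall k, B k x).
      apply: cvg_near_cst; apply: nearW => k; rewrite !indicE !mem_set//.
      exact: BE.
    have [k nBk] : exists k, ~ B k x by apply/existsNP.
    apply: cvg_near_cst; exists k => // j /= kj; rewrite !indicE !memNset//.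
      move=> Cx; apply: nBk => i; have := Cx i; rewrite !mxE => /andP[h1 h2].
      have : (0 : R) <= k.+1%:R^-1 by rewrite invr_ge0.
      by move: (_^-1) => p p0; apply/andP; split; lra.
    by move=> Bj; apply: nBk; have /subsetPset := ndB _ _ kj; apply.
  have [|_ h _] := dominated_cvg_int (F := fun k => \1_(B k)) (fun k => mC _ _)
    (mC a b) (intg_indic_cbox _ _ : intg mu \1_(B 0%N))
    (aeW _ BC).
    apply: aeW => x k; rewrite !indicE normr_nat ler_nat.
    have : B k `<=` B 0%N by have /subsetPset := ndB 0%N k (leq0n k).
    have [/set_mem Bk /(_ x Bk)/mem_set ->//|//] := boolP (x \in B k).
  have e2 : 0 < e / 2 by rewrite divr_gt0.
  have /cvgrPdist_lt/(_ _ e2)[k _ /(_ k (leqnn k))] := h.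
  rewrite sub0r normrN => /(le_lt_trans (ler_norm _)) hk.
  exists k.+1%:R^-1 => [|y yk]; first by rewrite invr_gt0.
  have IC : intg mu \1_(cbox a b) by exact: intg_indic_cbox.
  have IB : intg mu \1_(B k) by exact: intg_indic_cbox.
  have ICy := intg_translate y IC.
  (* The absolute value |s| is written as 2 s^+ - s. The integral of s vanishes by translation
     invariance, and s^+ is supported in the enlarged box minus the box. *)
  rewrite (eq_int (fun x : X => 2 * Num.max (\1_(cbox a b) (x + y) - \1_(cbox a b) x) 0
      + (\1_(cbox a b) x - \1_(cbox a b) (x + y)))); last first.
    move=> x; rewrite !indicE; case: (_ \in _); case: (_ \in _) => /=;
    rewrite ?subrr ?normr0 ?sub0r ?subr0 ?normrN ?normr1 ?maxxx ?mulr0 ?addr0//.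
      by rewrite max_l//; ring.
    by rewrite max_r ?oppr_le0//; ring.
  have Im : intg mu (fun x : X => Num.max (\1_(cbox a b) (x + y) - \1_(cbox a b) x) 0 : R).
    apply: (@intg_dom _ _ _ _ (fun x : X => `|\1_(cbox a b) (x + y) - \1_(cbox a b) x|)).
    - by apply: measurable_maxr => //; exact: (intg_measurable (intgB ICy IC)).
    - by apply: intg_norm; exact: intgB.
    - by move=> x; rewrite maxElt; case: ifP => _; rewrite ?normr0.
  rewrite RintegralD//; [|exact: intgZ|exact: intgB].
  rewrite RintegralB// (int_translate y (mC a b)).
  rewrite subrr addr0 RintegralZl// mulrC -ltr_pdivlMr//.
  apply: le_lt_trans hk; apply: int_le => //; first by apply: intg_norm; exact: intgB.
  move=> x; rewrite !indicE.
  have [/set_mem Cxy|_] := boolP (x + y \in cbox a b); last first.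
    by rewrite ge_max normr_ge0 andbT sub0r (le_trans _ (normr_ge0 _))// oppr_le0.
  have -> : x \in B k.
    rewrite inE => i; have := Cxy i; rewrite !mxE.
    have := le_trans (norm_coor y i) yk; rewrite ler_norml.
    move: (_^-1) => p /andP[h1 h2] /andP[h3 h4]; by apply/andP; split; lra.
  by rewrite ge_max normr_ge0 ler_norm.
- have e2 : 0 < e / 2 by rewrite divr_gt0.
  have [r r0 hr] := Pf _ e2; have [s s0 hs] := Pg _ e2.
  exists (Num.min r s) => [|y]; first by rewrite lt_min r0.
  rewrite le_min => /andP[/hr fy /hs gy].
  have h1 : intg mu (fun x => `|f (x + y) - f x|).
    by apply/intg_norm/intgB => //; exact: intg_translate.
  have h2 : intg mu (fun x => `|g (x + y) - g x|).
    by apply/intg_norm/intgB => //; exact: intg_translate.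
  rewrite [e]splitr; apply: le_lt_trans (ltrD fy gy); rewrite -RintegralD//.
  apply: int_le.
  + apply/intg_norm/intgB; last exact: intgD.
    by apply: (@intgD _ _ _ mu (fun x => f (x + y)) (fun x => g (x + y))); exact: intg_translate.
  + exact: intgD.
  + by move=> x; rewrite opprD addrACA ler_normD.
- have c0 : 0 < `|c| + 1 by rewrite ltr_wpDl.
  have [r r0 hr] := Pf _ (divr_gt0 e0 c0); exists r => // y /hr h.
  have h1 : intg mu (fun x => `|f (x + y) - f x|).
    by apply/intg_norm/intgB => //; exact: intg_translate.
  rewrite (eq_int (fun x : X => `|c| * `|f (x + y) - f x|)); last first.
    by move=> x; rewrite -mulrBr normrM.
  rewrite RintegralZl//; apply: (@le_lt_trans _ _ ((`|c| + 1) * \int[mu]_x `|f (x + y) - f x|)).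
    by apply: ler_wpM2r; [exact: int_ge0|rewrite lerDl].
  by rewrite mulrC -ltr_pdivlMr.
- have e3 : 0 < e / 3 by rewrite divr_gt0.
  have [g [Ig Pg fg]] := Pf _ e3; have [r r0 hr] := Pg _ e3.
  exists r => // y /hr h.
  have Ify := intg_translate y If; have Igy := intg_translate y Ig.
  have I1 := intg_norm (intgB Ify Igy); have I2 := intg_norm (intgB Igy Ig).
  have I3 := intg_norm (intgB If Ig).
  have fgy : \int[mu]_x `|f (x + y) - g (x + y)| = \int[mu]_x `|f x - g x|.
    by apply: (int_translate y (f := fun x => `|f x - g x|)); exact: intg_measurable I3.
  apply: (@le_lt_trans _ _ (\int[mu]_x (`|f (x + y) - g (x + y)| +
      (`|g (x + y) - g x| + `|f x - g x|)))).
    apply: int_le; [by apply/intg_norm/intgB|by do 2 apply: intgD => //|].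
    move=> x; rewrite (_ : f (x + y) - f x = (f (x + y) - g (x + y)) +
      ((g (x + y) - g x) - (f x - g x))); last by ring.
    by rewrite (le_trans (ler_normD _ _))// lerD2l (le_trans (ler_normB _ _)).
  by rewrite !RintegralD//; [rewrite fgy; lra|exact: intgD].
Qed.

End translation.

Lemma fast_subsequence (P : nat -> nat -> Prop) :
  (forall k, exists N, forall j, (N <= j)%N -> P k j) ->
  exists2 s : nat -> nat, {homo s : i j / (i < j)%N} & forall k, P k (s k).
Proof.
move=> /choice[N hN].
pose s := fix s k := if k is k'.+1 then maxn (s k').+1 (N k) else N 0%N.
exists s; last by case=> [|k]; apply: hN => //; exact: leq_maxr.
by apply: homo_ltn => [? ? ?|k]; [exact: ltn_trans|exact: leq_maxl].
Qed.

(** * Mollification *)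

Section fast_convergence.
Context d (T : measurableType d) (R : realType) (mu : {measure set T -> \bar R}).

(** The series of the [G k] has integral at most the geometric sum 2, hence is finite almost
    everywhere, and its terms tend to 0. The domain may move with k, which later yields almost
    everywhere convergence on an exhaustion in one extraction. *)
Lemma ae_cvg0_fast (G : nat -> T -> R) : (forall k, intg mu (G k)) ->
  (forall k x, 0 <= G k x) -> (forall k, \int[mu]_x G k x <= 2^-1 ^+ k) ->
  {ae mu, forall x, G k x @[k --> \oo] --> 0}.
Proof.
move=> IG G0 Gk.
have mG k : measurable_fun setT (EFin \o G k) by apply/measurable_EFinP/intg_measurable.
have Gfin : mu.-integrable setT (fun x => \sum_(0 <= k <oo) (G k x)%:E)%E.
  apply/integrableP; split.
    apply: (emeasurable_fun_cvg (fun k x => \sum_(0 <= i < k) (G i x)%:E)%E).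
      by move=> k; apply: emeasurable_sum => i; exact: mG.
    by move=> x _; apply: is_cvg_nneseries => k _ _; rewrite lee_fin.
  have S0 x : (0 <= \sum_(0 <= k <oo) (G k x)%:E)%E.
    by apply: nneseries_ge0 => k _ _; rewrite lee_fin.
  under eq_integral do rewrite gee0_abs//.
  rewrite integral_nneseries//; last by move=> k x _; rewrite lee_fin.
  apply: (@le_lt_trans _ _ (\sum_(0 <= k <oo) ((2^-1 ^+ k)%:E : \bar R))%E).
    apply: lee_nneseries => [k _ _|k _]; first by apply: integral_ge0 => x _; rewrite lee_fin.
    by rewrite (int_fineK (IG k)) lee_fin.
  rewrite (_ : (\sum_(0 <= k <oo) _)%E = (2 : R)%:E) ?ltry//.
  apply/cvg_lim => //; apply: cvg_trans (cvg_EFin _ _ : (fun k => (series (geometric 1 2^-1) k)%:E) @ \oo --> (2 : R)%:E).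
  - apply: near_eq_cvg; apply: nearW => k; rewrite /series/= -sumEFin.
    by apply: eq_bigr => i _; rewrite mul1r.
  - exact: nearW.
  - have := @cvg_geometric_series R 1 2^-1; rewrite (_ : 1 / (1 - 2^-1) = 2); last by field.
    by apply; rewrite ger0_norm ?invr_ge0// invf_lt1// ltr1n.
have := integrable_ae measurableT Gfin; apply: filterS => x /(_ I) xfin.
apply: cvg_series_cvg_0; apply: nnseries_is_cvg => //.
by rewrite -ge0_fin_numE// nneseries_ge0// => k _ _; rewrite lee_fin.
Qed.

Lemma L1_cvg_ae_subseq (F : nat -> T -> R) (f : T -> R) :
  (forall k, intg mu (F k)) -> intg mu f ->
  \int[mu]_x `|F k x - f x| @[k --> \oo] --> 0 ->
  exists2 s : nat -> nat, {homo s : i j / (i < j)%N} &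
    {ae mu, forall x, F (s k) x @[k --> \oo] --> f x}.
Proof.
move=> IF If h.
have [k|s s_mono sk] := @fast_subsequence
    (fun k j => \int[mu]_x `|F j x - f x| <= 2^-1 ^+ k).
  have /cvgrPdist_le/(_ (2^-1 ^+ k))[|N _ hN] := h; first by rewrite exprn_gt0// invr_gt0.
  by exists N => j /hN; rewrite sub0r normrN; apply: le_trans; exact: ler_norm.
exists s => //; have := @ae_cvg0_fast (fun k x => `|F (s k) x - f x|) _ _ sk.
move=> /(_ _ _)/filterS; apply => //.
  move=> x h0; apply/cvgrPdist_lt => e e0; have /cvgrPdist_lt/(_ _ e0) := h0.
  by apply: filterS => k; rewrite sub0r normrN normr_id distrC.
by move=> k; apply/intg_norm/intgB.
Qed.

End fast_convergence.

Section mollifier.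
Context {R : realType} {n : nat}.
Notation X := 'rV[R]_n.
Notation mu := (@lebesgue_rV R n).
Implicit Types K f : X -> R.

(** A correlation rather than a convolution: no reflection of the kernel occurs, and the kernel
    moved to x is [K (y - x)], see [moll_shift]. *)
Definition moll K f (x : X) : R := \int[mu]_y (K y * f (x + y)).

Lemma moll_shift K f x : measurable_fun setT K -> measurable_fun setT f ->
  moll K f x = \int[mu]_y (K (y - x) * f y).
Proof.
move=> mK mf; rewrite -(@int_translate _ _ x (fun y => K (y - x) * f y)).
  by apply: eq_int => y; rewrite addrK addrC.
by apply: measurable_funM => //; apply: measurableT_comp => //; exact: measurable_translate.
Qed.

Lemma intg_moll K f (M : R) x : intg mu K -> measurable_fun setT f ->
  (forall x, `|f x| <= M) -> intg mu (fun y => K y * f (x + y)).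
Proof.
move=> IK mf fM; rewrite (_ : (fun _ => _) = (fun y => f (x + y) * K y)).
  apply: (@intgM_bounded _ _ _ _ M) => //.
  apply: (measurableT_comp mf).
  exact: measurable_rV_add.
by apply/funext => y; rewrite mulrC.
Qed.

Lemma moll_bound K f (M : R) x : intg mu K -> measurable_fun setT f ->
  (forall y, 0 <= K y) -> \int[mu]_y K y = 1 ->
  (forall x, `|f x| <= M) -> `|moll K f x| <= M.
Proof.
move=> IK mf K0 K1 fM; have I1 := intg_moll x IK mf fM.
apply: le_trans (int_norm_le I1) _.
rewrite -[leRHS]mulr1 -K1 -RintegralZl//; apply: int_le => //.
- exact: intg_norm.
- exact: intgZ.
- by move=> y; rewrite normrM ger0_norm// mulrC ler_wpM2r.
Qed.

Let mF K f : measurable_fun setT K -> measurable_fun setT f ->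
  measurable_fun setT (fun z : X * X => K z.2 * f (z.1 + z.2)).
Proof.
move=> mK mf; apply: measurable_funM.
  exact: (measurableT_comp mK measurable_snd).
apply: (measurableT_comp mf).
by apply: measurable_rV_add; [exact: measurable_fst|exact: measurable_snd].
Qed.

Lemma measurable_moll K f (M : R) : intg mu K -> (forall y, 0 <= K y) ->
  measurable_fun setT f -> (forall x, `|f x| <= M) -> measurable_fun setT (moll K f).
Proof.
move=> IK K0 mf fM; have mK := intg_measurable IK.
(* Adding the bound M makes the integrand non-negative, so that measurability in x follows from
   Tonelli's theorem. *)
have mfM : measurable_fun setT (fun x => f x + M) by exact: measurable_funD.
rewrite (_ : moll K f = fun x => moll K (fun x => f x + M) x - M * \int[mu]_y K y).
  apply: measurable_funB => //; rewrite /moll /Rintegral.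
  apply: (measurableT_comp (fine_measurable _)) => //.
  apply: (measurable_fun_fubini_tonelli_F (m2 := lebesgue_rV_sf n)
    (fun z : X * X => (K z.2 * (f (z.1 + z.2) + M))%:E)).
    by apply/measurable_EFinP; exact: (mF mK mfM).
  move=> z; rewrite lee_fin mulr_ge0// -lerBlDr sub0r.
  by have := fM (z.1 + z.2); rewrite ler_norml => /andP[].
apply/funext => x; rewrite /moll -RintegralZl//.
under [X in X - _]eq_int do rewrite mulrDr.
rewrite RintegralD//; last 2 first.
- exact: intg_moll fM.
- by under eq_fun do rewrite mulrC; exact: intgZ.
by rewrite (eq_int (fun y => M * K y) (f := fun y => K y * M)) ?addrK// => y; rewrite mulrC.
Qed.

(** By Tonelli's theorem the error on D is at most the K-average of the translation errors on D, and
    only translations in the support of K occur. The set D is kept because the translation estimates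
    for the pressures are local. *)
Lemma moll_err K f (M c : R) (D : set X) : intg mu K -> (forall y, 0 <= K y) ->
  \int[mu]_y K y = 1 -> intg mu f -> (forall x, `|f x| <= M) -> measurable D ->
  (forall y, K y != 0 -> \int[mu]_x (\1_D x * `|f (x + y) - f x|) <= c) ->
  intg mu (fun x => \1_D x * `|moll K f x - f x|) /\
  \int[mu]_x (\1_D x * `|moll K f x - f x|) <= c.
Proof.
move=> IK K0 K1 If fM mD hc; have mf := intg_measurable If.
have mK := intg_measurable IK.
have mG : measurable_fun setT (fun z : X * X => \1_D z.1 * (K z.2 * `|f (z.1 + z.2) - f z.1|)).
  apply: measurable_funM.
    by apply: (measurableT_comp (measurable_indic mD)); exact: measurable_fst.
  apply: measurable_funM; first exact: (measurableT_comp mK measurable_snd).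
  apply: measurableT_comp => //; apply: measurable_funB.
    apply: (measurableT_comp mf).
    by apply: measurable_rV_add; [exact: measurable_fst|exact: measurable_snd].
  exact: (measurableT_comp mf measurable_fst).
have G0 (z : X * X) : (0 <= (\1_D z.1 * (K z.2 * `|f (z.1 + z.2) - f z.1|))%:E)%E.
  by rewrite lee_fin mulr_ge0// mulr_ge0.
have mmf : measurable_fun setT (fun x => \1_D x * `|moll K f x - f x|).
  apply: measurable_funM; first exact: measurable_indic.
  apply: measurableT_comp => //; apply: measurable_funB => //.
  exact: measurable_moll fM.
have Iy y : intg mu (fun x => \1_D x * `|f (x + y) - f x|).
  apply: (@intgM_bounded _ _ _ _ 1).
  - by apply: intg_norm; apply: intgB => //; exact: intg_translate.
  - exact: measurable_indic.
  - by move=> x; rewrite indicE normr_nat lern1 leq_b1.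
have Ix x : intg mu (fun y => K y * `|f (x + y) - f x|).
  rewrite (_ : (fun _ => _) = (fun y => `|f (x + y) - f x| * K y)); last first.
    by apply/funext => y; rewrite mulrC.
  apply: (@intgM_bounded _ _ _ _ (M + M)) => //.
    apply: measurableT_comp => //; apply: measurable_funB => //.
    apply: (measurableT_comp mf).
    exact: measurable_rV_add.
  by move=> y; rewrite normr_id (le_trans (ler_normB _ _))// lerD.
have key : (\int[mu]_x (\1_D x * `|moll K f x - f x|)%:E <= c%:E)%E.
  apply: (@le_trans _ _ (\int[lebesgue_rV_sf n]_x \int[lebesgue_rV_sf n]_y
      (\1_D x * (K y * `|f (x + y) - f x|))%:E)%E).
    apply: ge0_le_integral => //.
    - exact/measurable_EFinP.
    - apply: (measurable_fun_fubini_tonelli_F (m2 := lebesgue_rV_sf n)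
        (fun z : X * X => (\1_D z.1 * (K z.2 * `|f (z.1 + z.2) - f z.1|))%:E)) => //.
      exact/measurable_EFinP.
    - move=> x _; rewrite (int_fineK (intgZ (\1_D x) (Ix x))) lee_fin RintegralZl//; last exact: Ix.
      apply: ler_wpM2l => //; apply: le_trans (_ : \int[mu]_y `|K y * (f (x + y) - f x)| <= _).
        have -> : moll K f x - f x = \int[mu]_y (K y * (f (x + y) - f x)).
          under [RHS]eq_int do rewrite mulrBr.
          have I1 := intg_moll x IK mf fM.
          have I2 : intg mu (fun y => K y * f x).
            by under eq_fun do rewrite mulrC; exact: intgZ.
          by rewrite RintegralB// RintegralZr// K1 mul1r.
        apply: int_norm_le; apply: (@intg_dom _ _ _ _ (fun y => K y * `|f (x + y) - f x|)) => //.
          apply: measurable_funM => //; apply: measurable_funB => //.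
          apply: (measurableT_comp mf).
          exact: measurable_rV_add.
        by move=> y; rewrite normrM ger0_norm.
      by under eq_int do rewrite normrM ger0_norm//.
  rewrite [X in (X <= _)%E](_ : _ = (\int[lebesgue_rV_sf n]_y \int[lebesgue_rV_sf n]_x
      (\1_D x * (K y * `|f (x + y) - f x|))%:E)%E); last first.
    apply: (fubini_tonelli (m1 := lebesgue_rV_sf n) (m2 := lebesgue_rV_sf n)
      (fun z : X * X => (\1_D z.1 * (K z.2 * `|f (z.1 + z.2) - f z.1|))%:E)) => //.
    exact/measurable_EFinP.
  rewrite -[X in (_ <= X)%E]mule1 -K1 -(int_fineK IK) -ge0_integralZl//; last 3 first.
  - exact/measurable_EFinP.
  - by move=> y _; rewrite lee_fin.
  (* The sign of c is extracted from the hypothesis at one point where K does not vanish; such a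
     point exists since K has integral 1. *)
  - have [y Ky] : exists y, K y != 0.
      apply: contrapT => /forallNP nK; have : \int[mu]_y K y = 0.
        rewrite (eq_int (fun=> 0)) ?Rintegral_cst ?mul0r// => y.
        by apply/eqP; have /negP := nK y; rewrite negbK.
      by rewrite K1 => /eqP; rewrite oner_eq0.
    apply: le_trans (hc y Ky); apply: int_ge0 => x; exact: mulr_ge0.
  apply: ge0_le_integral => //.
  - by move=> y _; apply: integral_ge0 => x _; exact: (G0 (x, y)).
  - apply: (measurable_fun_fubini_tonelli_G (m1 := lebesgue_rV_sf n)
        (fun z : X * X => (\1_D z.1 * (K z.2 * `|f (z.1 + z.2) - f z.1|))%:E)) => //.
    exact/measurable_EFinP.
  - by apply/measurable_EFinP; exact: measurable_funM.
  - move=> y _; have -> : (\int[lebesgue_rV_sf n]_x (\1_D x * (K y * `|f (x + y) - f x|))%:E)%E =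
      (K y * \int[mu]_x (\1_D x * `|f (x + y) - f x|))%:E.
      transitivity (\int[mu]_x (K y * (\1_D x * `|f (x + y) - f x|))%:E)%E.
        by apply: eq_integral => x _; rewrite mulrCA.
      by rewrite (int_fineK (intgZ (K y) (Iy y))) RintegralZl//; exact: Iy.
    rewrite -EFinM lee_fin mulrC; have [->|Ky] := eqVneq (K y) 0; first by rewrite !mulr0.
    by rewrite ler_wpM2r// hc.
have I1 : intg mu (fun x => \1_D x * `|moll K f x - f x|).
  apply/integrableP; split; first exact/measurable_EFinP.
  under eq_integral do rewrite gee0_abs ?lee_fin ?mulr_ge0//.
  by apply: le_lt_trans key _; rewrite ltry.
by split => //; rewrite -lee_fin -int_fineK.
Qed.

Definition approximate_identity (K : nat -> X -> R) := exists r : nat -> R,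
  r k @[k --> \oo] --> 0 /\ forall k, [/\ intg mu (K k), forall y, 0 <= K k y,
    \int[mu]_y K k y = 1 & forall y, K k y != 0 -> `|y| <= r k].

Lemma moll_cvg (K : nat -> X -> R) f (M : R) : approximate_identity K -> intg mu f ->
  (forall x, `|f x| <= M) ->
  (forall k, intg mu (fun x => `|moll (K k) f x - f x|)) /\
  \int[mu]_x `|moll (K k) f x - f x| @[k --> \oo] --> 0.
Proof.
move=> [r [r0 hK]] If fM.
have mE k c : (forall y, K k y != 0 -> \int[mu]_x `|f (x + y) - f x| <= c) ->
    intg mu (fun x => `|moll (K k) f x - f x|) /\ \int[mu]_x `|moll (K k) f x - f x| <= c.
  move=> hc; have [IK K0 K1 _] := hK k.
  have E (g : X -> R) : (fun x => \1_(setT : set X) x * g x) = g.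
    by apply/funext => x; rewrite indicE in_setT mul1r.
  have := @moll_err (K k) f M c setT IK K0 K1 If fM measurableT.
  by rewrite (E (fun x => `|moll (K k) f x - f x|)); apply => y Ky;
    rewrite (E (fun x => `|f (x + y) - f x|)); exact: hc.
split.
  move=> k; have [] // := mE k (\int[mu]_x `|f x| + \int[mu]_x `|f x|) => y _.
  have Iy := intg_translate y If.
  rewrite -[X in _ <= X + _](int_translate y (f := fun x => `|f x|)); last first.
    exact: (intg_measurable (intg_norm If)).
  rewrite -RintegralD//; [|exact: intg_norm|exact: intg_norm].
  apply: int_le; first exact: (intg_norm (intgB Iy If)).
  - exact: (intgD (intg_norm Iy) (intg_norm If)).
  - by move=> x; exact: ler_normB.
apply/cvgrPdist_le => e e0; have [s s0 hs] := L1_translation_continuous If e0.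
have /cvgrPdist_le/(_ _ s0) := r0; apply: filterS => k.
rewrite sub0r normrN => rk; rewrite sub0r normrN ger0_norm; last exact: int_ge0.
apply: (mE k e _).2 => y Ky; apply/ltW/hs; have [_ _ _ h] := hK k.
by apply: le_trans (h _ Ky) _; exact: le_trans (ler_norm _) rk.
Qed.

End mollifier.

(** * Smooth functions and test functions *)

Section line_derivative.
Context {R : realType} {V : normedModType R}.
Implicit Types (g : V -> R) (x v : V).

Let line_quot g x v (s : R) :
  (fun h : R => h^-1 *: (((fun t : R => g (x + t *: v)) \o shift s) (h *: (1 : R)) -
    g (x + s *: v))) =
  (fun h : R => h^-1 *: ((g \o shift (x + s *: v)) (h *: v) - g (x + s *: v))).
Proof.
apply/funext => h; congr (_ *: (g _ - _)) => /=.
by rewrite [h *: 1]mulr1 scalerDl addrCA.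
Qed.

Lemma is_derive_line g x v (s : R) : derivable g (x + s *: v) v ->
  is_derive s 1 (fun t : R => g (x + t *: v)) ('D_v g (x + s *: v)).
Proof.
by move=> dg; split; rewrite /derivable /derive line_quot.
Qed.

Lemma derivable_line g x v (s : R) :
  derivable (fun t : R => g (x + t *: v)) s 1 -> derivable g (x + s *: v) v.
Proof. by rewrite /derivable line_quot. Qed.

Lemma derive_line g x v (s : R) :
  'D_1 (fun t : R => g (x + t *: v)) s = 'D_v g (x + s *: v).
Proof. by rewrite /derive line_quot. Qed.

Lemma MVT_line g x v (a b : R) : a < b ->
  (forall s : R, a <= s <= b -> derivable g (x + s *: v) v) ->
  exists2 c, a < c < b &
    g (x + b *: v) - g (x + a *: v) = 'D_v g (x + c *: v) * (b - a).
Proof.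
move=> ab dg; have [||c] := @MVT R (fun t => g (x + t *: v))
    (fun t => 'D_v g (x + t *: v)) a b ab.
- move=> s; rewrite in_itv/= => /andP[h1 h2]; apply: is_derive_line.
  by apply: dg; rewrite !ltW.
- apply: derivable_within_continuous => s; rewrite in_itv/= => sab.
  by have [] := is_derive_line (dg s sab).
by rewrite in_itv/= => cab h; exists c.
Qed.

Lemma diff_quot_bound g x v (h C : R) : 0 < h ->
  (forall s : R, 0 <= s <= h -> derivable g (x + s *: v) v) ->
  (forall s : R, 0 <= s <= h -> `|'D_v g (x + s *: v)| <= C) ->
  `|(g (x + h *: v) - g x) / h| <= C.
Proof.
move=> h0 dg dC; have [c /andP[c1 c2]] := MVT_line h0 dg.
rewrite scale0r addr0 subr0 => ->; rewrite mulfK ?gt_eqF//; apply: dC.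
by rewrite !ltW.
Qed.

(** With A the second difference quotient, G(t) + G(-t) - A t^2 takes the same value at 0 and at h.
    Rolle's theorem gives a point c with G'(c) - G'(-c) = 2 A c, and the mean value theorem on
    [-c, c] turns the left side into 2 c G''(d). An exact value, rather than a Taylor remainder,
    gives uniform bounds from bounds on the second derivative. *)
Lemma second_diff g x v (h : R) : 0 < h ->
  (forall s : R, `|s| <= h -> derivable g (x + s *: v) v) ->
  (forall s : R, `|s| <= h -> derivable ('D_v g) (x + s *: v) v) ->
  exists2 c : R, `|c| <= h & (g (x + h *: v) + g (x - h *: v) - 2 * g x) / h ^+ 2 =
    'D_v ('D_v g) (x + c *: v).
Proof.
move=> h0 dg ddg; pose A := (g (x + h *: v) + g (x - h *: v) - 2 * g x) / h ^+ 2.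
pose G (t : R) : R := g (x + t *: v); pose G' (t : R) : R := 'D_v g (x + t *: v).
have GP (t : R) : `|t| <= h -> is_derive t 1 G (G' t) by move=> th; exact/is_derive_line/dg.
pose F (t : R) : R := (G t + (G \o -%R) t) - (A *: ((@id R) * (@id R))) t.
have FP (t : R) : `|t| <= h -> is_derive t 1 F (G' t + G' (- t) * -1 - A *: (t *: 1 + t *: 1)).
  move=> th; have GPt := GP t th; have GPN : is_derive (- t) 1 G (G' (- t)).
    by apply: GP; rewrite normrN.
  have := is_derive1_comp GPN (is_deriveNid _ _) => GPc.
  exact: is_deriveB.
have F0h : F 0 = F h.
  have FE t : F t = G t + G (- t) - A * (t * t) by [].
  rewrite !FE /G oppr0 scaleNr !scale0r !addr0 !mulr0 subr0 -expr2 /A.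
  by rewrite mulfVK ?expf_neq0 ?gt_eqF//; ring.
have hN t : 0 <= t <= h -> `|t| <= h by move=> /andP[t0 th]; rewrite ger0_norm.
have [||c] := @Rolle R F 0 h h0 _ _ F0h.
- move=> t; rewrite in_itv/= => /andP[t0 th]; have [] // := FP t _.
  by rewrite hN// !ltW.
- apply: derivable_within_continuous => t; rewrite in_itv/= => th.
  by have [] := FP t (hN _ th).
rewrite in_itv/= => /andP[c0 ch] [_ Fc0].
have [] := FP c (hN _ _); first by rewrite !ltW.
rewrite Fc0 => _ /esym Ec.
have [|s|d /andP[d1 d2] dE] := @MVT_line ('D_v g) x v (- c) c.
- by rewrite gtrN.
- by move=> /andP[s1 s2]; apply: ddg; rewrite ler_norml; apply/andP; split; lra.
exists d; first by rewrite ler_norml; apply/andP; split; lra.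
rewrite -/A; have c2 : c - - c != 0 by rewrite opprK gt_eqF// addr_gt0.
apply: (mulIf c2); rewrite -dE -/(G' c) -/(G' (- c)).
by move: Ec; rewrite /GRing.scale/= => Ec; lra.
Qed.

Lemma second_diff_cvg g x v (r : R) (h : nat -> R) : 0 < r ->
  (forall k, 0 < h k <= r) -> h k @[k --> \oo] --> 0 ->
  (forall s : R, `|s| <= r -> derivable g (x + s *: v) v) ->
  (forall s : R, `|s| <= r -> derivable ('D_v g) (x + s *: v) v) ->
  {for x, continuous ('D_v ('D_v g))} ->
  (g (x + h k *: v) + g (x - h k *: v) - 2 * g x) / h k ^+ 2 @[k --> \oo] -->
    'D_v ('D_v g) x.
Proof.
move=> r0 hr h0 dg ddg cg.
have /choice[c hc] : forall k, exists c, `|c| <= h k /\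
    (g (x + h k *: v) + g (x - h k *: v) - 2 * g x) / h k ^+ 2 =
    'D_v ('D_v g) (x + c *: v).
  move=> k; have /andP[hk0 hkr] := hr k.
  by have [s sh|s sh|c ch ->] := @second_diff g x v (h k) hk0;
    [exact/dg/(le_trans sh)|exact/ddg/(le_trans sh)|exists c].
under eq_cvg do rewrite (hc _).2.
have c0 : c k @[k --> \oo] --> 0.
  apply: (@squeeze_cvgr _ _ _ _ (fun k => - h k) h) => //.
  - by apply: nearW => k; have [+ _] := hc k; rewrite ler_norml.
  - by rewrite -oppr0; exact: cvgN.
have hx : x + c k *: v @[k --> \oo] --> x.
  rewrite -[X in _ --> X]addr0 -(scale0r v).
  by apply: cvgD; [exact: cvg_cst|exact: cvgZr_tmp].
exact: (cvg_comp _ _ hx cg).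
Qed.

Lemma diff_quot_cvg g x v (r : R) (h : nat -> R) : 0 < r ->
  (forall k, 0 < h k <= r) -> h k @[k --> \oo] --> 0 ->
  (forall s : R, 0 <= s <= r -> derivable g (x + s *: v) v) ->
  (g (x + h k *: v) - g x) / h k @[k --> \oo] --> 'D_v g x.
Proof.
move=> r0 hr h0 dg; have : derivable g x v.
  by have := dg 0; rewrite scale0r addr0; apply; rewrite lexx ltW.
move=> /cvg_ex[l hl]; have -> : 'D_v g x = l by exact: cvg_lim.
have hdn : h k @[k --> \oo] --> 0^'.
  move=> A /= [e e0 hA]; have /cvgrPdist_lt/(_ _ e0) := h0.
  apply: filterS => k hk; apply: hA => //; have /andP[+ _] := hr k.
  by rewrite lt_neqAle eq_sym => /andP[].
have := cvg_comp _ _ hdn hl; apply: cvg_trans; apply: near_eq_cvg; apply: nearW => k.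
have -> : x + h k *: v = h k *: v + x by rewrite addrC.
exact: mulrC.
Qed.

End line_derivative.

Section smooth_class.
Context {R : realType} {V : normedModType R}.
Implicit Types (f g : V -> R).

Definition smooth g := forall k, is_Ck k g.

Lemma is_CkS k g : is_Ck k.+1 g -> is_Ck k g.
Proof.
elim: k g => [|k IH] g /= [cg h]; first by split.
by split => // v; have [d1 d2] := h v; split => //; exact: IH.
Qed.

Lemma smooth_continuous g : smooth g -> continuous g.
Proof. by move=> /(_ 0%N)[]. Qed.

Lemma smooth_derivable g x v : smooth g -> derivable g x v.
Proof. by move=> /(_ 1%N)[_ /(_ v)[]]. Qed.

Lemma smooth_derive g v : smooth g -> smooth ('D_v g).
Proof. by move=> sg k; have [_ /(_ v)[]] := sg k.+1. Qed.

Lemma is_Ck_cst k (c : R) : is_Ck k (fun _ : V => c).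
Proof.
elim: k c => [|k IH] c; split=> //; try exact: cst_continuous.
move=> v; split; first by move=> x; exact: derivable_cst.
by rewrite (_ : 'D_v _ = fun _ => 0)//; apply/funext => x; exact: derive_cst.
Qed.

Lemma is_CkD k f g : is_Ck k f -> is_Ck k g -> is_Ck k (fun x => f x + g x).
Proof.
elim: k f g => [|k IH] f g [cf hf] [cg hg].
  by split => // x; apply: cvgD; [exact: cf|exact: cg].
split; first by move=> x; apply: cvgD; [exact: cf|exact: cg].
move=> v; have [df sf] := hf v; have [dg sg] := hg v.
split; first by move=> x; exact: derivableD.
rewrite (_ : 'D_v _ = fun x => 'D_v f x + 'D_v g x); first exact: IH.
by apply/funext => x; exact: deriveD.
Qed.

Lemma is_CkM k f g : is_Ck k f -> is_Ck k g -> is_Ck k (fun x => f x * g x).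
Proof.
elim: k f g => [|k IH] f g.
  by move=> [cf _] [cg _]; split => // x; apply: cvgM; [exact: cf|exact: cg].
move=> Hf Hg; have [cf hf] := Hf; have [cg hg] := Hg.
split; first by move=> x; apply: cvgM; [exact: cf|exact: cg].
move=> v; have [df sf] := hf v; have [dg sg] := hg v.
split; first by move=> x; exact: derivableM.
rewrite (_ : 'D_v _ = fun x => f x * 'D_v g x + g x * 'D_v f x); last first.
  by apply/funext => x; exact: deriveM.
by apply: is_CkD; apply: IH => //; exact: is_CkS.
Qed.

Lemma smooth_cst (c : R) : smooth (fun _ : V => c).
Proof. by move=> k; exact: is_Ck_cst. Qed.

Lemma smoothM f g : smooth f -> smooth g -> smooth (fun x => f x * g x).
Proof. by move=> hf hg k; exact: is_CkM. Qed.

Lemma smooth_prod (I : Type) (r : seq I) (F : I -> V -> R) :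
  (forall i, smooth (F i)) -> smooth (fun x => \prod_(i <- r) F i x).
Proof.
move=> hF; elim: r => [|i r IH].
  by under eq_fun do rewrite big_nil; exact: smooth_cst.
by under eq_fun do rewrite big_cons; exact: smoothM.
Qed.

Definition derivative_chain (D : nat -> R -> R) :=
  forall k (s : R), is_derive s 1 (D k) (D k.+1 s).

(** For l affine with linear part L, the derivative of [D j \o l] along v is L v times
    [D j.+1 \o l], so the family is stable under differentiation and the induction on the order
    closes. *)
Lemma smooth_comp (D : nat -> R -> R) (l : V -> R) (L : V -> R) :
  derivative_chain D -> continuous l ->
  (forall x v s, l (x + s *: v) = l x + s * L v) -> forall j, smooth (D j \o l).
Proof.
move=> hD cl hl j k; elim: k j => [|k IH] j.
all: have cD : continuous (D j \o l) by
  move=> x; apply: continuous_comp; [exact: cl|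
    apply/differentiable_continuous/derivable1_diffP; have [] := hD j (l x)].
- by split.
- split => // v.
  have dv x : is_derive x v (D j \o l) (L v * D j.+1 (l x)).
    have h1 : is_derive (0 : R) 1 (fun t : R => (D j \o l) (x + t *: v)) (D j.+1 (l x) * L v).
      rewrite (_ : (fun t => _) = D j \o (fun t : R => l x + t * L v)); last first.
        by apply/funext => t /=; rewrite hl.
      apply: is_derive1_comp; first by rewrite mul0r addr0; exact: hD.
      have -> : (fun t => l x + t * L v) = cst (l x) + L v *: (@id R).
        by apply/funext => t; rewrite /= mulrC.
      apply: is_derive_eq (is_deriveD (is_derive_cst (l x) (0 : R) (1 : R))
        (is_deriveZ (L v) (is_derive_id (0 : R) (1 : R)))) _.
      by rewrite add0r /GRing.scale/= mulr1.
    have := derive_line (D j \o l) x v 0; rewrite scale0r addr0 => h2.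
    split; last by rewrite -h2 mulrC derive_val.
    by rewrite -[x]addr0 -[X in _ + X](scale0r v); apply: derivable_line; case: h1.
  split; first by move=> x; have [] := dv x.
  rewrite (_ : 'D_v _ = fun x => L v * (D j.+1 \o l) x).
    by apply: is_CkM; [exact: is_Ck_cst|exact: IH].
  by apply/funext => x; rewrite derive_val.
Qed.

End smooth_class.

Section flat_function.
Context {R : realType}.
Implicit Types (q : {poly R}) (s : R).

(** The functions q(1/s) exp(-1/s), extended by 0, contain the standard flat function (q = 1) and
    are stable under differentiation: the derivative replaces q by (q - q') X^2. *)
Definition flat q s : R := if 0 < s then q.[s^-1] * expR (- s^-1) else 0.

Lemma flat_bound q : exists2 C : R, 0 <= C & forall s, s <= 1 -> `|flat q s| <= C * s ^+ 2.
Proof.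
pose S := \sum_(i < size q) `|q`_i|; pose d := size q.
have S0 : 0 <= S by exact: sumr_ge0.
exists (S * (d.+2)`!%:R) => [|s s1]; first by rewrite mulr_ge0.
rewrite /flat; case: ifPn => s0; last by rewrite normr0 mulr_ge0 ?sqr_ge0// mulr_ge0.
have y1 : 1 <= s^-1 by rewrite invf_ge1.
have y0 : 0 < s^-1 by rewrite invr_gt0.
have qy : `|q.[s^-1]| <= S * s^-1 ^+ d.
  rewrite horner_coef mulr_suml; apply: le_trans (ler_norm_sum _ _ _) _.
  apply: ler_sum => i _; rewrite normrM; apply: ler_wpM2l => //.
  rewrite ger0_norm; last by apply: exprn_ge0; exact: ltW.
  by apply: ler_weXn2l => //; exact/ltnW/ltn_ord.
(* One term of the exponential series at 1/s, of degree two more than [size q]: the powers of 1/s in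
   q are absorbed and a factor s^2 remains, which makes the derivative at 0 vanish. *)
have ey : expR (- s^-1) <= (d.+2)`!%:R * s ^+ d.+2.
  set P := (X in _ <= X); have P0 : 0 < P.
    by apply: mulr_gt0; [rewrite ltr0n fact_gt0|exact: exprn_gt0].
  rewrite expRN -[P]invrK lef_pV2 ?posrE ?expR_gt0 ?invr_gt0//.
  apply: le_trans (expR_ge1Dxn d.+1 (ltW y0)).
  by rewrite /P invfM exprVn mulrC lerDr.
rewrite normrM (ger0_norm (expR_ge0 _)).
apply: le_trans (ler_pM _ (expR_ge0 _) qy ey) _ => //.
rewrite mulrACA; apply: ler_wpM2l; first by rewrite mulr_ge0.
rewrite -addn2 exprD mulrA -exprMn mulVf ?gt_eqF// expr1n mul1r.
exact: lexx.
Qed.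

Lemma flat_derive q s : is_derive s 1 (flat q) (flat ((q - q^`()) * 'X^2) s).
Proof.
have [s0|s0|s0] := ltgtP 0 s.
- have -> : flat ((q - q^`()) * 'X^2) s =
    q.[s^-1] * expR (- s^-1) * (s ^-2) - q^`().[s^-1] * (s ^- 2) * expR (- s^-1).
    rewrite /flat s0 hornerM hornerD hornerN hornerXn exprVn; ring.
  apply: (@near_eq_is_derive _ _ _ (fun t : R => q.[t^-1] * expR (- t^-1))).
  + have nb : \forall t \near s, 0 < t by exact: (open_nbhs_nbhs (conj (@open_gt R 0) s0)).
    by apply: filterS nb => t t0; rewrite /flat t0.
  have dV : is_derive s 1 (fun t : R => t^-1) (- s ^- 2 *: 1).
    by apply: is_deriveV; rewrite gt_eqF.
  have dq : is_derive s 1 (fun t : R => q.[t^-1]) (q^`().[s^-1] * (- s ^- 2 *: 1)).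
    by apply: (is_derive1_comp (f := fun y : R => q.[y]) (g := fun t : R => t^-1)); exact: is_derive_poly.
  have de : is_derive s 1 (fun t : R => expR (- t^-1)) (expR (- s^-1) * - (- s ^- 2 *: 1)).
    by apply: (is_derive1_comp (f := expR) (g := fun t : R => - t^-1)).
  refine (is_derive_eq (is_deriveM dq de) _).
  by rewrite /GRing.scale/=; ring.
- have -> : flat ((q - q^`()) * 'X^2) s = 0 by rewrite /flat ltNge (ltW s0).
  apply: (@near_eq_is_derive _ _ _ (cst 0)).
  + have nb : \forall t \near s, t < 0 by exact: (open_nbhs_nbhs (conj (@open_lt R 0) s0)).
    by apply: filterS nb => t t0; rewrite /flat ltNge (ltW t0).
- have -> : flat ((q - q^`()) * 'X^2) s = 0 by rewrite /flat -s0 ltxx.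
  rewrite -s0.
  have [C C0 hC] := flat_bound q.
  have f0 : flat q 0 = 0 by rewrite /flat ltxx.
  have cv : (fun h : R => h^-1 *: ((flat q \o shift 0) (h *: 1) - flat q 0)) @ 0^' --> (0 : R).
    apply/cvgrPdist_le => e e0.
    have C1 : 0 < C + 1 by rewrite ltr_wpDl.
    near=> h; rewrite sub0r normrN f0 subr0 /= addr0 /GRing.scale/= mulr1 normrM normfV.
    have h0 : h != 0 by near: h; exact: nbhs_dnbhs_neq.
    have hh : `|h| <= Num.min 1 (e / (C + 1)).
      near: h; apply: (@dnbhs0_le _ R^o); rewrite lt_min ltr01 divr_gt0//.
    move: hh; rewrite le_min => /andP[h1 he].
    rewrite ler_pdivrMl ?normr_gt0//.
    apply: le_trans (hC h _) _; first exact: le_trans (ler_norm _) h1.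
    rewrite -real_normK ?num_real// expr2 mulrC -mulrA; apply: ler_wpM2l => //.
    apply: le_trans (_ : (e / (C + 1)) * (C + 1) <= _); last by rewrite divfK// gt_eqF.
    by apply: ler_pM => //; rewrite lerDl.
  split; first by apply/cvg_ex; exists 0.
  exact: cvg_lim cv.
Unshelve. all: by end_near. Qed.

Definition flat_chain (k : nat) : R -> R :=
  flat (iter k (fun q => (q - q^`()) * 'X^2) 1).

Lemma flat_chainP : derivative_chain flat_chain.
Proof. by move=> k s; exact: flat_derive. Qed.

Definition hump : R -> R := flat_chain 0.

Lemma humpE s : hump s = if 0 < s then expR (- s^-1) else 0.
Proof. by rewrite /hump /flat_chain /flat /= hornerC mul1r. Qed.

Lemma hump_ge0 s : 0 <= hump s.
Proof. by rewrite humpE; case: ifP => // _; exact: expR_ge0. Qed.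

Lemma hump_gt0 s : 0 < s -> 0 < hump s.
Proof. by move=> s0; rewrite humpE s0 expR_gt0. Qed.

Lemma hump_eq0 s : s <= 0 -> hump s = 0.
Proof. by move=> s0; rewrite humpE ltNge s0. Qed.

Lemma hump_le1 s : hump s <= 1.
Proof.
rewrite humpE; case: ifPn => // s0.
by rewrite -expR0 ler_expR oppr_le0 invr_ge0 ltW.
Qed.

Lemma hump_le s t : s <= t -> hump s <= hump t.
Proof.
move=> st; have [s0|s0] := leP s 0; first by rewrite hump_eq0// hump_ge0.
rewrite !humpE s0 (lt_le_trans s0 st) ler_expR lerN2 lef_pV2//.
by rewrite posrE (lt_le_trans s0 st).
Qed.

End flat_function.

Section test_functions.
Context {R : realType} {V : normedModType R}.
Implicit Types (phi : V -> R).

Lemma test_smooth phi : test_function phi -> smooth phi.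
Proof. by case. Qed.

Lemma test_intro phi (S : set V) : smooth phi -> compact S ->
  (forall x, phi x != 0 -> S x) -> test_function phi.
Proof.
move=> sphi cS phiS; split => //.
apply: (subclosed_compact _ cS); first exact: closed_closure.
have clS : closed S by apply: compact_closed => //; exact: norm_hausdorff.
by rewrite (closure_id S).1//; apply: closureS => x /phiS.
Qed.

Lemma test_support phi : test_function phi ->
  exists2 r : R, 0 < r & forall x, phi x != 0 -> `|x| <= r.
Proof.
move=> [_ /compact_bounded[M [_ hM]]]; exists (`|M| + 1) => [|x phix].
  by rewrite ltr_wpDl.
apply: hM; last exact: subset_closure.
by rewrite (le_lt_trans (ler_norm _))// ltrDl.
Qed.

Lemma continuous_compact_bounded phi (S : set V) : continuous phi -> compact S ->
  exists C : R, forall x, S x -> `|phi x| <= C.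
Proof.
move=> cphi cS; have cphi' : {within S, continuous phi} by exact: continuous_subspaceT.
have /compact_bounded[M [_ hM]] := continuous_compact cphi' cS.
exists (`|M| + 1) => x Sx; apply: hM; last by exists x.
by rewrite (le_lt_trans (ler_norm _))// ltrDl.
Qed.

Lemma test_bounded phi : test_function phi -> exists2 C : R, 0 <= C & forall x, `|phi x| <= C.
Proof.
move=> [sphi cphi].
have [C hC] := continuous_compact_bounded (smooth_continuous sphi) cphi.
exists `|C| => // x; have [->|phix] := eqVneq (phi x) 0; first by rewrite normr0.
by apply: le_trans (ler_norm _); apply: hC; exact: subset_closure.
Qed.

(** Outside the closure of the support phi vanishes near the point, and hence so does its
    derivative; the support does not grow. *)
Lemma test_derive phi v : test_function phi -> test_function ('D_v phi).
Proof.
move=> [sphi cphi]; apply: (test_intro _ cphi); first exact: smooth_derive.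
move=> x; apply: contraNP => nx; apply/eqP.
have nb : \forall y \near x, cst 0 y = phi y.
  have : nbhs x (~` closure [set x | phi x != 0]).
    by apply: open_nbhs_nbhs; split => //; exact/closed_openC/closed_closure.
  apply: filterS => y ny; apply/esym/eqP; apply: contrapT => /negP phiy.
  exact/ny/subset_closure.
have [->|v0] := eqVneq v 0; first exact: derive0.
by have [] := near_eq_is_derive nb (is_derive_cst (0 : R) x v).
Qed.

Lemma derive_scale phi (c : R) x v : derivable phi (c *: x) v ->
  is_derive x v (fun y => phi (c *: y)) (c * 'D_v phi (c *: x)).
Proof.
move=> dphi.
have h1 : is_derive (0 : R) 1 (fun t : R => phi (c *: (x + t *: v))) ('D_v phi (c *: x) * c).
  rewrite (_ : (fun t => _) = (fun t : R => phi (c *: x + t *: v)) \o (fun t => c * t)).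
    apply: is_derive1_comp.
      rewrite mulr0; have := @is_derive_line _ _ phi (c *: x) v 0.
      by rewrite scale0r addr0; apply.
    apply: is_derive_eq (is_deriveZ c (is_derive_id (0 : R) (1 : R))) _.
    by rewrite /GRing.scale/= mulr1.
  by apply/funext => t /=; rewrite scalerDr scalerA.
have := derive_line (fun y => phi (c *: y)) x v 0; rewrite scale0r addr0 => h2.
split; last by rewrite -h2 mulrC derive_val.
by rewrite -[x]addr0 -[X in _ + X](scale0r v); apply: derivable_line; case: h1.
Qed.

Lemma deriveX_fun phi k x v : derivable phi x v ->
  is_derive x v (fun y => phi y ^+ k.+1) (k.+1%:R * phi x ^+ k * 'D_v phi x).
Proof.
move=> dphi; have := @is_deriveX _ _ phi k.+1 x v _ (derivableP dphi).
rewrite (_ : phi ^+ k.+1 = fun y => phi y ^+ k.+1)//.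
by apply/funext => y; rewrite exprfctE.
Qed.

End test_functions.

Section bumps.
Context {R : realType} {n : nat}.
Notation X := 'rV[R]_n.

Lemma cbox_compact (a b : X) : compact (cbox a b).
Proof.
have := @rV_compact R n (fun i => `[a 0 i, b 0 i]%classic) (fun i => @segment_compact _ _ _).
by congr compact; apply/seteqP; split => x h i; have := h i; rewrite /= in_itv.
Qed.

Definition box_bump (c : R) (a b x : X) : R :=
  \prod_(i < n) (hump (c * (x 0 i - a 0 i)) * hump (c * (b 0 i - x 0 i))).

Lemma smooth_hump_comp (V : normedModType R) (l L : V -> R) (k : R) :
  (forall x y, `|l x - l y| <= k * `|x - y|) ->
  (forall x v s, l (x + s *: v) = l x + s * L v) -> smooth (hump \o l).
Proof.
move=> lk lL; exact: (smooth_comp flat_chainP (lipschitz_bound_continuous lk) lL 0%N).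
Qed.

Lemma smooth_box_bump c (a b : X) : smooth (box_bump c a b).
Proof.
apply: smooth_prod => i; apply: smoothM.
- apply: (@smooth_hump_comp _ (fun x : X => c * (x 0 i - a 0 i)) (fun v => c * v 0 i) `|c|).
    move=> x y; rewrite -mulrBr normrM; apply: ler_wpM2l => //.
    by rewrite opprB addrA subrK; have := norm_coor (x - y) i; rewrite !mxE.
  by move=> x v s; rewrite !mxE; ring.
- apply: (@smooth_hump_comp _ (fun x : X => c * (b 0 i - x 0 i)) (fun v => - c * v 0 i) `|c|).
    move=> x y; rewrite -mulrBr normrM; apply: ler_wpM2l => //.
    rewrite opprB addrCA addrAC subrr add0r distrC.
    by have := norm_coor (x - y) i; rewrite !mxE.
  by move=> x v s; rewrite !mxE; ring.
Qed.

Lemma box_bump_ge0 c (a b x : X) : 0 <= box_bump c a b x.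
Proof. by apply: prodr_ge0 => i _; rewrite mulr_ge0// hump_ge0. Qed.

Lemma box_bump_le1 c (a b x : X) : box_bump c a b x <= 1.
Proof.
have /andP[] // : 0 <= box_bump c a b x <= 1.
apply: (big_ind (fun y : R => 0 <= y <= 1)) => [|y z /andP[y0 y1] /andP[z0 z1]|i _].
- by rewrite ler01 lexx.
- by rewrite mulr_ge0//= mulr_ile1.
- by rewrite mulr_ge0 ?hump_ge0//= mulr_ile1 ?hump_ge0 ?hump_le1.
Qed.

Lemma box_bump_gt0 (c : R) (a b x : X) : 0 < c -> (forall i, a 0 i < x 0 i < b 0 i) ->
  0 < box_bump c a b x.
Proof.
move=> c0 h; apply: prodr_gt0 => i _; have /andP[h1 h2] := h i.
by rewrite mulr_gt0// hump_gt0// mulr_gt0// subr_gt0.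
Qed.

Lemma box_bump_neq0 (c : R) (a b x : X) : 0 < c -> box_bump c a b x != 0 ->
  forall i, a 0 i < x 0 i < b 0 i.
Proof.
move=> c0 /prodf_neq0 h i; have := h i isT; rewrite mulf_eq0 negb_or => /andP[h1 h2].
apply/andP; split; rewrite ltNge; apply/negP => le.
  by move: h1; rewrite hump_eq0 ?eqxx// pmulr_rle0// subr_le0.
by move: h2; rewrite hump_eq0 ?eqxx// pmulr_rle0// subr_le0.
Qed.

Lemma test_box_bump (c : R) (a b : X) : 0 < c -> test_function (box_bump c a b).
Proof.
move=> c0; apply: (@test_intro _ _ _ (cbox a b)).
- exact: smooth_box_bump.
- exact: cbox_compact.
by move=> x /(box_bump_neq0 c0) h i; have /andP[h1 h2] := h i; rewrite !ltW.
Qed.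

Definition time_bump (c s t : R) (r : R) : R := hump (c * (r - s)) * hump (c * (t - r)).

Definition space_time_bump (c : R) (a b : X) (s t : R) (z : X * R) : R :=
  box_bump c a b z.1 * time_bump c s t z.2.

Lemma norm_fst_le (z : X * R) : `|z.1| <= `|z|.
Proof. by rewrite prod_normE le_max lexx. Qed.

Lemma norm_snd_le (z : X * R) : `|z.2| <= `|z|.
Proof. by rewrite prod_normE le_max lexx orbT. Qed.

Lemma smooth_space_time_bump c (a b : X) s t : smooth (space_time_bump c a b s t).
Proof.
apply: smoothM; first (apply: smooth_prod => i; apply: smoothM).
- apply: (@smooth_hump_comp _ (fun z : X * R => c * (z.1 0 i - a 0 i)) (fun v => c * v.1 0 i) `|c|).
    move=> x y; rewrite -mulrBr normrM; apply: ler_wpM2l => //.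
    rewrite opprB addrA subrK; apply: le_trans (norm_fst_le (x - y)).
    by have := norm_coor (x.1 - y.1) i; rewrite !mxE.
  by move=> x v r; rewrite !mxE; ring.
- apply: (@smooth_hump_comp _ (fun z : X * R => c * (b 0 i - z.1 0 i)) (fun v => - c * v.1 0 i) `|c|).
    move=> x y; rewrite -mulrBr normrM; apply: ler_wpM2l => //.
    rewrite opprB addrCA addrAC subrr add0r distrC; apply: le_trans (norm_fst_le (x - y)).
    by have := norm_coor (x.1 - y.1) i; rewrite !mxE.
  by move=> x v r; rewrite !mxE; ring.
apply: smoothM.
- apply: (@smooth_hump_comp _ (fun z : X * R => c * (z.2 - s)) (fun v => c * v.2) `|c|).
    move=> x y; rewrite -mulrBr normrM; apply: ler_wpM2l => //.
    by rewrite opprB addrA subrK; exact: (norm_snd_le (x - y)).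
  by move=> x v r; rewrite /= /GRing.scale/=; ring.
- apply: (@smooth_hump_comp _ (fun z : X * R => c * (t - z.2)) (fun v => - c * v.2) `|c|).
    move=> x y; rewrite -mulrBr normrM; apply: ler_wpM2l => //.
    by rewrite opprB addrCA addrAC subrr add0r distrC; exact: (norm_snd_le (x - y)).
  by move=> x v r; rewrite /= /GRing.scale/=; ring.
Qed.

Lemma time_bump_ge0 c s t r : 0 <= time_bump c s t r.
Proof. by rewrite mulr_ge0// hump_ge0. Qed.

Lemma time_bump_gt0 (c s t r : R) : 0 < c -> s < r < t -> 0 < time_bump c s t r.
Proof. by move=> c0 /andP[h1 h2]; rewrite mulr_gt0// hump_gt0// mulr_gt0// subr_gt0. Qed.

Lemma time_bump_neq0 (c s t r : R) : 0 < c -> time_bump c s t r != 0 -> s < r < t.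
Proof.
move=> c0; rewrite mulf_eq0 negb_or => /andP[h1 h2].
apply/andP; split; rewrite ltNge; apply/negP => le.
  by move: h1; rewrite hump_eq0 ?eqxx// pmulr_rle0// subr_le0.
by move: h2; rewrite hump_eq0 ?eqxx// pmulr_rle0// subr_le0.
Qed.

Lemma test_space_time_bump (c : R) (a b : X) s t : 0 < c ->
  test_function (space_time_bump c a b s t).
Proof.
move=> c0; apply: (@test_intro _ _ _ (cbox a b `*` `[s, t]%classic)).
- exact: smooth_space_time_bump.
- by apply: compact_setX; [exact: cbox_compact|exact: segment_compact].
move=> z; rewrite mulf_eq0 negb_or => /andP[/(box_bump_neq0 c0) h /(time_bump_neq0 c0) /andP[h1 h2]].
split; first by move=> i; have /andP[h3 h4] := h i; rewrite !ltW.
by rewrite /= in_itv/= !ltW.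
Qed.

End bumps.

(** At each time only some backward step h with a one-sided estimate is available, as y is not known
    to be differentiable. Hence an argument by maximum: exp(-2Kt) y(t) - (E + d) t attains its
    maximum over [0, T], and the backward step excludes a maximum at a positive time. *)
Lemma gronwall_left {R : realType} (y : R -> R) (T K E : R) : 0 < T -> 0 < K -> 0 <= E ->
  continuous y -> (forall t, 0 <= y t) ->
  (forall t, 0 < t <= T -> forall e, 0 < e -> exists h,
     [/\ 0 < h, h <= t, K * h <= 2^-1 & y t - y (t - h) <= h * (K * y t + E + e)]) ->
  y T <= expR (2 * K * T) * (y 0 + E * T).
Proof.
move=> T0 K0 E0 cy y0 hy.
rewrite -ler_pdivrMl ?expR_gt0// -expRN; apply/ler_addgt0Pr => e e0.
(* The slope d, of total cost e over [0, T], exceeds the error d/2 allowed in each step and makes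
   the contradiction strict. *)
pose d := e / T; have d0 : 0 < d by rewrite divr_gt0.
pose z t := expR (- (2 * K * t)) * y t - (E + d) * t.
have cz : continuous z.
  move=> t; apply: cvgB.
    apply: cvgM; last exact: cy.
    apply: (cvg_comp (fun t : R => - (2 * K * t)) expR); last exact: continuous_expR.
    by apply: cvgN; apply: cvgM; [exact: cvg_cst|exact: cvg_id].
  by apply: cvgM; [exact: cvg_cst|exact: cvg_id].
have [c] := EVT_max (ltW T0) (continuous_subspaceT cz).
rewrite in_itv/= => /andP[c0 cT] cmax.
have zT : z T <= z c by apply: cmax; rewrite in_itv/= lexx ltW.
have c00 : c = 0.
  apply/eqP; rewrite eq_le c0 andbT leNgt; apply/negP => cpos.
  have d2 : 0 < d / 2 by rewrite divr_gt0.
  have [|h [h0 hc Kh yh]] := hy c _ _ d2; first by rewrite cpos.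
  have := cmax (c - h); rewrite in_itv/= => /(_ _)/wrap[].
    by rewrite subr_ge0 hc lerBlDr (le_trans cT)// lerDl ltW.
  apply/negP; rewrite -ltNge /z.
  have e1 : expR (- (2 * K * c)) = expR (- (2 * K * (c - h))) * expR (- (2 * K * h)).
    by rewrite -expRD; congr expR; ring.
  set a := expR (- (2 * K * (c - h))) in e1 *.
  have a0 : 0 < a by exact: expR_gt0.
  have a1 : a <= 1.
    by rewrite -expR0 ler_expR oppr_le0 mulr_ge0 ?subr_ge0// mulr_ge0// ltW.
  (* The rate is doubled because the right side of the step involves y at the later time: 1/(1 +
     2Kh) <= 1 - Kh is exactly the condition Kh <= 1/2. *)
  have b1 : expR (- (2 * K * h)) <= 1 - K * h.
    have k0 : 0 <= K * h by rewrite mulr_ge0 ?ltW.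
    rewrite expRN; apply: (@le_trans _ _ (1 + 2 * K * h)^-1).
      rewrite lef_pV2 ?posrE ?expR_gt0 ?expR_ge1Dx//.
      by rewrite ltr_pwDl// -mulrA mulr_ge0.
    have p0 : 0 < 1 + 2 * K * h by rewrite ltr_pwDl// -mulrA mulr_ge0.
    by rewrite -div1r ler_pdivrMr//; nra.
  rewrite e1.
  have yc : expR (- (2 * K * h)) * y c <= y (c - h) + h * (E + d / 2).
    by apply: le_trans (ler_wpM2r (y0 c) b1) _; nra.
  have : a * (expR (- (2 * K * h)) * y c) <= a * (y (c - h) + h * (E + d / 2)).
    by rewrite ler_pM2l.
  have : a * (h * (E + d / 2)) <= h * (E + d / 2).
    rewrite ler_piMl//; apply: mulr_ge0; first exact: ltW.
    by apply: addr_ge0 => //; exact: ltW.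
  have : 0 < h * (d / 2) by rewrite mulr_gt0.
  rewrite mulrDr mulrA; nra.
move: zT; rewrite /z c00 !mulr0 oppr0 expR0 mul1r ?subr0 ?addr0 => zT.
have -> : e = d * T by rewrite /d divfK// gt_eqF.
by lra.
Qed.

(** * The L1 comparison principle *)

Section discrete_laplacian.
Context {R : realType} {n : nat}.
Notation X := 'rV[R]_n.
Notation mu := (@lebesgue_rV R n).
Implicit Types (g phi : X -> R).

Definition basis_rV (i : 'I_n) : X := delta_mx 0 i.

Definition dlap (h : R) g (x : X) : R :=
  \sum_(i < n) (g (x + h *: basis_rV i) + g (x - h *: basis_rV i) - 2 * g x) / h ^+ 2.

Lemma norm_basis_rV i : `|basis_rV i| <= 1.
Proof.
apply: norm_ball_box => //; apply/ball_boxP => j; rewrite /basis_rV mxE eqxx/=.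
by case: (j == i); rewrite ?normr1 ?normr0.
Qed.

Lemma dlapB h g f x : dlap h (fun y => g y - f y) x = dlap h g x - dlap h f x.
Proof. by rewrite /dlap -sumrB; apply: eq_bigr => i _; ring. Qed.

Lemma measurable_dlap h g : measurable_fun setT g -> measurable_fun setT (dlap h g).
Proof.
move=> mg; apply: measurable_sum => i; apply: measurable_funM => //.
apply: measurable_funB; last exact: measurable_funM.
by apply: measurable_funD; apply: (measurableT_comp mg); exact: measurable_translate.
Qed.

(** The discrete Laplacian is a symmetric combination of translations, hence self-adjoint by
    translation invariance; g is only bounded and the integrability is carried by phi. *)
Lemma int_dlap_parts h g phi (M : R) : measurable_fun setT g -> (forall x, `|g x| <= M) ->
  intg mu phi ->
  [/\ intg mu (fun x => dlap h g x * phi x), intg mu (fun x => g x * dlap h phi x) &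
  \int[mu]_x (dlap h g x * phi x) = \int[mu]_x (g x * dlap h phi x)].
Proof.
move=> mg gM Iphi; have mphi := intg_measurable Iphi.
have It y : intg mu (fun x => g (x + y) * phi x).
  by apply: (intgM_bounded Iphi (M := M)) => //; apply: (measurableT_comp mg); exact: measurable_translate.
have It' y : intg mu (fun x => g x * phi (x + y)).
  exact: (intgM_bounded (intg_translate y Iphi) (M := M)).
have I0 : intg mu (fun x => g x * phi x) by exact: (intgM_bounded Iphi (M := M)).
have tr y : \int[mu]_x (g (x + y) * phi x) = \int[mu]_x (g x * phi (x - y)).
  rewrite -[RHS](int_translate y (f := fun x => g x * phi (x - y))).
    by apply: eq_int => x; rewrite addrK.
  exact: (intg_measurable (It' (- y))).
pose F i x := h ^- 2 * ((g (x + h *: basis_rV i) * phi x + g (x - h *: basis_rV i) * phi x) - 2 * (g x * phi x)).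
pose G i x := h ^- 2 * ((g x * phi (x + h *: basis_rV i) + g x * phi (x - h *: basis_rV i)) - 2 * (g x * phi x)).
have IF i : intg mu (F i).
  by apply: intgZ; apply: intgB; [apply: intgD; exact: It|exact: intgZ].
have IG i : intg mu (G i).
  by apply: intgZ; apply: intgB; [apply: intgD; exact: It'|exact: intgZ].
have EF : (fun x => dlap h g x * phi x) = (fun x => \sum_(i < n) F i x).
  by apply/funext => x; rewrite mulr_suml; apply: eq_bigr => i _; rewrite /F; ring.
have EG : (fun x => g x * dlap h phi x) = (fun x => \sum_(i < n) G i x).
  by apply/funext => x; rewrite mulr_sumr; apply: eq_bigr => i _; rewrite /G; ring.
split; [by rewrite EF; exact: intg_sum|by rewrite EG; exact: intg_sum|].
rewrite EF EG !int_sum//; apply: eq_bigr => i _; rewrite /F /G.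
rewrite !RintegralZl//; last 2 first.
- by apply: intgB; [apply: intgD; exact: It'|exact: intgZ].
- by apply: intgB; [apply: intgD; exact: It|exact: intgZ].
congr (_ * _); rewrite !RintegralB//; last 4 first.
- by apply: intgD; exact: It'.
- exact: intgZ.
- by apply: intgD; exact: It.
- exact: intgZ.
congr (_ - _); rewrite !RintegralD//; try by [exact: It|exact: It'].
rewrite (tr (h *: basis_rV i)) (tr (- (h *: basis_rV i))).
by rewrite opprK addrC.
Qed.

Definition pospart (r : R) : R := Num.max r 0.

Lemma pospart_ge0 r : 0 <= pospart r.
Proof. by rewrite le_max lexx orbT. Qed.

Lemma le_pospart r : r <= pospart r.
Proof. by rewrite le_max lexx. Qed.

Lemma pospart_le_norm r : pospart r <= `|r|.
Proof. by rewrite ge_max ler_norm normr_ge0. Qed.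

Lemma pospartE r : pospart r = ((0 < r)%R)%:R * r.
Proof.
rewrite /pospart maxElt; have [r0|r0] := ltP 0 r; first by rewrite mul1r ltNge (ltW r0).
rewrite mul0r; have [//|r0'] := ltP r 0; by apply/eqP; rewrite eq_le r0 r0'.
Qed.

Lemma measurable_pospart d (T : measurableType d) (f : T -> R) :
  measurable_fun setT f -> measurable_fun setT (fun x => pospart (f x)).
Proof. by move=> mf; exact: measurable_maxr. Qed.

Lemma measurable_pos_bool d (T : measurableType d) (f : T -> R) :
  measurable_fun setT f -> measurable_fun setT (fun x => ((0 < f x)%R)%:R : R).
Proof.
move=> mf; rewrite (_ : (fun x => _) = \1_(f @^-1` `]0, +oo[%classic)).
  by apply: measurable_indic; rewrite -[X in measurable X]setTI; exact: mf.
apply/funext => x; rewrite indicE (_ : (x \in _) = (0 < f x))//.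
by apply/idP/idP; rewrite inE/= in_itv/= andbT.
Qed.

(* On {a > 0} the discrete Laplacian of a is at most that of its positive part,
   and the latter is moved to phi by translation invariance: no smoothing of the
   sign function is needed. *)
Lemma kato_discrete (h : R) (a phi : X -> R) (M : R) : 0 < h -> measurable_fun setT a ->
  (forall x, `|a x| <= M) -> intg mu phi -> (forall x, 0 <= phi x) ->
  \int[mu]_x (((0 < a x)%R)%:R * dlap h a x * phi x) <=
  \int[mu]_x (pospart (a x) * dlap h phi x).
Proof.
move=> h0 ma aM Iphi phi0.
have mp := measurable_pospart ma.
have pM x : `|pospart (a x)| <= M.
  by rewrite ger0_norm ?pospart_ge0// (le_trans (pospart_le_norm _)).
have [I1 I2 <-] := int_dlap_parts h mp pM Iphi.
have [I3 _ _] := int_dlap_parts h ma aM Iphi.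
apply: int_le => //.
  rewrite (_ : (fun x => _) = (fun x => ((0 < a x)%R)%:R * (dlap h a x * phi x))).
    by apply: (intgM_bounded I3 (M := 1)) => [|x];
      [exact: measurable_pos_bool|rewrite normr_nat lern1 leq_b1].
  by apply/funext => x; rewrite mulrA.
move=> x; apply: ler_wpM2r => //; rewrite mulr_sumr; apply: ler_sum => i _.
rewrite mulrA ler_pM2r ?invr_gt0 ?exprn_gt0// mulrBr mulrDr.
rewrite mulrCA -pospartE lerD2r lerD//.
- by case: (0 < a x); rewrite ?mul1r ?mul0r ?le_pospart ?pospart_ge0.
- by case: (0 < a x); rewrite ?mul1r ?mul0r ?le_pospart ?pospart_ge0.
Qed.

(** Bounds and limits are required only where the weight is non-zero, because difference quotients
    of a smooth solution are controlled on compact sets only. *)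
Lemma dominated_cvg_weight (F : nat -> X -> R) (f phi : X -> R) (B : R) :
  intg mu phi -> (forall x, 0 <= phi x) -> (forall k, measurable_fun setT (F k)) ->
  (forall x, phi x != 0 -> (forall k, `|F k x| <= B) /\ F k x @[k --> \oo] --> f x) ->
  [/\ intg mu (fun x => f x * phi x), forall k, intg mu (fun x => F k x * phi x) &
    \int[mu]_x (F k x * phi x) @[k --> \oo] --> \int[mu]_x (f x * phi x)].
Proof.
move=> Iphi phi0 mF hF; have mphi := intg_measurable Iphi.
have cF x : F k x * phi x @[k --> \oo] --> f x * phi x.
  have [->|px] := eqVneq (phi x) 0.
    by rewrite mulr0; under eq_cvg do rewrite mulr0; exact: cvg_cst.
  by apply: cvgM; [exact: (hF x px).2|exact: cvg_cst].
have mFp k : measurable_fun setT (fun x => F k x * phi x) by exact: measurable_funM.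
have IB : intg mu (fun x => B * phi x) by exact: intgZ.
have bF x k : `|F k x * phi x| <= B * phi x.
  have [->|px] := eqVneq (phi x) 0; first by rewrite !mulr0 normr0.
  by rewrite normrM [`|phi x|]ger0_norm//; apply: ler_wpM2r => //; exact: (hF x px).1.
have mf : measurable_fun setT (fun x => f x * phi x).
  by apply: (measurable_fun_cvg mFp) => x _; exact: cF.
have [|If _ h] := dominated_cvg_int mFp mf IB (aeW _ cF); first exact: aeW.
by split => // k; exact: intg_dom (bF^~ k).
Qed.

End discrete_laplacian.

Section comparison.
Context {R : realType} {n : nat}.
Notation X := 'rV[R]_n.
Notation mu := (@lebesgue_rV R n).
Implicit Types (phi : X -> R).

Lemma cvg_sum_seq (I : Type) (r : seq I) (F : I -> nat -> R) (f : I -> R) :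
  (forall i, F i k @[k --> \oo] --> f i) ->
  \sum_(i <- r) F i k @[k --> \oo] --> \sum_(i <- r) f i.
Proof.
move=> hF; elim: r => [|i r IH].
  by rewrite big_nil; under eq_cvg do rewrite big_nil; exact: cvg_cst.
by rewrite big_cons; under eq_cvg do rewrite big_cons; exact: cvgD.
Qed.

Lemma test_intg phi : test_function phi -> intg mu phi.
Proof.
move=> tphi; have [C _ hC] := test_bounded tphi.
have [r r0 hr] := test_support tphi.
apply: (intg_supp (measurable_cbox _ _) (lebesgue_cbox_lty (const_mx (- r)) (const_mx r)) _ hC).
  exact: continuous_measurable_rV (smooth_continuous (test_smooth tphi)).
move=> x nx; apply/eqP; apply: contrapT => /negP /hr xr; apply: nx.
exact: ball_box_norm.
Qed.

Lemma dlap_test_bound phi : test_function phi ->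
  exists2 B : R, 0 <= B & forall (h : R) x, 0 < h -> `|dlap h phi x| <= B.
Proof.
move=> tphi; have /choice[C hC] : forall i, exists C : R, 0 <= C /\
    forall x, `|'D_(basis_rV i) ('D_(basis_rV i) phi) x| <= C.
  move=> i; have [C C0 hC] := test_bounded (test_derive (basis_rV i) (test_derive (basis_rV i) tphi)).
  by exists C.
exists (\sum_(i < n) C i) => [|h x h0]; first by apply: sumr_ge0 => i _; have [] := hC i.
rewrite /dlap; apply: le_trans (ler_norm_sum _ _ _) _; apply: ler_sum => i _.
have [s _|s _|c _ ->] := @second_diff _ _ phi x (basis_rV i) h h0.
- exact/smooth_derivable/test_smooth.
- exact/smooth_derivable/test_smooth/test_derive.
- by have [_] := hC i; apply.
Qed.

Lemma dlap_test_supp phi r (h : R) x : (forall x, phi x != 0 -> `|x| <= r) -> 0 < h ->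
  r + h < `|x| -> dlap h phi x = 0.
Proof.
move=> hr h0 xr; rewrite /dlap big1// => i _.
have z y : `|x - y| <= h -> phi y = 0.
  move=> xy; apply/eqP; apply: contrapT => /negP /hr yr; move: xr; rewrite ltNge.
  move=> /negP; apply; rewrite -[x](subrK y) addrC (le_trans (ler_normD _ _))// lerD//.
have nb : `|h *: basis_rV i : X| <= h.
  by rewrite normrZ gtr0_norm//; apply: ler_piMr; [exact: ltW|exact: norm_basis_rV].
have -> : phi x = 0 by apply: z; rewrite subrr normr0 ltW.
have -> : phi (x + h *: basis_rV i) = 0.
  by apply: z; rewrite opprD addrA subrr add0r normrN.
have -> : phi (x - h *: basis_rV i) = 0 by apply: z; rewrite opprB addrC subrK.
by rewrite mulr0 addr0 subr0 mul0r.
Qed.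

Lemma dlap_test_cvg phi (h : nat -> R) (r x : _) : test_function phi ->
  (forall k, 0 < h k <= r) -> h k @[k --> \oo] --> 0 ->
  dlap (h k) phi x @[k --> \oo] --> space_laplacian phi x.
Proof.
move=> tphi hr h0; have r0 : 0 < r by have /andP[a b] := hr 0%N; exact: lt_le_trans b.
rewrite /dlap /space_laplacian.
apply: cvg_sum_seq => i; apply: (second_diff_cvg r0 hr h0).
- by move=> s _; exact/smooth_derivable/test_smooth.
- by move=> s _; exact/smooth_derivable/test_smooth/test_derive.
- exact: (smooth_continuous (test_smooth (test_derive _ (test_derive _ tphi)))).
Qed.

Definition bounded_cvg_on phi (B : R) (F : nat -> X -> R) (f : X -> R) :=
  forall x, phi x != 0 -> (forall k, `|F k x| <= B) /\ F k x @[k --> \oo] --> f x.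

(** Here u is a supersolution, v a subsolution up to the error e, and U, V stand for their m-th
    powers. As v > u and V > U hold on the same set, one indicator serves both the time increment
    and the discrete Kato inequality, which puts the diffusion on phi. The remaining terms are
    bounded by the weighted integral of the positive part of v - u, and [gronwall_left] concludes.
    The Laplacian of V is only bounded below, through [lk], so that v may be less regular than u. *)
Lemma comparison (u v U V : X -> R -> R) (e phi : X -> R) (M C delta r T : R) :
  0 < T -> 0 < C -> 0 <= delta -> test_function phi -> (forall x, 0 <= phi x) ->
  (forall x, space_laplacian phi x <= C * phi x + delta * \1_(ball_box r) x) ->
  (forall t, [/\ measurable_fun setT (u^~ t), measurable_fun setT (v^~ t),
     measurable_fun setT (U^~ t) & measurable_fun setT (V^~ t)]) ->
  (forall x t, [/\ `|u x t| <= M, `|v x t| <= M, `|U x t| <= M & `|V x t| <= M]) ->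
  (forall x, continuous (u x)) -> (forall x, continuous (v x)) ->
  (forall x t, (u x t < v x t) = (U x t < V x t)) ->
  (forall x t, u x t < v x t -> V x t - U x t <= C * (v x t - u x t)) ->
  measurable_fun setT e -> (forall x, 0 <= e x <= M) ->
  (forall t, 0 < t <= T -> exists (h : nat -> R) (ut vt LU l : X -> R)
      (lk : nat -> X -> R) (B : R),
    (forall k, 0 < h k <= t) /\ h k @[k --> \oo] --> 0 /\
    bounded_cvg_on phi B (fun k x => (u x t - u x (t - h k)) / h k) ut /\
    bounded_cvg_on phi B (fun k x => (v x t - v x (t - h k)) / h k) vt /\
    bounded_cvg_on phi B (fun k => dlap (h k) (U^~ t)) LU /\
    bounded_cvg_on phi B lk l /\ (forall k, measurable_fun setT (lk k)) /\
    (forall k x, phi x != 0 -> lk k x <= dlap (h k) (V^~ t) x) /\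
    (forall x, phi x != 0 -> u x t < v x t ->
       vt x - ut x <= l x - LU x + C * (v x t - u x t) + e x)) ->
  \int[mu]_x (pospart (v x T - u x T) * phi x) <=
  expR (2 * (C ^+ 2 + C) * T) * (\int[mu]_x (pospart (v x 0 - u x 0) * phi x) +
    (\int[mu]_x (e x * phi x) + 2 * M * delta * fine (mu (ball_box r))) * T).
Proof.
move=> T0 C0 delta0 tphi phi0 hphi mfs bds cu cv uvUV VUC me eM hstep.
have Iphi := test_intg tphi; have mphi := intg_measurable Iphi.
have M0 : 0 <= M by have /andP[a b] := eM 0; exact: le_trans b.
have mB : measurable (ball_box r : set X) by exact: measurable_cbox.
have IBall : intg mu \1_(ball_box r) by exact: intg_indic_cbox.
have bd2 x t : `|v x t - u x t| <= 2 * M.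
  have [h1 h2 _ _] := bds x t; rewrite (le_trans (ler_normB _ _))//; lra.
have bdUV x t : `|V x t - U x t| <= 2 * M.
  have [_ _ h1 h2] := bds x t; rewrite (le_trans (ler_normB _ _))//; lra.
have mvu t : measurable_fun setT (fun x => v x t - u x t).
  by have [h1 h2 _ _] := mfs t; exact: measurable_funB.
have mVU t : measurable_fun setT (fun x => V x t - U x t).
  by have [_ _ h1 h2] := mfs t; exact: measurable_funB.
have Ib (b : R) (g : X -> R) : measurable_fun setT g -> (forall x, `|g x| <= b) ->
    intg mu (fun x => g x * phi x) by move=> mg gb; exact: (intgM_bounded Iphi (M := b)).
have Iyt t : intg mu (fun x => pospart (v x t - u x t) * phi x).
  apply: (Ib (2 * M)); first exact: measurable_pospart.
  by move=> x; rewrite ger0_norm ?pospart_ge0// (le_trans (pospart_le_norm _)).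
pose y t := \int[mu]_x (pospart (v x t - u x t) * phi x).
have y0 t : 0 <= y t.
  by apply: int_ge0 => x; rewrite mulr_ge0// pospart_ge0.
(* Continuity is tested along sequences, for which dominated convergence applies. *)
have cy : continuous y.
  move=> t; apply/(@cvg_nbhsP _ R^o) => s st.
  have [||||_ _] := @dominated_cvg_weight _ _ (fun k x => pospart (v x (s k) - u x (s k)))
      (fun x => pospart (v x t - u x t)) phi (2 * M) => //.
  - by move=> k; exact: measurable_pospart.
  - move=> x _; split => [k|].
      by rewrite ger0_norm ?pospart_ge0// (le_trans (pospart_le_norm _)).
    have c1 : v x (s k) - u x (s k) @[k --> \oo] --> v x t - u x t.
      by apply: cvgB; [exact: (cvg_comp _ _ st (cv x t))|exact: (cvg_comp _ _ st (cu x t))].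
    have cm : continuous (fun z : R => Num.max z (cst 0 z)).
      by move=> z; apply: continuous_max; [exact: cvg_id|exact: cst_continuous].
    exact: (cvg_comp _ _ c1 (cm _)).
pose E := \int[mu]_x (e x * phi x) + 2 * M * delta * fine (mu (ball_box r)).
have Ie : intg mu (fun x => e x * phi x).
  by apply: (Ib M) => // x; have /andP[e0 e1] := eM x; rewrite ger0_norm.
have E0 : 0 <= E.
  apply: addr_ge0.
    by apply: int_ge0 => x; rewrite mulr_ge0//; have /andP[] := eM x.
  by rewrite mulr_ge0 ?fine_ge0 ?measure_ge0// !mulr_ge0.
(* The square pairs the bound of the Laplacian of phi by C phi with the bound of V - U by C (v - u);
   the other C comes from the reaction. *)
have K0 : 0 < C ^+ 2 + C by rewrite addr_gt0// exprn_gt0.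
apply: (gronwall_left T0 K0 E0 cy y0) => t t0T eps eps0.
have [h [ut [vt [LU [l [lk [B]]]]]]] := hstep t t0T.
move=> [h0 [hc [but [bvt [bLU [bl [mlk [lkV ineq]]]]]]]].
pose chi x : R := ((0 < v x t - u x t)%R)%:R.
have chiE x : chi x = ((0 < V x t - U x t)%R)%:R by rewrite /chi !subr_gt0 uvUV.
have mchi : measurable_fun setT chi by exact: measurable_pos_bool.
have chib x : `|chi x| <= 1 by rewrite normr_nat lern1 leq_b1.
have chi0 x : 0 <= chi x by rewrite ler0n.
pose Dk k x := chi x * ((v x t - v x (t - h k)) / h k - (u x t - u x (t - h k)) / h k).
pose D x := chi x * (vt x - ut x).
have mDk k : measurable_fun setT (Dk k).
  have [a1 a2 _ _] := mfs t; have [a3 a4 _ _] := mfs (t - h k).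
  apply: measurable_funM => //; apply: measurable_funB; apply: measurable_funM => //.
    exact: measurable_funB.
  exact: measurable_funB.
have [|ID IDk cD] := @dominated_cvg_weight _ _ Dk D phi (B + B) Iphi phi0 mDk.
  move=> x px; have [b1 c1] := but x px; have [b2 c2] := bvt x px; split => [k|].
    rewrite normrM -[leRHS]mul1r; apply: ler_pM => //.
    by rewrite (le_trans (ler_normB _ _))// lerD.
  by apply: cvgM; [exact: cvg_cst|exact: cvgB].
pose Sk k x := chi x * (lk k x - dlap (h k) (U^~ t) x).
pose S x := chi x * (l x - LU x).
have mSk k : measurable_fun setT (Sk k).
  have [_ _ a1 _] := mfs t.
  by apply: measurable_funM => //; apply: measurable_funB => //; exact: measurable_dlap.
have [|IS ISk cS] := @dominated_cvg_weight _ _ Sk S phi (B + B) Iphi phi0 mSk.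
  move=> x px; have [b1 c1] := bl x px; have [b2 c2] := bLU x px; split => [k|].
    rewrite normrM -[leRHS]mul1r; apply: ler_pM => //.
    by rewrite (le_trans (ler_normB _ _))// lerD.
  by apply: cvgM; [exact: cvg_cst|exact: cvgB].
pose a x := V x t - U x t.
have ma : measurable_fun setT a by exact: mVU.
have aM x : `|a x| <= 2 * M by exact: bdUV.
have paM x : `|pospart (a x)| <= 2 * M.
  by rewrite ger0_norm ?pospart_ge0// (le_trans (pospart_le_norm _)).
have SkP k : \int[mu]_x (Sk k x * phi x) <= \int[mu]_x (pospart (a x) * dlap (h k) phi x).
  have /andP[hk0 _] := h0 k.
  apply: le_trans (kato_discrete hk0 ma aM Iphi phi0).
  apply: int_le => //.
    have [I1 _ _] := int_dlap_parts (h k) ma aM Iphi.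
    rewrite (_ : (fun x => _) = (fun x => chi x * (dlap (h k) a x * phi x))).
      exact: (intgM_bounded I1 (M := 1)).
    by apply/funext => x; rewrite mulrA chiE.
  move=> x; have [->|px] := eqVneq (phi x) 0; first by rewrite !mulr0.
  apply: ler_wpM2r => //; rewrite /Sk chiE; apply: ler_wpM2l; first by rewrite ler0n.
  by rewrite /a dlapB lerD2r; exact: lkV.
have [Bphi Bphi0 hBphi] := dlap_test_bound tphi.
have [rs rs0 hrs] := test_support tphi.
(* Since [h k <= t], all the [dlap (h k) phi] are supported in this box, which gives a common
   majorant. *)
have IQ : intg mu (fun x => 2 * M * Bphi * \1_(ball_box (rs + t)) x).
  by apply: intgZ; exact: intg_indic_cbox.
have mLphi : measurable_fun setT (space_laplacian phi).
  apply: measurable_sum => i; apply: continuous_measurable_rV.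
  exact: (smooth_continuous (test_smooth (test_derive _ (test_derive _ tphi)))).
have [||||ILphi _ cLphi] := @dominated_cvg_int _ _ _ mu (fun k x => pospart (a x) * dlap (h k) phi x)
    (fun x => pospart (a x) * space_laplacian phi x) _ _ _ IQ.
- by move=> k; apply: measurable_funM; [exact: measurable_pospart|exact: measurable_dlap].
- by apply: measurable_funM => //; exact: measurable_pospart.
- apply: aeW => x; apply: cvgM; first exact: cvg_cst.
  have := @dlap_test_cvg phi h t x tphi h0 hc.
  exact.
- apply: aeW => x k; have /andP[hk0 hkt] := h0 k.
  rewrite indicE; have [xq|xq] := boolP (x \in _).
    by rewrite mulr1 normrM; apply: ler_pM => //; exact: hBphi.
  rewrite (@dlap_test_supp _ rs)// ?mulr0 ?normr0//.
  apply: le_lt_trans (_ : rs + t < _); first by rewrite lerD2l.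
  rewrite ltNge; apply/negP => /ball_box_norm xb.
  by move: xq; rewrite notin_setE.
have SP : \int[mu]_x (S x * phi x) <= \int[mu]_x (pospart (a x) * space_laplacian phi x).
  apply: ler_cvg_to cS cLphi _; apply: nearW => k; exact: SkP.
have SLE : \int[mu]_x (pospart (a x) * space_laplacian phi x) <=
    C ^+ 2 * y t + 2 * M * delta * fine (mu (ball_box r)).
  have I1 : intg mu (fun x => 2 * M * delta * \1_(ball_box r) x) by exact: intgZ.
  have I2 := intgZ (C ^+ 2) (Iyt t).
  have -> : C ^+ 2 * y t + 2 * M * delta * fine (mu (ball_box r)) =
      \int[mu]_x (C ^+ 2 * (pospart (v x t - u x t) * phi x) + 2 * M * delta * \1_(ball_box r) x).
    rewrite RintegralD// (RintegralZl _ measurableT (Iyt t)).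
    by rewrite (RintegralZl _ measurableT IBall) int_indic.
  apply: int_le => //; first exact: intgD.
  move=> x; apply: le_trans (ler_wpM2l (pospart_ge0 _) (hphi x)) _.
  rewrite mulrDr; apply: lerD.
    rewrite mulrCA mulrA expr2 -!mulrA; apply: ler_wpM2l; first exact: ltW.
    rewrite mulrA; apply: ler_wpM2r => //; rewrite /a {1}/pospart.
    have pv0 : 0 <= C * pospart (v x t - u x t).
      by apply: mulr_ge0; [exact: ltW|exact: pospart_ge0].
    rewrite ge_max pv0 andbT.
    have [uv|uv] := ltP (u x t) (v x t).
      by apply: le_trans (VUC _ _ uv) _; rewrite ler_pM2l// le_pospart.
    apply: (@le_trans _ _ 0) => //.
    by rewrite subr_le0 leNgt -uvUV -leNgt.
  rewrite mulrA; apply: ler_wpM2r => //; apply: ler_wpM2r => //.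
  by apply: le_trans (paM x); exact: ler_norm.
have DE : \int[mu]_x (D x * phi x) <= (C ^+ 2 + C) * y t + E.
  have I3 := intgZ C (Iyt t).
  apply: (@le_trans _ _ (\int[mu]_x ((S x * phi x + C * (pospart (v x t - u x t) * phi x)) + e x * phi x))).
    apply: int_le => //; first by apply: intgD => //; exact: intgD.
    move=> x; have [->|px] := eqVneq (phi x) 0; first by rewrite !mulr0 !addr0.
    rewrite mulrA -!mulrDl; apply: ler_wpM2r => //; rewrite pospartE /D /S -/(chi x).
    have /andP[e0 _] := eM x.
    rewrite /chi subr_gt0; have [uv|uv] := ltP (u x t) (v x t); last first.
      by rewrite !mul0r mulr0 !add0r.
    by rewrite !mul1r; exact: ineq.
  rewrite !RintegralD//; last exact: intgD.
  rewrite (RintegralZl _ measurableT (Iyt t)) /E -/(y t).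
  by have hh := le_trans SP SLE; lra.
have := cD => /cvgrPdist_le/(_ _ eps0) cDe.
have hsmall : \forall k \near \oo, (C ^+ 2 + C) * h k <= 2^-1.
  have /cvgrPdist_le/(_ ((2 * (C ^+ 2 + C))^-1)) := hc.
  rewrite invr_gt0 mulr_gt0// => /(_ isT); apply: filterS => k.
  rewrite sub0r normrN => /(le_trans (ler_norm _)).
  by rewrite invfM ler_pdivlMr// mulrC.
have [k _ hk] := filterI cDe hsmall.
have [/= hk1 hk2] := hk k (leqnn k).
have /andP[hk0 hkt] := h0 k.
exists (h k); split => //.
rewrite mulrC -ler_pdivrMr//.
(* With the indicator chi taken at time t, the positive part equals chi (v - u) at time t and is at
   least chi (v - u) at time t - h. Its increment is thus at most chi times the increment of v -
   u. *)
apply: (@le_trans _ _ (\int[mu]_x (Dk k x * phi x))).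
  rewrite ler_pdivrMr// -RintegralZr//; last exact: IDk.
  rewrite -(RintegralB measurableT (Iyt t) (Iyt (t - h k))); apply: int_le.
  - exact: intgB.
  - by under eq_fun do rewrite mulrC; apply: intgZ; exact: IDk.
  - move=> x; rewrite -mulrBl mulrAC; apply: ler_wpM2r => //; rewrite /Dk.
    rewrite -mulrBl -mulrA divfK ?gt_eqF//.
    rewrite {1}pospartE -/(chi x) (_ : chi x * (v x t - v x (t - h k) - (u x t - u x (t - h k))) = chi x * (v x t - u x t) - chi x * (v x (t - h k) - u x (t - h k))); last by ring.
    rewrite lerD2l lerN2 /chi; case: (0 < _); rewrite ?mul1r ?mul0r ?pospart_ge0//.
    exact: le_pospart.
have := le_trans (ler_norm _) hk1; rewrite -[X in X <= _]opprB => hk3.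
have := ler_norm (\int[mu]_x (Dk k x * phi x) - \int[mu]_x (D x * phi x)).
by rewrite distrC => /le_trans/(_ hk1); lra.
Qed.

End comparison.

Lemma is_derive_mulc (R : realType) (V : normedModType R) (g : V -> R) (c d : R) (x v : V) :
  is_derive x v g d -> is_derive x v (fun y => c * g y) (c * d).
Proof. by move=> dg; exact: is_deriveZ. Qed.

Lemma second_derive_scale (R : realType) (V : normedModType R) (g : V -> R) (c : R) (x v : V) :
  smooth g -> 'D_v ('D_v (fun y => g (c *: y))) x = c ^+ 2 * 'D_v ('D_v g) (c *: x).
Proof.
move=> sg; have -> : 'D_v (fun y => g (c *: y)) = fun y => c * 'D_v g (c *: y).
  by apply/funext => y; have [_ ->] := derive_scale (smooth_derivable (x := c *: y) (v := v) sg).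
have d := derive_scale (smooth_derivable (x := c *: x) (v := v) (smooth_derive v sg)).
by have [_ ->] := is_derive_mulc c d; rewrite mulrA -expr2.
Qed.

(** * Weights whose Laplacian they dominate *)

Section cutoff.
Context {R : realType} {n : nat}.
Notation X := 'rV[R]_n.
Notation mu := (@lebesgue_rV R n).

Lemma lebesgue_ball_box (r : R) : 0 <= r ->
  fine (mu (ball_box r)) = (2 * r) ^+ n.
Proof.
move=> r0; rewrite lebesgue_cbox ifT; last first.
  by apply/forallP => i; rewrite !mxE ge0_cp.
rewrite /= -[n in RHS]card_ord -prodr_const; apply: eq_bigr => i _.
by rewrite !mxE; ring.
Qed.

Lemma second_derive_power (B : X -> R) (N : nat) i x : smooth B ->
  'D_(basis_rV i) ('D_(basis_rV i) (fun y => B y ^+ N.+2)) x =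
  N.+2%:R * (N.+1%:R * B x ^+ N * ('D_(basis_rV i) B x) ^+ 2 +
    B x ^+ N.+1 * 'D_(basis_rV i) ('D_(basis_rV i) B) x).
Proof.
move=> sB; set v := basis_rV i.
have -> : 'D_v (fun y => B y ^+ N.+2) = fun y => N.+2%:R * (B y ^+ N.+1 * 'D_v B y).
  apply/funext => y; have [_ ->] := deriveX_fun N.+1 (smooth_derivable (x := y) (v := v) sB).
  by rewrite mulrA.
have d1 := deriveX_fun N (smooth_derivable (x := x) (v := v) sB).
have d2 := derivableP (smooth_derivable (x := x) (v := v) (smooth_derive v sB)).
have [_ ->] := is_deriveZ N.+2%:R (is_deriveM d1 d2).
by rewrite /GRing.scale/=; ring.
Qed.

(* phi_k = (B(x/(k+1)))^(2n+4) for a bump B: its Laplacian is at most phi_k up to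
   an error that is integrable on the support and vanishes as k tends to oo. *)
Lemma cutoff_family : exists (w : nat -> X -> R) (delta : nat -> R) (c : R),
  [/\ 0 < c, forall k, test_function (w k) /\ 0 <= delta k, forall k x, 0 <= w k x <= 1,
   (forall k x, space_laplacian (w k) x <= w k x + delta k * \1_(ball_box k.+1%:R) x) /\
   (forall k x, `|x| <= k.+1%:R / 2 -> c <= w k x) &
   delta k * fine (mu (ball_box k.+1%:R)) @[k --> \oo] --> 0].
Proof.
pose B : X -> R := box_bump 1 (const_mx (-1)) (const_mx 1).
have tB : test_function B by exact: test_box_bump.
have sB := test_smooth tB.
have B0 x : 0 <= B x by exact: box_bump_ge0.
have B1 x : B x <= 1 by exact: box_bump_le1.
(* The exponent of the bump is N + 2 = 2 (n + 2). With s = 1/(k+1) it leads to the error delta = (A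
   s^2)^(n+2), which beats the volume (2/s)^n of the support: the product is of order s^(n+4). *)
have [N NE] : {N | N = (2 * n.+1)%N} by exists (2 * n.+1)%N.
pose P x := B x ^+ N.+2.
have sP : smooth P.
  rewrite (_ : P = fun x => \prod_(i < N.+2) B x); first by apply: smooth_prod => i.
  by apply/funext => x; rewrite /P prodr_const card_ord.
(* Two derivatives of the power N + 2 of B lose at most two factors B; the other factors are
   bounded. *)
have [A A0 hA] : exists2 A : R, 0 <= A & forall x, space_laplacian P x <= A * B x ^+ N.
  have /choice[C hC] : forall i, exists C : R, 0 <= C /\ forall x,
      `|'D_(basis_rV i) B x| <= C /\ `|'D_(basis_rV i) ('D_(basis_rV i) B) x| <= C.
    move=> i; have [C C0 hC] := test_bounded (test_derive (basis_rV i) tB).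
    have [C' C'0 hC'] := test_bounded (test_derive (basis_rV i) (test_derive (basis_rV i) tB)).
    exists (C + C'); split; first exact: addr_ge0.
    by move=> x; rewrite (le_trans (hC x)) ?lerDl// (le_trans (hC' x))// lerDr.
  exists (\sum_i N.+2%:R * (N.+1%:R * C i ^+ 2 + C i)).
    by apply: sumr_ge0 => i _; have [C0 _] := hC i;
      rewrite mulr_ge0// addr_ge0// mulr_ge0// exprn_ge0.
  move=> x; rewrite mulr_suml; apply: ler_sum => i _.
  rewrite -/(basis_rV i) second_derive_power// -[leRHS]mulrA; apply: ler_wpM2l => //.
  have [C0 /(_ x)[h1 h2]] := hC i; rewrite [leRHS]mulrDl; apply: lerD.
    rewrite mulrAC; apply: ler_wpM2r; first exact: exprn_ge0.
    apply: ler_wpM2l => //; rewrite -real_normK ?num_real// ler_sqr ?nnegrE//.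
  rewrite exprSr -mulrA mulrC; apply: ler_wpM2r; first exact: exprn_ge0.
  apply: le_trans (ler_wpM2l (B0 x) (le_trans (ler_norm _) h2)) _.
  by rewrite ler_piMl.
pose s k : R := k.+1%:R^-1.
have s0 k : 0 < s k by rewrite invr_gt0.
pose w k x := P (s k *: x).
have ddw k v x : 'D_v ('D_v (w k)) x = s k ^+ 2 * 'D_v ('D_v P) (s k *: x).
  exact: second_derive_scale.
have B_out k x : ~ ball_box k.+1%:R x -> B (s k *: x) = 0.
  move=> nx; apply/eqP; apply: contrapT => /negP /(box_bump_neq0 ltr01) h; apply: nx.
  apply/ball_boxP => i; have := h i; rewrite !mxE => /andP[h1 h2].
  rewrite ler_norml; apply/andP; split.
    by have := ltW h1; rewrite /s ler_pdivlMl// mulrN1.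
  by have := ltW h2; rewrite /s ler_pdivrMl// mulr1.
have tw k : test_function (w k).
  apply: (@test_intro _ _ _ (ball_box k.+1%:R)).
  - rewrite (_ : w k = fun x => \prod_(i < N.+2) box_bump (s k) (const_mx (- k.+1%:R)) (const_mx k.+1%:R) x).
      by apply: smooth_prod => i; exact: smooth_box_bump.
    apply/funext => x; rewrite /w /P prodr_const card_ord; congr (_ ^+ _).
    apply: eq_bigr => i _; rewrite !mxE !mul1r; congr (hump _ * hump _).
      by rewrite mulrBr mulrN mulVf// pnatr_eq0.
    by rewrite mulrBr mulVf// pnatr_eq0.
  - exact: cbox_compact.
  - by move=> x wx; apply: contrapT => /B_out w0; move: wx; rewrite /w /P w0 expr0n eqxx.
pose delta k := (A * s k ^+ 2) ^+ n.+2.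
have delta0 k : 0 <= delta k by rewrite exprn_ge0// mulr_ge0// exprn_ge0// ltW.
exists w, delta, (((hump 2^-1 * hump 2^-1) ^+ n) ^+ N.+2); split.
- by do 2 apply: exprn_gt0; rewrite mulr_gt0// hump_gt0// invr_gt0.
- by move=> k; split.
- by move=> k x; rewrite /w /P exprn_ge0//= exprn_ile1.
- split=> k x.
    have -> : space_laplacian (w k) x = s k ^+ 2 * space_laplacian P (s k *: x).
      by rewrite /space_laplacian mulr_sumr; apply: eq_bigr => i _; exact: ddw.
    apply: le_trans (ler_wpM2l (exprn_ge0 2 (ltW (s0 k))) (hA _)) _.
    have [xb|nxb] := pselect (ball_box k.+1%:R x); last first.
      by rewrite indicE memNset// mulr0 addr0 /w /P B_out// NE !expr0n/= !mulr0.
    rewrite indicE mem_set// mulr1.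
    rewrite /w /P /delta; set b := B _.
    have q0 : 0 <= b ^+ 2 by rewrite exprn_ge0// B0.
    have r0 : 0 <= A * s k ^+ 2 by rewrite mulr_ge0// exprn_ge0// ltW.
    rewrite mulrCA mulrA NE (_ : (2 * n.+1).+2 = 2 * n.+2)%N; last by rewrite !mulnS.
    (* The Laplacian is at most A s^2 b^N. If A s^2 <= b^2, this is at most b^(N+2), the weight
       itself; otherwise b^N <= (A s^2)^(n+1), and it is at most delta. *)
    rewrite !exprM; have [rq|rq] := leP (A * s k ^+ 2) (b ^+ 2).
      apply: le_trans (_ : b ^+ 2 * (b ^+ 2) ^+ n.+1 <= _).
        by apply: ler_wpM2r => //; exact: exprn_ge0.
      by rewrite -exprS lerDl exprn_ge0.
    apply: le_trans (_ : A * s k ^+ 2 * (A * s k ^+ 2) ^+ n.+1 <= _).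
      by apply: ler_wpM2l => //; apply: lerXn2r; rewrite ?nnegrE// ltW.
    by rewrite -exprS lerDr exprn_ge0.
  rewrite /w /P => xk; apply: lerXn2r; rewrite ?nnegrE//.
    by rewrite exprn_ge0// mulr_ge0// hump_ge0.
  rewrite -[n in X in X <= _]card_ord -prodr_const; apply: ler_prod => i _.
  rewrite mulr_ge0 ?hump_ge0//= !mxE !mul1r.
  have xi : `|s k * x 0 i| <= 2^-1.
    rewrite normrM gtr0_norm// /s ler_pdivrMl//; apply: le_trans (norm_coor x i) _.
    exact: xk.
  move: xi; rewrite ler_norml => /andP[h1 h2].
  by apply: ler_pM; rewrite ?hump_ge0//; apply: hump_le; lra.
have E k : delta k * fine (mu (ball_box k.+1%:R)) = (A ^+ n.+2 * 2 ^+ n) * s k ^+ n.+4.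
  rewrite /delta exprMn -exprM lebesgue_ball_box// exprMn (_ : (2 * n.+2 = n.+4 + n)%N); last first.
    by rewrite mul2n -addnn !addSn !addnS.
  rewrite exprD; have -> : k.+1%:R ^+ n = (s k ^+ n)^-1 by rewrite /s exprVn invrK.
  have sn : s k ^+ n != 0 by rewrite expf_neq0// gt_eqF.
  by field.
rewrite (_ : (fun k => _) = fun k => (A ^+ n.+2 * 2 ^+ n) * s k ^+ n.+4); last first.
  by apply/funext => k; exact: E.
rewrite -[X in _ --> X](mulr0 (A ^+ n.+2 * 2 ^+ n)).
apply: cvgM; first exact: cvg_cst.
apply: (@squeeze_cvgr _ _ _ _ (fun=> 0) s).
- apply: nearW => k; have s1 : s k <= 1 by rewrite /s invf_le1// ler1n.
  have sk0 := ltW (s0 k); apply/andP; split; first exact: exprn_ge0.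
  by rewrite exprS; apply: ler_piMr => //; exact: exprn_ile1.
- exact: cvg_cst.
- exact: (@cvg_harmonic R).
Qed.

End cutoff.

Lemma is_derive_comp1 (R : realType) (V : normedModType R) (g : V -> R) (F : R -> R)
    (dF d : R) (x v : V) :
  is_derive (g x) (1 : R) F dF -> is_derive x v g d ->
  is_derive x v (fun y => F (g y)) (dF * d).
Proof.
move=> hF [dg gd].
have h1 : is_derive (0 : R) 1 (fun t : R => F (g (x + t *: v))) (dF * d).
  apply: (is_derive1_comp (f := F) (g := fun t : R => g (x + t *: v))).
    by rewrite scale0r addr0.
  have h := @is_derive_line _ _ g x v 0; rewrite scale0r addr0 gd in h.
  exact: (h dg).
have := derive_line (fun y => F (g y)) x v 0; rewrite scale0r addr0 => h2.
split; last by rewrite -h2 derive_val.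
by rewrite -[x]addr0 -[X in _ + X](scale0r v); apply: derivable_line; case: h1.
Qed.

Lemma is_derive_mul (R : realType) (V : normedModType R) (g h : V -> R) (a b : R) (x v : V) :
  is_derive x v g a -> is_derive x v h b ->
  is_derive x v (fun y => g y * h y) (g x * b + h x * a).
Proof. by move=> dg dh; exact: is_deriveM. Qed.

Lemma powR_continuous_at (R : realType) (a r : R) : 0 < a ->
  {for a, continuous (fun x : R => x `^ r)}.
Proof.
move=> a0; apply/differentiable_continuous/derivable1_diffP.
by have [] := is_derive1_powR r a0.
Qed.

Section space_time_regularity.
Context {R : realType} {n : nat}.
Notation X := 'rV[R]_n.
Notation XT := ('rV[R]_n * measurableTypeR R)%type.
Implicit Types (u g : XT -> R) (z : XT).

Definition regular u := forall z, space_time z ->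
  [/\ {for z, continuous u}, derivable u z ((0 : X), (1 : R)), {for z, continuous (dt u)} &
    forall i, [/\ derivable u z ((delta_mx 0 i : X), (0 : R)), {for z, continuous (dx i u)},
      derivable (dx i u) z ((delta_mx 0 i : X), (0 : R)) &
      {for z, continuous (dx i (dx i u))}]].

Lemma open_space_time : open (@space_time R n : set (X * R)).
Proof.
apply: (@open_comp _ _ (snd : X * R -> R) [set t | 0 < t]); last exact: open_gt.
by move=> z _; exact: cvg_snd.
Qed.

Lemma near_space_time z : space_time z -> \forall y \near (z : X * R), space_time y.
Proof. by move=> sz; apply: open_nbhs_nbhs; split => //; exact: open_space_time. Qed.

Lemma smooth_solution_regular f m u : smooth_positive_solution f m u -> regular u.
Proof.
case=> cu _ C21 _ z sz; have [d1 c1 h] := C21 z sz.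
split; [|exact: d1|exact: c1|]; last first.
  by move=> i; have [d2 c2 h2] := h i; have [d3 c3] := h2 i; split.
have := cu; move=> /subspace_continuousP/(_ z); rewrite /space_time_closed /=.
move=> /(_ (ltW sz)) h1; apply: cvg_trans h1; apply: cvg_app => A.
rewrite /within/= => h2; apply: filterS2 (near_space_time sz) h2 => y sy; apply.
exact: ltW.
Qed.

Variables (u : XT -> R) (ur : regular u) (u0 : forall z, space_time z -> 0 < u z).

Lemma derive_powR_space_time r z v : space_time z -> derivable u z v ->
  is_derive z v (fun y => u y `^ r) (r * u z `^ (r - 1) * 'D_v u z).
Proof.
move=> sz du.
exact: (is_derive_comp1 (F := fun x => x `^ r) (is_derive1_powR r (u0 sz)) (derivableP du)).
Qed.

Lemma dx_powR r i z : space_time z ->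
  dx i (fun y => u y `^ r) z = r * u z `^ (r - 1) * dx i u z.
Proof.
move=> sz; have [_ _ _ h] := ur sz; have [d _ _ _] := h i.
by have [_] := derive_powR_space_time r sz d.
Qed.

Lemma dt_powR r z : space_time z ->
  dt (fun y => u y `^ r) z = r * u z `^ (r - 1) * dt u z.
Proof.
move=> sz; have [_ d _ _] := ur sz.
by have [_] := derive_powR_space_time r sz d.
Qed.

Lemma is_derive_dx_powR r i z : space_time z ->
  is_derive z ((delta_mx 0 i : X), (0 : R)) (dx i (fun y => u y `^ r))
    (r * ((r - 1) * u z `^ (r - 2) * dx i u z ^+ 2 + u z `^ (r - 1) * dx i (dx i u) z)).
Proof.
move=> sz; have [_ _ _ h] := ur sz; have [d1 _ d2 _] := h i.
apply: (@near_eq_is_derive _ _ _ (fun y => r * (u y `^ (r - 1) * dx i u y))).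
  by apply: filterS (near_space_time sz) => y sy; rewrite dx_powR// mulrA.
have h1 := derive_powR_space_time (r - 1) sz d1.
have h2 := is_derive_mulc r (is_derive_mul h1 (derivableP d2)).
apply: is_derive_eq h2 _; rewrite (_ : r - 1 - 1 = r - 2); last by ring.
by rewrite -/(dx i u z) -/(dx i (dx i u) z); ring.
Qed.

Lemma powR_at_continuous r z : space_time z -> {for z, continuous (fun y => u y `^ r)}.
Proof.
move=> sz; have [c _ _ _] := ur sz.
exact: (cvg_comp _ _ c (powR_continuous_at (u0 sz))).
Qed.

Lemma regular_powR r : regular (fun y => u y `^ r).
Proof.
move=> z sz; have [c0 d0 c1 h] := ur sz; split.
- exact: powR_at_continuous.
- by have [] := derive_powR_space_time r sz d0.
- have e : \forall y \near (z : X * R), r * u y `^ (r - 1) * dt u y = dt (fun y => u y `^ r) y.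
    by apply: filterS (near_space_time sz) => y sy; rewrite dt_powR.
  rewrite /prop_for /continuous_at dt_powR//; apply: cvg_trans (near_eq_cvg e) _.
  apply: cvgM => //; apply: cvgM; first exact: cvg_cst.
  exact: powR_at_continuous.
move=> i; have [d1 c2 d2 c3] := h i; split.
- by have [] := derive_powR_space_time r sz d1.
- have e : \forall y \near (z : X * R), r * u y `^ (r - 1) * dx i u y = dx i (fun y => u y `^ r) y.
    by apply: filterS (near_space_time sz) => y sy; rewrite dx_powR.
  rewrite /prop_for /continuous_at dx_powR//; apply: cvg_trans (near_eq_cvg e) _.
  apply: cvgM => //; apply: cvgM; first exact: cvg_cst.
  exact: powR_at_continuous.
- by have [] := is_derive_dx_powR r i sz.
have e : \forall y \near (z : X * R), r * ((r - 1) * u y `^ (r - 2) * dx i u y ^+ 2 +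
    u y `^ (r - 1) * dx i (dx i u) y) = dx i (dx i (fun y => u y `^ r)) y.
  by apply: filterS (near_space_time sz) => y sy; have [_ <-] := is_derive_dx_powR r i sy.
rewrite /prop_for /continuous_at.
have -> : dx i (dx i (fun y => u y `^ r)) z = r * ((r - 1) * u z `^ (r - 2) * dx i u z ^+ 2 +
    u z `^ (r - 1) * dx i (dx i u) z) by have [_ <-] := is_derive_dx_powR r i sz.
apply: cvg_trans (near_eq_cvg e) _; apply: cvgM; first exact: cvg_cst.
apply: cvgD; apply: cvgM => //.
- by apply: cvgM; [exact: cvg_cst|exact: powR_at_continuous].
- exact: (cvgM c2 c2).
- exact: powR_at_continuous.
Qed.

End space_time_regularity.

(** * The porous medium equation *)

Section quotients.
Context {R : realType} {n : nat}.
Notation X := 'rV[R]_n.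
Notation XT := ('rV[R]_n * measurableTypeR R)%type.
Implicit Types (g : XT -> R) (phi : X -> R).

Lemma continuous_on_compact_bounded (V : normedModType R) (g : V -> R) (S : set V) :
  compact S -> (forall z, S z -> {for z, continuous g}) ->
  exists C : R, forall x, S x -> `|g x| <= C.
Proof.
move=> cS cg; have cg' : {within S, continuous g}.
  by apply: continuous_in_subspaceT => z /set_mem; exact: cg.
have /compact_bounded[M [_ hM]] := continuous_compact cg' cS.
exists (`|M| + 1) => x Sx; apply: hM; last by exists x.
by rewrite (le_lt_trans (ler_norm _))// ltrDl.
Qed.

Lemma slab_bounded g (r a b : R) : 0 < a ->
  (forall z, space_time z -> {for z, continuous g}) ->
  exists C : R, forall x t, `|x| <= r -> a <= t <= b -> `|g (x, t)| <= C.
Proof.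
move=> a0 cg; have [||C hC] := @continuous_on_compact_bounded (X * R)%type g
    (ball_box r `*` `[a, b]%classic).
- by apply: compact_setX; [exact: cbox_compact|exact: segment_compact].
- move=> z [_]; rewrite /= in_itv/= => /andP[az _]; apply: cg.
  exact: lt_le_trans az.
exists C => x t xr tab; apply: hC; split => /=; first exact: ball_box_norm.
by rewrite in_itv.
Qed.

(** Steps of at most t/2 keep the mean value points in the slab [t/2, t], where the time derivative
    is bounded over the compact support of phi; nothing is known about derivatives at time 0. *)
Lemma time_quot_cvg g phi (t : R) (h : nat -> R) : regular g -> 0 < t ->
  (forall k, 0 < h k <= t / 2) -> h k @[k --> \oo] --> 0 -> test_function phi ->
  exists B, bounded_cvg_on phi B (fun k x => (g (x, t) - g (x, t - h k)) / h k)
    (fun x => dt g (x, t)).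
Proof.
move=> rg t0 hk h0 tphi; have [r r0 hr] := test_support tphi.
have t2 : 0 < t / 2 by rewrite divr_gt0.
have [C hC] := @slab_bounded (dt g) r (t / 2) t t2 (fun z sz => let: And4 _ _ c _ := rg z sz in c).
exists C => x /hr xr.
have quot k : exists2 c, 0 <= c <= h k & (g (x, t) - g (x, t - h k)) / h k = dt g (x, t - c).
  have /andP[hk0 hkt] := hk k.
  have [|s /andP[s1 s2]|c /andP[c1 c2]] := @MVT_line R (X * R)%type g (x, t) ((0 : X), (1 : R)) (- h k) 0.
  - by rewrite oppr_lt0.
  - have sz : space_time ((x, t) + s *: ((0 : X), (1 : R)) : X * R).
      by rewrite /space_time/= /GRing.scale/= mulr1; lra.
    by have [] := rg _ sz.
  rewrite scale0r addr0 sub0r opprK => e; exists (- c); first by apply/andP; split; lra.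
  have e2 s : (x, t) + s *: ((0 : X), (1 : R)) = (x, t + s) :> X * R.
    by congr pair; rewrite /= ?scaler0 ?addr0// /GRing.scale/= mulr1.
  by rewrite -[t - h k]/(t + - h k) -e2 e mulfK ?gt_eqF// e2 opprK.
split => [k|].
  have [c /andP[c1 c2] ->] := quot k; apply: hC => //; have /andP[_ h2] := hk k.
  by apply/andP; split; lra.
have /choice[c hc] : forall k, exists c, 0 <= c <= h k /\
    (g (x, t) - g (x, t - h k)) / h k = dt g (x, t - c).
  by move=> k; have [c c1 c2] := quot k; exists c.
rewrite (_ : (fun k => _) = fun k => dt g (x, t - c k)); last first.
  by apply/funext => k; have [] := hc k.
have c0 : c k @[k --> \oo] --> 0.
  apply: (@squeeze_cvgr _ _ _ _ (fun=> 0) h) => //; last exact: cvg_cst.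
  by apply: nearW => k; have [] := hc k.
have sz : space_time (x, t) by [].
have [_ _ cdt _] := rg _ sz.
have cz : ((x, t - c k) : X * R) @[k --> \oo] --> ((x, t) : X * R).
  rewrite (_ : (fun k => _) = fun k => ((x, t) : X * R) + (- c k) *: ((0 : X), (1 : R))).
    have cN : - c k @[k --> \oo] --> (0 : R) by rewrite -oppr0; exact: cvgN.
    rewrite -[X in _ --> X]addr0 -(scale0r ((0 : X), (1 : R))).
    by apply: cvgD; [exact: cvg_cst|exact: cvgZr_tmp].
  apply/funext => k; congr pair; first by rewrite /= scaler0 addr0.
  by rewrite /= /GRing.scale/= mulr1.
exact: (cvg_comp _ _ cz cdt).
Qed.

Lemma space_quot_cvg g phi (t : R) (h : nat -> R) : regular g -> 0 < t ->
  (forall k, 0 < h k <= t / 2) -> h k @[k --> \oo] --> 0 -> test_function phi ->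
  exists B, bounded_cvg_on phi B (fun k => dlap (h k) (fun x => g (x, t)))
    (fun x => laplacian g (x, t)).
Proof.
move=> rg t0 hk h0 tphi; have [r r0 hr] := test_support tphi.
have t2 : 0 < t / 2 by rewrite divr_gt0.
have /choice[C hC] : forall i, exists C : R, forall x s, `|x| <= r + t -> t <= s <= t ->
    `|dx i (dx i g) (x, s)| <= C.
  by move=> i; apply: slab_bounded => // z sz; have [_ _ _ /(_ i)[]] := rg z sz.
have e2 i x s : (x, t) + s *: ((delta_mx 0 i : X), (0 : R)) = (x + s *: basis_rV i, t) :> X * R.
  by congr pair; rewrite /= scaler0 addr0.
have e3 i x s : (x, t) - s *: ((delta_mx 0 i : X), (0 : R)) = (x - s *: basis_rV i, t) :> X * R.
  by rewrite -scaleNr e2 scaleNr.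
have dg i x s : derivable g (((x, t) : X * R) + s *: ((delta_mx 0 i : X), (0 : R))) ((delta_mx 0 i : X), (0 : R)).
  by rewrite e2; have [_ _ _ /(_ i)[]] := rg (x + s *: basis_rV i, t) t0.
have ddg i x s : derivable (dx i g) (((x, t) : X * R) + s *: ((delta_mx 0 i : X), (0 : R))) ((delta_mx 0 i : X), (0 : R)).
  by rewrite e2; have [_ _ _ /(_ i)[]] := rg (x + s *: basis_rV i, t) t0.
exists (\sum_i C i) => x /hr xr; split => [k|].
  rewrite /dlap; apply: le_trans (ler_norm_sum _ _ _) _; apply: ler_sum => i _.
  have /andP[hk0 hkt] := hk k.
  have [s _|s _|c ch] := @second_diff R (X * R)%type g (x, t) ((delta_mx 0 i : X), (0 : R)) (h k) hk0.
  - exact: dg.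
  - exact: ddg.
  rewrite e2 e3 => ->; rewrite e2; apply: hC; last by rewrite lexx.
  apply: le_trans (ler_normD _ _) _; apply: lerD => //.
  rewrite normrZ; apply: le_trans (_ : `|c| * 1 <= _).
    by apply: ler_wpM2l => //; exact: norm_basis_rV.
  by rewrite mulr1; lra.
rewrite /dlap /laplacian; apply: cvg_sum_seq => i.
have := @second_diff_cvg R (X * R)%type g (x, t) ((delta_mx 0 i : X), (0 : R)) (t / 2) h t2 hk h0
  (fun s _ => dg i x s) (fun s _ => ddg i x s).
rewrite (_ : (fun k => _) = fun k => (g (x + h k *: basis_rV i, t) + g (x - h k *: basis_rV i, t) - 2 * g (x, t)) / h k ^+ 2).
  by apply; have [_ _ _ /(_ i)[]] := rg (x, t) t0.
by apply/funext => k; rewrite e2 e3.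
Qed.

(** The initial value is continued to negative times, so that a function continuous on the closed
    half-space becomes continuous, hence measurable, everywhere. *)
Definition clamp_time (u : XT -> R) (x : X) (t : R) : R := u (x, Num.max t 0).

Lemma clamp_time_continuous u : {within space_time_closed, continuous u} ->
  continuous (fun z : X * R => clamp_time u z.1 z.2).
Proof.
move=> /subspace_continuousP cu z.
have cl y : (space_time_closed ((y.1, Num.max y.2 0) : XT)) by rewrite /space_time_closed /= le_max lexx orbT.
have := cu _ (cl z); apply: cvg_comp => A; rewrite /within/= => hA.
have cc : continuous ((fun y : X * R => (y.1, Num.max y.2 0)) : X * R -> X * R).
  apply: (@lipschitz_bound_continuous _ _ _ 1) => y y'; rewrite mul1r.
  rewrite [X in X <= _]prod_normE/= ge_max (norm_fst_le (y - y'))/=.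
  apply: le_trans (norm_snd_le (y - y')) => /=.
  have h1 := ler_norm (y.2 - y'.2); have h2 := ler_norm (y'.2 - y.2).
  rewrite distrC in h2; rewrite ler_norml /Num.max.
  by have [h3|h3] := ltP y.2 0; have [h4|h4] := ltP y'.2 0; apply/andP; split; lra.
have := cc z _ hA; rewrite /nbhs/=; apply: filterS => y /=; apply; exact: cl.
Qed.

End quotients.

(** * Algebra and convexity of pressure and density *)

Section pressure.
Context {R : realType}.
Variable (m : R) (m1 : 1 < m).

Let m0 : 0 < m. Proof. exact: lt_trans m1. Qed.
Let m10 : 0 < m - 1. Proof. by rewrite subr_gt0. Qed.
Let k0 : 0 < m / (m - 1). Proof. exact: divr_gt0. Qed.
Let c0 : 0 < (m - 1) / m. Proof. exact: divr_gt0. Qed.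
Let kc : m / (m - 1) * ((m - 1) / m) = 1.
Proof. by rewrite mulrA divfK ?mulfV ?gt_eqF. Qed.

Lemma pressure_ge0 (r : R) : 0 <= pressure m r.
Proof. by apply: mulr_ge0; [exact: ltW|exact: powR_ge0]. Qed.

Lemma pressure0 : pressure m 0 = 0.
Proof. by rewrite /pressure powR0 ?mulr0// gt_eqF. Qed.

Lemma pressure_le (a b : R) : 0 <= a -> a <= b -> pressure m a <= pressure m b.
Proof.
move=> a0 ab; apply: ler_wpM2l; first exact: ltW.
have b0 : 0 <= b by exact: le_trans ab.
by apply: ge0_ler_powR => //; exact: ltW.
Qed.

(** The inverse of [pressure m] on the non-negative reals, see [densityK] and [pressureK]. *)
Definition density (q : R) : R := ((m - 1) / m * q) `^ (m - 1)^-1.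

Lemma density_ge0 q : 0 <= density q. Proof. exact: powR_ge0. Qed.

Lemma densityK q : 0 <= q -> pressure m (density q) = q.
Proof.
move=> q0; rewrite /pressure /density -powRrM mulVf ?gt_eqF//.
have h : 0 <= (m - 1) / m * q by apply: mulr_ge0 => //; exact: ltW.
by rewrite powRr1// mulrA kc mul1r.
Qed.

Lemma pressureK r : 0 <= r -> density (pressure m r) = r.
Proof.
move=> r0; rewrite /pressure /density mulrA (mulrC ((m - 1) / m)) kc mul1r.
by rewrite -powRrM mulfV ?gt_eqF// powRr1.
Qed.

Lemma density_le a b : 0 <= a -> a <= b -> density a <= density b.
Proof.
move=> a0 ab; have b0 : 0 <= b by exact: le_trans ab.
have i0 : 0 <= (m - 1)^-1 by rewrite invr_ge0 ltW.
have ha : 0 <= (m - 1) / m * a by apply: mulr_ge0 => //; exact: ltW.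
have hb : 0 <= (m - 1) / m * b by apply: mulr_ge0 => //; exact: ltW.
by apply: ge0_ler_powR => //; apply: ler_wpM2l => //; exact: ltW.
Qed.

(* rho^m is a convex function of the pressure q, with derivative rho = density q;
   this is Young's inequality. *)
Lemma density_convex q q0 : 0 <= q -> 0 <= q0 ->
  density q0 * (q - q0) <= density q `^ m - density q0 `^ m.
Proof.
move=> hq hq0; set a := density q; set b := density q0.
rewrite -(densityK hq) -(densityK hq0) -/a -/b /pressure.
have a0 : 0 <= a by exact: density_ge0.
have b0 : 0 <= b by exact: density_ge0.
have y := @conjugate_powR R b (a `^ (m - 1)) m (m / (m - 1)) b0 (powR_ge0 _ _) m0 (divr_gt0 m0 m10).
have e1 : m^-1 + (m / (m - 1))^-1 = 1 by field; rewrite !gt_eqF//.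
have {}y := y e1.
rewrite -powRrM (_ : (m - 1) * (m / (m - 1)) = m) in y; last by field; rewrite gt_eqF//.
have bm : b * b `^ (m - 1) = b `^ m by rewrite mulr_powRB1.
move: y bm; move: (b `^ (m - 1)) (a `^ (m - 1)) (b `^ m) (a `^ m) => B1 A1 Bm Am y bm.
have -> : b * (m / (m - 1) * A1 - m / (m - 1) * B1) =
    m / (m - 1) * (b * A1) - m / (m - 1) * Bm by rewrite -bm; ring.
have := ler_wpM2l (ltW k0) y.
have -> : m / (m - 1) * (Bm / m + Am / (m / (m - 1))) = Bm / (m - 1) + Am.
  by field; rewrite !gt_eqF//.
have -> : m / (m - 1) * Bm = Bm + Bm / (m - 1) by field; rewrite gt_eqF//.
by move: (Bm / _) (_ * (b * A1)) => z1 z2; lra.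
Qed.

Lemma powR_lipschitz (M a b : R) : 0 < a -> a < b -> b <= M ->
  b `^ m - a `^ m <= m * M `^ (m - 1) * (b - a).
Proof.
move=> a0 ab bM.
have [||c] := @MVT R (fun x => x `^ m) (fun x => m * x `^ (m - 1)) a b ab.
- by move=> x; rewrite in_itv/= => /andP[ax _]; apply: is_derive1_powR; exact: lt_trans ax.
- apply: derivable_within_continuous => x; rewrite in_itv/= => /andP[ax _].
  by have [] := is_derive1_powR m (lt_le_trans a0 ax).
rewrite in_itv/= => /andP[ac cb] ->; apply: ler_wpM2r; first by rewrite subr_ge0 ltW.
have c00 := lt_trans a0 ac; apply: ler_wpM2l; first exact: ltW.
have cM : c <= M by rewrite (le_trans (ltW cb)).
by apply: ge0_ler_powR; rewrite ?nnegrE// ltW// (lt_le_trans c00).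
Qed.

(** For m < 2 the pressure is not Lipschitz near 0. The increment of f(p) is multiplied by the
    smaller density a, and a (p(b) - p(a)) is at most m/(m-1) (b^m - a^m), for which
    [powR_lipschitz] gives a constant that does not involve a lower bound of the densities. *)
Lemma reaction_lipschitz (f : R -> R) (L M a b : R) : 0 <= L ->
  (forall x y, `|f x - f y| <= L * `|x - y|) -> 0 < a -> a < b -> b <= M ->
  b * f (pressure m b) - a * f (pressure m a) <=
  (`|f 0| + L * pressure m M + L * (m / (m - 1)) * (m * M `^ (m - 1))) * (b - a).
Proof.
move=> L0 fL a0 ab bM.
have b0 := lt_trans a0 ab.
have h1 : f (pressure m b) <= `|f 0| + L * pressure m M.
  apply: le_trans (ler_norm _) _; rewrite -[f _](subrK (f 0)) addrC.
  apply: le_trans (ler_normD _ _) _; rewrite lerD2l.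
  apply: le_trans (fL _ _) _; apply: ler_wpM2l => //.
  by rewrite subr0 ger0_norm ?pressure_ge0// pressure_le// ltW.
have h2 : f (pressure m b) - f (pressure m a) <= L * (pressure m b - pressure m a).
  apply: le_trans (ler_norm _) _; apply: le_trans (fL _ _) _.
  by rewrite ger0_norm// subr_ge0 pressure_le ?ltW.
have h3 : a * (pressure m b - pressure m a) <= m / (m - 1) * (m * M `^ (m - 1) * (b - a)).
  apply: le_trans (_ : m / (m - 1) * (b `^ m - a `^ m) <= _).
    rewrite /pressure -mulrBr mulrCA; apply: ler_wpM2l; first exact: ltW.
    have ea := mulr_powRB1 (ltW a0) m0; have eb := mulr_powRB1 (ltW b0) m0.
    rewrite mulrBr ea -eb lerD2r.
    by apply: ler_wpM2r; [exact: powR_ge0|exact: ltW].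
  by apply: ler_wpM2l; [exact: ltW|exact: powR_lipschitz].
have -> : b * f (pressure m b) - a * f (pressure m a) =
   (b - a) * f (pressure m b) + a * (f (pressure m b) - f (pressure m a)) by ring.
rewrite [leRHS]mulrDl; apply: lerD.
  by rewrite mulrC; apply: ler_wpM2r => //; rewrite subr_ge0 ltW.
apply: le_trans (ler_wpM2l (ltW a0) h2) _; rewrite mulrCA -!(mulrA L).
by apply: ler_wpM2l => //; rewrite -!mulrA in h3 *.
Qed.

End pressure.

Section pme_comparison.
Context {R : realType} {n : nat}.
Notation X := 'rV[R]_n.
Notation mu := (@lebesgue_rV R n).
Implicit Types (phi : X -> R) (u v : X -> R -> R).

Definition step (t : R) (k : nat) : R := t / 2 / k.+1%:R.

Lemma step_itv t k : 0 < t -> 0 < step t k <= t / 2.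
Proof.
move=> t0; rewrite /step; apply/andP; split; first by rewrite !divr_gt0.
have t2 : 0 <= t / 2 by rewrite divr_ge0// ltW.
by rewrite ler_pdivrMr ?ltr0n//; apply: ler_peMr => //; rewrite ler1n.
Qed.

Lemma step_cvg t : step t k @[k --> \oo] --> 0.
Proof.
by rewrite -(mulr0 (t / 2)); apply: cvgM; [exact: cvg_cst|exact: (@cvg_harmonic R)].
Qed.

Definition super_step (f : R -> R) (m : R) phi u (T : R) := forall t, 0 < t <= T ->
  exists (ut LU : X -> R) (B : R),
  [/\ bounded_cvg_on phi B (fun k x => (u x t - u x (t - step t k)) / step t k) ut,
      bounded_cvg_on phi B (fun k => dlap (step t k) (fun x => u x t `^ m)) LU &
      forall x, phi x != 0 -> LU x + u x t * f (pressure m (u x t)) <= ut x].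

(** The Laplacian of v^m is replaced by a lower bound [lk] of its discrete Laplacians: for a
    mollified stationary subsolution, convexity provides [lk], while v^m itself may fail to be twice
    differentiable where the pressure vanishes. The function e holds the mollification error. *)
Definition sub_step (f : R -> R) (m : R) phi (e : X -> R) v (T : R) := forall t, 0 < t <= T ->
  exists (vt l : X -> R) (lk : nat -> X -> R) (B : R),
  [/\ bounded_cvg_on phi B (fun k x => (v x t - v x (t - step t k)) / step t k) vt,
      bounded_cvg_on phi B lk l, forall k, measurable_fun setT (lk k),
      forall k x, phi x != 0 -> lk k x <= dlap (step t k) (fun x => v x t `^ m) x &
      forall x, phi x != 0 -> vt x <= l x + v x t * f (pressure m (v x t)) + e x].

Definition admissible (M : R) u :=
  [/\ forall t, measurable_fun setT (u^~ t), forall x t, 0 <= u x t <= M &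
      forall x, continuous (u x)].

(** The point is the order of quantifiers: K is chosen from f, L, m and the bounds M and E, before
    the functions, the weight and the time. It can therefore be used for all approximations at once,
    although their positive lower bounds may degenerate. *)
Lemma pme_comparison (f : R -> R) (L m M E : R) : 1 < m -> 0 < M -> 0 <= L ->
  (forall x y, `|f x - f y| <= L * `|x - y|) -> exists2 K : R, 0 < K &
  forall u v (e phi : X -> R) (delta r T : R), 0 < T -> 0 <= delta -> test_function phi ->
  (forall x, 0 <= phi x) ->
  (forall x, space_laplacian phi x <= phi x + delta * \1_(ball_box r) x) ->
  admissible M u -> admissible M v -> (forall x t, 0 < u x t) ->
  measurable_fun setT e -> (forall x, 0 <= e x <= E) ->
  super_step f m phi u T -> sub_step f m phi e v T ->
  \int[mu]_x (pospart (v x T - u x T) * phi x) <=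
  expR (K * T) * (\int[mu]_x (pospart (v x 0 - u x 0) * phi x) +
    (\int[mu]_x (e x * phi x) + K * (delta * fine (mu (ball_box r)))) * T).
Proof.
move=> m1 M0 L0 fL; have m0 : 0 < m by rewrite (lt_trans ltr01).
pose C1 := `|f 0| + L * pressure m M + L * (m / (m - 1)) * (m * M `^ (m - 1)).
pose C2 := m * M `^ (m - 1).
have C10 : 0 <= C1.
  by rewrite !addr_ge0 ?mulr_ge0 ?pressure_ge0 ?powR_ge0// ?invr_ge0 ?subr_ge0 ltW.
have C20 : 0 <= C2 by rewrite mulr_ge0 ?powR_ge0// ltW.
(* [C1] serves the reaction and [C2] the power; the added 1 ensures C >= 1, so that a Laplacian
   bounded by phi is also bounded by C phi. *)
pose C := C1 + C2 + 1; have C0 : 0 < C by apply: ltr_wpDl => //; exact: addr_ge0.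
have C1C : C1 <= C by rewrite /C; lra.
have C2C : C2 <= C by rewrite /C; lra.
have C1' : 1 <= C by rewrite /C; lra.
clearbody C.
pose M' := M + M `^ m + `|E|.
have M1 : M `^ m <= M' by rewrite /M'; have := normr_ge0 E; lra.
have M2 : M <= M' by rewrite /M'; have := normr_ge0 E; have := powR_ge0 M m; lra.
have M3 : `|E| <= M' by rewrite /M'; have := powR_ge0 M m; lra.
have M'0 : 0 <= M' by exact: le_trans M3.
clearbody M'.
exists (2 * (C ^+ 2 + C) + 2 * M').
  by rewrite ltr_pwDl ?mulr_ge0// mulr_gt0// addr_gt0// exprn_gt0.
move=> u v e phi delta r T T0 delta0 tphi phi0 hphi [mu_ ub cu] [mv vb cv] u0 me eE su sv.
have pw w : 0 <= w <= M -> `|w `^ m| <= M'.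
  move=> /andP[w0 wM]; rewrite ger0_norm ?powR_ge0//; apply: le_trans M1.
  by apply: ge0_ler_powR; rewrite ?nnegrE// ltW.
have bw w : 0 <= w <= M -> `|w| <= M'.
  by move=> /andP[w0 wM]; rewrite ger0_norm//; exact: le_trans M2.
have order x t : (u x t < v x t) = (u x t `^ m < v x t `^ m).
  have /andP[a1 a2] := ub x t; have /andP[b1 b2] := vb x t.
  apply/idP/idP => [uv|]; first by apply: gt0_ltr_powR; rewrite ?nnegrE.
  by apply: contraTT; rewrite -!leNgt => vu; apply: ge0_ler_powR; rewrite ?nnegrE// ltW.
have lip x t : u x t < v x t -> v x t `^ m - u x t `^ m <= C * (v x t - u x t).
  move=> uv; have /andP[b1 b2] := vb x t.
  apply: le_trans (powR_lipschitz m1 (u0 x t) uv b2) _; apply: ler_wpM2r.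
    by rewrite subr_ge0 ltW.
  exact: C2C.
have rea x t : u x t < v x t -> v x t * f (pressure m (v x t)) - u x t * f (pressure m (u x t)) <=
    C * (v x t - u x t).
  move=> uv; have /andP[b1 b2] := vb x t.
  apply: le_trans (reaction_lipschitz m1 L0 fL (u0 x t) uv b2) _; apply: ler_wpM2r.
    by rewrite subr_ge0 ltW.
  exact: C1C.
have := @comparison R n u v (fun x t => u x t `^ m) (fun x t => v x t `^ m) e phi M' C delta r T
  T0 C0 delta0 tphi phi0.
have hphi' x : space_laplacian phi x <= C * phi x + delta * \1_(ball_box r) x.
  apply: le_trans (hphi x) _; by rewrite lerD2r; apply: ler_peMl.
move=> /(_ hphi'); have mes t : [/\ measurable_fun setT (u^~ t), measurable_fun setT (v^~ t),
    measurable_fun setT (fun x => u x t `^ m) & measurable_fun setT (fun x => v x t `^ m)].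
  split; [exact: mu_|exact: mv| |].
  - exact: (measurableT_comp (measurable_powR m) (mu_ t)).
  - exact: (measurableT_comp (measurable_powR m) (mv t)).
move=> /(_ mes); have bds x t : [/\ `|u x t| <= M', `|v x t| <= M', `|u x t `^ m| <= M' & `|v x t `^ m| <= M'].
  by split; [exact/bw/ub|exact/bw/vb|exact/pw/ub|exact/pw/vb].
move=> /(_ bds cu cv order lip me); have eM' x : 0 <= e x <= M'.
  have /andP[-> eE2] := eE x; rewrite (le_trans eE2)//=.
  by rewrite (le_trans (ler_norm _)).
move=> /(_ eM') main; apply: le_trans (main _) _ => [t t0T|].
  have [ut [LU [B1 [b1 b2 ineq1]]]] := su t t0T.
  have [vt [l [lk [B2 [b3 b4 mlk lkV ineq2]]]]] := sv t t0T.
  have /andP[t0 _] := t0T.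
  have enl (B B' : R) (F : nat -> X -> R) (g : X -> R) : B <= B' -> bounded_cvg_on phi B F g -> bounded_cvg_on phi B' F g.
    by move=> BB' h x px; have [h1 h2] := h x px; split => // k; exact: le_trans BB'.
  exists (step t), ut, vt, LU, l, lk, (Num.max B1 B2); split.
    move=> k; have /andP[s0 st] := step_itv k t0; rewrite s0 (le_trans st)//.
    by rewrite ler_pdivrMr// ler_pMr// ler1n.
  split; first exact: step_cvg.
  split; first by apply: (enl B1); rewrite ?le_max ?lexx.
  split; first by apply: (enl B2); rewrite ?le_max ?lexx ?orbT.
  split; first by apply: (enl B1); rewrite ?le_max ?lexx.
  split; first by apply: (enl B2); rewrite ?le_max ?lexx ?orbT.
  split => //; split => // x px uv.
  by have := ineq1 x px; have := ineq2 x px; have := rea x t uv; lra.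
have Iphi := test_intg tphi.
have vol0 : 0 <= delta * fine (mu (ball_box r : set X)) by rewrite mulr_ge0// fine_ge0.
have a0 : 0 <= \int[mu]_x (pospart (v x 0 - u x 0) * phi x).
  by apply: int_ge0 => x; rewrite mulr_ge0 ?pospart_ge0.
have a1 : 0 <= \int[mu]_x (e x * phi x).
  by apply: int_ge0 => x; rewrite mulr_ge0//; have /andP[] := eE x.
have CC0 : 0 <= C ^+ 2 + C by rewrite addr_ge0// ?exprn_ge0// ltW.
apply: ler_pM.
- exact: expR_ge0.
- by rewrite addr_ge0// mulr_ge0 ?(ltW T0)// addr_ge0// -mulrA mulr_ge0// mulr_ge0.
- by rewrite ler_expR ler_pM2r// lerDl mulr_ge0.
- rewrite lerD2l ler_pM2r// lerD2l -mulrA; apply: ler_wpM2r => //.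
  by rewrite lerDr mulr_ge0.
Qed.

End pme_comparison.

Section shift.
Context {R : realType} {V : normedModType R}.
Implicit Types (u : V -> R).

Let quot_shift u (c v x : V) :
  (fun h : R => h^-1 *: (((fun y => u (y + c)) \o shift x) (h *: v) - u (x + c))) =
  (fun h : R => h^-1 *: ((u \o shift (x + c)) (h *: v) - u (x + c))).
Proof. by apply/funext => h /=; rewrite addrA. Qed.

Lemma derive_translate u (c v x : V) : 'D_v (fun y => u (y + c)) x = 'D_v u (x + c).
Proof. by rewrite /derive quot_shift. Qed.

Lemma derivable_translate u (c v x : V) : derivable u (x + c) v ->
  derivable (fun y => u (y + c)) x v.
Proof. by rewrite /derivable quot_shift. Qed.

Lemma continuous_shift_at u (c x : V) : {for x + c, continuous u} ->
  {for x, continuous (fun y => u (y + c))}.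
Proof.
move=> cu; apply: (@continuous_comp _ _ _ (fun y => y + c) u) => //.
by apply: (@cvgD _ V _ _ _ id (cst c)); [exact: cvg_id|exact: cvg_cst].
Qed.

End shift.

Section solutions.
Context {R : realType} {n : nat}.
Notation X := 'rV[R]_n.
Notation XT := ('rV[R]_n * measurableTypeR R)%type.
Notation mu := (@lebesgue_rV R n).
Implicit Types (u : XT -> R).
Variables (f : R -> R) (m : R).

Definition solves u := [/\ continuous (fun z : X * R => clamp_time u z.1 z.2),
  forall z, space_time_closed z -> 0 < u z, regular u &
  forall z, space_time z ->
    dt u z = laplacian (fun y => u y `^ m) z + u z * f (pressure m (u z))].

Lemma smooth_solution_solves u : smooth_positive_solution f m u -> solves u.
Proof. move=> su; have ru := smooth_solution_regular su.
by case: su => cu u0 _ eq; split => //; exact: clamp_time_continuous. Qed.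

Definition shift_time (h : R) u : XT -> R := fun z => u (z + ((0 : X), h) : X * R).

Lemma shift_timeE h u x t : shift_time h u (x, t) = u (x, t + h).
Proof. by rewrite /shift_time; congr (u (_, _)); rewrite /= addr0. Qed.

Lemma dt_shift h u : dt (shift_time h u) = shift_time h (dt u).
Proof. by apply/funext => z; rewrite /dt /shift_time (@derive_translate R (X * R)%type). Qed.

Lemma dx_shift h u i : dx i (shift_time h u) = shift_time h (dx i u).
Proof. by apply/funext => z; rewrite /dx /shift_time (@derive_translate R (X * R)%type). Qed.

Lemma solves_shift h u : 0 <= h -> solves u -> solves (shift_time h u).
Proof.
move=> h0 [cu u0 ru eq].
have st z : space_time z -> space_time ((z : X * R) + ((0 : X), h) : XT).
  by rewrite /space_time/= => z0; rewrite ltr_wpDr.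
have sc z : space_time_closed z -> space_time_closed ((z : X * R) + ((0 : X), h) : XT).
  by rewrite /space_time_closed/= => z0; rewrite addr_ge0.
split.
- move=> z.
  have E : (fun z : X * R => clamp_time (shift_time h u) z.1 z.2) =
      (fun z : X * R => clamp_time u z.1 z.2) \o (fun y : X * R => (y.1, Num.max y.2 0 + h) : X * R).
    apply/funext => y; rewrite /clamp_time shift_timeE/=; congr (u (_, _)).
    by rewrite [RHS]max_l// addr_ge0// le_max lexx orbT.
  rewrite E; apply: continuous_comp; last exact: cu.
  apply: (@lipschitz_bound_continuous R (X * R)%type (X * R)%type 1) => y y'; rewrite mul1r.
  rewrite [X in X <= _]prod_normE/= ge_max (norm_fst_le (y - y'))/=.
  apply: le_trans (norm_snd_le (y - y')) => /=.
  have h1 := ler_norm (y.2 - y'.2); have h2 := ler_norm (y'.2 - y.2).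
  rewrite distrC in h2; rewrite ler_norml /Num.max.
  by have [h3|h3] := ltP y.2 0; have [h4|h4] := ltP y'.2 0; apply/andP; split; lra.
- by move=> z /sc /u0.
- move=> z /st sz; have [c1 d1 c2 hx] := ru _ sz; split.
  + exact: (@continuous_shift_at R (X * R)%type u ((0 : X), h) z c1).
  + exact: (@derivable_translate R (X * R)%type u ((0 : X), h) ((0 : X), (1 : R)) z d1).
  + rewrite dt_shift; exact: (@continuous_shift_at R (X * R)%type (dt u) ((0 : X), h) z c2).
  + move=> i; have [d3 c3 d4 c4] := hx i; rewrite !dx_shift; split.
    * exact: (@derivable_translate R (X * R)%type u ((0 : X), h) ((delta_mx 0 i : X), (0 : R)) z d3).
    * exact: (@continuous_shift_at R (X * R)%type (dx i u) ((0 : X), h) z c3).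
    * exact: (@derivable_translate R (X * R)%type (dx i u) ((0 : X), h) ((delta_mx 0 i : X), (0 : R)) z d4).
    * exact: (@continuous_shift_at R (X * R)%type (dx i (dx i u)) ((0 : X), h) z c4).
- move=> z /st sz; rewrite dt_shift.
  have E : laplacian (fun y => shift_time h u y `^ m) z =
      shift_time h (laplacian (fun y => u y `^ m)) z.
    have E2 : (fun y => shift_time h u y `^ m) = shift_time h (fun y => u y `^ m) by [].
    by rewrite E2 [in RHS]/shift_time /laplacian; apply: eq_bigr => i _; rewrite !dx_shift.
  by rewrite E; exact: eq.
Qed.

Lemma clamp_time_pos u x (t : R) : 0 < t -> clamp_time u x t = u (x, t).
Proof. by move=> t0; rewrite /clamp_time max_l// ltW. Qed.

Lemma solves_clamp_gt0 u x t : solves u -> 0 < clamp_time u x t.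
Proof. by move=> [_ u0 _ _]; apply: u0; rewrite /space_time_closed/= le_max lexx orbT. Qed.

Lemma solves_clamp_continuous u : solves u ->
  continuous (fun z : X * R => clamp_time u z.1 z.2).
Proof. by case. Qed.

Lemma solves_clamp_measurable u : solves u ->
  measurable_fun setT (fun z : XT => clamp_time u z.1 z.2).
Proof.
by move=> su; apply: continuous_measurable_space_time; exact: solves_clamp_continuous.
Qed.

Lemma solves_admissible u (M : R) : solves u ->
  (forall z, space_time_closed z -> u z <= M) -> admissible M (clamp_time u).
Proof.
move=> su uM; have cu := solves_clamp_continuous su; split.
- move=> t; exact: (measurableT_comp (solves_clamp_measurable su) (pair2_measurable t)).
- move=> x t; rewrite ltW ?solves_clamp_gt0//=.
  by apply: uM; rewrite /space_time_closed/= le_max lexx orbT.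
- move=> x t.
  apply: (@continuous_comp _ _ _ (fun t : R => (x, t) : X * R) (fun z : X * R => clamp_time u z.1 z.2)).
    apply: (@lipschitz_bound_continuous R R (X * R)%type 1) => s s'; rewrite mul1r.
    by rewrite prod_normE/= subrr normr0 ge_max normr_ge0 lexx.
  exact: cu.
Qed.

Lemma solves_step u (phi : X -> R) (T : R) : solves u -> test_function phi ->
  super_step f m phi (clamp_time u) T /\ sub_step f m phi (fun=> 0) (clamp_time u) T.
Proof.
move=> [cu u0 ru eq] tphi.
have u0' z : space_time z -> 0 < u z by move=> z0; apply: u0; exact: ltW.
have main (t : R) : 0 < t -> exists B : R,
  [/\ bounded_cvg_on phi B (fun k x => (clamp_time u x t - clamp_time u x (t - step t k)) / step t k)
        (fun x => dt u (x, t)),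
      bounded_cvg_on phi B (fun k => dlap (step t k) (fun x => clamp_time u x t `^ m))
        (fun x => laplacian (fun y => u y `^ m) (x, t)) &
      forall x, dt u (x, t) = laplacian (fun y => u y `^ m) (x, t) +
        clamp_time u x t * f (pressure m (clamp_time u x t))].
  move=> t0; have hs k : 0 < step t k <= t / 2 by exact: step_itv.
  have [B1 h1] := time_quot_cvg ru t0 hs (step_cvg t) tphi.
  have [B2 h2] := space_quot_cvg (regular_powR ru u0' m) t0 hs (step_cvg t) tphi.
  exists (Num.max B1 B2); split.
  - move=> x px; have [b c] := h1 x px.
    have E k : (clamp_time u x t - clamp_time u x (t - step t k)) / step t k =
        (u (x, t) - u (x, t - step t k)) / step t k.
      have /andP[_ st] := hs k.
      by rewrite !clamp_time_pos// subr_gt0 (le_lt_trans st)// ltr_pdivrMr// ltr_pMr// ltr1n.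
    split; last by rewrite (_ : (fun k => _) = (fun k => (u (x, t) - u (x, t - step t k)) / step t k)) //; apply/funext.
    by move=> k; rewrite E le_max b.
  - move=> x px; have [b c] := h2 x px.
    have E : (fun x => clamp_time u x t `^ m) = (fun x => u (x, t) `^ m).
      by apply/funext => y; rewrite clamp_time_pos.
    rewrite E; split => // k.
    by rewrite le_max b orbT.
  - by move=> x; rewrite !clamp_time_pos// eq.
split=> t /andP[t0 tT]; have [B [h1 h2 h3]] := main t t0.
  exists (fun x => dt u (x, t)), (fun x => laplacian (fun y => u y `^ m) (x, t)), B.
  by split => // x _; rewrite h3.
exists (fun x => dt u (x, t)), (fun x => laplacian (fun y => u y `^ m) (x, t)),
  (fun k => dlap (step t k) (fun x => clamp_time u x t `^ m)), B.
split => //.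
- move=> k; apply: measurable_dlap.
  have mc : measurable_fun setT (fun x : X => clamp_time u x t).
    apply: (measurableT_comp (solves_clamp_measurable _) (pair2_measurable t)).
    by split.
  exact: (measurableT_comp (measurable_powR m) mc).
- by move=> x _; rewrite h3 addr0.
Qed.

(** Used with c the density of pressure p_M, where f is non-positive, to bound solutions from
    above. *)
Lemma super_step_cst (phi : X -> R) (c T : R) : 0 <= c -> f (pressure m c) <= 0 ->
  super_step f m phi (fun _ _ => c) T.
Proof.
move=> c0 fc t _; exists (fun=> 0), (fun=> 0), 0; split.
- move=> x _; split => [k|]; rewrite ?subrr ?mul0r ?normr0//.
  rewrite (_ : (fun _ => _) = (fun=> 0)); first exact: cvg_cst.
  by apply/funext => k; rewrite mul0r.
- have d0 k x : dlap (step t k) (fun _ : X => c `^ m) x = 0.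
    by rewrite /dlap big1// => i _; rewrite (_ : _ - _ = 0) ?mul0r//; ring.
  move=> x _; split => [k|]; first by rewrite d0 normr0.
  rewrite (_ : (fun _ => _) = (fun=> 0)); first exact: cvg_cst.
  by apply/funext => k; rewrite d0.
- by move=> x _; rewrite add0r mulr_ge0_le0.
Qed.

End solutions.

(** * Stationary subsolutions and monotonicity *)

Section mollification.
Context {R : realType} {n : nat}.
Notation X := 'rV[R]_n.
Notation mu := (@lebesgue_rV R n).
Implicit Types (K p phi : X -> R).

Lemma test_scale (c : R) phi : test_function phi -> test_function (fun x => c * phi x).
Proof.
move=> tphi; have [r r0 hr] := test_support tphi.
apply: (@test_intro _ _ _ (ball_box r)); last 2 first.
- exact: cbox_compact.
- move=> x; rewrite mulf_eq0 negb_or => /andP[_ px]; exact/ball_box_norm/hr.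
- by apply: smoothM; [exact: smooth_cst|exact: test_smooth].
Qed.

Lemma int_box_bump_gt0 (r : R) : 0 < r ->
  0 < \int[mu]_x box_bump 1 (const_mx (- r)) (const_mx r) x.
Proof.
move=> r0; set B := box_bump _ _ _.
have tB : test_function B by exact: test_box_bump.
have IB := test_intg tB.
rewrite lt_neqAle int_ge0 ?andbT; last by move=> x; exact: box_bump_ge0.
apply/negP => /eqP B0.
have [|N [mN N0 hN]] := @int_norm0_ae _ _ _ mu B IB.
  by rewrite B0; apply: eq_int => x; rewrite ger0_norm// box_bump_ge0.
have sub : ball_box (r / 2) `<=` N.
  move=> x /ball_boxP xr; apply: hN => /= Bx.
  have : 0 < B x; last by rewrite Bx ltxx.
  apply: box_bump_gt0 => // i; rewrite !mxE.
  by have := xr i; rewrite ler_norml => /andP[h1 h2]; apply/andP; split; lra.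
have : mu (ball_box (r / 2)) = 0%E.
  apply/eqP; rewrite eq_le measure_ge0 andbT -N0.
  by apply: le_measure; rewrite ?inE//; exact: measurable_cbox.
have h : 0 <= r / 2 by rewrite divr_ge0// ltW.
have := lebesgue_ball_box (n := n) h => /[swap] -> /= /esym/eqP.
by rewrite mulrCA mulfV ?mulr1 ?pnatr_eq0// gt_eqF// exprn_gt0.
Qed.

Lemma mollifier_family : exists K : nat -> X -> R, forall k,
  [/\ test_function (K k), forall y, 0 <= K k y, \int[mu]_y K k y = 1 &
    forall y, K k y != 0 -> `|y| <= k.+1%:R^-1].
Proof.
pose r k : R := k.+1%:R^-1.
have r0 k : 0 < r k by rewrite invr_gt0.
pose B k := box_bump 1 (const_mx (- r k)) (const_mx (r k) : X).
have c0 k : 0 < \int[mu]_x B k x by exact: int_box_bump_gt0.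
have tB k : test_function (B k) by exact: test_box_bump.
exists (fun k x => (\int[mu]_x B k x)^-1 * B k x) => k; split.
- exact: test_scale.
- by move=> y; rewrite mulr_ge0 ?invr_ge0 ?box_bump_ge0// ltW.
- by rewrite (RintegralZl _ measurableT (test_intg (tB k))) mulVf// gt_eqF.
- move=> y; rewrite mulf_eq0 negb_or => /andP[_ By].
  apply: norm_ball_box; first exact/ltW/r0.
  apply/ball_boxP => i; rewrite ler_norml.
  by have := box_bump_neq0 ltr01 By i; rewrite !mxE => /andP[h1 h2]; rewrite !ltW.
Qed.

Lemma mollifier_approximate_identity (K : nat -> X -> R) : (forall k,
    [/\ test_function (K k), forall y, 0 <= K k y, \int[mu]_y K k y = 1 &
      forall y, K k y != 0 -> `|y| <= k.+1%:R^-1]) -> approximate_identity K.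
Proof.
move=> hK; exists (fun k => k.+1%:R^-1); split; first exact: cvg_harmonic.
by move=> k; have [h1 h2 h3 h4] := hK k; split => //; exact: test_intg.
Qed.

Lemma test_shift phi (c : X) : test_function phi ->
  test_function (fun x => phi (x - c)) /\
  forall x, space_laplacian (fun x => phi (x - c)) x = space_laplacian phi (x - c).
Proof.
move=> tphi; have D v (g : X -> R) : 'D_v (fun y => g (y - c)) = (fun x => 'D_v g (x - c)).
  by apply/funext => x; exact: (derive_translate g (- c) v x).
have [r r0 hr] := test_support tphi; split.
  apply: (@test_intro _ _ _ (ball_box (r + `|c|))); last 2 first.
  - exact: cbox_compact.
  - move=> x /hr xc; apply: ball_box_norm; rewrite -[x](subrK c).
    by rewrite (le_trans (ler_normD _ _))// lerD2r.
  - have : smooth phi by exact: test_smooth.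
    move=> sphi k; elim: k phi sphi {tphi hr} => [|k IH] phi sphi.
      split => // x; apply: continuous_shift_at; exact: (smooth_continuous sphi).
    split; first by move=> x; apply: continuous_shift_at; exact: (smooth_continuous sphi).
    move=> v; split; first by move=> x; apply: derivable_translate; exact: smooth_derivable.
    rewrite (D v phi); exact: (IH _ (smooth_derive v sphi)).
move=> x; rewrite /space_laplacian; apply: eq_bigr => i _.
rewrite (D _ phi).
exact: (congr1 (fun g => g x) (D (delta_mx 0 i) ('D_(delta_mx 0 i) phi))).
Qed.

Lemma dlap_moll (h : R) K p (M : R) x : intg mu K -> measurable_fun setT p ->
  (forall x, `|p x| <= M) ->
  intg mu (fun y => dlap h K (y - x) * p y) /\
  dlap h (moll K p) x = \int[mu]_y (dlap h K (y - x) * p y).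
Proof.
move=> IK mp pM; have mK := intg_measurable IK.
have I c : intg mu (fun y => K (y - c) * p y).
  under eq_fun do rewrite mulrC.
  apply: (intgM_bounded (M := M)) => //.
  exact: (intg_translate (- c) IK).
have E y : dlap h K (y - x) * p y = \sum_(i < n) (h ^+ 2)^-1 *
    ((K (y - (x - h *: basis_rV i)) * p y + K (y - (x + h *: basis_rV i)) * p y)
      - 2 * (K (y - x) * p y)).
  rewrite /dlap mulr_suml; apply: eq_bigr => i _.
  rewrite !opprD !opprK !addrA; set a := K _; set b := K _; set c := K _; set d := p y.
  by rewrite mulrAC mulrC; congr (_ * _); ring.
have I2 i : intg mu (fun y => (h ^+ 2)^-1 *
    ((K (y - (x - h *: basis_rV i)) * p y + K (y - (x + h *: basis_rV i)) * p y)
      - 2 * (K (y - x) * p y))).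
  by apply: intgZ; apply: intgB; [exact: intgD|exact: intgZ].
split; first by under eq_fun do rewrite E; exact: intg_sum.
rewrite (eq_int _ E) int_sum//; apply: eq_bigr => i _.
rewrite (RintegralZl _ measurableT) //; last by apply: intgB; [exact: intgD|exact: intgZ].
rewrite RintegralB//; [|exact: intgD|exact: intgZ].
have S z : moll K p z = \int[mu]_y (K (y - z) * p y) by exact: moll_shift.
rewrite (RintegralD measurableT (I (x - h *: basis_rV i)) (I (x + h *: basis_rV i))) !S.
have -> : \int[mu]_y (2 * (K (y - x) * p y)) = 2 * \int[mu]_y (K (y - x) * p y).
  exact: (RintegralZl 2 measurableT (I x)).
by rewrite mulrC [in RHS](addrC (\int[mu]_y _)).
Qed.

Lemma dlap_moll_cvg (h : nat -> R) (r : R) K p (M : R) : (forall k, 0 < h k <= r) ->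
  h k @[k --> \oo] --> 0 -> test_function K -> measurable_fun setT p ->
  (forall x, `|p x| <= M) -> exists B : R, forall x,
    (forall k, `|dlap (h k) (moll K p) x| <= B) /\
    dlap (h k) (moll K p) x @[k --> \oo] --> \int[mu]_y (space_laplacian K (y - x) * p y).
Proof.
move=> hr h0 tK mp pM; have IK := test_intg tK.
have M0 : 0 <= M by exact: le_trans (pM 0).
have [B B0 hB] := dlap_test_bound tK; have [rs rs0 hrs] := test_support tK.
exists (B * M * fine (mu (ball_box (rs + r)))) => x.
have mB : measurable (ball_box (rs + r) : set X) by exact: measurable_cbox.
have IB : intg mu \1_(ball_box (rs + r)) by exact: intg_indic_cbox.
have IBx := intg_translate (- x) IB.
have Ig := intgZ (B * M) IBx.
have bound k y : `|dlap (h k) K (y - x) * p y| <= B * M * \1_(ball_box (rs + r)) (y - x).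
  have /andP[hk hkr] := hr k.
  rewrite indicE; have [xq|xq] := boolP (y - x \in _).
    by rewrite mulr1 normrM; apply: ler_pM => //; exact: hB.
  rewrite (@dlap_test_supp _ _ K rs)// ?mul0r ?mulr0 ?normr0//.
  apply: le_lt_trans (_ : rs + r < _); first by rewrite lerD2l.
  rewrite ltNge; apply/negP => /ball_box_norm xb.
  by move: xq; rewrite notin_setE.
have Ik k := (dlap_moll (h k) x IK mp pM).1.
split => [k|].
  rewrite (dlap_moll _ _ IK mp pM).2; apply: le_trans (int_norm_le (Ik k)) _.
  have -> : B * M * fine (mu (ball_box (rs + r))) =
      \int[mu]_y (B * M * \1_(ball_box (rs + r)) (y - x)).
    rewrite (RintegralZl _ measurableT)// (int_translate (- x) (f := \1_(ball_box (rs + r)))).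
      by rewrite int_indic.
    exact: (intg_measurable IB).
  by apply: int_le => //; exact: intg_norm.
have E k : dlap (h k) (moll K p) x = \int[mu]_y (dlap (h k) K (y - x) * p y).
  by rewrite (dlap_moll _ _ IK mp pM).2.
rewrite (_ : (fun k => _) = (fun k => \int[mu]_y (dlap (h k) K (y - x) * p y))); last exact/funext.
have mL : measurable_fun setT (space_laplacian K).
  apply: measurable_sum => i; apply: continuous_measurable_rV.
  exact: (smooth_continuous (test_smooth (test_derive _ (test_derive _ tK)))).
have [||||_ _] := @dominated_cvg_int _ _ _ mu (fun k y => dlap (h k) K (y - x) * p y)
    (fun y => space_laplacian K (y - x) * p y) _ _ _ Ig => //.
- by move=> k; exact: intg_measurable.
- have mLx : measurable_fun setT (fun y : X => space_laplacian K (y - x)).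
    exact: (measurableT_comp mL (measurable_translate (- x))).
  exact: (measurable_funM mLx mp).
- apply: aeW => y; apply: cvgM; last exact: cvg_cst.
  have := @dlap_test_cvg _ _ K h r (y - x) tK hr h0; exact.
- by apply: aeW => y k.
Qed.

End mollification.

Lemma powR_cvg_ge0 (R : realType) (r l : R) (a : nat -> R) : 0 < r ->
  (forall k, 0 <= a k) -> a k @[k --> \oo] --> l -> a k `^ r @[k --> \oo] --> l `^ r.
Proof.
move=> r0 a0 al; have l0 : 0 <= l.
  by apply: (ler_cvg_to (cvg_cst (0 : R)) al); apply: nearW.
move: l0; rewrite le_eqVlt => /predU1P[l0|l0]; last first.
  have c := @powR_continuous_at R l r l0.
  exact: (@cvg_comp _ _ _ a (fun x : R => x `^ r) _ _ _ al c).
rewrite -l0 powR0 ?gt_eqF//; apply/cvgrPdist_le => e e0.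
have ep : 0 < e `^ r^-1 by exact: powR_gt0.
have := al => /cvgrPdist_le/(_ _ ep); apply: filterS => k.
rewrite -l0 !sub0r !normrN !ger0_norm ?powR_ge0// => ak.
have := @ge0_ler_powR R r (ltW r0) (a k) (e `^ r^-1).
rewrite !nnegrE => /(_ (a0 k) (powR_ge0 _ _) ak).
by rewrite -powRrM mulVf ?gt_eqF// powRr1// ltW.
Qed.

Section stationary.
Context {R : realType} {n : nat}.
Notation X := 'rV[R]_n.
Notation XT := ('rV[R]_n * measurableTypeR R)%type.
Notation mu := (@lebesgue_rV R n).
Variables (f : R -> R) (L m pM : R).
Hypothesis (m1 : 1 < m) (L0 : 0 <= L) (pM0 : 0 < pM).
Hypothesis f_lip : forall x y, `|f x - f y| <= L * `|x - y|.

Let m0 : 0 < m. Proof. exact: lt_trans m1. Qed.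

Lemma lipschitz_measurable : measurable_fun setT f.
Proof.
by apply: continuous_measurable_fun; exact: (@lipschitz_bound_continuous R R R L).
Qed.

Let Fb := `|f 0| + L * pM.

Lemma reaction_bound q : 0 <= q <= pM -> `|f q| <= Fb.
Proof.
move=> /andP[q0 qM]; rewrite -[f q](subrK (f 0)) addrC.
apply: le_trans (ler_normD _ _) _; rewrite lerD2l.
apply: le_trans (f_lip _ _) _; apply: ler_wpM2l => //.
by rewrite subr0 ger0_norm.
Qed.

Lemma measurable_density d (T : measurableType d) (g : T -> R) :
  measurable_fun setT g -> measurable_fun setT (fun x => density m (g x)).
Proof.
move=> mg; apply: (measurableT_comp (measurable_powR _)).
by apply: measurable_funM.
Qed.

Variables (p : X -> R) (mp : measurable_fun setT p) (pb : forall x, 0 <= p x <= pM).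
Hypothesis psub : stationary_pressure_subsolution f p.

Let F x := f (p x) * \1_[set y | 0 < p y] x.

Let mF : measurable_fun setT F.
Proof.
apply: measurable_funM; first exact: (measurableT_comp lipschitz_measurable).
apply: measurable_indic; rewrite [X in measurable X](_ : _ = setT `&` p @^-1` `]0, +oo[).
  exact: mp.
by rewrite setTI; apply/seteqP; split => x /=; rewrite in_itv/= andbT.
Qed.

Let Fbd x : `|F x| <= Fb.
Proof.
have Fb0 : 0 <= Fb by rewrite /Fb addr_ge0// mulr_ge0// ltW.
rewrite /F normrM indicE; case: (_ \in _); rewrite ?normr1 ?mulr1 ?normr0 ?mulr0//.
exact: reaction_bound.
Qed.

Let pbd x : `|p x| <= pM.
Proof. by have /andP[h1 h2] := pb x; rewrite ger0_norm. Qed.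

Section kernel.
Variables (K : X -> R) (tK : test_function K) (K0 : forall y, 0 <= K y).
Hypothesis K1 : \int[mu]_y K y = 1.
Let q := moll K p.

Lemma moll_pressure_bound x : 0 <= q x <= pM.
Proof.
apply/andP; split.
  by apply: int_ge0 => y; rewrite mulr_ge0//; have /andP[] := pb (x + y).
by apply: le_trans (ler_norm _) _; exact: (moll_bound x (test_intg tK) mp K0 K1 pbd).
Qed.

Lemma measurable_moll_pressure : measurable_fun setT q.
Proof. exact: (measurable_moll (test_intg tK) K0 mp pbd). Qed.

(** For q = K * p and F = f(p) 1_{p > 0}, mollification gives Laplacian(q) + K * F >= 0 instead of
    Laplacian(q) + f(q) >= 0. The defect is weighted by the density because the inequality is
    multiplied by it. That factor matters in the limit: F and f(p) may differ where p = 0, and there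
    the density vanishes. *)
Definition stationary_error (x : X) : R := density m (q x) * `|moll K F x - f (q x)|.

Lemma measurable_stationary_error : measurable_fun setT stationary_error.
Proof.
have mq := measurable_moll_pressure.
have mMF : measurable_fun setT (moll K F) by exact: (measurable_moll (test_intg tK) K0 mF Fbd).
have mfq : measurable_fun setT (fun x => f (q x)) by exact: (measurableT_comp lipschitz_measurable mq).
apply: measurable_funM; first exact: measurable_density.
by apply: measurableT_comp => //; exact: measurable_funB.
Qed.

Lemma stationary_error_bound x : 0 <= stationary_error x <= density m pM * (2 * Fb).
Proof.
have /andP[q0 qM] := moll_pressure_bound x.
have d0 := density_ge0 m (q x); rewrite mulr_ge0//=.
apply: ler_pM => //; first exact: density_le.
apply: le_trans (ler_normB _ _) _.
have h1 := reaction_bound (moll_pressure_bound x).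
have h2 := moll_bound x (test_intg tK) mF K0 K1 Fbd.
by lra.
Qed.

(** The weak inequality is tested with the kernel moved to x, which is a non-negative test
    function. *)
Lemma moll_subsolution x :
  0 <= \int[mu]_y (space_laplacian K (y - x) * p y) + moll K F x.
Proof.
have [tKx lapE] := test_shift x tK.
have IK := test_intg tKx.
have mL : measurable_fun setT (space_laplacian (fun y => K (y - x))).
  apply: measurable_sum => i; apply: continuous_measurable_rV.
  exact: (smooth_continuous (test_smooth (test_derive _ (test_derive _ tKx)))).
have IL : intg mu (space_laplacian (fun y => K (y - x))).
  apply: intg_sum => i; exact: (test_intg (test_derive _ (test_derive _ tKx))).
have I1 : intg mu (fun y => space_laplacian K (y - x) * p y).
  have := intgM_bounded IL mp pbd; apply: eq_integrable => // y _.
  by rewrite /= lapE mulrC.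
have I2 : intg mu (fun y => K (y - x) * F y).
  have := intgM_bounded IK mF Fbd; apply: eq_integrable => // y _.
  by rewrite /= mulrC.
rewrite (moll_shift x (intg_measurable (test_intg tK)) mF) -(RintegralD measurableT I1 I2).
have := psub tKx (fun y => K0 (y - x)); congr (0 <= _).
by apply: eq_int => y; rewrite lapE /F; ring.
Qed.

(** By [density_convex], applied at the two neighbours of x, the discrete Laplacian of the m-th
    power of the density is at least the density times the discrete Laplacian of q; the latter
    converges since q is a mollification. *)
Lemma stationary_sub_step (phi : X -> R) (T : R) :
  sub_step f m phi stationary_error (fun x _ => density m (q x)) T.
Proof.
move=> t /andP[t0 _].
have hs k : 0 < step t k <= t / 2 by exact: step_itv.
have [B hB] := dlap_moll_cvg hs (step_cvg t) tK mp pbd.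
have mq := measurable_moll_pressure.
have B0 : 0 <= B by have [/(_ 0%N) h _] := hB 0; exact: le_trans h.
have dM x : 0 <= density m (q x) <= density m pM.
  by have /andP[q0 qM] := moll_pressure_bound x; rewrite density_ge0 density_le.
exists (fun=> 0), (fun x => density m (q x) * \int[mu]_y (space_laplacian K (y - x) * p y)),
  (fun k x => density m (q x) * dlap (step t k) q x), (density m pM * B); split.
- move=> x _; split => [k|].
    by rewrite subrr mul0r normr0 mulr_ge0// density_ge0.
  rewrite (_ : (fun _ => _) = (fun=> 0)); first exact: cvg_cst.
  by apply/funext => k; rewrite subrr mul0r.
- move=> x _; have [h1 h2] := hB x; split => [k|].
    rewrite normrM; apply: ler_pM => //.
    by have /andP[d0 d1] := dM x; rewrite ger0_norm.
  by apply: cvgM; [exact: cvg_cst|exact: h2].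
- move=> k; apply: measurable_funM; first exact: measurable_density.
  exact: measurable_dlap.
- move=> k x _; rewrite /dlap mulr_sumr; apply: ler_sum => i _.
  rewrite mulrA; apply: ler_wpM2r; first by rewrite invr_ge0 exprn_ge0//; have /andP[/ltW] := hs k.
  have q_ge0 y : 0 <= q y by have /andP[] := moll_pressure_bound y.
  have h1 := density_convex m1 (q_ge0 (x + step t k *: basis_rV i)) (q_ge0 x).
  have h2 := density_convex m1 (q_ge0 (x - step t k *: basis_rV i)) (q_ge0 x).
  have alg (d a b c a' b' c' : R) : d * (a - c) <= a' - c' -> d * (b - c) <= b' - c' ->
      d * (a + b - 2 * c) <= a' + b' - 2 * c'.
    by move=> h3 h4; have := lerD h3 h4; congr (_ <= _); ring.
  exact: alg h1 h2.
- move=> x _; have /andP[q0 qM] := moll_pressure_bound x.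
  rewrite densityK// /stationary_error -!mulrDr; apply: mulr_ge0; first exact: density_ge0.
  have := moll_subsolution x; have := ler_norm (moll K F x - f (q x)); lra.
Qed.

End kernel.

End stationary.

Lemma pospart_cvg (R : realType) (a : nat -> R) (l : R) :
  a k @[k --> \oo] --> l -> pospart (a k) @[k --> \oo] --> pospart l.
Proof.
move=> al; have cm : continuous (fun z : R => Num.max z (cst 0 z)).
  by move=> z; apply: continuous_max; [exact: cvg_id|exact: cst_continuous].
exact: (@cvg_comp _ _ _ a (fun z : R => Num.max z (cst 0 z)) _ _ _ al (cm l)).
Qed.

Section stationary_limit.
Context {R : realType} {n : nat}.
Notation X := 'rV[R]_n.
Notation XT := ('rV[R]_n * measurableTypeR R)%type.
Notation mu := (@lebesgue_rV R n).

(** Both functions are cut off to a box with margin 1, the largest radius of the kernels: this makes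
    them integrable without changing the mollifications at the points considered. L1 convergence
    then yields one almost everywhere subsequence for the two. *)
Lemma moll_ae_subseq (K : nat -> X -> R) (p F : X -> R) (M r : R) :
  (forall k, [/\ test_function (K k), forall y, 0 <= K k y, \int[mu]_y K k y = 1 &
      forall y, K k y != 0 -> `|y| <= k.+1%:R^-1]) ->
  measurable_fun setT p -> measurable_fun setT F ->
  (forall x, `|p x| <= M) -> (forall x, `|F x| <= M) ->
  exists2 s : nat -> nat, {homo s : i j / (i < j)%N} & {ae mu, forall x, `|x| <= r ->
    moll (K (s k)) p x @[k --> \oo] --> p x /\ moll (K (s k)) F x @[k --> \oo] --> F x}.
Proof.
move=> hK mp mF pM FM; pose B : set X := ball_box (r + 1).
have mB : measurable B by exact: measurable_cbox.
have IB : intg mu \1_B by exact: intg_indic_cbox.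
have loc (g : X -> R) : measurable_fun setT g -> (forall x, `|g x| <= M) ->
    [/\ intg mu (fun x => g x * \1_B x), forall x, `|g x * \1_B x| <= M &
      forall k x, `|x| <= r -> moll (K k) g x = moll (K k) (fun x => g x * \1_B x) x].
  move=> mg gM; split; first exact: (intgM_bounded IB mg gM).
    move=> x; rewrite normrM indicE; case: (_ \in _); rewrite ?normr1 ?mulr1// normr0 mulr0.
    exact: le_trans (gM 0).
  move=> k x xr; apply: eq_int => y.
  have [->|Ky] := eqVneq (K k y) 0; first by rewrite !mul0r.
  rewrite indicE mem_set ?mulr1//; apply: ball_box_norm.
  apply: le_trans (ler_normD _ _) _; apply: lerD => //.
  have [_ _ _ /(_ _ Ky) h] := hK k; apply: le_trans h _.
  by rewrite invf_le1// ler1n.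
have gB (g : X -> R) x : `|x| <= r -> g x * \1_B x = g x.
  move=> xr; rewrite indicE mem_set ?mulr1//; apply: ball_box_norm.
  by rewrite (le_trans xr)// lerDl.
have aK := mollifier_approximate_identity hK.
have [Ip pM' pE] := loc p mp pM; have [IF FM' FE] := loc F mF FM.
have [I1 c1] := moll_cvg aK Ip pM'; have [I2 c2] := moll_cvg aK IF FM'.
set p1 := fun x => p x * _ in Ip pM' pE I1 c1.
set F1 := fun x => F x * _ in IF FM' FE I2 c2.
pose G k x := `|moll (K k) p1 x - p1 x| + `|moll (K k) F1 x - F1 x|.
have IG k : intg mu (G k) by exact: intgD (I1 k) (I2 k).
have G0 k x : 0 <= G k x by rewrite addr_ge0.
have cG : \int[mu]_x `|G k x - 0| @[k --> \oo] --> 0.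
  have E k : \int[mu]_x `|G k x - 0| = \int[mu]_x `|moll (K k) p1 x - p1 x| +
      \int[mu]_x `|moll (K k) F1 x - F1 x|.
    rewrite -(RintegralD measurableT (I1 k) (I2 k)); apply: eq_int => x.
    by rewrite subr0 ger0_norm.
  rewrite (_ : (fun _ => _) = (fun k => \int[mu]_x `|moll (K k) p1 x - p1 x| +
      \int[mu]_x `|moll (K k) F1 x - F1 x|)); last exact/funext.
  by rewrite -[0]addr0; exact: cvgD c1 c2.
have [s smono sae] := L1_cvg_ae_subseq IG (intg0 mu) cG.
exists s => //; apply: filterS sae => x Gx xr.
have sq (a b : nat -> R) (l : R) : (forall k, `|b k - l| <= a k) -> a k @[k --> \oo] --> 0 ->
    b k @[k --> \oo] --> l.
  move=> ab a0; apply/cvgrPdist_le => e e0.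
  have := a0 => /cvgrPdist_le/(_ _ e0); apply: filterS => k.
  by rewrite sub0r normrN distrC => /(le_trans (ler_norm _)); exact: le_trans.
split; apply: sq Gx => k.
- by rewrite pE// -(gB p x xr) /G lerDl.
- by rewrite FE// -(gB F x xr) /G lerDr.
Qed.

(** [pme_comparison] is applied to the mollified subsolution with a constant that does not depend on
    the kernel. Dominated convergence on the support of phi then removes the mollification, and the
    error e tends to 0. *)
Lemma stationary_comparison (f : R -> R) (L m pM M : R) : 1 < m -> 0 <= L -> 0 < pM ->
  (forall x y, `|f x - f y| <= L * `|x - y|) -> 0 < M -> density m pM <= M ->
  exists2 C : R, 0 < C & forall (p : X -> R) (u : XT -> R) (phi : X -> R) (delta r T : R),
  measurable_fun setT p -> (forall x, 0 <= p x <= pM) ->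
  stationary_pressure_subsolution f p ->
  solves f m u -> (forall z, space_time_closed z -> u z <= M) ->
  test_function phi -> (forall x, 0 <= phi x) -> 0 <= delta -> 0 < T ->
  (forall x, space_laplacian phi x <= phi x + delta * \1_(ball_box r) x) ->
  \int[mu]_x (pospart (density m (p x) - clamp_time u x T) * phi x) <=
  expR (C * T) * (\int[mu]_x (pospart (density m (p x) - clamp_time u x 0) * phi x) +
    C * (delta * fine (mu (ball_box r))) * T).
Proof.
move=> m1 L0 pM0 f_lip M0 dM; have m10 : 0 < m - 1 by rewrite subr_gt0.
set E := density m pM * (2 * (`|f 0| + L * pM)).
have [C C0 hC] := @pme_comparison R n f L m M E m1 M0 L0 f_lip; exists C => //.
move=> p u phi delta r T mp pb psub su uM tphi phi0 d0 T0 hphi.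
have [K hK] := @mollifier_family R n.
pose F x := f (p x) * \1_[set y | 0 < p y] x.
have Iphi := test_intg tphi; have mphi := intg_measurable Iphi.
have [rs rs0 hrs] := test_support tphi.
have mf := lipschitz_measurable f_lip.
have Fb0 : 0 <= `|f 0| + L * pM by rewrite addr_ge0// mulr_ge0// ltW.
have mF : measurable_fun setT F.
  apply: measurable_funM; first exact: (measurableT_comp mf).
  apply: measurable_indic; rewrite [X in measurable X](_ : _ = setT `&` p @^-1` `]0, +oo[).
    exact: mp.
  by rewrite setTI; apply/seteqP; split => x /=; rewrite in_itv/= andbT.
have Fbd x : `|F x| <= pM + (`|f 0| + L * pM).
  rewrite /F normrM indicE; apply: le_trans (_ : `|f 0| + L * pM <= _); last by rewrite lerDr ltW.
  case: (_ \in _); rewrite ?normr1 ?mulr1 ?normr0 ?mulr0//.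
  exact: reaction_bound.
have pbd x : `|p x| <= pM + (`|f 0| + L * pM).
  by have /andP[h1 h2] := pb x; rewrite ger0_norm// (le_trans h2)// lerDl.
have [s smono sae] := moll_ae_subseq rs hK mp mF pbd Fbd.
pose q k := moll (K (s k)) p; pose v k x := density m (q k x).
pose e k := stationary_error f m p (K (s k)).
have qb k x : 0 <= q k x <= pM by have [h1 h2 h3 h4] := hK (s k); exact: moll_pressure_bound.
have mq k : measurable_fun setT (q k) by have [h1 h2 h3 h4] := hK (s k); exact: (@measurable_moll_pressure _ _ pM).
have mv k : measurable_fun setT (v k) by exact: measurable_density.
have vb k x : 0 <= v k x <= M.
  have /andP[q0 qM] := qb k x; rewrite density_ge0/=; apply: le_trans dM; exact: density_le.
have eb k x : 0 <= e k x <= E.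
  have [h1 h2 h3 h4] := hK (s k).
  exact: (stationary_error_bound m1 L0 pM0 f_lip mp pb h1 h2 h3 x).
have me k : measurable_fun setT (e k).
  have [h1 h2 h3 h4] := hK (s k).
  exact: (measurable_stationary_error m L0 pM0 f_lip mp pb h1 h2).
have [mu_ ub cu] := solves_admissible su uM.
have [ssu _] := solves_step T su tphi.
have ineq k : \int[mu]_x (pospart (v k x - clamp_time u x T) * phi x) <=
  expR (C * T) * (\int[mu]_x (pospart (v k x - clamp_time u x 0) * phi x) +
    (\int[mu]_x (e k x * phi x) + C * (delta * fine (mu (ball_box r)))) * T).
  have [h1 h2 h3 h4] := hK (s k).
  apply: (hC (clamp_time u) (fun x _ => v k x) (e k) phi delta r T) => //.
  - by split => // x t; exact: cvg_cst.
  - by move=> x t; exact: solves_clamp_gt0 su.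
  - exact: (stationary_sub_step m1 L0 pM0 f_lip mp pb psub h1 h2 h3).
have Ig (c : R) := intgZ c Iphi.
have vcvg : {ae mu, forall x, phi x != 0 -> v k x @[k --> \oo] --> density m (p x)}.
  apply: filterS sae => x hx px; have [hq _] := hx (hrs x px).
  rewrite /v /density; apply: powR_cvg_ge0.
  - by rewrite invr_gt0.
  - move=> k; have /andP[q0 _] := qb k x; apply: mulr_ge0 => //.
    by rewrite divr_ge0 ?ltW// (lt_trans ltr01).
  - by apply: cvgM; [exact: cvg_cst|exact: hq].
have lim t : \int[mu]_x (pospart (v k x - clamp_time u x t) * phi x) @[k --> \oo] -->
    \int[mu]_x (pospart (density m (p x) - clamp_time u x t) * phi x).
  have [||||_ _] := @dominated_cvg_int _ _ _ mu (fun k x => pospart (v k x - clamp_time u x t) * phi x)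
    (fun x => pospart (density m (p x) - clamp_time u x t) * phi x) _ _ _ (Ig M) => //.
  - move=> k; apply: measurable_funM => //; apply: measurable_pospart.
    by apply: measurable_funB => //; exact: mu_.
  - apply: measurable_funM => //; apply: measurable_pospart.
    by apply: measurable_funB; [exact: measurable_density|exact: mu_].
  - apply: filterS vcvg => x hx.
    have [->|px] := eqVneq (phi x) 0.
      by rewrite mulr0 (_ : (fun _ => _) = (fun=> 0)); [exact: cvg_cst|apply/funext => k; rewrite mulr0].
    apply: cvgM; last exact: cvg_cst.
    by apply: pospart_cvg; apply: cvgB; [exact: hx|exact: cvg_cst].
  - apply: aeW => x k; rewrite normrM !ger0_norm ?pospart_ge0//; apply: ler_wpM2r => //.
    have /andP[v0 vM] := vb k x; have /andP[u0 _] := ub x t.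
    by rewrite /pospart ge_max (ltW M0) andbT; lra.
have elim : \int[mu]_x (e k x * phi x) @[k --> \oo] --> 0.
  have [||||_ _] := @dominated_cvg_int _ _ _ mu (fun k x => e k x * phi x) (fun=> 0) _ _ _ (Ig E) => //.
  - by move=> k; exact: measurable_funM.
  - apply: filterS2 vcvg sae => x hv hs.
    have [->|px] := eqVneq (phi x) 0.
      by rewrite (_ : (fun _ => _) = (fun=> 0)); [exact: cvg_cst|apply/funext => k; rewrite mulr0].
    have [hq hF] := hs (hrs x px); rewrite -(mul0r (phi x)).
    apply: cvgM; last exact: cvg_cst.
    have fq : f (q k x) @[k --> \oo] --> f (p x).
      have cf := @lipschitz_bound_continuous R R R L f f_lip (p x).
      exact: (@cvg_comp _ _ _ (fun k => q k x) f _ _ _ hq cf).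
    have c := cvgM (hv px) (cvg_norm (cvgB hF fq)).
    (* The limit of the error vanishes in both cases: where p = 0 the density does, and where p > 0
       the indicator equals 1 and F = f(p). *)
    rewrite [X in _ --> X](_ : 0 = density m (p x) * `|F x - f (p x)|); first exact: c.
    have /andP[p0 _] := pb x; move: p0; rewrite le_eqVlt => /predU1P[p0|p0].
      by rewrite -p0 /density mulr0 powR0 ?mul0r// invr_eq0 gt_eqF.
    by rewrite /F indicE mem_set// mulr1 subrr normr0 mulr0.
  - apply: aeW => x k; have /andP[e0 e1] := eb k x.
    by rewrite normrM !ger0_norm//; apply: ler_wpM2r.
  by rewrite /Rintegral (integral0 mu setT).
have rhs : expR (C * T) * (\int[mu]_x (pospart (v k x - clamp_time u x 0) * phi x) +
      (\int[mu]_x (e k x * phi x) + C * (delta * fine (mu (ball_box r)))) * T) @[k --> \oo] -->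
    expR (C * T) * (\int[mu]_x (pospart (density m (p x) - clamp_time u x 0) * phi x) +
      (0 + C * (delta * fine (mu (ball_box r)))) * T).
  apply: cvgM; first exact: cvg_cst.
  apply: cvgD; first exact: lim.
  apply: cvgM; last exact: cvg_cst.
  by apply: cvgD; [exact: elim|exact: cvg_cst].
rewrite add0r in rhs; apply: ler_cvg_to (lim T) rhs _; exact: nearW.
Qed.

End stationary_limit.

Section restriction.
Context d (T : measurableType d) (R : realType) (mu : {measure set T -> \bar R}).
Implicit Types (f : T -> R) (D : set T).

Let restrictE D f : ((EFin \o f) \_ D) = EFin \o (fun x => \1_D x * f x).
Proof.
apply/funext => x; rewrite patchE /= indicE; case: (_ \in _); rewrite ?mul1r//.
by rewrite mul0r.
Qed.

Lemma intg_indicP D f : measurable D ->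
  mu.-integrable D (EFin \o f) <-> intg mu (fun x => \1_D x * f x).
Proof.
by move=> mD; rewrite /intg -restrictE; exact: integrable_mkcond.
Qed.

Lemma int_indicE D f : \int[mu]_(x in D) f x = \int[mu]_x (\1_D x * f x).
Proof. by rewrite /Rintegral integral_mkcond restrictE. Qed.

Lemma L1_cvg_indic D (u_ : nat -> T -> R) u : measurable D ->
  L1_cvg mu D u_ u <-> [/\ forall k, intg mu (fun x => \1_D x * u_ k x),
    intg mu (fun x => \1_D x * u x) &
    \int[mu]_x (\1_D x * `|u_ k x - u x|) @[k --> \oo] --> 0].
Proof.
move=> mD; have Ik k : intg mu (fun x => \1_D x * u_ k x) -> intg mu (fun x => \1_D x * u x) ->
    intg mu (fun x => \1_D x * `|u_ k x - u x|).
  move=> h1 h2; have := intg_norm (intgB h1 h2); apply: eq_integrable => // x _ /=.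
  by rewrite -mulrBr normrM [X in X * _]ger0_norm// indicE ler0n.
have E k : (\int[mu]_(x in D) `|u_ k x - u x|%:E = \int[mu]_x (\1_D x * `|u_ k x - u x|)%:E)%E.
  by rewrite integral_mkcond (restrictE D (fun x => `|u_ k x - u x|)).
split=> -[h1 h2 h3].
  have i1 k : intg mu (fun x => \1_D x * u_ k x) by exact: (intg_indicP (u_ k) mD).1 (h1 k).
  have i2 : intg mu (fun x => \1_D x * u x) by exact: (intg_indicP u mD).1 h2.
  split => //; move/fine_cvgP : h3 => [_]; rewrite (_ : fine \o _ = fun k => \int[mu]_x (\1_D x * `|u_ k x - u x|))//.
  by apply/funext => k /=; rewrite E.
split; [by move=> k; exact: (intg_indicP (u_ k) mD).2 (h1 k)|exact: (intg_indicP u mD).2 h2|].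
apply: cvg_EFin.
  by apply: nearW => k; rewrite E (int_fineK (Ik k (h1 k) h2)).
rewrite (_ : fine \o _ = fun k => \int[mu]_x (\1_D x * `|u_ k x - u x|))//.
by apply/funext => k /=; rewrite E.
Qed.

End restriction.

(** * Compact exhaustion of space-time and limits of time slices *)

Section slabs.
Context {R : realType} {n : nat}.
Notation X := 'rV[R]_n.
Notation XT := ('rV[R]_n * measurableTypeR R)%type.
Notation mu := (@lebesgue_rV R n).
Notation nu := (@space_time_measure R n).

(** A countable exhaustion of [space_time] by compact sets that stay away from time 0. Almost
    everywhere statements ([ae_slab]) and local L1 limits ([compact_in_slab]) reduce to it. *)
Definition slab (j : nat) : set XT :=
  ball_box j.+1%:R `*` `[j.+1%:R^-1, j.+1%:R]%classic.

Lemma measurable_slab j : measurable (slab j).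
Proof. by apply: measurableX; [exact: measurable_cbox|exact: measurable_itv]. Qed.

Lemma compact_slab j : compact (slab j : set (X * R)).
Proof. by apply: compact_setX; [exact: cbox_compact|exact: segment_compact]. Qed.

Lemma slab_space_time j : slab j `<=` space_time.
Proof.
by move=> z [_]; rewrite /= in_itv/= => /andP[h _]; apply: lt_le_trans h; rewrite invr_gt0.
Qed.

Lemma in_slab (r a b : R) : 0 < a -> exists j, forall z : XT, `|z.1| <= r -> a <= z.2 <= b -> slab j z.
Proof.
move=> a0; have [i hi] := exists_natSinv_lt a0.
exists (maxn i (maxn `|Num.ceil r|%N `|Num.ceil b|%N)); set j := maxn _ _.
have jR k (c : R) : (k <= j)%N -> c <= k%:R -> c <= j.+1%:R.
  by move=> kj ck; apply: (le_trans ck); rewrite ler_nat; exact: leqW.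
have cR (c : R) : c <= `|Num.ceil c|%N%:R.
  by rewrite natr_absz (le_trans (ceil_ge c))// ler_int ler_norm.
move=> z zr /andP[az zb]; split.
  apply: ball_box_norm; apply: (le_trans zr); apply: jR (cR r).
  by rewrite /j !leq_max leqnn orbT.
rewrite /= in_itv/=; apply/andP; split.
  rewrite (le_trans _ az)// ltW// (le_lt_trans _ hi)// lef_pV2 ?posrE// ler_nat ltnS.
  by rewrite /j leq_max leqnn.
apply: (le_trans zb); apply: jR (cR b).
by rewrite /j !leq_max leqnn !orbT.
Qed.

Lemma bigcup_slab z : space_time z -> exists j, slab j z.
Proof.
by move=> z0; have [j hj] := in_slab `|z.1| z.2 z0; exists j; apply: hj; rewrite ?lexx.
Qed.

Lemma ae_slab (P : XT -> Prop) : (forall j, {ae nu, forall z, slab j z -> P z}) ->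
  {ae nu, forall z, space_time z -> P z}.
Proof.
move=> /ae_foralln; apply: filterS => z Pz /bigcup_slab[j sj]; exact: Pz sj.
Qed.

Lemma ball_box_lty (r : R) : (mu (ball_box r) < +oo)%E.
Proof. exact: lebesgue_cbox_lty. Qed.

Lemma int_slab (g : XT -> R) (B : set X) (I : set R) (M : R) :
  measurable_fun setT g -> (forall z, 0 <= g z <= M) -> measurable B -> (mu B < +oo)%E ->
  measurable I -> (lebesgue_measure (I : set (measurableTypeR R)) < +oo)%E ->
  [/\ intg nu (fun z => \1_(B `*` I) z * g z),
    intg (@lebesgue_measure R) (fun t => \1_I t * \int[mu]_x (\1_B x * g (x, t))) &
  \int[nu]_z (\1_(B `*` I) z * g z) =
    \int[lebesgue_measure]_t (\1_I t * \int[mu]_x (\1_B x * g (x, t)))].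
Proof.
move=> mg gb mB fB mI fI.
have M0 : 0 <= M by have /andP[a b] := gb (0, 0); exact: le_trans b.
have mBI : measurable (B `*` I : set XT) by exact: measurableX.
have fBI : (nu (B `*` I) < +oo)%E.
  change ((lebesgue_rV_sf n \x @lebesgue_measure R)%E (B `*` I) < +oo)%E.
  rewrite product_measure1E//; apply: lte_mul_pinfty => //.
  by rewrite ge0_fin_numE.
have Ig : intg nu (fun z => \1_(B `*` I) z * g z).
  have h : intg nu (fun z => g z * \1_(B `*` I) z).
    apply: (intgM_bounded (intg_indic mBI fBI) mg (M := M)) => z.
    by have /andP[a b] := gb z; rewrite ger0_norm.
  by under eq_fun do rewrite mulrC.
have IB : intg mu \1_B by exact: intg_indic.
have Ix t : intg mu (fun x => \1_B x * g (x, t)).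
  under eq_fun do rewrite mulrC.
  apply: (intgM_bounded IB (M := M)); first exact: (measurableT_comp mg (pair2_measurable t)).
  by move=> x; have /andP[a b] := gb (x, t); rewrite ger0_norm.
have G0 t : 0 <= \int[mu]_x (\1_B x * g (x, t)).
  by apply: int_ge0 => x; rewrite mulr_ge0//; have /andP[] := gb (x, t).
have GM t : \int[mu]_x (\1_B x * g (x, t)) <= M * fine (mu B).
  rewrite -(int_indic _ mB) -(RintegralZl _ measurableT IB); apply: int_le => //; first exact: intgZ.
  by move=> x; rewrite mulrC; apply: ler_wpM2r; [rewrite indicE|have /andP[] := gb (x, t)].
pose gg (z : XT) : \bar R := (\1_(B `*` I) z * g z)%:E.
have mgg : measurable_fun setT gg by apply/measurable_EFinP; exact: intg_measurable Ig.
have gg0 z : (0 <= gg z)%E by rewrite lee_fin mulr_ge0//; have /andP[] := gb z.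
have GE t : fubini_G (lebesgue_rV_sf n) gg t = (\1_I t * \int[mu]_x (\1_B x * g (x, t)))%:E.
  rewrite /fubini_G -(RintegralZl _ measurableT (Ix t)) -int_fineK; last exact: intgZ.
  apply: eq_integral => x _; rewrite /gg mulrA; congr (_ * _)%:E.
  by rewrite !indicE in_setX/= -natrM mulnb andbC.
have mG : measurable_fun setT (fun t : measurableTypeR R => \1_I t * \int[mu]_x (\1_B x * g (x, t))).
  apply/measurable_EFinP; rewrite (_ : _ \o _ = fubini_G (lebesgue_rV_sf n) gg); last exact/funext.
  exact: measurable_fun_fubini_tonelli_G.
split => //.
  apply: (@intg_dom _ _ _ (@lebesgue_measure R) (fun t : measurableTypeR R => M * fine (mu B) * \1_I t) _ mG).
    by apply: intgZ; exact: intg_indic.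
  by move=> t; rewrite normrM mulrC !ger0_norm//; apply: ler_wpM2r => //; rewrite indicE.
rewrite /Rintegral; congr (fine _).
rewrite [LHS](@fubini_tonelli2 _ _ _ _ _ (lebesgue_rV_sf n) (@lebesgue_measure R) gg mgg gg0).
by apply: eq_integral => t _; rewrite GE.
Qed.

(** The comparison controls one time at a time; the uniform bound of the slices permits dominated
    convergence in the time variable. *)
Lemma slab_slices (g : nat -> XT -> R) (M : R) (j : nat) :
  (forall k, measurable_fun setT (g k)) -> (forall k z, 0 <= g k z <= M) ->
  (forall t, 0 < t -> \int[mu]_x (\1_(ball_box j.+1%:R) x * g k (x, t)) @[k --> \oo] --> 0) ->
  (forall k, intg nu (fun z => \1_(slab j) z * g k z)) /\
  \int[nu]_z (\1_(slab j) z * g k z) @[k --> \oo] --> 0.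
Proof.
move=> mg gb hg; set B : set X := ball_box j.+1%:R in hg *.
pose I : set R := `[j.+1%:R^-1, j.+1%:R]%classic.
have mB : measurable B by exact: measurable_cbox.
have mI : measurable I by exact: measurable_itv.
have fI : (lebesgue_measure (I : set (measurableTypeR R)) < +oo)%E.
  by rewrite lebesgue_measure_itv/=; case: ifP => _; rewrite ?ltry// -EFinB ltry.
have S k := int_slab (mg k) (gb k) mB (ball_box_lty _) mI fI.
split; first by move=> k; have [] := S k.
rewrite (_ : (fun k => _) = (fun k => \int[lebesgue_measure]_t (\1_I t * \int[mu]_x (\1_B x * g k (x, t))))); last first.
  by apply/funext => k; have [] := S k.
have IB : intg mu \1_B by exact: intg_indic_cbox.
have II : intg (@lebesgue_measure R) (\1_I : measurableTypeR R -> R) by exact: intg_indic.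
have [||||_ _] := @dominated_cvg_int _ _ _ (@lebesgue_measure R)
    (fun k t => \1_I t * \int[mu]_x (\1_B x * g k (x, t))) (fun=> 0) _ _ _ (intgZ (M * fine (mu B)) II) => //.
- by move=> k; have [_ h _] := S k; exact: intg_measurable h.
- apply: aeW => t; have [tI|tI] := pselect (I t); last first.
    rewrite (_ : (fun _ => _) = (fun=> 0)); first exact: cvg_cst.
    by apply/funext => k; rewrite indicE memNset// mul0r.
  rewrite (_ : (fun _ => _) = (fun k => \int[mu]_x (\1_B x * g k (x, t)))); last first.
    by apply/funext => k; rewrite indicE mem_set// mul1r.
  apply: hg; move: tI; rewrite /I/= in_itv/= => /andP[h _].
  by apply: lt_le_trans h; rewrite invr_gt0.
- apply: aeW => t k; rewrite normrM mulrC; have i0 : 0 <= (\1_I t : R) by rewrite indicE.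
  rewrite (ger0_norm i0); apply: ler_wpM2r => //.
  rewrite ger0_norm; last by apply: int_ge0 => x; rewrite mulr_ge0//; have /andP[] := gb k (x, t).
  rewrite -(int_indic _ mB) -(RintegralZl _ measurableT IB); apply: int_le; last first.
  + by move=> x; rewrite mulrC; apply: ler_wpM2r; [rewrite indicE|have /andP[] := gb k (x, t)].
  + exact: intgZ.
  + under eq_fun do rewrite mulrC.
    apply: (intgM_bounded IB (M := M)); first exact: (measurableT_comp (mg k) (pair2_measurable t)).
    by move=> x; have /andP[a b] := gb k (x, t); rewrite ger0_norm.
by rewrite /Rintegral (integral0 (@lebesgue_measure R) setT).
Qed.

Lemma slices_zero (g : nat -> XT -> R) (h : XT -> R) (D : nat -> XT -> R) (M : R) :
  (forall k, measurable_fun setT (g k)) -> (forall k z, 0 <= g k z <= M) ->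
  (forall r t, 0 < r -> 0 < t -> \int[mu]_x (\1_(ball_box r) x * g k (x, t)) @[k --> \oo] --> 0) ->
  measurable_fun setT h ->
  (forall k z, space_time z -> `|g k z - h z| <= D k z) ->
  (forall j, (forall k, intg nu (fun z => \1_(slab j) z * D k z)) /\
    \int[nu]_z (\1_(slab j) z * D k z) @[k --> \oo] --> 0) ->
  {ae nu, forall z, space_time z -> h z = 0}.
Proof.
move=> mg gb hg mh ghD hD; apply: ae_slab => j.
have [|Ig cg] := slab_slices (j := j) mg gb; first by move=> t t0; apply: hg.
have [ID cD] := hD j; have mS := measurable_slab j.
have le k z : `|\1_(slab j) z * h z| <= \1_(slab j) z * g k z + \1_(slab j) z * D k z.
  rewrite normrM -mulrDr; have [zs|zs] := pselect (slab j z); last first.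
    by rewrite indicE memNset// !mul0r normr0 mul0r.
  rewrite indicE mem_set// !mul1r normr1 mul1r.
  rewrite -[h z](subKr (g k z)); apply: le_trans (ler_normB _ _) _.
  have /andP[g0 _] := gb k z; rewrite ger0_norm// lerD2l; exact/ghD/(slab_space_time zs).
have Ih : intg nu (fun z => \1_(slab j) z * h z).
  apply: (@intg_dom _ _ _ _ _ _ _ (intgD (Ig 0%N) (ID 0%N))) => //.
  by apply: measurable_funM => //; exact: measurable_indic.
have h0 : \int[nu]_z `|\1_(slab j) z * h z| = 0.
  apply/eqP; rewrite eq_le int_ge0// andbT.
  have c : \int[nu]_z (\1_(slab j) z * g k z) + \int[nu]_z (\1_(slab j) z * D k z) @[k --> \oo] --> 0.
    by rewrite -[0]addr0; exact: cvgD.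
  apply: ler_cvg_to (cvg_cst _) c _; apply: nearW => k.
  rewrite -(RintegralD measurableT (Ig k) (ID k)); apply: int_le => //; first exact: intg_norm.
  exact: intgD.
have := int_norm0_ae Ih h0; apply: filterS => z hz zs.
by move: hz; rewrite indicE mem_set// mul1r.
Qed.

(** The weights of [cutoff_family] are used in this order: first the index j, large enough for the
    delta term to be below c e/2 and for the weight to be at least c on the given box, then k, to
    make [A k] small. It is essential that c does not depend on j. *)
Lemma limit_slice (g : nat -> X -> R) (M C : R) :
  (forall k, measurable_fun setT (g k)) -> (forall k x, 0 <= g k x <= M) -> 0 <= C ->
  (forall phi delta r, test_function phi -> (forall x, 0 <= phi x <= 1) -> 0 <= delta ->
    (forall x, space_laplacian phi x <= phi x + delta * \1_(ball_box r) x) ->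
    exists2 A : nat -> R, A k @[k --> \oo] --> 0 &
    forall k, \int[mu]_x (g k x * phi x) <= A k + C * (delta * fine (mu (ball_box r)))) ->
  forall r, 0 < r -> \int[mu]_x (\1_(ball_box r) x * g k x) @[k --> \oo] --> 0.
Proof.
move=> mg gb C0 hA r r0.
have [w [delta [c [c0 wd w01 [lapw cw] dv]]]] := @cutoff_family R n.
have IB : intg mu \1_(ball_box r) by exact: intg_indic_cbox.
have gM k x : `|g k x| <= M by have /andP[a b] := gb k x; rewrite ger0_norm.
apply/cvgrPdist_le => e e0.
have e1 : 0 < c * e / 2 by rewrite divr_gt0// mulr_gt0.
have dv2 : C * (delta k * fine (mu (ball_box k.+1%:R))) @[k --> \oo] --> 0.
  by rewrite -(mulr0 C); apply: cvgM; [exact: cvg_cst|exact: dv].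
have := dv2 => /cvgrPdist_le/(_ _ e1)[N _ hN].
pose j := maxn N `|Num.ceil (2 * r)|%N.
have jr : r <= j.+1%:R / 2.
  have h1 : 2 * r <= `|Num.ceil (2 * r)|%N%:R by rewrite natr_absz (le_trans (ceil_ge _))// ler_int ler_norm.
  have h2 : (`|Num.ceil (2 * r)|%N%:R : R) <= j.+1%:R by rewrite ler_nat leqW// /j leq_maxr.
  by rewrite ler_pdivlMr// mulrC (le_trans h1).
have := hN j (leq_maxl _ _); rewrite /= sub0r normrN => /(le_trans (ler_norm _)) hj.
have [tw d0] := wd j.
have [A A0 hAk] := hA (w j) (delta j) j.+1%:R tw (w01 j) d0 (lapw j).
have := A0 => /cvgrPdist_le/(_ _ e1); apply: filterS => k; rewrite sub0r normrN => /(le_trans (ler_norm _)) Ak.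
have w0 x : 0 <= w j x by have /andP[] := w01 j x.
have G0 : 0 <= \int[mu]_x (\1_(ball_box r) x * g k x).
  by apply: int_ge0 => x; rewrite mulr_ge0//; have /andP[] := gb k x.
rewrite sub0r normrN ger0_norm// -(ler_pM2l c0).
have I1 : intg mu (fun x => \1_(ball_box r) x * g k x).
  by under eq_fun do rewrite mulrC; exact: (intgM_bounded IB (mg k) (gM k)).
apply: (@le_trans _ _ (\int[mu]_x (g k x * w j x))).
  rewrite -(RintegralZl _ measurableT I1); apply: int_le; first exact: intgZ.
    exact: (intgM_bounded (test_intg tw) (mg k) (gM k)).
  move=> x; have /andP[gk0 _] := gb k x; rewrite mulrA (mulrC (g k x)); apply: ler_wpM2r => //.
  have [xr|xr] := pselect (ball_box r x); last by rewrite indicE memNset// mulr0.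
  by rewrite indicE mem_set// mulr1; apply: cw; rewrite (le_trans _ jr)// norm_ball_box// ltW.
by have := hAk k; lra.
Qed.

End slabs.

Section monotonicity.
Context {R : realType} {n : nat}.
Notation X := 'rV[R]_n.
Notation XT := ('rV[R]_n * measurableTypeR R)%type.
Notation mu := (@lebesgue_rV R n).
Notation nu := (@space_time_measure R n).

Lemma ae_fst (P : X -> Prop) : {ae mu, forall x, P x} -> {ae nu, forall z : XT, P z.1}.
Proof.
move=> [N [mN N0 hN]]; exists (N `*` setT); split.
- exact: measurableX.
- change ((lebesgue_rV_sf n \x @lebesgue_measure R)%E (N `*` setT) = 0%E).
  by rewrite product_measure1E// [X in (X * _)%E]N0 mul0e.
- by move=> z nP; split => //; exact: hN.
Qed.

Lemma pospart_lip (a b : R) : `|pospart a - pospart b| <= `|a - b|.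
Proof.
have h1 := ler_norm (a - b); have h2 := ler_norm (b - a); rewrite distrC in h2.
rewrite ler_norml /pospart /Num.max.
by have [h3|h3] := ltP a 0; have [h4|h4] := ltP b 0; apply/andP; split; lra.
Qed.

(** The comparison yields that positive parts of differences of approximations vanish in the limit
    at each time; local L1 convergence in space-time turns this into an order between the limits. *)
Lemma ordered_limits (a b : nat -> XT -> R) (A B : XT -> R) (D : nat -> XT -> R) (M : R) :
  (forall k, measurable_fun setT (a k)) -> (forall k, measurable_fun setT (b k)) ->
  (forall k z, a k z <= M) -> (forall k z, 0 <= b k z) -> 0 <= M ->
  measurable_fun setT A -> measurable_fun setT B ->
  (forall r t, 0 < r -> 0 < t -> \int[mu]_x (\1_(ball_box r) x *
    pospart (a k (x, t) - b k (x, t))) @[k --> \oo] --> 0) ->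
  (forall k z, space_time z -> `|a k z - A z| + `|b k z - B z| <= D k z) ->
  (forall j, (forall k, intg nu (fun z => \1_(slab j) z * D k z)) /\
    \int[nu]_z (\1_(slab j) z * D k z) @[k --> \oo] --> 0) ->
  {ae nu, forall z, space_time z -> A z <= B z}.
Proof.
move=> ma mb aM b0 M0 mA mB hs hD1 hD2.
have := @slices_zero R n (fun k z => pospart (a k z - b k z)) (fun z => pospart (A z - B z)) D M.
move=> h; have {}h : {ae nu, forall z : XT, space_time z -> pospart (A z - B z) = 0}.
  apply: h => //.
  - by move=> k; apply: measurable_pospart; exact: measurable_funB.
  - move=> k z; rewrite pospart_ge0/= /pospart ge_max M0 andbT.
    by have := aM k z; have := b0 k z; lra.
  - by apply: measurable_pospart; exact: measurable_funB.
  - move=> k z /(hD1 k z); apply: le_trans; apply: le_trans (pospart_lip _ _) _.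
    rewrite (_ : _ - _ - _ = (a k z - A z) - (b k z - B z)); last by ring.
    exact: ler_normB.
apply: filterS h => z h z0.
by have := le_pospart (A z - B z); rewrite (h z0) subr_le0.
Qed.

Lemma pospart_slice (a b : nat -> X -> R) (M C : R) :
  (forall k, measurable_fun setT (a k)) -> (forall k, measurable_fun setT (b k)) ->
  (forall k z, a k z <= M) -> (forall k z, 0 <= b k z) -> 0 <= M -> 0 <= C ->
  (forall phi delta r, test_function phi -> (forall x, 0 <= phi x <= 1) -> 0 <= delta ->
    (forall x, space_laplacian phi x <= phi x + delta * \1_(ball_box r) x) ->
    exists2 A : nat -> R, A k @[k --> \oo] --> 0 &
    forall k, \int[mu]_x (pospart (a k x - b k x) * phi x) <=
      A k + C * (delta * fine (mu (ball_box r)))) ->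
  forall r, 0 < r -> \int[mu]_x (\1_(ball_box r) x * pospart (a k x - b k x)) @[k --> \oo] --> 0.
Proof.
move=> ma mb aM b0 M0 C0; apply: (@limit_slice _ _ _ M C _ _ C0).
- by move=> k; apply: measurable_pospart; exact: measurable_funB.
- move=> k z; rewrite pospart_ge0/= /pospart ge_max M0 andbT.
  by have := aM k z; have := b0 k z; lra.
Qed.

Variables (f : R -> R) (L m pM : R) (rho_in : X -> R) (rho : XT -> R).
Hypothesis (m1 : 1 < m) (L0 : 0 <= L) (pM0 : 0 < pM) (fpM : f pM <= 0).
Hypothesis f_lip : forall x y, `|f x - f y| <= L * `|x - y|.
Hypothesis in0 : {ae mu, forall x, 0 <= rho_in x}.
Hypothesis in_L1 : intg mu rho_in.
Hypothesis in_le : {ae mu, forall x, pressure m (rho_in x) <= pM}.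

(** The assumptions on the data hold almost everywhere; capping at p_M gives a representative that
    satisfies the bounds at every point. *)
Definition initial_pressure x := Num.min (pressure m (rho_in x)) pM.
Definition initial_density x := density m (initial_pressure x).

Let c := density m pM.

Let c0 : 0 < c.
Proof.
apply: powR_gt0; apply: mulr_gt0 => //; apply: divr_gt0; first by rewrite subr_gt0.
exact: lt_trans m1.
Qed.

Lemma initial_pressure_bound x : 0 <= initial_pressure x <= pM.
Proof. by rewrite le_min pressure_ge0// (ltW pM0) ge_min lexx orbT. Qed.

Lemma measurable_pressure d (T : measurableType d) (g : T -> R) :
  measurable_fun setT g -> measurable_fun setT (fun x => pressure m (g x)).
Proof.
move=> mg; apply: measurable_funM; first exact: measurable_cst.
exact: (measurableT_comp (measurable_powR _)).
Qed.

Lemma measurable_initial_pressure : measurable_fun setT initial_pressure.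
Proof.
apply: measurable_minr; last exact: measurable_cst.
by apply: measurable_pressure; exact: intg_measurable in_L1.
Qed.

Lemma initial_density_bound x : 0 <= initial_density x <= c.
Proof.
have /andP[h1 h2] := initial_pressure_bound x.
by rewrite density_ge0; apply: density_le.
Qed.

Lemma measurable_initial_density : measurable_fun setT initial_density.
Proof. by apply: measurable_density; exact: measurable_initial_pressure. Qed.

Lemma initial_pressureE : {ae mu, forall x, initial_pressure x = pressure m (rho_in x)}.
Proof. by apply: filterS in_le => x h; rewrite /initial_pressure min_l. Qed.

Lemma initial_densityE : {ae mu, forall x, initial_density x = rho_in x}.
Proof.
apply: filterS2 in0 initial_pressureE => x h0 h.
by rewrite /initial_density h pressureK.
Qed.

Hypothesis rho_meas : measurable_fun space_time rho.
Hypothesis sol : limit_of_smooth_positive_solutions f m rho_in rho.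

Let r0 := initial_density.
Let rr (z : XT) : R := \1_space_time z * rho z.

Let mst : measurable (space_time : set XT).
Proof.
rewrite (_ : space_time = setT `*` `]0, +oo[%classic); first exact: measurableX.
by apply/seteqP; split => z /=; rewrite /space_time/= in_itv/= andbT => // -[].
Qed.

Let mrr : measurable_fun setT rr.
Proof.
rewrite (_ : rr = rho \_ space_time); first exact/(measurable_restrictT _ _).1.
by apply/funext => z; rewrite /rr patchE indicE; case: (_ \in _); rewrite ?mul1r ?mul0r.
Qed.

(** The bound M is enlarged to dominate c, so that the constant supersolution and the initial
    density satisfy the same bounds as the approximations. The convergence of the initial values is
    put in the weighted form that the comparison consumes. *)
Lemma regularized_solutions : exists (u : nat -> XT -> R) (M : R),
  [/\ c <= M, forall k, solves f m (u k), forall k z, space_time_closed z -> u k z <= M,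
   forall phi : X -> R, test_function phi -> (forall x, 0 <= phi x <= 1) ->
     \int[mu]_x (`|clamp_time (u k) x 0 - r0 x| * phi x) @[k --> \oo] --> 0 &
   forall j, (forall k, intg nu (fun z => \1_(slab j) z * `|clamp_time (u k) z.1 z.2 - rr z|)) /\
    \int[nu]_z (\1_(slab j) z * `|clamp_time (u k) z.1 z.2 - rr z|) @[k --> \oo] --> 0].
Proof.
have [u [M0 [su uM _ uin uloc]]] := sol.
pose M := Num.max M0 c.
have suk k := smooth_solution_solves (su k).
have uM' k z : space_time_closed z -> u k z <= M by move=> /(uM k z) h; rewrite le_max h.
have adm k : admissible M (clamp_time (u k)) by exact: solves_admissible (suk k) (uM' k).
have mr0 := measurable_initial_density.
exists u, M; split => //; first by rewrite le_max lexx orbT.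
  move=> phi tphi phi01; have [r r_gt0 hr] := test_support tphi.
  have mB : measurable (ball_box r : set X) by exact: measurable_cbox.
  have hK : L1_cvg mu (ball_box r) (fun k x => u k (x, 0)) rho_in := uin (ball_box r) (@cbox_compact R n (const_mx (- r)) (const_mx r)).
  have [I1 I2 c1] := iffLR (@L1_cvg_indic _ _ R mu (ball_box r) (fun k x => u k (x, 0)) rho_in mB) hK.
  have E k x : clamp_time (u k) x 0 = u k (x, 0) by rewrite /clamp_time maxxx.
  have Iphi := test_intg tphi.
  have b k x : `|clamp_time (u k) x 0 - r0 x| <= M + c.
    have [_ b1 _] := adm k; have /andP[h1 h2] := b1 x 0; have /andP[h3 h4] := initial_density_bound x.
    apply: le_trans (ler_normB _ _) _; rewrite !ger0_norm//; exact: lerD.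
  have mm k : measurable_fun setT (fun x => `|clamp_time (u k) x 0 - r0 x|).
    by have [h _ _] := adm k; apply: measurableT_comp => //; exact: measurable_funB.
  have Ia k : intg mu (fun x => `|clamp_time (u k) x 0 - r0 x| * phi x).
    by apply: (intgM_bounded Iphi (mm k) (M := M + c)) => x; rewrite normr_id.
  have Ib k : intg mu (fun x => \1_(ball_box r) x * `|u k (x, 0) - rho_in x|).
    have := intg_norm (intgB (I1 k) I2); apply: eq_integrable => // x _ /=.
    by rewrite -mulrBr normrM [X in X * _]ger0_norm// indicE ler0n.
  apply: (squeeze_cvgr _ (cvg_cst (0 : R)) c1); apply: nearW => k; apply/andP; split.
    by apply: int_ge0 => x; rewrite mulr_ge0//; have /andP[] := phi01 x.
  apply: int_le_ae => //; apply: filterS initial_densityE => x hx.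
  rewrite E /r0 hx mulrC; have [->|px] := eqVneq (phi x) 0; first by rewrite mul0r mulr_ge0// indicE.
  rewrite indicE mem_set; last exact/ball_box_norm/hr.
  by apply: ler_wpM2r => //; have /andP[] := phi01 x.
move=> j; have mS : measurable (slab j : set XT) by exact: measurable_slab.
have hK : L1_cvg nu (slab j) u rho := uloc (slab j) (@compact_slab _ _ j) (@slab_space_time _ _ j).
have hI := @L1_cvg_indic _ XT R nu (slab j) u rho mS.
have [I1 I2 c1] := iffLR hI hK.
have E k z : \1_(slab j) z * `|clamp_time (u k) z.1 z.2 - rr z| = \1_(slab j) z * `|u k z - rho z|.
  have [zs|zs] := pselect (slab j z); last by rewrite indicE memNset// !mul0r.
  have z0 := slab_space_time zs.
  by rewrite clamp_time_pos// /rr [X in X * rho z]indicE mem_set// mul1r; case: (z).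
split.
  move=> k; have := intg_norm (intgB (I1 k) I2); apply: eq_integrable => // z _ /=.
  by rewrite E -mulrBr normrM [X in X * _]ger0_norm// indicE ler0n.
by rewrite (_ : (fun k => _) = (fun k => \int[nu]_z (\1_(slab j) z * `|u k z - rho z|))) //; apply/funext => k; apply: eq_int => z; exact: E.
Qed.

End monotonicity.

Section monotone_solution.
Context {R : realType} {n : nat}.
Notation X := 'rV[R]_n.
Notation XT := ('rV[R]_n * measurableTypeR R)%type.
Notation mu := (@lebesgue_rV R n).
Notation nu := (@space_time_measure R n).
Variables (f : R -> R) (L m pM : R) (rho_in : X -> R) (rho : XT -> R).
Hypothesis (m1 : 1 < m) (L0 : 0 <= L) (pM0 : 0 < pM) (fpM : f pM <= 0).
Hypothesis f_lip : forall x y, `|f x - f y| <= L * `|x - y|.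
Hypothesis in0 : {ae mu, forall x, 0 <= rho_in x}.
Hypothesis in_L1 : intg mu rho_in.
Hypothesis in_le : {ae mu, forall x, pressure m (rho_in x) <= pM}.
Hypothesis rho_meas : measurable_fun space_time rho.
Hypothesis sol : limit_of_smooth_positive_solutions f m rho_in rho.

Let c := density m pM.
Let r0 := initial_density m pM rho_in.
Let rr (z : XT) : R := \1_space_time z * rho z.

Let c_gt0 : 0 < c.
Proof.
apply: powR_gt0; apply: mulr_gt0 => //; apply: divr_gt0; first by rewrite subr_gt0.
exact: lt_trans m1.
Qed.

Lemma measurable_space_time : measurable (@space_time R n).
Proof.
rewrite (_ : space_time = setT `*` `]0, +oo[%classic); first exact: measurableX.
by apply/seteqP; split => z /=; rewrite /space_time/= in_itv/= andbT => // -[].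
Qed.

Lemma measurable_extension (g : XT -> R) : measurable_fun space_time g ->
  measurable_fun setT (fun z => \1_space_time z * g z).
Proof.
move=> mg; rewrite (_ : (fun _ => _) = g \_ space_time).
  by have mst := measurable_space_time; exact/(measurable_restrictT _ _).1.
by apply/funext => z; rewrite patchE indicE; case: (_ \in _); rewrite ?mul1r ?mul0r.
Qed.

Let mrr : measurable_fun setT rr. Proof. exact: measurable_extension. Qed.

Let rrE z : space_time z -> rr z = rho z.
Proof. by move=> z0; rewrite /rr indicE mem_set// mul1r. Qed.

Lemma norm_sub_le (a b M : R) : 0 <= a <= M -> 0 <= b <= M -> `|a - b| <= M.
Proof. by move=> /andP[h1 h2] /andP[h3 h4]; rewrite ler_norml; apply/andP; split; lra. Qed.

Lemma pospart_sub_le (a b d : R) : b <= d -> pospart (a - d) <= `|a - b|.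
Proof.
by move=> bd; rewrite /pospart ge_max normr_ge0 andbT; have := ler_norm (a - b); lra.
Qed.

Lemma initial_le (phi a b g : X -> R) (E K t d M : R) : test_function phi -> (forall x, 0 <= phi x) ->
  0 <= E -> 0 <= M -> measurable_fun setT a -> measurable_fun setT b -> measurable_fun setT g ->
  (forall x, 0 <= a x <= M) -> (forall x, 0 <= b x <= M) -> (forall x, 0 <= g x <= M) ->
  (forall x, pospart (a x - b x) <= g x) ->
  E * (\int[mu]_x (pospart (a x - b x) * phi x) + (\int[mu]_x (0 * phi x) + K * d) * t) <=
  E * \int[mu]_x (g x * phi x) + E * K * t * d.
Proof.
move=> tphi phi0 E0 M0 ma mb mg aM bM gM abg; have Iphi := test_intg tphi.
have z0 : \int[mu]_x (0 * phi x) = 0.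
  by rewrite (eq_int (fun=> 0)) => [|x]; rewrite ?mul0r// /Rintegral (integral0 mu setT).
have h : \int[mu]_x (pospart (a x - b x) * phi x) <= \int[mu]_x (g x * phi x).
  apply: int_le.
  - apply: (intgM_bounded Iphi (M := M)).
      by apply: measurable_pospart; exact: measurable_funB.
    by move=> x; rewrite ger0_norm ?pospart_ge0// (le_trans (abg x))//; have /andP[] := gM x.
  - by apply: (intgM_bounded Iphi (M := M)) => // x; have /andP[g0 g1] := gM x; rewrite ger0_norm.
  - by move=> x; apply: ler_wpM2r.
rewrite z0 add0r mulrDr (_ : E * (K * d * t) = E * K * t * d); last by ring.
by rewrite lerD2r; apply: ler_wpM2l.
Qed.

(** Comparison of the approximations, as subsolutions, with the constant c as supersolution; the
    initial excess over c is at most the distance to [r0], which tends to 0. *)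
Lemma solution_le : {ae nu, forall z, space_time z -> rho z <= c}.
Proof.
have [u [M [cM su uM uin uloc]]] := regularized_solutions m1 pM0 in0 in_L1 in_le sol.
have M0 : 0 < M by exact: lt_le_trans cM.
have r0b x : 0 <= r0 x <= c by exact: initial_density_bound.
have r0M x : 0 <= r0 x <= M by have /andP[-> r0c] := r0b x; exact: le_trans cM.
have adm k : admissible M (clamp_time (u k)) by exact: solves_admissible (su k) (uM k).
have mu_ k := solves_clamp_measurable (su k).
have [K K0 hK] := @pme_comparison R n f L m M 0 m1 M0 L0 f_lip.
suff : {ae nu, forall z, space_time z -> rr z <= c}.
  by apply: filterS => z h z0; rewrite -rrE//; exact: h.
apply: (@ordered_limits _ _ (fun k z => clamp_time (u k) z.1 z.2) (fun _ _ => c) rr (fun=> c)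
  (fun k z => `|clamp_time (u k) z.1 z.2 - rr z|) M) => //.
- by move=> k z; have [_ b _] := adm k; have /andP[] := b z.1 z.2.
- by move=> _ _; exact: ltW.
- exact: ltW.
- move=> r t r_gt0 t0 /=.
  apply: (@pospart_slice _ _ (fun k x => clamp_time (u k) x t) (fun _ _ => c) M (expR (K * t) * K * t)) => //.
  + by move=> k; have [h _ _] := adm k; exact: h.
  + by move=> k x; have [_ b _] := adm k; have /andP[] := b x t.
  + by move=> _ _; exact: ltW.
  + exact: ltW.
  + apply: mulr_ge0; [apply: mulr_ge0; [exact: expR_ge0|exact: ltW]|exact: ltW].
  + move=> phi delta r' tphi phi01 d0 lap.
    have phi0 x : 0 <= phi x by have /andP[] := phi01 x.
    exists (fun k => expR (K * t) * \int[mu]_x (`|clamp_time (u k) x 0 - r0 x| * phi x)).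
      rewrite [X in _ --> X](_ : 0 = expR (K * t) * 0); last by rewrite mulr0.
      by apply: cvgM; [exact: cvg_cst|exact: (uin phi tphi phi01)].
    move=> k; have [_ sst] := solves_step t (su k) tphi.
    apply: le_trans (hK (fun _ _ => c) (clamp_time (u k)) (fun=> 0) phi delta r' t t0 d0 tphi phi0 lap _ _ _ _ _ _ sst) _ => //.
    * by split => // [x t'|x t']; [rewrite ltW//= |exact: cvg_cst].
    * by rewrite lexx.
    * by apply: super_step_cst; [exact: ltW|rewrite /c densityK// ltW].
    * have [mk bk _] := adm k.
      apply: (@initial_le phi (fun x => clamp_time (u k) x 0) (fun=> c)
        (fun x => `|clamp_time (u k) x 0 - r0 x|) _ K t _ M) => //.
      - exact: ltW.
      - by apply: measurableT_comp => //; apply: measurable_funB; [exact: mk|exact: measurable_initial_density].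
      - by move=> _; rewrite (ltW c_gt0) cM.
      - by move=> x; rewrite normr_ge0; apply: norm_sub_le; [exact: bk|exact: r0M].
      - by move=> x; apply: pospart_sub_le; have /andP[] := r0b x.
- by move=> k z _; rewrite subrr normr0 addr0.
Qed.

Hypothesis psub : stationary_pressure_subsolution f (initial_pressure m pM rho_in).

(** Comparison of the stationary subsolution with the approximations. Their initial order holds only
    up to the difference of the initial values, which vanishes in the limit; hence a statement on
    limits of slices rather than an inequality for each k. *)
Lemma initial_slices (u : nat -> XT -> R) (M : R) : c <= M ->
  (forall k, solves f m (u k)) -> (forall k z, space_time_closed z -> u k z <= M) ->
  (forall phi : X -> R, test_function phi -> (forall x, 0 <= phi x <= 1) ->
     \int[mu]_x (`|clamp_time (u k) x 0 - r0 x| * phi x) @[k --> \oo] --> 0) ->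
  forall r t, 0 < r -> 0 < t ->
  \int[mu]_x (\1_(ball_box r) x * pospart (r0 x - clamp_time (u k) x t)) @[k --> \oo] --> 0.
Proof.
move=> cM su uM uin r t r_gt0 t0.
have M0 : 0 < M by exact: lt_le_trans cM.
have adm k : admissible M (clamp_time (u k)) by exact: solves_admissible (su k) (uM k).
have r0b x : 0 <= r0 x <= c by exact: initial_density_bound.
have r0M x : 0 <= r0 x <= M by have /andP[-> r0c] := r0b x; exact: le_trans cM.
have mr0 : measurable_fun setT r0 by exact: measurable_initial_density.
have [K K0 hK] := @stationary_comparison R n f L m pM M m1 L0 pM0 f_lip M0 cM.
apply: (@pospart_slice _ _ (fun=> r0) (fun k x => clamp_time (u k) x t) M (expR (K * t) * K * t)) => //.
- by move=> k; have [h _ _] := adm k; exact: h.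
- by move=> k x; have /andP[_ h] := r0b x; exact: le_trans cM.
- by move=> k x; have [_ b _] := adm k; have /andP[] := b x t.
- exact: ltW.
- apply: mulr_ge0; [apply: mulr_ge0; [exact: expR_ge0|exact: ltW]|exact: ltW].
- move=> phi delta r' tphi phi01 d0 lap.
  have phi0 x : 0 <= phi x by have /andP[] := phi01 x.
  exists (fun k => expR (K * t) * \int[mu]_x (`|clamp_time (u k) x 0 - r0 x| * phi x)).
    rewrite [X in _ --> X](_ : 0 = expR (K * t) * 0); last by rewrite mulr0.
    by apply: cvgM; [exact: cvg_cst|exact: (uin phi tphi phi01)].
  move=> k; have [mk bk _] := adm k.
  have mp : measurable_fun setT (initial_pressure m pM rho_in) by exact: measurable_initial_pressure.
  have pb x : 0 <= initial_pressure m pM rho_in x <= pM by exact: initial_pressure_bound.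
  apply: le_trans (hK (initial_pressure m pM rho_in) (u k) phi delta r' t mp pb psub (su k) (uM k)
    tphi phi0 d0 t0 lap) _.
  have zE : \int[mu]_x (0 * phi x) = 0.
    by rewrite (eq_int (fun=> 0)) => [|x]; rewrite ?mul0r// /Rintegral (integral0 mu setT).
  apply: le_trans (_ : expR (K * t) * (\int[mu]_x (pospart (r0 x - clamp_time (u k) x 0) * phi x) +
    (\int[mu]_x (0 * phi x) + K * (delta * fine (mu (ball_box r')))) * t) <= _).
    by rewrite zE add0r.
  apply: (@initial_le phi r0 (fun x => clamp_time (u k) x 0)
    (fun x => `|clamp_time (u k) x 0 - r0 x|) _ K t _ M) => //.
  + exact: ltW.
  + by apply: measurableT_comp => //; apply: measurable_funB; [exact: mk|].
  + by move=> x; rewrite normr_ge0; apply: norm_sub_le; [exact: bk|exact: r0M].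
  + by move=> x; rewrite distrC; exact: pospart_sub_le.
Qed.

Lemma solution_ge_initial : {ae nu, forall z, space_time z -> rho_in z.1 <= rho z}.
Proof.
have [u [M [cM su uM uin uloc]]] := regularized_solutions m1 pM0 in0 in_L1 in_le sol.
have M0 : 0 < M by exact: lt_le_trans cM.
have adm k : admissible M (clamp_time (u k)) by exact: solves_admissible (su k) (uM k).
have r0b x : 0 <= r0 x <= c by exact: initial_density_bound.
have r0M x : 0 <= r0 x <= M by have /andP[-> r0c] := r0b x; exact: le_trans cM.
have mr0 : measurable_fun setT r0 by exact: measurable_initial_density.
suff h : {ae nu, forall z, space_time z -> r0 z.1 <= rr z}.
  have := ae_fst (initial_densityE m1 in0 in_le).
  by apply: filterS2 h => z h hz z0; rewrite -rrE// -hz; exact: h.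
have mA : measurable_fun setT (fun z : XT => r0 z.1).
  exact: (measurableT_comp mr0 measurable_fst).
apply: (@ordered_limits R n (fun (_ : nat) (z : XT) => r0 z.1) (fun k z => clamp_time (u k) z.1 z.2)
  (fun z => r0 z.1) rr (fun k z => `|clamp_time (u k) z.1 z.2 - rr z|) M (fun _ => mA)
  (fun k => solves_clamp_measurable (su k)) _ _ (ltW M0) mA mrr _ _ uloc).
- by move=> k z; have /andP[_ h] := r0b z.1; exact: le_trans cM.
- by move=> k z; have [_ b _] := adm k; have /andP[] := b z.1 z.2.
- by move=> r t r_gt0 t0; exact: (initial_slices cM su uM uin r_gt0 t0).
- by move=> k z _; rewrite subrr normr0 add0r.
Qed.

(** The function shifted by h is again a solution and serves as supersolution for the unshifted one.
    The defect at time 0 is split at [r0]: the part from u(0) to [r0] vanishes by convergence of the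
    data, and the part from [r0] to u(h) by [initial_slices] at time h. *)
Lemma solution_nondecreasing (h : R) : 0 < h ->
  {ae nu, forall z, space_time z -> rho z <= rho (z.1, z.2 + h)}.
Proof.
move=> h0.
have [u [M [cM su uM uin uloc]]] := regularized_solutions m1 pM0 in0 in_L1 in_le sol.
have M0 : 0 < M by exact: lt_le_trans cM.
have adm k : admissible M (clamp_time (u k)) by exact: solves_admissible (su k) (uM k).
have r0b x : 0 <= r0 x <= c by exact: initial_density_bound.
have r0M x : 0 <= r0 x <= M by have /andP[-> r0c] := r0b x; exact: le_trans cM.
have mr0 : measurable_fun setT r0 by exact: measurable_initial_density.
have mu_ k := solves_clamp_measurable (su k).
have msh : measurable_fun setT (fun z : XT => (z.1 + 0, z.2 + h) : XT).
  apply: measurable_fun_pair.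
    by apply: (measurableT_comp (measurable_translate 0)); exact: measurable_fst.
  by apply: measurable_funD; [exact: measurable_snd|exact: measurable_cst].
have mp_sh A : measurable A -> nu ((fun z : XT => (z.1 + 0, z.2 + h) : XT) @^-1` A) = nu A.
  by move=> mA; exact: (space_time_translate 0 h mA).
pose D k (z : XT) := `|clamp_time (u k) z.1 z.2 - rr z|.
have mD k : measurable_fun setT (D k).
  by apply: measurableT_comp => //; exact: measurable_funB.
suff H : {ae nu, forall z, space_time z -> rr z <= rr (z.1 + 0, z.2 + h)}.
  apply: filterS H => z H z0; have := H z0; rewrite addr0 !rrE//.
  by rewrite /space_time/= addr_gt0.
apply: (@ordered_limits R n (fun k z => clamp_time (u k) z.1 z.2)
  (fun k z => clamp_time (u k) (z.1 + 0) (z.2 + h)) rr (fun z => rr (z.1 + 0, z.2 + h))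
  (fun k z => D k z + D k (z.1 + 0, z.2 + h)) M mu_ (fun k => measurableT_comp (mu_ k) msh) _ _
  (ltW M0) mrr (measurableT_comp mrr msh)).
- by move=> k z; have [_ b _] := adm k; have /andP[] := b z.1 z.2.
- by move=> k z; have [_ b _] := adm k; have /andP[] := b (z.1 + 0) (z.2 + h).
- move=> r t r_gt0 t0.
  have [K K0 hK] := @pme_comparison R n f L m M 0 m1 M0 L0 f_lip.
  rewrite (_ : (fun k => _) = (fun k => \int[mu]_x (\1_(ball_box r) x *
      pospart (clamp_time (u k) x t - clamp_time (u k) x (t + h))))); last first.
    by apply/funext => k; apply: eq_int => x /=; rewrite addr0.
  apply: (@pospart_slice _ _ (fun k x => clamp_time (u k) x t) (fun k x => clamp_time (u k) x (t + h)) M (expR (K * t) * K * t)) => //.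
  + by move=> k; have [mk _ _] := adm k; exact: mk.
  + by move=> k; have [mk _ _] := adm k; exact: mk.
  + by move=> k x; have [_ b _] := adm k; have /andP[] := b x t.
  + by move=> k x; have [_ b _] := adm k; have /andP[] := b x (t + h).
  + exact: ltW.
  + apply: mulr_ge0; [apply: mulr_ge0; [exact: expR_ge0|exact: ltW]|exact: ltW].
  + move=> phi delta r' tphi phi01 d0 lap.
    have phi0 x : 0 <= phi x by have /andP[] := phi01 x.
    have [rs rs0 hrs] := test_support tphi.
    have Iphi := test_intg tphi.
    have slice := initial_slices cM su uM uin rs0 h0.
    have ucl := uin phi tphi phi01.
    (* Majorant of the positive part of u(0) - u(h), obtained by inserting [r0]. *)
    pose g k x := `|clamp_time (u k) x 0 - r0 x| + pospart (r0 x - clamp_time (u k) x h).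
    have mg1 k : measurable_fun setT (fun x => `|clamp_time (u k) x 0 - r0 x|).
      have [mk _ _] := adm k.
      by apply: measurableT_comp => //; apply: measurable_funB; [exact: mk|].
    have mg2 k : measurable_fun setT (fun x => pospart (r0 x - clamp_time (u k) x h)).
      have [mk _ _] := adm k.
      by apply: measurable_pospart; apply: measurable_funB; [|exact: mk].
    have b1 k x : `|clamp_time (u k) x 0 - r0 x| <= M.
      by have [_ bk _] := adm k; apply: norm_sub_le; [exact: bk|exact: r0M].
    have b2 k x : 0 <= pospart (r0 x - clamp_time (u k) x h) <= M.
      have [_ bk _] := adm k; rewrite pospart_ge0/=.
      apply: le_trans (pospart_le_norm _) _; apply: norm_sub_le; [exact: r0M|exact: bk].
    have I1 k : intg mu (fun x => `|clamp_time (u k) x 0 - r0 x| * phi x).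
      by apply: (intgM_bounded Iphi (mg1 k) (M := M)) => x; rewrite normr_id.
    have I2 k : intg mu (fun x => pospart (r0 x - clamp_time (u k) x h) * phi x).
      by apply: (intgM_bounded Iphi (mg2 k) (M := M)) => x; have /andP[p0 p1] := b2 k x; rewrite ger0_norm.
    have I3 k : intg mu (fun x => \1_(ball_box rs) x * pospart (r0 x - clamp_time (u k) x h)).
      under eq_fun do rewrite mulrC.
      apply: (intgM_bounded (intg_indic_cbox _ _) (mg2 k) (M := M)) => x.
      by have /andP[p0 p1] := b2 k x; rewrite ger0_norm.
    have sl2 : \int[mu]_x (pospart (r0 x - clamp_time (u k) x h) * phi x) @[k --> \oo] --> 0.
      apply: (squeeze_cvgr _ (cvg_cst (0 : R)) slice); apply: nearW => k; apply/andP; split.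
        by apply: int_ge0 => x; rewrite mulr_ge0 ?pospart_ge0.
      apply: int_le => // x; have [->|px] := eqVneq (phi x) 0.
        by rewrite mulr0 mulr_ge0 ?pospart_ge0// indicE.
      rewrite mulrC indicE mem_set; last exact/ball_box_norm/hrs.
      by apply: ler_wpM2r; [exact: pospart_ge0|have /andP[] := phi01 x].
    exists (fun k => expR (K * t) * \int[mu]_x (g k x * phi x)).
      rewrite [X in _ --> X](_ : 0 = expR (K * t) * 0); last by rewrite mulr0.
      apply: cvgM; first exact: cvg_cst.
      rewrite (_ : (fun k => _) = (fun k => \int[mu]_x (`|clamp_time (u k) x 0 - r0 x| * phi x) +
          \int[mu]_x (pospart (r0 x - clamp_time (u k) x h) * phi x))); last first.
        apply/funext => k; rewrite -(RintegralD measurableT (I1 k) (I2 k)).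
        by apply: eq_int => x; rewrite /g mulrDl.
      rewrite [X in _ --> X](_ : 0 = 0 + 0); last by rewrite addr0.
      exact: cvgD ucl sl2.
    move=> k; have [_ sst] := solves_step t (su k) tphi.
    have ssh : solves f m (shift_time h (u k)) by apply: solves_shift => //; exact: ltW.
    have [sup _] := solves_step t ssh tphi.
    have shM z : space_time_closed z -> shift_time h (u k) z <= M.
      move=> z0; apply: uM; move: z0; rewrite /space_time_closed/= => z0.
      by apply: addr_ge0 => //; exact: ltW.
    have shE x s : 0 <= s -> clamp_time (shift_time h (u k)) x s = clamp_time (u k) x (s + h).
      move=> s0; rewrite /clamp_time !max_l ?shift_timeE//.
      by apply: addr_ge0 => //; exact: ltW.
    have := hK (clamp_time (shift_time h (u k))) (clamp_time (u k)) (fun=> 0) phi delta r' t t0 d0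
      tphi phi0 lap (solves_admissible ssh shM) (adm k).
    move=> /(_ (fun x s => solves_clamp_gt0 x s ssh) (measurable_cst _)).
    have e0 (x : X) : 0 <= (0 : R) <= 0 by rewrite !lexx.
    move=> /(_ e0 sup sst) main.
    have E s : 0 <= s -> \int[mu]_x (pospart (clamp_time (u k) x s - clamp_time (shift_time h (u k)) x s) * phi x) =
        \int[mu]_x (pospart (clamp_time (u k) x s - clamp_time (u k) x (s + h)) * phi x).
      by move=> s0; apply: eq_int => x; rewrite shE.
    rewrite !E// in main; last exact: ltW.
    rewrite add0r in main; apply: le_trans main _.
    have [mk bk _] := adm k.
    apply: (@initial_le phi (fun x => clamp_time (u k) x 0) (fun x => clamp_time (u k) x h)
      (g k) _ K t _ (M + M)) => //.
    * by rewrite addr_ge0// ltW.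
    * by apply: measurable_funD; [exact: mg1|exact: mg2].
    * by move=> x; have /andP[-> p1] := bk x 0; rewrite (le_trans p1)// lerDl ltW.
    * by move=> x; have /andP[-> p1] := bk x h; rewrite (le_trans p1)// lerDl ltW.
    * move=> x; rewrite addr_ge0 ?pospart_ge0//=; apply: lerD => //.
      by have /andP[] := b2 k x.
    * move=> x; rewrite /g {1}/pospart ge_max addr_ge0 ?pospart_ge0// andbT.
      rewrite (_ : clamp_time (u k) x 0 - clamp_time (u k) x h =
        (clamp_time (u k) x 0 - r0 x) + (r0 x - clamp_time (u k) x h)); last by ring.
      by apply: lerD; [exact: ler_norm|exact: le_pospart].
- by move=> k z _; exact: lexx.
- move=> j; have [U1 U2] := uloc j.
  have j0 : 0 < (j.+1%:R^-1 : R) by rewrite invr_gt0.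
  (* A larger slab that also contains the slab j moved forward by h, so that the shifted error is
     controlled by translation invariance. *)
  have [i hi] := @in_slab R n j.+1%:R (j.+1%:R^-1) (j.+1%:R + h) j0.
  have [V1 V2] := uloc i.
  have mS l : measurable (slab l : set XT) by exact: measurable_slab.
  pose F k (z : XT) := \1_(slab i) z * D k z.
  have IF k : intg nu (fun z : XT => F k (z.1 + 0, z.2 + h)) by exact: (integrable_mp msh mp_sh (V1 k)).
  have cF : \int[nu]_z F k (z.1 + 0, z.2 + h) @[k --> \oo] --> 0.
    rewrite (_ : (fun k => _) = (fun k => \int[nu]_z F k z)); first exact: V2.
    apply/funext => k; rewrite -(Rintegral_mp msh mp_sh)//.
    exact: (intg_measurable (V1 k)).
  have le k z : 0 <= \1_(slab j) z * D k (z.1 + 0, z.2 + h) <= F k (z.1 + 0, z.2 + h).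
    have D0 y : 0 <= D k y by exact: normr_ge0.
    have i0 l (y : XT) : 0 <= (\1_(slab l) y : R) by rewrite indicE ler0n.
    rewrite mulr_ge0//=; have [zs|zs] := pselect (slab j z); last first.
      by rewrite indicE memNset// mul0r /F mulr_ge0.
    rewrite indicE mem_set// mul1r /F indicE mem_set ?mul1r//; apply: hi.
      by rewrite /= addr0; apply: norm_ball_box => //; case: zs.
    case: zs => _; rewrite /= in_itv/= => /andP[z1 z2]; apply/andP; split.
      by rewrite (le_trans z1)// lerDl ltW.
    by rewrite lerD2r.
  have IS k : intg nu (fun z => \1_(slab j) z * D k (z.1 + 0, z.2 + h)).
    apply: (@intg_dom _ _ _ _ _ _ _ (IF k)).
      apply: measurable_funM; first exact: measurable_indic.
      exact: (measurableT_comp (mD k) msh).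
    by move=> z; have /andP[l0 l1] := le k z; rewrite ger0_norm.
  split.
    move=> k; have := intgD (U1 k) (IS k); apply: eq_integrable => // z _ /=.
    by rewrite mulrDr.
  rewrite (_ : (fun k => _) = (fun k => \int[nu]_z (\1_(slab j) z * D k z) +
      \int[nu]_z (\1_(slab j) z * D k (z.1 + 0, z.2 + h)))); last first.
    apply/funext => k; rewrite -(RintegralD measurableT (U1 k) (IS k)).
    by apply: eq_int => z; rewrite mulrDr.
  rewrite [X in _ --> X](_ : 0 = 0 + 0); last by rewrite addr0.
  apply: cvgD; first exact: U2.
  apply: (squeeze_cvgr _ (cvg_cst (0 : R)) cF); apply: nearW => k; apply/andP; split.
    by apply: int_ge0 => z; have /andP[] := le k z.
  by apply: int_le => // z; have /andP[] := le k z.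
Qed.

End monotone_solution.

(** * The energy estimate *)

Section space_time_parts.
Context {R : realType} {n : nat}.
Notation X := 'rV[R]_n.
Notation XT := ('rV[R]_n * measurableTypeR R)%type.
Notation nu := (@space_time_measure R n).
Implicit Types (c v : X * R) (f G g phi : XT -> R).

Lemma measurable_st_translate c : measurable_fun setT (fun z : XT => (z : X * R) + c : XT).
Proof.
apply: measurable_fun_pair => /=.
  by apply: (measurableT_comp (measurable_translate c.1)); exact: measurable_fst.
by apply: measurable_funD; [exact: measurable_snd|exact: measurable_cst].
Qed.

Lemma st_translate_mp c A : measurable A -> nu ((fun z : XT => (z : X * R) + c : XT) @^-1` A) = nu A.
Proof. by move=> mA; exact: (space_time_translate c.1 c.2 mA). Qed.

Lemma int_st_translate c f : measurable_fun setT f ->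
  \int[nu]_z f ((z : X * R) + c) = \int[nu]_z f z.
Proof.
by move=> mf; rewrite -(Rintegral_mp (measurable_st_translate c) (@st_translate_mp c) mf).
Qed.

Lemma intg_st_translate c f : intg nu f -> intg nu (fun z => f ((z : X * R) + c)).
Proof. by move=> If; exact: (integrable_mp (measurable_st_translate c) (@st_translate_mp c) If). Qed.

Definition st_box (r : R) : set XT := ball_box r `*` `[- r, r]%classic.

Lemma measurable_st_box r : measurable (st_box r).
Proof. by apply: measurableX; [exact: measurable_cbox|exact: measurable_itv]. Qed.

Lemma compact_st_box r : compact (st_box r : set (X * R)).
Proof. by apply: compact_setX; [exact: cbox_compact|exact: segment_compact]. Qed.

Lemma st_boxP (z : X * R) r : `|z| <= r -> st_box r z.
Proof.
move=> zr; split; first by apply: ball_box_norm; exact: le_trans (norm_fst_le z) zr.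
by rewrite /= in_itv/= -ler_norml; exact: le_trans (norm_snd_le z) zr.
Qed.

Lemma st_box_lty r : (nu (st_box r) < +oo)%E.
Proof.
change ((lebesgue_rV_sf n \x @lebesgue_measure R)%E (st_box r) < +oo)%E.
rewrite product_measure1E; [|exact: measurable_cbox|exact: measurable_itv].
apply: lte_mul_pinfty => //.
- by rewrite ge0_fin_numE//; exact: lebesgue_cbox_lty.
- have h : (lebesgue_measure (`[(- r)%R, r]%classic : set (measurableTypeR R)) < +oo)%E.
    by rewrite lebesgue_measure_itv/=; case: ifP => _; rewrite ?ltry// -EFinB ltry.
  exact: h.
Qed.

Lemma intg_st_box r : intg nu \1_(st_box r).
Proof. by apply: intg_indic; [exact: measurable_st_box|exact: st_box_lty]. Qed.

(* Translation invariance makes the difference quotients of G integrate to zero. *)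
Lemma int_derive0 (G : X * R -> R) v (r : R) : (forall z, derivable G z v) ->
  continuous G -> continuous ('D_v G) -> (forall z, G z != 0 -> `|z| <= r) ->
  intg nu ('D_v G) /\ \int[nu]_z 'D_v G z = 0.
Proof.
move=> dG cG cD supp; pose h k : R := k.+1%:R^-1.
have h0 k : 0 < h k <= 1 by rewrite invr_gt0 ltr0n invf_le1// ler1n.
have [C hC] : exists C : R, forall z : X * R, `|z| <= r + `|v| + `|v| -> `|'D_v G z| <= C.
  have [C hC] := @continuous_on_compact_bounded _ (X * R)%type ('D_v G) _ (@compact_st_box (r + `|v| + `|v|)) (fun z _ => cD z).
  by exists C => z /st_boxP; exact: hC.
have mG : measurable_fun setT (G : XT -> R) by exact: continuous_measurable_space_time.
have mD : measurable_fun setT ('D_v G : XT -> R) by exact: continuous_measurable_space_time.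
have IG : intg nu (G : XT -> R).
  have [C' hC'] := @continuous_on_compact_bounded _ (X * R)%type G _ (@compact_st_box r) (fun z _ => cG z).
  apply: (intg_supp (measurable_st_box r) (st_box_lty r) mG (M := `|C'|)).
    move=> z; have [->|/supp zr] := eqVneq (G z) 0; first by rewrite normr0.
    by rewrite (le_trans (hC' _ (st_boxP zr)))// ler_norm.
  by move=> z nz; apply/eqP; apply: contrapT => /negP /supp /st_boxP.
have hv k : `|h k *: v| <= `|v|.
  have /andP[hk0 hk1] := h0 k; rewrite normrZ gtr0_norm//; exact: ler_piMl.
pose F k (z : XT) := (G ((z : X * R) + h k *: v) - G z) / h k.
have Fb k z : `|F k z| <= C * \1_(st_box (r + `|v|)) z.
  have /andP[hk0 hk1] := h0 k.
  rewrite indicE; have [zs|zs] := boolP (z \in _); last first.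
    have z0 (y : X * R) : `|z - y| <= `|v| -> G y = 0.
      move=> zy; apply/eqP; apply: contrapT => /negP /supp yr; move: zs; rewrite notin_setE; apply.
      apply: st_boxP; rewrite -[z : X * R](subrK y) addrC (le_trans (ler_normD _ _))// lerD//.
    rewrite mulr0 /F !z0 ?subrr ?mul0r ?normr0//.
    by rewrite opprD addrA subrr add0r normrN.
  rewrite mulr1; have zr : `|z : X * R| <= r + `|v|.
    move: zs; rewrite inE => -[/= b1]; rewrite in_itv/= -ler_norml => b2.
    rewrite prod_normE/= ge_max b2 andbT; apply: norm_ball_box b1; exact: le_trans b2.
  apply: (@diff_quot_bound _ _ G z v (h k) C hk0) => [s _|s /andP[s0 s1]]; first exact: dG.
  apply: hC; apply: le_trans (ler_normD _ _) _; apply: lerD => //.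
  rewrite normrZ ger0_norm//; apply: ler_piMl => //; exact: le_trans hk1.
have [||||ID _ cF] := @dominated_cvg_int _ _ _ nu F ('D_v G) _ _ _ (intgZ C (intg_st_box (r + `|v|))) => //.
- move=> k; apply: measurable_funM; last exact: measurable_cst.
  apply: measurable_funB => //; exact: (measurableT_comp mG (measurable_st_translate _)).
- apply: aeW => z.
  have := @diff_quot_cvg _ _ G z v 1 h ltr01 h0 (@cvg_harmonic R) (fun s _ => dG _); exact.
- by apply: aeW => z k; exact: Fb.
split => //.
have F0 k : \int[nu]_z F k z = 0.
  have I1 := intg_st_translate (h k *: v) IG.
  transitivity (\int[nu]_z ((h k)^-1 * (G ((z : X * R) + h k *: v) - G z))).
    by apply: eq_int => z; rewrite /F mulrC.
  rewrite (RintegralZl _ measurableT (intgB I1 IG)) (RintegralB measurableT I1 IG).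
  by rewrite (int_st_translate _ mG) subrr mulr0.
have c0 : \int[nu]_z F k z @[k --> \oo] --> 0.
  by rewrite (_ : (fun k => _) = (fun=> 0)); [exact: cvg_cst|exact/funext].
exact: (cvg_unique _ cF c0).
Qed.

(** Cut-offs that vanish before a positive time: integrations by parts against them only use the
    regularity of solutions at positive times. *)
Definition supported_after (a : R) (phi : X * R -> R) := forall z, phi z != 0 -> a <= z.2.

Lemma supported_near0 (a : R) (phi : X * R -> R) (z : X * R) : supported_after a phi -> z.2 < a ->
  \forall y \near (z : X * R), phi y = 0.
Proof.
move=> phia za; have o : open [set y : X * R | y.2 < a].
  apply: (@open_comp _ _ (snd : X * R -> R) [set s | s < a]); last exact: open_lt.
  by move=> y _; exact: cvg_snd.
have := open_nbhs_nbhs (conj o za); apply: filterS => y /= ya.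
by apply/eqP; apply: contrapT => /negP /phia; rewrite leNgt ya.
Qed.

Lemma near0_is_derive (G : X * R -> R) (z : X * R) v : (\forall y \near (z : X * R), G y = 0) -> is_derive z v G 0.
Proof.
move=> G0; have nb : \forall y \near (z : X * R), cst 0 y = G y by apply: filterS G0 => y ->.
exact: (near_eq_is_derive nb (is_derive_cst (0 : R) z v)).
Qed.

Lemma supported_derive (a : R) (phi : X * R -> R) v :
  supported_after a phi -> supported_after a ('D_v phi).
Proof.
move=> phia z Dz; rewrite leNgt; apply/negP => za.
have := near0_is_derive v (supported_near0 phia za) => D0.
by move: Dz; rewrite (@derive_val _ _ _ z v phi 0 D0) eqxx.
Qed.

Lemma cutoff_continuous (a : R) (phi : X * R -> R) g : 0 < a -> continuous phi ->
  supported_after a phi ->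
  (forall z, space_time z -> {for z, continuous (g : X * R -> R)}) ->
  continuous (fun z : X * R => g z * phi z).
Proof.
move=> a0 cphi phia cg z; have [z0|z0] := ltP 0 z.2.
  by apply: cvgM; [exact: (cg z z0)|exact: cphi].
have za : z.2 < a by exact: le_lt_trans a0.
have n0 := supported_near0 phia za.
have E : \forall y \near z, (fun=> 0) y = g y * phi y.
  by apply: filterS n0 => y ->; rewrite mulr0.
rewrite /continuous_at (nbhs_singleton n0) mulr0.
by apply: cvg_trans (near_eq_cvg E) _; exact: cvg_cst.
Qed.

Lemma cutoff_intg (a : R) (phi : X * R -> R) g : 0 < a -> test_function phi ->
  supported_after a phi ->
  (forall z, space_time z -> {for z, continuous (g : X * R -> R)}) ->
  intg nu (fun z : XT => g z * phi z).
Proof.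
move=> a0 tphi phia cg.
have c := cutoff_continuous a0 (smooth_continuous (test_smooth tphi)) phia cg.
have [r r0 hr] := test_support tphi.
have [C hC] := @continuous_on_compact_bounded _ (X * R)%type _ _ (@compact_st_box r) (fun z _ => c z).
have b (z : X * R) : g z * phi z != 0 -> `|z| <= r.
  by rewrite mulf_eq0 negb_or => /andP[_ /hr].
have mG : measurable_fun setT (fun z : XT => g z * phi z) by exact: continuous_measurable_space_time.
apply: (intg_supp (measurable_st_box r) (st_box_lty r) mG (M := `|C|)).
  move=> z; have [->|/b zr] := eqVneq (g z * phi z) 0; first by rewrite normr0.
  by rewrite (le_trans (hC _ (st_boxP zr)))// ler_norm.
by move=> z nz; apply/eqP; apply: contrapT => /negP /b /st_boxP.
Qed.

Lemma cutoff_derive (a : R) (phi : X * R -> R) g v : 0 < a -> test_function phi ->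
  supported_after a phi ->
  (forall z, space_time z -> {for z, continuous (g : X * R -> R)}) ->
  (forall z, space_time z -> derivable (g : X * R -> R) z v) ->
  (forall z, space_time z -> {for z, continuous ('D_v (g : X * R -> R))}) ->
  \int[nu]_z ('D_v (g : X * R -> R) z * phi z) = - (\int[nu]_z (g z * 'D_v phi z)).
Proof.
move=> a0 tphi phia cg dg cDg.
have sphi := test_smooth tphi; have cphi := smooth_continuous sphi.
have tD := test_derive v tphi; have Da := @supported_derive a phi v phia.
pose G (z : X * R) := g z * phi z.
have dG z : is_derive z v G (g z * 'D_v phi z + phi z * 'D_v (g : X * R -> R) z).
  have [z0|z0] := ltP 0 z.2.
    apply: (@is_derive_mul R (X * R)%type g phi); apply/derivableP; first exact: (dg z z0).
    exact: smooth_derivable.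
  have za : z.2 < a by exact: le_lt_trans a0.
  rewrite (nbhs_singleton (supported_near0 phia za)) (nbhs_singleton (supported_near0 Da za)).
  rewrite mulr0 mul0r addr0; apply: near0_is_derive.
  by apply: filterS (supported_near0 phia za) => y; rewrite /G => ->; rewrite mulr0.
have DE : 'D_v G = fun z => g z * 'D_v phi z + 'D_v (g : X * R -> R) z * phi z.
  by apply/funext => z; rewrite (@derive_val _ _ _ _ _ _ _ (dG z)) (mulrC (phi z)).
have [r r0 hr] := test_support tphi.
have I1 := cutoff_intg a0 tD Da cg; have I2 := cutoff_intg a0 tphi phia cDg.
have [||||_ ] := @int_derive0 G v r.
- by move=> z; exact: (@ex_derive _ _ _ _ _ _ _ (dG z)).
- exact: cutoff_continuous a0 cphi phia cg.
- rewrite DE => z; apply: cvgD.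
    exact: (cutoff_continuous a0 (smooth_continuous (test_smooth tD)) Da cg).
  exact: (cutoff_continuous a0 cphi phia cDg).
- by move=> z; rewrite /G mulf_eq0 negb_or => /andP[_ /hr].
rewrite DE (RintegralD measurableT I1 I2) => /eqP; rewrite addr_eq0 => /eqP ->.
by rewrite opprK.
Qed.

End space_time_parts.

Lemma continuous_at_sum (R : realType) (V : normedModType R) (I : Type) (r : seq I)
    (F : I -> V -> R) (z : V) : (forall i, {for z, continuous (F i)}) ->
  {for z, continuous (fun y => \sum_(i <- r) F i y)}.
Proof.
move=> cF; elim: r => [|i r IH].
  rewrite (_ : (fun _ => _) = cst 0); first exact: cst_continuous.
  by apply/funext => y; rewrite big_nil.
rewrite (_ : (fun _ => _) = (fun y => F i y + \sum_(j <- r) F j y)); last first.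
  by apply/funext => y; rewrite big_cons.
by apply: cvgD; [exact: cF|exact: IH].
Qed.

Lemma continuous_at_sqr (R : realType) (V : normedModType R) (g : V -> R) (z : V) :
  {for z, continuous g} -> {for z, continuous (fun y => g y ^+ 2)}.
Proof.
move=> cg; rewrite (_ : (fun y => _) = g \* g); last by apply/funext => y; rewrite expr2.
exact: cvgM.
Qed.

Section energy.
Context {R : realType} {n : nat}.
Notation X := 'rV[R]_n.
Notation XT := ('rV[R]_n * measurableTypeR R)%type.
Notation nu := (@space_time_measure R n).
Variables (f : R -> R) (L m : R) (u : XT -> R).
Hypothesis (m1 : 1 < m) (f_lip : forall x y, `|f x - f y| <= L * `|x - y|).
Hypothesis su : solves f m u.

Let ru : regular u. Proof. by case: su. Qed.
Let u0 z : space_time z -> 0 < u z.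
Proof. by move=> z0; case: su => _ h _ _; apply: h; exact: ltW. Qed.
Let m0 : 0 < m. Proof. exact: lt_trans m1. Qed.

Let w (z : XT) := u z `^ (m - 1).
(** Up to the constant (m/(m-1))^2 this is the square of the pressure. *)
Let Q (z : XT) := u z `^ (2 * m - 2).
Let rw : regular w. Proof. exact: regular_powR. Qed.
Let rQ : regular Q. Proof. exact: regular_powR. Qed.

Definition pressure_gradient2 (z : XT) : R :=
  \sum_(i < n) (m / (m - 1) * dx i (fun y => u y `^ (m - 1)) z) ^+ 2.

(** The pressure satisfies p_t = (m-1) p (Lap p + f) + |grad p|^2, and Lap(p^2)/2 = p Lap p + |grad
    p|^2. Eliminating p Lap p leaves (m-2) |grad p|^2 = (m-1)/2 Lap(p^2) + (m-1) p f - p_t, where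
    every derivative on the right stands outside. *)
Lemma energy_identity z : space_time z ->
  (m - 2) * pressure_gradient2 z =
  (m / (m - 1)) ^+ 2 * ((m - 1) / 2) * laplacian Q z +
  (m - 1) * (pressure m (u z) * f (pressure m (u z))) - m / (m - 1) * dt w z.
Proof.
move=> z0; case: su => _ _ _ /(_ z z0) eq; have uz := u0 z0.
pose a := \sum_(i < n) dx i u z ^+ 2; pose b := \sum_(i < n) dx i (dx i u) z.
have lapE r : laplacian (fun y => u y `^ r) z =
    r * ((r - 1) * u z `^ (r - 2) * a + u z `^ (r - 1) * b).
  rewrite /laplacian /a /b mulrDr !mulr_sumr -big_split/=; apply: eq_bigr => i _.
  have d := is_derive_dx_powR ru u0 r i z0.
  rewrite {1}/dx (@derive_val _ _ _ _ _ _ _ d); ring.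
have grE : pressure_gradient2 z = m ^+ 2 * (u z `^ (m - 2)) ^+ 2 * a.
  rewrite /pressure_gradient2 /a mulr_sumr; apply: eq_bigr => i _.
  rewrite (dx_powR ru u0)// (_ : m - 1 - 1 = m - 2); last by ring.
  by field; rewrite subr_eq0 gt_eqF.
rewrite grE (dt_powR ru u0)// eq !lapE /pressure.
set F := f _; move: F => F.
rewrite (_ : m - 1 - 1 = m - 2); last by ring.
rewrite (_ : 2 * m - 2 - 2 = (m - 2) + (m - 2)); last by ring.
rewrite (_ : 2 * m - 2 - 1 = (m - 2) + (m - 1)); last by ring.
have pw r s : u z `^ (r + s) = u z `^ r * u z `^ s.
  by rewrite powRD//; apply/implyP => _; rewrite gt_eqF.
have e1 : u z `^ (m - 1) = u z `^ (m - 2) * u z.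
  rewrite (_ : m - 1 = (m - 2) + 1); last by ring.
  by rewrite pw powRr1// ltW.
rewrite (pw (m - 2) (m - 2)) (pw (m - 2) (m - 1)) e1.
clear lapE grE pw e1 eq; clearbody a b; move: (u z `^ (m - 2)) (u z) => A v.
by field; rewrite subr_eq0 gt_eqF.
Qed.

(** All derivatives on the right of [energy_identity] are moved to the cut-off. What remains
    involves p only through p^2, p f(p) and p, and so is controlled by a bound of p. *)
Lemma energy_balance (phi : X * R -> R) (a : R) : 0 < a -> test_function phi ->
  supported_after a phi ->
  [/\ intg nu (fun z => pressure_gradient2 z * phi z),
   intg nu (fun z => (m - 1) / 2 * pressure m (u z) ^+ 2 * laplacian phi z +
     (m - 1) * (pressure m (u z) * f (pressure m (u z))) * phi z + pressure m (u z) * dt phi z) &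
  (m - 2) * \int[nu]_z (pressure_gradient2 z * phi z) =
  \int[nu]_z ((m - 1) / 2 * pressure m (u z) ^+ 2 * laplacian phi z +
     (m - 1) * (pressure m (u z) * f (pressure m (u z))) * phi z + pressure m (u z) * dt phi z)].
Proof.
move=> a0 tphi phia; pose K := m / (m - 1).
have cQ z : space_time z -> {for z, continuous (Q : X * R -> R)} by move=> /rQ[].
have cw z : space_time z -> {for z, continuous (w : X * R -> R)} by move=> /rw[].
have cp z : space_time z -> {for z, continuous ((fun z => pressure m (u z)) : X * R -> R)}.
  by move=> z0; apply: cvgM; [exact: cvg_cst|exact: cw].
have cf z : space_time z -> {for z, continuous ((fun z => pressure m (u z) * f (pressure m (u z))) : X * R -> R)}.
  move=> z0; apply: cvgM; first exact: (cp z z0).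
  have cf := @lipschitz_bound_continuous R R R L f f_lip (pressure m (u z)).
  exact: (continuous_comp (cp z z0) cf).
have cg z : space_time z -> {for z, continuous (pressure_gradient2 : X * R -> R)}.
  move=> z0; have [_ _ _ hw] := rw z0.
  apply: (@continuous_at_sum R (X * R)%type) => i; have [_ c _ _] := hw i.
  have c2 : {for z, continuous (fun y : X * R => m / (m - 1) * dx i w y)}.
    by apply: cvgM; [exact: cvg_cst|exact: c].
  exact: (@continuous_at_sqr R (X * R)%type _ _ c2).
have Ig := cutoff_intg a0 tphi phia cg.
have If := cutoff_intg a0 tphi phia cf.
have tD v := test_derive v tphi; have aD v := @supported_derive _ _ a phi v phia.
have tDD v := test_derive v (tD v); have aDD v := @supported_derive _ _ a _ v (aD v).
pose e i : X * R := ((delta_mx 0 i : X), (0 : R)); pose et : X * R := ((0 : X), (1 : R)).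
have IQ i : intg nu (fun z => Q z * dx i (dx i phi) z) by exact: (cutoff_intg a0 (tDD (e i)) (aDD (e i)) cQ).
have Iw : intg nu (fun z => w z * dt phi z) by exact: (cutoff_intg a0 (tD et) (aD et) cw).
have cQi i z : space_time z -> {for z, continuous (dx i (dx i Q) : X * R -> R)}.
  by move=> /rQ[_ _ _ /(_ i)[]].
have IQ2 i : intg nu (fun z => dx i (dx i Q) z * phi z) by exact: (cutoff_intg a0 tphi phia (cQi i)).
have ctw z : space_time z -> {for z, continuous (dt w : X * R -> R)} by move=> /rw[].
have Iw2 : intg nu (fun z => dt w z * phi z) by exact: (cutoff_intg a0 tphi phia ctw).
have parts_t : \int[nu]_z (dt w z * phi z) = - \int[nu]_z (w z * dt phi z).
  by apply: (cutoff_derive a0 tphi phia cw) => // z /rw[].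
have parts_x i : \int[nu]_z (dx i (dx i Q) z * phi z) = \int[nu]_z (Q z * dx i (dx i phi) z).
  have c1 z : space_time z -> {for z, continuous (dx i Q : X * R -> R)} by move=> /rQ[_ _ _ /(_ i)[]].
  have d1 z : space_time z -> derivable (dx i Q : X * R -> R) z (e i) by move=> /rQ[_ _ _ /(_ i)[]].
  have d2 z : space_time z -> derivable (Q : X * R -> R) z (e i) by move=> /rQ[_ _ _ /(_ i)[]].
  have h1 : \int[nu]_z (dx i (dx i Q) z * phi z) = - (\int[nu]_z (dx i Q z * dx i phi z)).
    exact: (@cutoff_derive R n a phi (dx i Q) (e i) a0 tphi phia c1 d1 (cQi i)).
  have h2 : \int[nu]_z (dx i Q z * dx i phi z) = - (\int[nu]_z (Q z * dx i (dx i phi) z)).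
    exact: (@cutoff_derive R n a (dx i phi) Q (e i) a0 (tD (e i)) (aD (e i)) cQ d2 c1).
  by rewrite h1 h2 opprK.
have IQs : intg nu (fun z => Q z * laplacian phi z).
  rewrite (_ : (fun z => _) = (fun z => \sum_(i < n) Q z * dx i (dx i phi) z)); first exact: intg_sum.
  by apply/funext => z; rewrite /laplacian mulr_sumr.
have IQ2s : intg nu (fun z => laplacian Q z * phi z).
  rewrite (_ : (fun z => _) = (fun z => \sum_(i < n) dx i (dx i Q) z * phi z)); first exact: intg_sum.
  by apply/funext => z; rewrite /laplacian mulr_suml.
have parts_lap : \int[nu]_z (laplacian Q z * phi z) = \int[nu]_z (Q z * laplacian phi z).
  rewrite (eq_int (fun z => \sum_(i < n) dx i (dx i Q) z * phi z)); last first.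
    by move=> z; rewrite /laplacian mulr_suml.
  rewrite (int_sum _ IQ2) (eq_int (fun z => \sum_(i < n) Q z * dx i (dx i phi) z)); last first.
    by move=> z; rewrite /laplacian mulr_sumr.
  by rewrite (int_sum _ IQ); apply: eq_bigr => i _; exact: parts_x.
have phi_out z : ~ space_time z -> phi z = 0.
  move=> nz; apply/eqP; apply: contrapT => /negP /phia az; apply: nz; exact: lt_le_trans az.
have dphi_out v z : ~ space_time z -> 'D_v phi z = 0.
  move=> nz; apply/eqP; apply: contrapT => /negP /(aD v) az; apply: nz; exact: lt_le_trans az.
have ddphi_out v z : ~ space_time z -> 'D_v ('D_v phi) z = 0.
  move=> nz; apply/eqP; apply: contrapT => /negP /(aDD v) az; apply: nz; exact: lt_le_trans az.
have uQ z : space_time z -> pressure m (u z) ^+ 2 = K ^+ 2 * Q z.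
  move=> z0; rewrite /pressure -/K exprMn; congr (_ * _).
  rewrite expr2 -powRD; first by congr (_ `^ _); ring.
  by apply/implyP => _; rewrite gt_eqF// u0.
pose A := K ^+ 2 * ((m - 1) / 2).
have E z : (m - 1) / 2 * pressure m (u z) ^+ 2 * laplacian phi z +
     (m - 1) * (pressure m (u z) * f (pressure m (u z))) * phi z + pressure m (u z) * dt phi z =
   (A * (Q z * laplacian phi z) + (m - 1) * (pressure m (u z) * f (pressure m (u z)) * phi z)) +
   K * (w z * dt phi z).
  have [z0|z0] := pselect (space_time z).
    by rewrite uQ// /A {3}/pressure -/K -/(w z); ring.
  have l0 : laplacian phi z = 0 by rewrite /laplacian big1// => i _; exact: ddphi_out.
  have t0 : dt phi z = 0 by exact: dphi_out.
  by rewrite l0 t0 phi_out//; ring.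
have J1 := intgZ A IQs; have J2 := intgZ (m - 1) If; have J3 := intgZ K Iw.
split => //.
  by under eq_fun do rewrite E; apply: intgD => //; exact: intgD.
rewrite (eq_int _ E) (RintegralD measurableT (intgD J1 J2) J3) (RintegralD measurableT J1 J2).
rewrite (RintegralZl A measurableT IQs) (RintegralZl (m - 1) measurableT If) (RintegralZl K measurableT Iw).
have -> : \int[nu]_z (w z * dt phi z) = - \int[nu]_z (dt w z * phi z) by rewrite parts_t opprK.
rewrite -parts_lap.
rewrite -(RintegralZl A measurableT IQ2s) -(RintegralZl (m - 1) measurableT If) -(RintegralZl (m - 2) measurableT Ig).
rewrite mulrN -(RintegralZl K measurableT Iw2).
have J1' := intgZ A IQ2s; have J3' := intgZ K Iw2.
rewrite -(RintegralD measurableT J1' J2) -(RintegralB measurableT (intgD J1' J2) J3').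
apply: eq_int => z; have [z0|z0] := pselect (space_time z); last by rewrite phi_out//; ring.
rewrite mulrA energy_identity// /A -/K; ring.
Qed.

End energy.

Lemma energy_arith (R : realType) (m I0 I1 G : R) : 3 <= m -> 0 <= G ->
  I1 - I0 <= m - 2 -> I0 <= (m - 1) * G -> I1 <= (m - 2) * (2 * G + 1).
Proof.
move=> m3 G0 h1 h2; have h3 : (m - 1) * G <= (m - 2) * 2 * G by apply: ler_wpM2r => //; lra.
by rewrite mulrDr mulr1 mulrA; lra.
Qed.

(** * Gradient bound uniform in the exponent *)

Section energy_bound.
Context {R : realType} {n : nat}.
Notation X := 'rV[R]_n.
Notation XT := ('rV[R]_n * measurableTypeR R)%type.
Notation mu := (@lebesgue_rV R n).
Notation nu := (@space_time_measure R n).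
Variables (f : R -> R) (L pM : R).

Definition bounded_solution (m : R) (rho_in : X -> R) (rho : XT -> R) :=
  [/\ [/\ 1 < m, {ae mu, forall x, 0 <= rho_in x}, intg mu rho_in &
     {ae mu, forall x, pressure m (rho_in x) <= pM}], measurable_fun space_time rho,
   {ae nu, forall z, space_time z -> 0 <= rho z} &
   limit_of_smooth_positive_solutions f m rho_in rho].

Definition extension (g : XT -> R) (z : XT) : R := \1_space_time z * g z.

Lemma extensionE g z : space_time z -> extension g z = g z.
Proof. by move=> z0; rewrite /extension indicE mem_set// mul1r. Qed.

Hypothesis (L0 : 0 <= L) (pM0 : 0 < pM) (fpM : f pM <= 0).
Hypothesis f_lip : forall x y, `|f x - f y| <= L * `|x - y|.

Lemma extension_pressure_bound m rho_in rho : bounded_solution m rho_in rho ->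
  {ae nu, forall z, 0 <= pressure m (extension rho z) <= pM}.
Proof.
move=> [[m1 in0 in_L1 in_le] mrho rho0 sol].
have le := solution_le m1 L0 pM0 fpM f_lip in0 in_L1 in_le mrho sol.
apply: filterS2 rho0 le => z h0 h1; rewrite pressure_ge0//=.
have [z0|z0] := pselect (space_time z).
  rewrite extensionE// -[leRHS](densityK m1 (ltW pM0)); apply: pressure_le => //; [exact: h0|exact: h1].
by rewrite /extension indicE memNset// mul0r pressure0// ltW.
Qed.

Lemma ae_subsequence m rho_in rho (j : nat) : bounded_solution m rho_in rho ->
  exists (u : nat -> XT -> R) (M : R), [/\ 0 <= M, forall k, solves f m (u k),
    forall k z, space_time_closed z -> u k z <= M &
    {ae nu, forall z, slab j z -> clamp_time (u k) z.1 z.2 @[k --> \oo] --> extension rho z}].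
Proof.
move=> [[m1 in0 in_L1 in_le] mrho rho0 sol].
have [u [M [cM su uM _ uloc]]] := regularized_solutions m1 pM0 in0 in_L1 in_le sol.
have [I1 c1] := uloc j.
have c2 : \int[nu]_z `|\1_(slab j) z * `|clamp_time (u k) z.1 z.2 - extension rho z| - 0| @[k --> \oo] --> 0.
  rewrite (_ : (fun k => _) = (fun k => \int[nu]_z (\1_(slab j) z * `|clamp_time (u k) z.1 z.2 - extension rho z|))) //.
  by apply/funext => k; apply: eq_int => z; rewrite subr0 ger0_norm// mulr_ge0// indicE.
have [s smono sae] := L1_cvg_ae_subseq I1 (intg0 nu) c2.
exists (fun k => u (s k)), M; split => //.
- by apply: le_trans cM; exact: density_ge0.
- by move=> k z; exact: uM.
- apply: filterS sae => z h zs; apply/cvgrPdist_le => e e0.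
  have := h => /cvgrPdist_le/(_ _ e0); apply: filterS => k.
  by rewrite sub0r normrN indicE mem_set// mul1r normr_id distrC.
Qed.

Lemma test_laplacian_intg (phi : X * R -> R) : test_function phi ->
  intg nu (phi : XT -> R) /\ intg nu (laplacian phi : XT -> R) /\ intg nu (dt phi : XT -> R).
Proof.
have I (g : X * R -> R) : test_function g -> intg nu (g : XT -> R).
  move=> tg; have [r r0 hr] := test_support tg; have [C C0 hC] := test_bounded tg.
  have mg : measurable_fun setT (g : XT -> R).
    by apply: continuous_measurable_space_time; exact: smooth_continuous (test_smooth tg).
  apply: (intg_supp (measurable_st_box r) (st_box_lty r) mg hC) => z nz.
  by apply/eqP; apply: contrapT => /negP /hr /st_boxP.
move=> tphi; split; [exact: I|split]; last exact: (I _ (test_derive _ tphi)).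
by apply: intg_sum => i; exact: (I _ (test_derive _ (test_derive _ tphi))).
Qed.

Definition supported_within (r : R) (phi : X * R -> R) := forall z, phi z != 0 -> `|z| <= r.

Lemma supported_within_derive r phi v :
  supported_within r phi -> supported_within r ('D_v phi).
Proof.
move=> hr z Dz; rewrite leNgt; apply/negP => zr.
have o : open [set y : X * R | r < `|y|].
  apply: (@open_comp _ _ (fun y : X * R => `|y|) [set s | r < s]); last exact: open_gt.
  by move=> y _; exact: norm_continuous.
have n0 : \forall y \near (z : X * R), phi y = 0.
  have := open_nbhs_nbhs (conj o zr); apply: filterS => y /= ya.
  by apply/eqP; apply: contrapT => /negP /hr; rewrite leNgt ya.
have D0 := near0_is_derive v n0.
by move: Dz; rewrite (@derive_val _ _ _ z v phi 0 D0) eqxx.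
Qed.

Lemma slab_mono (i j : nat) : (i <= j)%N -> slab i `<=` (slab j : set XT).
Proof.
move=> ij z [/ball_boxP h1]; rewrite /= in_itv/= => /andP[h2 h3].
have ijR : i.+1%:R <= j.+1%:R :> R by rewrite ler_nat.
split; first by apply/ball_boxP => l; exact: le_trans (h1 l) ijR.
rewrite /= in_itv/= (le_trans h3 ijR) andbT; apply: le_trans h2.
by rewrite lef_pV2 ?posrE.
Qed.

(** The gradient exists for the approximations, but their upper bound M may exceed p_M and vary with
    m. The right side of [energy_balance] involves no gradient and converges to its value for rho,
    where p_M applies; hence a constant independent of m, valid for k beyond a threshold that may
    depend on the solution. *)
Lemma energy_bound (phi : X * R -> R) (a : R) : 0 < a -> test_function phi ->
  (forall z, 0 <= phi z) -> supported_after a phi -> exists C : R, exists j0 : nat,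
  forall m rho_in rho, 3 <= m -> bounded_solution m rho_in rho ->
  forall j, (j0 <= j)%N -> exists (u : nat -> XT -> R) (M : R),
   [/\ 0 <= M, forall k, solves f m (u k), forall k z, space_time_closed z -> u k z <= M,
     {ae nu, forall z, slab j z -> clamp_time (u k) z.1 z.2 @[k --> \oo] --> extension rho z} &
     \forall k \near \oo, intg nu (fun z => pressure_gradient2 m (u k) z * phi z) /\
       \int[nu]_z (pressure_gradient2 m (u k) z * phi z) <= C].
Proof.
move=> a0 tphi phi0 phia.
have [I1 [I2 I3]] := test_laplacian_intg tphi.
pose Fb := `|f 0| + L * pM; have Fb0 : 0 <= Fb by rewrite addr_ge0// mulr_ge0// ltW.
(* The right side of the balance for a pressure below p_M, divided by m - 1; the time derivative
   term does not carry this factor and is simply bounded, as m - 1 >= 1. *)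
pose g (z : XT) := pM ^+ 2 / 2 * `|laplacian phi z| + pM * Fb * `|phi z| + pM * `|dt phi z|.
have Ig : intg nu g.
  by apply: intgD; [apply: intgD|]; apply: intgZ => //; exact: intg_norm.
have [r r0 hr] := test_support tphi.
have [j0 hj0] := @in_slab R n r a r a0.
(* The factor 2 comes from m - 1 <= 2 (m - 2), that is m >= 3; the summand 1 absorbs an error of at
   most m - 2 in the limit over k. *)
exists (2 * \int[nu]_z g z + 1), j0 => m rho_in rho m3 bs j jj0.
have m1 : 1 < m by case: bs => -[].
have m2 : 0 < m - 2 by rewrite subr_gt0 (lt_le_trans _ m3)// ltr_nat.
have m1' : 0 < m - 1 by rewrite subr_gt0.
have [u [M [M0 su uM uae]]] := ae_subsequence j bs.
exists u, M; split => //.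
have bal k := energy_balance m1 f_lip (su k) a0 tphi phia.
pose E (p : R) (z : XT) := (m - 1) / 2 * p ^+ 2 * laplacian phi z + (m - 1) * (p * f p) * phi z + p * dt phi z.
pose P (z : XT) := pressure m (extension rho z).
pose pk k (z : XT) := pressure m (clamp_time (u k) z.1 z.2).
have out psi z : supported_after a psi -> supported_within r psi -> ~ slab j z -> psi z = 0.
  move=> pa pr nz; apply/eqP; apply: contrapT => /negP pz; apply: nz; apply: (slab_mono jj0); apply: hj0.
    exact: le_trans (norm_fst_le z) (pr z pz).
  by rewrite pa//= (le_trans (ler_norm _))// (le_trans (norm_snd_le z))// pr.
have Da v := @supported_derive _ _ a phi v phia; have Dr v := @supported_within_derive r phi v hr.
have out1 z : ~ slab j z -> phi z = 0 by exact: out.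
have out2 z : ~ slab j z -> laplacian phi z = 0.
  move=> nz; rewrite /laplacian big1// => i _; apply: out nz.
    by apply: supported_derive; exact: Da.
  by apply: supported_within_derive; exact: Dr.
have out3 z : ~ slab j z -> dt phi z = 0 by apply: out; [exact: Da|exact: Dr].
have Eout p z : ~ slab j z -> E p z = 0 by move=> nz; rewrite /E out1// out2// out3// !mulr0 !addr0.
have Eb (b B p : R) z : 0 <= p <= b -> `|f p| <= B ->
    `|E p z| <= (m - 1) / 2 * b ^+ 2 * `|laplacian phi z| + (m - 1) * (b * B) * `|phi z| + b * `|dt phi z|.
  move=> /andP[p0 pb] fB; have b0 := le_trans p0 pb.
  apply: le_trans (ler_normD _ _) _; apply: lerD; last first.
    by rewrite normrM ger0_norm//; apply: ler_wpM2r.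
  apply: le_trans (ler_normD _ _) _; apply: lerD.
    rewrite normrM; apply: ler_wpM2r => //.
    rewrite ger0_norm; last by rewrite mulr_ge0 ?divr_ge0 ?exprn_ge0// ltW.
    by apply: ler_wpM2l; [rewrite divr_ge0// ltW|rewrite lerXn2r].
  rewrite normrM; apply: ler_wpM2r => //; rewrite normrM ger0_norm; last exact: ltW.
  by apply: ler_wpM2l; [exact: ltW|rewrite normrM ger0_norm//; apply: ler_pM].
have mL : measurable_fun setT (laplacian phi : XT -> R) by exact: intg_measurable I2.
have mphi : measurable_fun setT (phi : XT -> R) by exact: intg_measurable I1.
have mdt : measurable_fun setT (dt phi : XT -> R) by exact: intg_measurable I3.
have mf := lipschitz_measurable f_lip.
have mE (q : XT -> R) : measurable_fun setT q -> measurable_fun setT (fun z => E (q z) z).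
  move=> mq; apply: measurable_funD; [apply: measurable_funD|exact: measurable_funM].
    apply: measurable_funM => //; apply: measurable_funM => //.
    by apply: measurable_funX.
  apply: measurable_funM => //; apply: measurable_funM => //; apply: measurable_funM => //.
  exact: (measurableT_comp mf mq).
have mpk k : measurable_fun setT (pk k) by apply: measurable_pressure; exact: solves_clamp_measurable (su k).
have mrho : measurable_fun space_time rho by case: bs.
have mP : measurable_fun setT P by apply: measurable_pressure; exact: measurable_extension.
have cb k z : 0 <= clamp_time (u k) z.1 z.2 <= M.
  by have [_ b _] := solves_admissible (su k) (uM k); exact: b.
pose PM := pressure m M.
have pkb k z : 0 <= pk k z <= PM.
  by have /andP[h1 h2] := cb k z; rewrite /pk pressure_ge0//= /PM pressure_le.
have fb (b p : R) : 0 <= p <= b -> `|f p| <= `|f 0| + L * b.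
  move=> /andP[p0 pb]; rewrite -[f p](subrK (f 0)) addrC.
  apply: le_trans (ler_normD _ _) _; rewrite lerD2l.
  apply: le_trans (f_lip _ _) _; apply: ler_wpM2l => //.
  by rewrite subr0 ger0_norm.
have dom k z := Eb PM _ (pk k z) z (pkb k z) (fb _ _ (pkb k z)).
have [||IE _ cE] := @dominated_cvg_int _ _ _ nu (fun k z => E (pk k z) z) (fun z => E (P z) z) _
   (fun k => mE _ (mpk k)) (mE _ mP)
   (intgD (intgD (intgZ ((m - 1) / 2 * PM ^+ 2) (intg_norm I2)) (intgZ ((m - 1) * (PM * (`|f 0| + L * PM))) (intg_norm I1)))
     (intgZ PM (intg_norm I3))).
- apply: filterS uae => z hz; have [zs|zs] := pselect (slab j z); last first.
    rewrite Eout// (_ : (fun k => _) = (fun=> 0)); first exact: cvg_cst.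
    by apply/funext => k; rewrite Eout.
  have c1 : pk k z @[k --> \oo] --> P z.
    apply: cvgM; first exact: cvg_cst.
    by apply: powR_cvg_ge0 => //; [move=> k; have /andP[] := cb k z|exact: hz].
  have cf : f (pk k z) @[k --> \oo] --> f (P z).
    have cf := @lipschitz_bound_continuous R R R L f f_lip (P z).
    exact: (@cvg_comp _ _ _ (fun k => pk k z) f _ _ _ c1 cf).
  have c2 : pk k z ^+ 2 @[k --> \oo] --> P z ^+ 2.
    rewrite expr2 (_ : (fun k => _) = (fun k => pk k z * pk k z)); first exact: cvgM.
    by apply/funext => k; rewrite expr2.
  apply: cvgD; last by apply: cvgM => //; exact: cvg_cst.
  apply: cvgD; (apply: cvgM; last exact: cvg_cst); (apply: cvgM; first exact: cvg_cst) => //.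
  exact: cvgM.
- by apply: aeW => z k; exact: dom.
have le_of_eq (x y : R) : x = y -> x <= y by move=> ->.
have IE2 : \int[nu]_z E (P z) z <= (m - 1) * \int[nu]_z g z.
  rewrite -(RintegralZl _ measurableT Ig); apply: int_le_ae => //; first exact: intgZ.
  apply: filterS (extension_pressure_bound bs) => z Pz.
  apply: le_trans (ler_norm _) _; apply: le_trans (Eb pM Fb _ z Pz (fb _ _ Pz)) _.
  rewrite /g !mulrDr; apply: lerD; first apply: lerD.
  + by apply: le_of_eq; ring.
  + by apply: le_of_eq; ring.
  + apply: ler_peMl; first by apply: mulr_ge0 => //; exact: ltW.
    lra.
have := cE => /cvgrPdist_le/(_ _ m2); apply: filterS => k hk.
have [J1 _ J3] := bal k; split => //.
have EE : (m - 2) * \int[nu]_z (pressure_gradient2 m (u k) z * phi z) = \int[nu]_z E (pk k z) z.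
  rewrite J3; apply: eq_int => z; have [zs|zs] := pselect (slab j z); last first.
    by rewrite Eout// out1// out2// out3// !mulr0 !addr0.
  have z0 := slab_space_time zs; rewrite /E /pk clamp_time_pos//; by case: (z).
rewrite -(ler_pM2l m2) EE; apply: (@energy_arith _ _ (\int[nu]_z E (P z) z)) => //.
  by apply: int_ge0 => z; apply: addr_ge0; [apply: addr_ge0|]; apply: mulr_ge0 => //;
    [rewrite divr_ge0 ?exprn_ge0// ltW|rewrite mulr_ge0// ltW|exact: ltW].
by rewrite distrC in hk; apply: le_trans hk; exact: ler_norm.
Qed.

End energy_bound.

(** * Translation estimates *)

Section translation_estimate.
Context {R : realType} {n : nat}.
Notation X := 'rV[R]_n.
Notation XT := ('rV[R]_n * measurableTypeR R)%type.
Notation mu := (@lebesgue_rV R n).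
Notation nu := (@space_time_measure R n).

Definition cylinder (r a b : R) : set XT := ball_box r `*` `[a, b]%classic.

Lemma measurable_cylinder r a b : measurable (cylinder r a b).
Proof. by apply: measurableX; [exact: measurable_cbox|exact: measurable_itv]. Qed.

Lemma cylinder_lty r a b : (nu (cylinder r a b) < +oo)%E.
Proof.
change ((lebesgue_rV_sf n \x @lebesgue_measure R)%E (cylinder r a b) < +oo)%E.
rewrite product_measure1E; [|exact: measurable_cbox|exact: measurable_itv].
apply: lte_mul_pinfty => //.
- by rewrite ge0_fin_numE//; exact: lebesgue_cbox_lty.
- have h : (lebesgue_measure (`[a, b]%classic : set (measurableTypeR R)) < +oo)%E.
    by rewrite lebesgue_measure_itv/=; case: ifP => _; rewrite ?ltry// -EFinB ltry.
  exact: h.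
Qed.

Lemma intg_cylinder r a b : intg nu \1_(cylinder r a b).
Proof. by apply: intg_indic; [exact: measurable_cylinder|exact: cylinder_lty]. Qed.

Lemma cylinderP r a b (z : XT) : 0 <= r -> cylinder r a b z <-> `|z.1| <= r /\ a <= z.2 <= b.
Proof.
move=> r0; split=> [[h1]|[h1 h2]]; first by rewrite /= in_itv; split => //; exact: norm_ball_box.
by split; [exact: ball_box_norm|rewrite /= in_itv].
Qed.

Lemma intg_indic_bounded (S : set XT) (g : XT -> R) (M : R) : measurable S -> intg nu \1_S ->
  measurable_fun setT g -> (forall z, `|g z| <= M) -> intg nu (fun z => \1_S z * g z).
Proof.
by move=> mS IS mg gM; under eq_fun do rewrite mulrC; exact: (intgM_bounded IS mg gM).
Qed.

(** The translation by v is a chain of k + 1 translations by v/(k+1); translation invariance brings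
    each link back to the same integral over S', which must contain all intermediate points. *)
Lemma translation_telescope (g : XT -> R) (S S' : set XT) (v : X * R) (M : R) (k : nat) :
  measurable_fun setT g -> (forall z, `|g z| <= M) -> measurable S -> intg nu \1_S ->
  measurable S' -> intg nu \1_S' ->
  (forall (z : X * R) (s : R), S z -> 0 <= s <= 1 -> S' (z + s *: v)) ->
  \int[nu]_z (\1_S z * `|g ((z : X * R) + v) - g z|) <=
  k.+1%:R * \int[nu]_z (\1_S' z * `|g ((z : X * R) + k.+1%:R^-1 *: v) - g z|).
Proof.
move=> mg gM mS IS mS' IS' SS'; pose N : R := k.+1%:R.
have N0 : 0 < N by rewrite ltr0n.
have md (c : X * R) : measurable_fun setT (fun z : XT => `|g ((z : X * R) + c) - g z|).
  apply: measurableT_comp => //; apply: measurable_funB => //.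
  exact: (measurableT_comp mg (measurable_st_translate c)).
have db (c : X * R) (z : XT) : `| `|g ((z : X * R) + c) - g z| | <= M + M.
  by rewrite normr_id (le_trans (ler_normB _ _))// lerD.
pose F (z : XT) := \1_S' z * `|g ((z : X * R) + N^-1 *: v) - g z|.
have IF : intg nu F by exact: intg_indic_bounded (db _).
pose Fj (j : 'I_k.+1) (z : XT) := F ((z : X * R) + (j%:R / N) *: v).
have IFj j : intg nu (Fj j) by exact: intg_st_translate.
apply: (@le_trans _ _ (\int[nu]_z (\sum_(j < k.+1) Fj j z))); last first.
  rewrite int_sum// (eq_bigr (fun=> \int[nu]_z F z)); last first.
    by move=> j _; rewrite (int_st_translate _ (intg_measurable IF)).
  by rewrite sumr_const card_ord mulr_natl.
apply: int_le; [exact: intg_indic_bounded (db _)|exact: intg_sum|].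
move=> z; have [zS|zS] := pselect (S z); last first.
  rewrite indicE memNset// mul0r; apply: sumr_ge0 => j _.
  by rewrite /Fj /F mulr_ge0// indicE ler0n.
rewrite indicE mem_set// mul1r.
have FE (j : 'I_k.+1) : Fj j z = `|g ((z : X * R) + (j.+1%:R / N) *: v) - g ((z : X * R) + (j%:R / N) *: v)|.
  rewrite /Fj /F indicE mem_set ?mul1r; last first.
    apply: SS' => //; rewrite divr_ge0//= ?(ltW N0)// ler_pdivrMr// mul1r ler_nat; exact: ltnW.
  by rewrite -addrA -scalerDl -{2}[N^-1]mul1r -mulrDl -natr1.
rewrite (eq_bigr _ (fun j _ => FE j)).
have T : g ((z : X * R) + v) - g z = \sum_(0 <= j < k.+1)
    (g ((z : X * R) + (j.+1%:R / N) *: v) - g ((z : X * R) + (j%:R / N) *: v)).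
  rewrite (telescope_sumr (fun j => g ((z : X * R) + (j%:R / N) *: v)))//.
  by rewrite mulfV ?gt_eqF// scale1r mul0r scale0r addr0.
by rewrite T big_mkord; exact: ler_norm_sum.
Qed.

(** In [translation_telescope] the step tends to 0, and its difference quotients converge boundedly
    on the larger cylinder. This replaces the fundamental theorem of calculus along lines followed
    by Fubini's theorem. The function g is a version of g0 that is bounded and measurable
    everywhere; g0 is differentiable at positive times. *)
Lemma translation_le_derivative (g g0 : XT -> R) (M r a b h : R) (i : 'I_n) :
  measurable_fun setT g -> (forall z, `|g z| <= M) -> 0 < a -> 0 < h -> 0 <= r ->
  (forall z, space_time z -> g z = g0 z) ->
  (forall z, space_time z -> derivable (g0 : X * R -> R) z ((delta_mx 0 i : X), (0 : R))) ->
  (forall z, space_time z -> {for z, continuous (dx i g0 : X * R -> R)}) ->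
  intg nu (fun z => \1_(cylinder (r + h) a b) z * `|dx i g0 z|) /\
  \int[nu]_z (\1_(cylinder r a b) z * `|g ((z : X * R) + ((h *: delta_mx 0 i : X), (0 : R))) - g z|) <=
  h * \int[nu]_z (\1_(cylinder (r + h) a b) z * `|dx i g0 z|).
Proof.
move=> mg gM a0 h0 r0 gg0 dg cg; pose e : X * R := ((delta_mx 0 i : X), (0 : R)).
have rh : 0 <= r + h by rewrite addr_ge0// ltW.
have eE (s : R) : s *: e = ((s *: delta_mx 0 i : X), (0 : R)) by congr pair; rewrite /= scaler0.
have e1 (s : R) : 0 <= s -> `|s *: (delta_mx 0 i : X)| <= s.
  move=> s0; rewrite normrZ ger0_norm//; apply: ler_piMr => //; exact: norm_basis_rV.
pose hk k : R := h / k.+1%:R.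
have hk0 k : 0 < hk k <= h.
  rewrite divr_gt0//= ler_pdivrMr ?ltr0n//; apply: ler_peMr; [exact: ltW|by rewrite ler1n].
have hc : hk k @[k --> \oo] --> 0.
  by rewrite -(mulr0 h); apply: cvgM; [exact: cvg_cst|exact: (@cvg_harmonic R)].
have mS := measurable_cylinder; have IS := intg_cylinder.
have [C hC] := @slab_bounded R n (dx i g0) (r + h + h) a b a0 cg.
have st (z : XT) (s : R) : cylinder (r + h) a b z -> space_time ((z : X * R) + s *: e).
  by move=> /(cylinderP _ _ _ rh)[_ /andP[az _]]; rewrite eE /space_time/= addr0 (lt_le_trans a0).
pose D k (z : XT) := \1_(cylinder (r + h) a b) z * `|(g ((z : X * R) + hk k *: e) - g z) / hk k|.
have Db k z : `|D k z| <= C * \1_(cylinder (r + h) a b) z.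
  have /andP[k0 kh] := hk0 k.
  rewrite /D indicE; have [zS|zS] := boolP (z \in _); last by rewrite mul0r mulr0 normr0.
  move: zS; rewrite inE => zS; rewrite mul1r mulr1 normr_id.
  have := st z 0 zS; rewrite scale0r addr0 => z0.
  rewrite (gg0 _ z0) gg0; last exact: st.
  apply: (@diff_quot_bound R (X * R)%type g0 z e (hk k) C k0) => s /andP[s0 s1].
    by apply: dg; exact: st.
  have /(cylinderP _ _ _ rh)[z1 z2] := zS.
  rewrite eE; apply: (hC (z.1 + s *: delta_mx 0 i) (z.2 + 0)); last by rewrite addr0.
  by rewrite (le_trans (ler_normD _ _))// lerD// (le_trans (e1 _ s0))// (le_trans s1).
have mD k : measurable_fun setT (D k).
  apply: measurable_funM; first by apply: measurable_indic; exact: measurable_cylinder.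
  apply: measurableT_comp => //; apply: measurable_funM; last exact: measurable_cst.
  apply: measurable_funB => //; exact: (measurableT_comp mg (measurable_st_translate _)).
have Dc z : D k z @[k --> \oo] --> \1_(cylinder (r + h) a b) z * `|dx i g0 z|.
  have [zS|zS] := pselect (cylinder (r + h) a b z); last first.
    rewrite (_ : (fun k => _) = (fun=> 0)); last by apply/funext => k; rewrite /D indicE memNset// mul0r.
    by rewrite indicE memNset// mul0r; exact: cvg_cst.
  apply: cvgM; first exact: cvg_cst.
  apply: cvg_norm; have := st z 0 zS; rewrite scale0r addr0 => z0.
  rewrite (_ : (fun k => _) = (fun k => (g0 ((z : X * R) + hk k *: e) - g0 z) / hk k)); last first.
    by apply/funext => k; rewrite (gg0 _ z0) gg0//; exact: st.
  apply: (@diff_quot_cvg R (X * R)%type g0 z e h hk h0 hk0 hc) => s _.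
  by apply: dg; exact: st.
have mlim : measurable_fun setT (fun z : XT => \1_(cylinder (r + h) a b) z * `|dx i g0 z|).
  apply: (@measurable_fun_cvg _ _ R setT D) => // z _; exact: Dc.
have [||IL _ cL] := @dominated_cvg_int _ _ _ nu D _ _ mD mlim (intgZ C (IS (r + h) a b)).
- by apply: aeW.
- by apply: aeW => z k.
split => //.
have c2 : h * \int[nu]_z D k z @[k --> \oo] --> h * \int[nu]_z (\1_(cylinder (r + h) a b) z * `|dx i g0 z|).
  by apply: cvgM; [exact: cvg_cst|exact: cL].
apply: ler_cvg_to (cvg_cst _) c2 _; apply: nearW => k.
have /andP[k0 kh] := hk0 k.
have := @translation_telescope g (cylinder r a b) (cylinder (r + h) a b) (h *: e) M k mg gM
  (mS _ _ _) (IS _ _ _) (mS _ _ _) (IS _ _ _).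
rewrite -eE => /(_ _)/le_trans; apply.
  move=> z s /(cylinderP _ _ _ r0)[z1 z2] /andP[s0 s1]; apply/(cylinderP _ _ _ rh).
  rewrite scalerA eE/= addr0; split => //.
  rewrite (le_trans (ler_normD _ _))// lerD// (le_trans (e1 _ _))//; first by rewrite mulr_ge0// ltW.
  by apply: ler_piMl => //; exact: ltW.
have ID : intg nu (fun z : XT => \1_(cylinder (r + h) a b) z * `|g ((z : X * R) + hk k *: e) - g z|).
  apply: (@intg_indic_bounded _ _ (M + M)) => //.
    apply: measurableT_comp => //; apply: measurable_funB => //.
    exact: (measurableT_comp mg (measurable_st_translate _)).
  by move=> z; rewrite normr_id (le_trans (ler_normB _ _))// lerD.
rewrite scalerA (mulrC (k.+1%:R^-1)) -/(hk k).
have -> : \int[nu]_z D k z = (hk k)^-1 * \int[nu]_z (\1_(cylinder (r + h) a b) z * `|g ((z : X * R) + hk k *: e) - g z|).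
  rewrite -(RintegralZl _ measurableT ID); apply: eq_int => z.
  by rewrite /D normrM (ger0_norm (_ : 0 <= (hk k)^-1)) ?invr_ge0 ?(ltW k0)// mulrA mulrC.
rewrite mulrA (_ : h * (hk k)^-1 = k.+1%:R)//.
by rewrite /hk invf_div mulrCA mulfV ?mulr1// gt_eqF.
Qed.

End translation_estimate.

Lemma near_continuous_at (R : realType) (V : normedModType R) (g h : V -> R) (z : V) :
  (\forall y \near z, g y = h y) -> {for z, continuous g} -> {for z, continuous h}.
Proof.
move=> E cg; have gz : g z = h z := nbhs_singleton E.
have : h @ z --> g z by exact: cvg_trans (near_eq_cvg E) cg.
by rewrite gz.
Qed.

Section space_translation.
Context {R : realType} {n : nat}.
Notation X := 'rV[R]_n.
Notation XT := ('rV[R]_n * measurableTypeR R)%type.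
Notation mu := (@lebesgue_rV R n).
Notation nu := (@space_time_measure R n).
Variables (f : R -> R) (L pM : R).
Hypothesis (L0 : 0 <= L) (pM0 : 0 < pM) (fpM : f pM <= 0).
Hypothesis f_lip : forall x y, `|f x - f y| <= L * `|x - y|.

Lemma ae_st_translate (c : X * R) (P : XT -> Prop) : {ae nu, forall z, P z} ->
  {ae nu, forall z, P ((z : X * R) + c)}.
Proof.
move=> [N [mN N0 hN]]; exists ((fun z : XT => (z : X * R) + c : XT) @^-1` N); split.
- by rewrite -[X in measurable X]setTI; exact: measurable_st_translate.
- by rewrite (@st_translate_mp _ _ c).
- by move=> z /= nP; exact: hN.
Qed.

(** Almost everywhere equal to the pressure, but bounded by p_M at every point, as the compactness
    lemmas require. *)
Definition capped_pressure (m : R) (rho : XT -> R) (z : XT) : R :=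
  Num.min (pressure m (extension rho z)) pM.

Lemma capped_pressureE m rho_in rho : bounded_solution f pM m rho_in rho ->
  {ae nu, forall z, capped_pressure m rho z = pressure m (extension rho z)}.
Proof.
move=> bs; apply: filterS (extension_pressure_bound L0 pM0 fpM f_lip bs) => z /andP[_ h].
by rewrite /capped_pressure min_l.
Qed.

Lemma capped_pressure_bound m rho z : 1 < m -> 0 <= capped_pressure m rho z <= pM.
Proof. by move=> m1; rewrite le_min pressure_ge0// (ltW pM0) ge_min lexx orbT. Qed.

Lemma measurable_capped_pressure m rho : measurable_fun space_time rho ->
  measurable_fun setT (capped_pressure m rho).
Proof.
move=> mrho; apply: measurable_minr; last exact: measurable_cst.
by apply: measurable_pressure; exact: measurable_extension.
Qed.

Lemma cylinder_bump (r a b : R) : 0 <= r -> 0 < a ->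
  exists (phi : X * R -> R) (C : R), [/\ test_function phi, forall z, 0 <= phi z,
    supported_after (a / 2) phi, 0 <= C &
    forall z, cylinder r a b z -> 1 <= C * phi z].
Proof.
move=> r0 a0; pose phi := @space_time_bump R n 1 (const_mx (- (r + 1))) (const_mx (r + 1)) (a / 2) (b + 1).
have tphi : test_function phi by exact: test_space_time_bump.
have phi0 z : 0 <= phi z by rewrite mulr_ge0 ?box_bump_ge0 ?time_bump_ge0.
have pos z : cylinder r a b z -> 0 < phi z.
  move=> /(cylinderP _ _ _ r0)[z1 /andP[z2 z3]]; apply: mulr_gt0.
    apply: box_bump_gt0 => // i; rewrite !mxE.
    have := le_trans (norm_coor z.1 i) z1; rewrite ler_norml => /andP[h1 h2].
    by apply/andP; split; lra.
  by apply: time_bump_gt0 => //; apply/andP; split; lra.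
have cV (z : X * R) : cylinder r a b z -> {for z, continuous (fun z : X * R => (phi z)^-1)}.
  move=> zS; apply: cvgV; first exact: lt0r_neq0 (pos z zS).
  exact: (smooth_continuous (test_smooth tphi)).
have [C hC] := @continuous_on_compact_bounded R (X * R)%type (fun z => (phi z)^-1) (cylinder r a b)
  (compact_setX (@cbox_compact R n _ _) (@segment_compact R a b)) cV.
exists phi, `|C|; split => //.
- move=> z; rewrite /phi /space_time_bump mulf_eq0 negb_or => /andP[_ h].
  by have /andP[/ltW] := time_bump_neq0 ltr01 h.
- move=> z zS; have p0 := pos z zS.
  rewrite -(mulVf (lt0r_neq0 p0)); apply: ler_wpM2r => //.
  apply: le_trans (ler_norm _) _; apply: le_trans (hC z zS) _; exact: ler_norm.
Qed.

(** Translation differences of the approximations are bounded by their gradient, which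
    [energy_bound] controls; being of order zero, they then pass to the limit by dominated
    convergence. The constant C1 bounds the inverse of the cut-off on the cylinder. *)
Lemma space_translation (r a b : R) : 0 <= r -> 0 < a -> exists2 C : R, 0 <= C &
  forall m rho_in rho (i : 'I_n) (h : R), 3 <= m -> bounded_solution f pM m rho_in rho ->
  0 < h <= 1 ->
  \int[nu]_z (\1_(cylinder r a b) z *
    `|capped_pressure m rho ((z : X * R) + ((h *: delta_mx 0 i : X), (0 : R))) - capped_pressure m rho z|) <= h * C.
Proof.
move=> r0 a0; have r1 : 0 <= r + 1 by rewrite addr_ge0.
have [phi [C1 [tphi phi0 phia C10 hC1]]] := @cylinder_bump (r + 1) a b r1 a0.
have a2 : 0 < a / 2 by rewrite divr_gt0.
have [C [j0 hE]] := energy_bound L0 pM0 fpM f_lip a2 tphi phi0 phia.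
have [j1 hj1] := @in_slab R n (r + 1) a b a0.
pose S := cylinder r a b : set XT; pose S1 := cylinder (r + 1) a b : set XT.
have mS : measurable S by exact: measurable_cylinder.
have IS : intg nu \1_S by exact: intg_cylinder.
have mS1 : measurable S1 by exact: measurable_cylinder.
have IS1 : intg nu \1_S1 by exact: intg_cylinder.
exists (fine (nu S1) + C1 * `|C|); first by rewrite addr_ge0 ?fine_ge0 ?mulr_ge0.
move=> m rho_in rho i h m3 bs /andP[h0 h1].
have m1 : 1 < m by case: bs => -[].
have [u [M [M0 su uM uae hnear]]] := hE m rho_in rho m3 bs (maxn j0 j1) (leq_maxl _ _).
pose j := maxn j0 j1; pose c : X * R := ((h *: delta_mx 0 i : X), (0 : R)).
pose pk k (z : XT) := pressure m (clamp_time (u k) z.1 z.2).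
have mpk k : measurable_fun setT (pk k) by apply: measurable_pressure; exact: solves_clamp_measurable (su k).
have cb k z : 0 <= clamp_time (u k) z.1 z.2 <= M.
  by have [_ b0 _] := solves_admissible (su k) (uM k); exact: b0.
pose PM := pressure m M.
have pkb k z : `|pk k z| <= PM.
  by have /andP[h2 h3] := cb k z; rewrite /pk ger0_norm ?pressure_ge0//= /PM pressure_le.
have slabS1 z : S1 z -> slab j z.
  by move=> /(cylinderP _ _ _ r1)[z1 z2]; apply: (slab_mono (leq_maxr _ _)); exact: hj1.
have SS1 z : S z -> S1 z /\ S1 ((z : X * R) + c).
  move=> /(cylinderP _ _ _ r0)[z1 z2]; split; apply/(cylinderP _ _ _ r1); split => //.
  - by rewrite (le_trans z1)// lerDl.
  - rewrite /c/= (le_trans (ler_normD _ _))// lerD//.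
    by rewrite normrZ gtr0_norm// mulr_ile1// ?(ltW h0)//; exact: norm_basis_rV.
  - by rewrite /c/= addr0.
pose P := capped_pressure m rho.
have mrho : measurable_fun space_time rho by case: bs.
have mP : measurable_fun setT P by exact: measurable_capped_pressure.
have pkc : {ae nu, forall z, S1 z -> pk k z @[k --> \oo] --> P z}.
  apply: filterS2 uae (capped_pressureE bs) => z hz PE /slabS1 zs.
  rewrite /P PE; apply: cvgM; first exact: cvg_cst.
  apply: powR_cvg_ge0; [by rewrite subr_gt0|by move=> k; have /andP[] := cb k z|exact: hz].
have [||||_ _ cW] := @dominated_cvg_int _ _ _ nu (fun k z => \1_S z * `|pk k ((z : X * R) + c) - pk k z|)
   (fun z => \1_S z * `|P ((z : X * R) + c) - P z|) _ _ _ (intgZ (PM + PM) IS).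
- move=> k; apply: measurable_funM; first exact: measurable_indic.
  apply: measurableT_comp => //; apply: measurable_funB => //.
  exact: (measurableT_comp (mpk k) (measurable_st_translate _)).
- apply: measurable_funM; first exact: measurable_indic.
  apply: measurableT_comp => //; apply: measurable_funB => //.
  exact: (measurableT_comp mP (measurable_st_translate _)).
- apply: filterS2 pkc (ae_st_translate c pkc) => z hz hzc.
  have [zS|zS] := pselect (S z); last first.
    rewrite indicE memNset// mul0r (_ : (fun k => _) = (fun=> 0)); first exact: cvg_cst.
    by apply/funext => k; rewrite mul0r.
  have [z1 z2] := SS1 z zS.
  apply: cvgM; first exact: cvg_cst.
  by apply: cvg_norm; apply: cvgB; [exact: hzc|exact: hz].
- apply: aeW => z k; rewrite normrM normr_id mulrC ger0_norm; last by rewrite indicE.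
  apply: ler_wpM2r; first by rewrite indicE.
  by rewrite (le_trans (ler_normB _ _))// lerD.
apply: ler_cvg_to cW (cvg_cst (h * (fine (nu S1) + C1 * `|C|))) _.
apply: filterS hnear => k [Igr grC].
pose g0 (z : XT) := pressure m (u k z).
have ru : regular (u k) by case: (su k).
have u0 z : space_time z -> 0 < u k z by move=> z0; case: (su k) => _ h2 _ _; apply: h2; exact: ltW.
pose w (z : XT) := u k z `^ (m - 1).
have rw : regular w by exact: regular_powR.
pose e : X * R := ((delta_mx 0 i : X), (0 : R)).
have dg0 z : space_time z -> is_derive (z : X * R) e (g0 : X * R -> R) (m / (m - 1) * dx i w z).
  move=> z0; apply: (@is_derive_mulc R (X * R)%type w); apply/derivableP.
  by have [_ _ _ /(_ i)[]] := rw z z0.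
have dxg0 z : space_time z -> dx i g0 z = m / (m - 1) * dx i w z.
  by move=> /dg0 d; rewrite /dx (@derive_val _ _ _ _ _ _ _ d).
have cdx z : space_time z -> {for z, continuous (dx i g0 : X * R -> R)}.
  move=> z0; have [_ _ _ /(_ i)[_ c1 _ _]] := rw z z0.
  apply: (@near_continuous_at R (X * R)%type (fun y => m / (m - 1) * dx i w y)).
    by apply: filterS (near_space_time z0) => y y0; rewrite dxg0.
  by apply: cvgM; [exact: cvg_cst|exact: c1].
have gE z : space_time z -> pk k z = g0 z.
  by move=> z0; rewrite /pk /g0 clamp_time_pos//; case: (z).
have ddx z : space_time z -> derivable (g0 : X * R -> R) z e.
  by move=> /dg0 d; exact: (@ex_derive _ _ _ _ _ _ _ d).
have [ID1 W] := @translation_le_derivative R n (pk k) g0 PM r a b h i (mpk k) (pkb k) a0 h0 r0 gE ddx cdx.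
apply: le_trans W _; apply: ler_wpM2l; first exact: ltW.
apply: (@le_trans _ _ (\int[nu]_z (\1_S1 z + C1 * (pressure_gradient2 m (u k) z * phi z)))).
  apply: int_le => //; first by apply: intgD => //; exact: intgZ.
  move=> z; have gr0 : 0 <= pressure_gradient2 m (u k) z by apply: sumr_ge0 => l _; exact: sqr_ge0.
  have pos : 0 <= C1 * (pressure_gradient2 m (u k) z * phi z) by rewrite !mulr_ge0.
  have [zS|zS] := pselect (cylinder (r + h) a b z); last first.
    by rewrite indicE memNset// mul0r addr_ge0// indicE.
  have rh : 0 <= r + h by rewrite addr_ge0// ltW.
  have zS1 : S1 z.
    have /(cylinderP _ _ _ rh)[z1 z2] := zS; apply/(cylinderP _ _ _ r1); split => //.
    by rewrite (le_trans z1)// lerD2l.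
  rewrite !indicE (mem_set zS) (mem_set zS1) mul1r dxg0; last exact: slab_space_time (slabS1 z zS1).
  set d := _ * dx i w z; have d2 : d ^+ 2 <= pressure_gradient2 m (u k) z.
    rewrite /pressure_gradient2 (bigD1 i)//= lerDl; apply: sumr_ge0 => l _; exact: sqr_ge0.
  (* Turns the L2 bound into an L1 bound on a set of finite measure. *)
  have dd : `|d| <= 1 + d ^+ 2.
    rewrite -real_normK ?num_real//; have := sqr_ge0 (`|d| - 1); have := sqr_ge0 `|d|; nra.
  apply: le_trans dd _; rewrite lerD2l; apply: le_trans d2 _.
  by rewrite mulrCA ler_peMr// hC1.
rewrite (RintegralD measurableT IS1 (intgZ C1 Igr)) int_indic// (RintegralZl _ measurableT Igr).
by rewrite lerD2l; apply: ler_wpM2l => //; exact: le_trans (ler_norm C).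
Qed.

End space_translation.

Section general_translation.
Context {R : realType} {n : nat}.
Notation X := 'rV[R]_n.
Notation XT := ('rV[R]_n * measurableTypeR R)%type.
Notation mu := (@lebesgue_rV R n).
Notation nu := (@space_time_measure R n).

Lemma translation_shift_le (g : XT -> R) (S S' : set XT) (c d : X * R) (M : R) :
  measurable_fun setT g -> (forall z, `|g z| <= M) -> measurable S -> intg nu \1_S ->
  measurable S' -> intg nu \1_S' -> (forall z : X * R, S z -> S' (z + d)) ->
  \int[nu]_z (\1_S z * `|g ((z : X * R) + d + c) - g ((z : X * R) + d)|) <=
  \int[nu]_z (\1_S' z * `|g ((z : X * R) + c) - g z|).
Proof.
move=> mg gM mS IS mS' IS' SS'.
have mt (c' : X * R) : measurable_fun setT (fun z : XT => g ((z : X * R) + c')).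
  exact: (measurableT_comp mg (measurable_st_translate c')).
pose F (z : XT) := \1_S' z * `|g ((z : X * R) + c) - g z|.
have b (z z' : XT) : `| `|g z - g z'| | <= M + M.
  by rewrite normr_id (le_trans (ler_normB _ _))// lerD.
have IF : intg nu F.
  apply: (intg_indic_bounded mS' IS' (M := M + M)) => [|z]; last exact: b.
  by apply: measurableT_comp => //; apply: measurable_funB.
rewrite -(int_st_translate d (intg_measurable IF)); apply: int_le.
- apply: (intg_indic_bounded mS IS (M := M + M)) => [|z]; last exact: b.
  apply: measurableT_comp => //; apply: measurable_funB => //.
  rewrite (_ : (fun z => _) = (fun z : XT => g ((z : X * R) + (d + c)))); first exact: mt.
  by apply/funext => z; rewrite addrA.
- exact: intg_st_translate.
- move=> z; rewrite /F; apply: ler_wpM2r => //.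
  have [zS|zS] := pselect (S z); last by rewrite indicE memNset// indicE.
  by rewrite !indicE mem_set// mem_set//; exact: SS'.
Qed.

(** Monotonicity removes the absolute value. The integral is then the difference of the integrals
    over two cylinders shifted by h, and is at most the integral over the layer between b and b +
    h. *)
Lemma time_translation (g : XT -> R) (M r a b h : R) : measurable_fun setT g ->
  (forall z, 0 <= g z <= M) -> 0 <= r -> 0 < a -> 0 < h ->
  {ae nu, forall z, space_time z -> g z <= g ((z : X * R) + ((0 : X), h))} ->
  \int[nu]_z (\1_(cylinder r a b) z * `|g ((z : X * R) + ((0 : X), h)) - g z|) <=
  h * (M * fine (mu (ball_box r))).
Proof.
move=> mg gM r0 a0 h0 mono; pose S := cylinder r a b : set XT.
pose c : X * R := ((0 : X), h); pose T := cylinder r b (b + h) : set XT.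
have M0 : 0 <= M by have /andP[h1 h2] := gM (0, 0); exact: le_trans h2.
have mS : measurable S by exact: measurable_cylinder.
have IS : intg nu \1_S by exact: intg_cylinder.
have mT : measurable T by exact: measurable_cylinder.
have IT : intg nu \1_T by exact: intg_cylinder.
have gb z : `|g z| <= M by have /andP[h1 h2] := gM z; rewrite ger0_norm.
have mt (c' : X * R) : measurable_fun setT (fun z : XT => g ((z : X * R) + c')).
  exact: (measurableT_comp mg (measurable_st_translate c')).
have I1 : intg nu (fun z => \1_S z * g z) by exact: intg_indic_bounded gb.
have I2 : intg nu (fun z => \1_S z * g ((z : X * R) + c)).
  by apply: (intg_indic_bounded mS IS (mt c) (M := M)).
have I3 : intg nu (fun z => \1_S ((z : X * R) - c) * g z).
  have := intg_st_translate (- c) I2; apply: eq_integrable => // z _ /=.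
  by rewrite subrK.
have I4 : intg nu (fun z => \1_T z * g z) by exact: intg_indic_bounded gb.
have E : \int[nu]_z (\1_S z * `|g ((z : X * R) + c) - g z|) =
    \int[nu]_z (\1_S ((z : X * R) - c) * g z) - \int[nu]_z (\1_S z * g z).
  have -> : \int[nu]_z (\1_S ((z : X * R) - c) * g z) = \int[nu]_z (\1_S z * g ((z : X * R) + c)).
    rewrite -[RHS](int_st_translate (- c) (intg_measurable I2)).
    by apply: eq_int => z; rewrite subrK.
  rewrite -(RintegralB measurableT I2 I1); apply: int_eq_ae.
  - apply: measurable_funM; first exact: measurable_indic.
    by apply: measurableT_comp => //; exact: measurable_funB.
  - by apply: measurable_funB; [exact: intg_measurable I2|exact: intg_measurable I1].
  - apply: filterS mono => z hz; rewrite -mulrBr.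
    have [zS|zS] := pselect (S z); last by rewrite indicE memNset// !mul0r.
    rewrite ger0_norm// subr_ge0; apply: hz.
    by have /(cylinderP _ _ _ r0)[_ /andP[h1 _]] := zS; exact: lt_le_trans h1.
rewrite E lerBlDr; apply: (@le_trans _ _ (\int[nu]_z (\1_T z * g z + \1_S z * g z))).
  apply: int_le => //; first exact: intgD.
  move=> z; rewrite -mulrDl; have /andP[g0 _] := gM z; apply: ler_wpM2r => //.
  have [zS|zS] := pselect (S ((z : X * R) - c)); last by rewrite indicE memNset// addr_ge0// indicE.
  rewrite indicE mem_set//; have /(cylinderP _ _ _ r0)[] := zS; rewrite /= subr0 => z1 /andP[z2 z3].
  have [zb|zb] := leP z.2 b.
    rewrite [X in _ <= _ + X]indicE (mem_set (_ : S z)) ?lerDr ?indicE//.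
    by apply/(cylinderP _ _ _ r0); split => //; rewrite zb andbT; lra.
  rewrite [X in _ <= X + _]indicE (mem_set (_ : T z)) ?lerDl ?indicE//.
  by apply/(cylinderP _ _ _ r0); split => //; apply/andP; split; lra.
rewrite (RintegralD measurableT I4 I1) lerD2r.
have volT : fine (nu T) = h * fine (mu (ball_box r)).
  change (fine ((lebesgue_rV_sf n \x @lebesgue_measure R)%E T) = h * fine (mu (ball_box r))).
  rewrite product_measure1E; [|exact: measurable_cbox|exact: measurable_itv].
  have hl : (lebesgue_measure (`[b, (b + h)%R]%classic : set (measurableTypeR R)) = h%:E)%E.
    by rewrite lebesgue_measure_itv/= lte_fin ltrDl h0 -EFinB addrAC subrr add0r.
  rewrite [X in (_ * X)%E]hl fineM//; first by rewrite mulrC.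
  by rewrite ge0_fin_numE//; exact: lebesgue_cbox_lty.
rewrite mulrCA -volT -int_indic// -(RintegralZl _ measurableT IT).
apply: int_le => //; first exact: intgZ.
by move=> z; rewrite mulrC; have /andP[_ gz] := gM z; apply: ler_wpM2r; rewrite ?indicE.
Qed.

Variables (f : R -> R) (L pM : R).
Hypothesis (L0 : 0 <= L) (pM0 : 0 < pM) (fpM : f pM <= 0).
Hypothesis f_lip : forall x y, `|f x - f y| <= L * `|x - y|.

(** The translation is decomposed into one step in time and n steps along the axes, each bounded by
    the previous estimates on a larger cylinder that contains all the intermediate base points. *)
Lemma general_translation (r a b : R) : 0 <= r -> 0 < a -> exists2 C : R, 0 <= C &
  forall m rho_in rho (y : X) (s eps : R), 3 <= m -> bounded_solution f pM m rho_in rho ->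
  (forall h, 0 < h -> {ae nu, forall z, space_time z -> rho z <= rho (z.1, z.2 + h)}) ->
  eps <= 1 -> eps <= a / 2 -> `|y| <= eps -> `|s| <= eps ->
  \int[nu]_z (\1_(cylinder r a b) z *
    `|capped_pressure pM m rho ((z : X * R) + (y, s)) - capped_pressure pM m rho z|) <= eps * C.
Proof.
move=> r0 a0; have r2 : 0 <= r + 2 by rewrite addr_ge0.
have a2 : 0 < a / 2 by rewrite divr_gt0.
have [C C0 hC] := @space_translation R n f L pM L0 pM0 fpM f_lip (r + 2) (a / 2) (b + 1) r2 a2.
pose Ct := pM * fine (mu (ball_box (r + 2))).
have Ct0 : 0 <= Ct by rewrite mulr_ge0 ?fine_ge0// ltW.
exists (Ct + n%:R * C); first by rewrite addr_ge0// mulr_ge0.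
move=> m rho_in rho y s eps m3 bs mono e1 e2 ye se.
have eps0 : 0 <= eps by exact: le_trans ye.
have m1 : 1 < m by case: bs => -[].
pose g := capped_pressure pM m rho.
have gb z : 0 <= g z <= pM by exact: capped_pressure_bound.
have mrho : measurable_fun space_time rho by case: bs.
have mg : measurable_fun setT g by exact: measurable_capped_pressure.
have gM z : `|g z| <= pM by have /andP[h1 h2] := gb z; rewrite ger0_norm.
pose S := cylinder r a b : set XT; pose B := cylinder (r + 2) (a / 2) (b + 1) : set XT.
have mS : measurable S by exact: measurable_cylinder.
have IS : intg nu \1_S by exact: intg_cylinder.
have mB : measurable B by exact: measurable_cylinder.
have IB : intg nu \1_B by exact: intg_cylinder.
have inB (z : X * R) (y' : X) (s' : R) : S z -> `|y'| <= 2 -> `|s'| <= eps -> B (z + (y', s')).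
  move=> /(cylinderP _ _ _ r0)[z1 /andP[z2 z3]] h1 h2; apply/(cylinderP _ _ _ r2); split.
    by rewrite /= (le_trans (ler_normD _ _))// lerD.
  by move: h2; rewrite ler_norml => /andP[h3 h4]; rewrite /=; apply/andP; split; lra.
(* A negative step is a positive step seen from its end point; [translation_shift_le] moves the base
   point at the price of passing from S to B. *)
have signed (e : X * R) (K h : R) (d : X * R) : 0 <= K ->
    (forall h', 0 < h' <= 1 -> h' <= `|h| -> \int[nu]_z (\1_B z * `|g ((z : X * R) + h' *: e) - g z|) <= h' * K) ->
    `|h| <= 1 -> (forall z : X * R, S z -> B (z + d)) -> (forall z : X * R, S z -> B (z + (d + h *: e))) ->
    \int[nu]_z (\1_S z * `|g ((z : X * R) + d + h *: e) - g ((z : X * R) + d)|) <= `|h| * K.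
  move=> K0 hK h1 Bd Bdh; have [h0|h0|->] := ltgtP h 0; last first.
  - rewrite scale0r normr0 mul0r (eq_int (fun=> 0)); last by move=> z; rewrite addr0 subrr normr0 mulr0.
    by rewrite /Rintegral (integral0 nu setT).
  - apply: le_trans (translation_shift_le _ mg gM mS IS mB IB Bd) _.
    by rewrite gtr0_norm//; apply: hK; rewrite ?h0//= gtr0_norm// in h1 *.
  - have hh : 0 < - h by rewrite oppr_gt0.
    have := translation_shift_le ((- h) *: e) mg gM mS IS mB IB Bdh.
    have -> : \int[nu]_z (\1_S z * `|g ((z : X * R) + (d + h *: e) + - h *: e) - g ((z : X * R) + (d + h *: e))|) =
        \int[nu]_z (\1_S z * `|g ((z : X * R) + d + h *: e) - g ((z : X * R) + d)|).
      by apply: eq_int => z; rewrite scaleNr !addrA addrK distrC.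
    move=> /le_trans; apply; rewrite ltr0_norm//; apply: hK; rewrite ?hh//= ltr0_norm// in h1 *.
(* Corners of the path: the first l coordinates of y have already been moved. *)
pose yl (l : nat) : X := \row_i (if (i < l)%N then y 0 i else 0).
have yl0 : yl 0%N = 0 by apply/rowP => i; rewrite !mxE.
have yln : yl n = y by apply/rowP => i; rewrite !mxE ltn_ord.
have ylS (i : 'I_n) : yl i.+1 = yl i + y 0 i *: delta_mx 0 i.
  apply/rowP => i'; rewrite !mxE/= ltnS leq_eqVlt.
  have [->|ni] := eqVneq i' i; first by rewrite eqxx/= ltnn add0r mulr1.
  by rewrite (_ : (i' == i :> nat) = false) ?mulr0 ?addr0//; apply/negbTE.
have yle l : `|yl l| <= eps.
  apply: norm_ball_box => //; apply/ball_boxP => i; rewrite !mxE; case: ifP => _; rewrite ?normr0//.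
  exact: le_trans (norm_coor y i) ye.
have mt (c' : X * R) : measurable_fun setT (fun z : XT => g ((z : X * R) + c')).
  exact: (measurableT_comp mg (measurable_st_translate c')).
have Ib (c c' : X * R) : intg nu (fun z => \1_S z * `|g ((z : X * R) + c) - g ((z : X * R) + c')|).
  apply: (intg_indic_bounded mS IS (M := pM + pM)) => [|z].
    by apply: measurableT_comp => //; exact: measurable_funB.
  by rewrite normr_id (le_trans (ler_normB _ _))// lerD.
have time : \int[nu]_z (\1_S z * `|g ((z : X * R) + (yl 0%N, s)) - g z|) <= eps * Ct.
  pose e : X * R := ((0 : X), (1 : R)).
  have eE h : h *: e = ((0 : X), h) by congr pair; rewrite /= ?scaler0// /GRing.scale/= mulr1.
  apply: le_trans (_ : `|s| * Ct <= _); last exact: ler_wpM2r.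
  have := signed e Ct s 0 Ct0.
  rewrite (eq_int (fun z => \1_S z * `|g ((z : X * R) + (yl 0%N, s)) - g z|)); last first.
    by move=> z; rewrite !addr0 eE yl0.
  apply => [h' /andP[h0 h1] hs| | |].
  - rewrite eE; apply: time_translation => //.
    have PE := capped_pressureE L0 pM0 fpM f_lip bs.
    have rho0 : {ae nu, forall z, space_time z -> 0 <= rho z} by case: bs.
    apply: filterS2 (filterI PE (ae_st_translate ((0 : X), h') PE)) (filterI (mono h' h0) rho0).
    move=> z [P1 P2] [hm hr] z0; rewrite /g P1 P2.
    have z0' : space_time ((z : X * R) + ((0 : X), h') : XT).
      by rewrite /space_time/= addr_gt0.
    rewrite !extensionE//; apply: pressure_le => //; first exact: hr.
    have := hm z0; rewrite (_ : (z.1, z.2 + h') = (z : X * R) + ((0 : X), h'))//.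
    by congr pair; rewrite /= addr0.
  - exact: le_trans e1.
  - by move=> z zS; rewrite -[0]/((0 : X), (0 : R)); apply: inB; rewrite ?normr0.
  - by move=> z zS; rewrite add0r eE; apply: inB; rewrite ?normr0.
have space (i : 'I_n) : \int[nu]_z (\1_S z * `|g ((z : X * R) + (yl i.+1, s)) - g ((z : X * R) + (yl i, s))|) <= eps * C.
  pose e : X * R := ((delta_mx 0 i : X), (0 : R)).
  have eE h : h *: e = ((h *: delta_mx 0 i : X), (0 : R)) by congr pair; rewrite /= scaler0.
  have dE : (yl i, s) + y 0 i *: e = (yl i.+1, s) :> X * R by rewrite eE ylS; congr pair; rewrite /= addr0.
  have yi : `|y 0 i| <= eps by exact: le_trans (norm_coor y i) ye.
  apply: le_trans (_ : `|y 0 i| * C <= _); last exact: ler_wpM2r.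
  have := signed e C (y 0 i) (yl i, s) C0.
  rewrite (eq_int (fun z => \1_S z * `|g ((z : X * R) + (yl i.+1, s)) - g ((z : X * R) + (yl i, s))|)); last first.
    by move=> z; rewrite -addrA dE.
  apply => [h' h01 hs| | |].
  - by rewrite eE; exact: (hC m rho_in rho i h' m3 bs h01).
  - exact: le_trans e1.
  - by move=> z zS; apply: inB => //; rewrite (le_trans (yle _))// (le_trans e1)// ler1n.
  - by move=> z zS; rewrite dE; apply: inB => //; rewrite (le_trans (yle _))// (le_trans e1)// ler1n.
have tele z : g ((z : X * R) + (y, s)) - g z = (g ((z : X * R) + (yl 0%N, s)) - g z) +
    \sum_(i < n) (g ((z : X * R) + (yl i.+1, s)) - g ((z : X * R) + (yl i, s))).
  have T : \sum_(0 <= i < n) (g ((z : X * R) + (yl i.+1, s)) - g ((z : X * R) + (yl i, s))) =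
      g ((z : X * R) + (y, s)) - g ((z : X * R) + (yl 0%N, s)).
    by rewrite (telescope_sumr (fun i => g ((z : X * R) + (yl i, s))))// yln.
  by rewrite big_mkord in T; rewrite T [RHS]addrC [RHS]addrA subrK.
have I0 : intg nu (fun z => \1_S z * `|g ((z : X * R) + (yl 0%N, s)) - g z|).
  have := Ib (yl 0%N, s) 0; apply: eq_integrable => // z _ /=.
  by rewrite addr0.
have Isum : intg nu (fun z => \sum_(i < n) \1_S z * `|g ((z : X * R) + (yl i.+1, s)) - g ((z : X * R) + (yl i, s))|).
  by apply: intg_sum => i; exact: Ib.
apply: (@le_trans _ _ (\int[nu]_z (\1_S z * `|g ((z : X * R) + (yl 0%N, s)) - g z| +
    \sum_(i < n) \1_S z * `|g ((z : X * R) + (yl i.+1, s)) - g ((z : X * R) + (yl i, s))|))).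
  apply: int_le; [|exact: intgD|].
    have := Ib (y, s) 0; apply: eq_integrable => // z _ /=.
    by rewrite addr0.
  move=> z; rewrite tele -mulr_sumr -mulrDr; apply: ler_wpM2l; first by rewrite indicE.
  by apply: le_trans (ler_normD _ _) _; rewrite lerD2l; exact: ler_norm_sum.
rewrite (RintegralD measurableT I0 Isum) int_sum// mulrDr; apply: lerD => //.
apply: le_trans (ler_sum _ (fun i _ => space i)) _.
by rewrite sumr_const card_ord mulrCA mulr_natl.
Qed.

End general_translation.

(** * Weak and strong compactness *)

Section L1_dual.
Context {R : realType} {n : nat}.
Notation X := 'rV[R]_n.
Notation mu := (@lebesgue_rV R n).
Variables (T : (X -> R) -> R) (M : R).
Hypothesis M0 : 0 <= M.
Hypothesis TD : forall f g, intg mu f -> intg mu g -> T (fun x => f x + g x) = T f + T g.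
Hypothesis TZ : forall c f, intg mu f -> T (fun x => c * f x) = c * T f.
Hypothesis T_ge0 : forall f, intg mu f -> (forall x, 0 <= f x) -> 0 <= T f.
Hypothesis T_bound : forall f, intg mu f -> `|T f| <= M * \int[mu]_x `|f x|.

Let B (j : nat) : set X := ball_box j%:R.

Let mB j : measurable (B j). Proof. exact: measurable_cbox. Qed.

Let IAB j A : measurable A -> intg mu \1_(A `&` B j).
Proof.
move=> mA; apply: intg_indic; first exact: measurableI.
exact: lebesgue_setI_cbox_lty.
Qed.

Let IB j : intg mu \1_(B j). Proof. exact: intg_indic_cbox. Qed.

Let T0 : T (fun=> 0) = 0.
Proof.
rewrite -[RHS](mul0r (T (fun=> 0))) -(TZ 0 (intg0 mu)); congr T.
by apply/funext => x; rewrite mul0r.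
Qed.

Let TB f g : intg mu f -> intg mu g -> T (fun x => f x - g x) = T f - T g.
Proof.
move=> If Ig; have IN : intg mu (fun x => -1 * g x) by exact: intgZ.
rewrite -[- T g]mulN1r -(TZ _ Ig) -(TD If IN); congr T.
by apply/funext => x; rewrite mulN1r.
Qed.

(** A positive bounded functional on L1, evaluated on indicators within one box, is a finite
    measure; the value 0 on non-measurable sets only makes the function total. *)
Definition local_measure (j : nat) (A : set X) : \bar R :=
  if pselect (measurable A) then (T (\1_(A `&` B j)))%:E else 0%E.

Let lmE j A : measurable A -> local_measure j A = (T (\1_(A `&` B j)))%:E.
Proof. by move=> mA; rewrite /local_measure; case: pselect. Qed.

Let lm0 j : local_measure j set0 = 0%E.
Proof.
rewrite lmE// set0I (_ : \1_set0 = fun=> 0) ?T0//.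
by apply/funext => x; rewrite indicE in_set0.
Qed.

Let lm_ge0 j A : (0 <= local_measure j A)%E.
Proof.
rewrite /local_measure; case: pselect => // mA; rewrite lee_fin; apply: T_ge0; first exact: IAB.
by move=> x; rewrite indicE.
Qed.

Let lm_sigma j : semi_sigma_additive (local_measure j).
Proof.
move=> F mF tF mUF; rewrite (lmE _ mUF).
pose S k := \bigcup_(i < k) F i.
have mS k : measurable (S k) by exact: bigcup_measurable.
have E k : (\sum_(0 <= i < k) local_measure j (F i))%E = (T (\1_(S k `&` B j)))%:E.
  elim: k => [|k IH].
    rewrite big_geq// (_ : S 0%N = set0); last by rewrite /S bigcup0// => i.
    by rewrite -(lmE j measurable0) lm0.
  rewrite big_nat_recr//= IH (lmE _ (mF k)) -EFinD -TD; [|exact: IAB..].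
  congr (T _)%:E; apply/funext => x; rewrite !indicE !in_setI -natrD; congr (_%:R).
  have SU : S k.+1 = S k `|` F k by rewrite /S bigcup_mkord big_ord_recr/= -bigcup_mkord.
  rewrite SU in_setU; case: (x \in B j); rewrite ?andbF ?andbT//.
  have [xS|xS] := boolP (x \in S k); have [xF|xF] := boolP (x \in F k) => //.
  move: xS xF; rewrite !inE => -[i/= ik Fi] Fk.
  by move: (tF i k I I); rewrite /=; move=> /(_ (ex_intro _ x (conj Fi Fk))) ik2; move: ik; rewrite ik2 ltnn.
rewrite (_ : (fun k => _) = (fun k => (T (\1_(S k `&` B j)))%:E)); last exact/funext.
apply: cvg_EFin; first exact: nearW.
have US : \bigcup_k F k = \bigcup_k S k.
  apply/seteqP; split => x [i _ Fi]; last by have [l _ Fl] := Fi; exists l.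
  by exists i.+1 => //; exists i => /=.
have ndS : nondecreasing_seq S.
  move=> k l kl; apply/subsetPset => x [i/= ik Fi]; exists i => //=; exact: leq_trans kl.
have [||||_ c _] := @dominated_cvg_int _ _ _ mu (fun k => \1_(S k `&` B j)) (\1_(\bigcup_k F k `&` B j)) _ _ _ (IB j).
- by move=> k; apply: measurable_indic; exact: measurableI.
- by apply: measurable_indic; exact: measurableI.
- apply: aeW => x; rewrite US.
  have := @cvg_indic_nondecreasing R X S x ndS => c0.
  have E1 (A : set X) : (\1_(A `&` B j) x : R) = \1_A x * \1_(B j) x.
    by rewrite !indicE in_setI -natrM mulnb.
  rewrite E1 (_ : (fun k => _) = (fun k => \1_(S k) x * \1_(B j) x)); last exact/funext.
  by apply: cvgM => //; exact: cvg_cst.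
- apply: aeW => x k; rewrite ger0_norm ?indicE// in_setI.
  by rewrite ler_nat; case: (_ \in _); case: (_ \in _).
apply/cvgrPdist_le => e e0.
have c1 : M * \int[mu]_x `|\1_(S k `&` B j) x - \1_(\bigcup_k F k `&` B j) x| @[k --> \oo] --> 0.
  by rewrite -(mulr0 M); apply: cvgM => //; exact: cvg_cst.
have := c1 => /cvgrPdist_le/(_ _ e0); apply: filterS => k /=; rewrite sub0r normrN => /(le_trans (ler_norm _)) h.
rewrite distrC -TB; [|exact: IAB..].
apply: le_trans (T_bound _) h; apply: intgB; exact: IAB.
Qed.

HB.instance Definition _ j := isMeasure.Build _ _ _ (local_measure j)
  (lm0 j) (lm_ge0 j) (@lm_sigma j).

Let lm_fin j : fin_num_fun (local_measure j).
Proof. by move=> A mA; rewrite lmE. Qed.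

HB.instance Definition _ j := Measure_isFinite.Build _ _ _ (local_measure j) (@lm_fin j).

Lemma local_density j : exists h : X -> R, [/\ measurable_fun setT h,
  forall x, 0 <= h x <= M & forall A, measurable A -> T \1_(A `&` B j) = \int[mu]_x (\1_A x * h x)].
Proof.
have dom : local_measure j `<< lebesgue_rV_sf n.
  apply/null_content_dominatesP => A mA A0; rewrite lmE//; congr EFin; apply/eqP.
  rewrite -normr_le0 (le_trans (T_bound (IAB j mA)))//.
  rewrite (eq_int (\1_(A `&` B j))); last by move=> x; rewrite ger0_norm ?indicE.
  rewrite int_indic; last exact: measurableI.
  rewrite (_ : mu (A `&` B j) = 0%E) ?mulr0//; apply/eqP; rewrite eq_le measure_ge0 andbT.
  by rewrite -[leRHS]A0; apply: le_measure; rewrite ?inE//; exact: measurableI.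
have [k [k0 kfin Ik kE]] := radon_nikodym_sigma_finite dom.
pose k' x := fine (k x).
have kk' : k = EFin \o k' by apply/funext => x; rewrite /= /k' fineK.
have Ik' : intg mu k' by rewrite /intg -kk'.
have mk' := intg_measurable Ik'.
have k'0 x : 0 <= k' x by apply: fine_ge0; exact: k0.
have TE A : measurable A -> T \1_(A `&` B j) = \int[mu]_x (\1_A x * k' x).
  move=> mA; rewrite -int_indicE; have h : (T \1_(A `&` B j))%:E = (\int[mu]_(x in A) (k' x)%:E)%E.
    by rewrite -(lmE j mA); have := kE A mA; rewrite kk'.
  by rewrite /Rintegral -h.
(* On the set where the density exceeds M, [T_bound] forces the density to be almost everywhere at
   most M; hence this set is null and capping at M changes nothing. *)
pose A' : set X := [set x | M < k' x].
have mA' : measurable A'.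
  rewrite (_ : A' = setT `&` k' @^-1` `]M, +oo[); first exact: mk'.
  by rewrite setTI; apply/seteqP; split => x /=; rewrite in_itv/= andbT.
have IA'k : intg mu (fun x => \1_A' x * k' x).
  apply: (@intg_dom _ _ _ _ k') => //; first by apply: measurable_funM => //; exact: measurable_indic.
  move=> x; rewrite indicE; case: (_ \in _); rewrite ?mul1r ?mul0r ?normr0//.
  by rewrite ger0_norm.
have IA'B := IAB j mA'; have IMB := intgZ M IA'B.
have kM : {ae mu, forall x, \1_A' x * k' x - M * \1_(A' `&` B j) x = 0}.
  have pos x : 0 <= \1_A' x * k' x - M * \1_(A' `&` B j) x.
    rewrite !indicE in_setI; have [xA|xA] := boolP (x \in A'); last by rewrite mul0r mulr0 subrr.
    rewrite mul1r subr_ge0; move: xA; rewrite inE => /ltW; apply: le_trans.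
    by rewrite ler_piMr// lern1; case: (_ \in _).
  apply: int_norm0_ae; first exact: intgB.
  rewrite (eq_int (fun x => \1_A' x * k' x - M * \1_(A' `&` B j) x)); last by move=> x; rewrite ger0_norm.
  apply/eqP; rewrite eq_le int_ge0// andbT (RintegralB measurableT IA'k IMB) subr_le0 -TE//.
  apply: le_trans (ler_norm _) _; apply: le_trans (T_bound IA'B) _.
  rewrite (RintegralZl _ measurableT IA'B); apply: ler_wpM2l => //.
  by apply: int_le => //; [exact: intg_norm|move=> x; rewrite ger0_norm ?indicE].
exists (fun x => Num.min (k' x) M); split.
- by apply: measurable_minr => //; exact: measurable_cst.
- by move=> x; rewrite le_min k'0 M0 ge_min lexx orbT.
- move=> A mA; rewrite (TE A mA); apply: int_eq_ae.
  + by apply: measurable_funM => //; exact: measurable_indic.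
  + apply: measurable_funM; first exact: measurable_indic.
    by apply: measurable_minr => //; exact: measurable_cst.
  + apply: filterS kM => x hx; congr (_ * _); rewrite min_l// leNgt; apply/negP => Mk.
    have xA : x \in A' by rewrite inE.
    move: hx; rewrite !indicE in_setI xA mul1r => /eqP; rewrite subr_eq0 => /eqP kx.
    by move: Mk; rewrite kx ltNge ler_piMr// lern1; case: (_ \in _).
Qed.

(* Radon-Nikodym on bounded boxes; the densities are then glued. *)
Lemma L1_dual_density : exists h : X -> R, [/\ measurable_fun setT h,
  forall x, 0 <= h x <= M & forall psi, intg mu psi -> T psi = \int[mu]_x (psi x * h x)].
Proof.
have [hj hjP] := choice local_density.
pose E := seqDU B.
have ndB : nondecreasing_seq B.
  move=> i j ij; apply/subsetPset => x /ball_boxP xi; apply/ball_boxP => l.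
  by apply: (le_trans (xi l)); rewrite ler_nat.
have mE j : measurable (E j).
  by apply: measurableD => //; exact: bigsetU_measurable.
have UE : \bigcup_j E j = setT by rewrite -seqDU_bigcup_eq bigcup_ball_box.
have tE : trivIset setT E by exact: trivIset_seqDU.
have exE x : exists j, E j x by have : setT x by []; rewrite -UE => -[j _]; exists j.
have [J JP] := choice exE.
pose h x := hj (J x) x.
have hE j x : E j x -> h x = hj j x.
  move=> xj; rewrite /h (_ : J x = j)//.
  by apply: (tE _ _ I I); exists x; split => //; exact: JP.
have mh : measurable_fun setT h.
  rewrite -UE; apply/measurable_fun_bigcup => // j.
  apply: (eq_measurable_fun (hj j)); first by move=> x; rewrite inE => /hE.
  by have [m1 _ _] := hjP j; exact: measurable_funTS.
have hb x : 0 <= h x <= M by have [_ b _] := hjP (J x); exact: b.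
have hn x : `|h x| <= M by have /andP[h0 h1] := hb x; rewrite ger0_norm.
have I1 f : intg mu f -> intg mu (fun x => f x * h x).
  by move=> If; under eq_fun do rewrite mulrC; exact: (intgM_bounded If mh hn).
exists h; split => //; apply: L1_induction.
- move=> a b.
  have [K hK] : exists K : nat, cbox a b `<=` B K.
    have [r r0 hr] : exists2 r : R, 0 < r & forall x, cbox a b x -> `|x| <= r.
      exists (`|a| + `|b| + 1); first by rewrite ltr_wpDl// addr_ge0.
      move=> x xab; apply: norm_ball_box; first by rewrite !addr_ge0.
      apply/ball_boxP => i; have /andP[h1 h2] := xab i.
      have := norm_coor a i; have := norm_coor b i; have := normr_ge0 a; have := normr_ge0 b.
      rewrite !ler_norml => b0 a0 /andP[h3 h4] /andP[h5 h6]; apply/andP; split; lra.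
    exists `|Num.ceil r|%N => x /hr xr; apply: ball_box_norm; apply: (le_trans xr).
    by rewrite natr_absz (le_trans (ceil_ge _))// ler_int ler_norm.
  set A := cbox a b; have mA : measurable A by exact: measurable_cbox.
  (* A bounded box meets finitely many of the disjoint shells E, so that finite additivity of T
     suffices for the gluing. *)
  have AE x : \1_A x = \sum_(j < K.+1) \1_(A `&` E j `&` B j) x :> R.
    have UK : \bigcup_(j < K.+1) E j = B K.
      rewrite bigcup_mkord -bigsetU_seqDU; apply/seteqP; split => y.
        rewrite -bigcup_mkord => -[j/= jK]; have /subsetPset := ndB j K jK; exact.
      by rewrite -bigcup_mkord => yK; exists K => /=.
    have EB j : E j `<=` B j by exact: subDsetl.
    have [xA|xA] := pselect (A x); last first.
      rewrite indicE memNset// big1// => j _; rewrite indicE memNset//.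
      by move=> [[]].
    rewrite indicE mem_set//; have := hK x xA; rewrite -UK => -[j/= jK xj].
    rewrite (bigD1 (Ordinal jK))//= indicE mem_set; last by split => //; exact: EB.
    rewrite big1 ?addr0// => i ij; rewrite indicE memNset// => -[[_ xi] _].
    move: ij; rewrite -val_eqE/=; apply/negP; rewrite negbK; apply/eqP.
    by apply: (tE _ _ I I); exists x.
  have Ij j : intg mu \1_(A `&` E j `&` B j) by apply: IAB; exact: measurableI.
  have Tsum (r : seq nat) : T (fun x => \sum_(j <- r) \1_(A `&` E j `&` B j) x) =
      \sum_(j <- r) T \1_(A `&` E j `&` B j).
    elim: r => [|j r IH].
      by rewrite big_nil -[RHS]T0; congr T; apply/funext => x; rewrite big_nil.
    rewrite big_cons -IH -TD//; last exact: intg_sum.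
    by congr T; apply/funext => x; rewrite big_cons.
  have -> : (\1_A : X -> R) = (fun x => \sum_(j <- index_iota 0 K.+1) \1_(A `&` E j `&` B j) x).
    by apply/funext => x; rewrite AE big_mkord.
  rewrite Tsum (eq_int (fun x => \sum_(j <- index_iota 0 K.+1) \1_(A `&` E j `&` B j) x * h x)); last first.
    by move=> x; rewrite mulr_suml.
  rewrite int_sum; last by move=> j; exact: I1.
  apply: eq_bigr => j _; have [_ _ ->] := hjP j; last exact: measurableI.
  apply: eq_int => x; have [xj|xj] := pselect ((A `&` E j) x); last first.
    by rewrite !indicE in_setI (memNset xj)/= !mul0r.
  have xB : B j x by case: xj => _; exact: subDsetl.
  by rewrite !indicE in_setI (mem_set xj) (mem_set xB)/= (hE j)//; case: xj.
- move=> f g If Ig Pf Pg; rewrite TD// Pf Pg -(RintegralD measurableT (I1 f If) (I1 g Ig)).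
  by apply: eq_int => x; rewrite mulrDl.
- move=> c f If Pf; rewrite TZ// Pf -(RintegralZl _ measurableT (I1 f If)).
  by apply: eq_int => x; rewrite mulrA.
- move=> f If H; apply/eqP; rewrite -subr_eq0 -normr_le0; apply/ler_addgt0Pl => e e0; rewrite addr0.
  have e1 : 0 < e / (2 * M + 1) by rewrite divr_gt0// ltr_wpDl// mulr_ge0.
  have [g [Ig Pg fg]] := H _ e1.
  have IN := intg_norm (intgB If Ig).
  have h1 : `|T f - T g| <= M * \int[mu]_x `|f x - g x|.
    by rewrite -TB//; apply: T_bound; exact: intgB.
  have h2 : `|\int[mu]_x (f x * h x) - \int[mu]_x (g x * h x)| <= M * \int[mu]_x `|f x - g x|.
    rewrite -(RintegralB measurableT (I1 f If) (I1 g Ig)) -(RintegralZl _ measurableT IN).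
    have IB2 := intgB (I1 f If) (I1 g Ig).
    apply: le_trans (int_norm_le IB2) _; apply: int_le; [exact: intg_norm|exact: intgZ|].
    by move=> x; rewrite -mulrBl normrM mulrC; apply: ler_wpM2r.
  have h3 : M * \int[mu]_x `|f x - g x| <= M * (e / (2 * M + 1)) by apply: ler_wpM2l => //; exact: ltW.
  have h4 : 2 * M * (e / (2 * M + 1)) <= e.
    rewrite mulrA ler_pdivrMr; last by rewrite ltr_wpDl// mulr_ge0.
    by rewrite mulrC ler_wpM2l ?(ltW e0)// lerDl.
  rewrite (_ : T f - _ = (T f - T g) + (\int[mu]_x (g x * h x) - \int[mu]_x (f x * h x))); last by rewrite Pg; ring.
  apply: le_trans (ler_normD _ _) _; rewrite [X in _ + X]distrC.
  by move: h1 h2 h3 h4; move: (`|_|) (`|_|) (\int[mu]_x _) => A1 A2 A3; lra.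
Qed.

End L1_dual.

Section ultra_limits.
Context {R : realType}.
Variables (U : set_system nat) (UU : UltraFilter U).

(* Limits along an ultrafilter finer than oo replace the diagonal extraction. *)
Lemma bounded_ultra_cvg (a : nat -> R) (C : R) : (forall j, `|a j| <= C) ->
  exists l : R, a j @[j --> U] --> l.
Proof.
move=> aC; have PF : ProperFilter (a j @[j --> U]) by apply: fmap_proper_filter.
have FA : (a j @[j --> U]) `[- C, C]%classic.
  change (U (a @^-1` `[- C, C]%classic)); apply: (@filterS _ U _ setT); last exact: filterT.
  by move=> j _ /=; rewrite in_itv/= -ler_norml.
have [l [_ cl]] := @segment_compact R (- C) C _ PF FA.
exists l => A lA; have [//|nA] := @in_ultra_setVsetC _ U (a @^-1` A) UU.
have nFA : (a j @[j --> U]) (~` A) by exact: nA.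
by have [x [nAx Ax]] := cl _ _ nFA lA.
Qed.

(** A member of an ultrafilter finer than [\oo] meets every tail, so indices can be picked
    increasingly, one property at a time. *)
Lemma ultra_subsequence (P : nat -> nat -> Prop) : \oo `<=` U ->
  (forall k, U [set j | P k j]) ->
  exists2 s : nat -> nat, {homo s : i j / (i < j)%N} & forall k, P k (s k).
Proof.
move=> ooU UP; have ex k N : exists j, (N <= j)%N /\ P k j.
  have h : U ([set j | P k j] `&` [set j | (N <= j)%N]).
    by apply: filterI => //; apply: ooU; exists N.
  by have [j [Pj Nj]] := filter_ex h; exists j.
have [c cP] : {c : nat -> nat -> nat | forall k N, (N <= c k N)%N /\ P k (c k N)}.
  have /choice[c0 hc] : forall kN : nat * nat, exists j, (kN.2 <= j)%N /\ P kN.1 j by move=> [k N]; exact: ex.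
  by exists (fun k N => c0 (k, N)) => k N; exact: (hc (k, N)).
pose s := fix s k := if k is k'.+1 then c k (s k').+1 else c 0%N 0%N.
exists s; last by case=> [|k]; [have [] := cP 0%N 0%N|have [] := cP k.+1 (s k).+1].
apply: homo_ltn; first exact: ltn_trans.
by move=> k /=; have [] := cP k.+1 (s k).+1.
Qed.

End ultra_limits.

Lemma weakstar_arith (R : realType) (A B C D e d : R) : `|A - B| <= d -> d <= e / 3 ->
  `|C - B| <= e / 3 -> `|D - A| <= e / 3 -> `|D - C| <= e.
Proof.
rewrite !ler_norml => /andP[h1 h2] h3 /andP[h4 h5] /andP[h6 h7].
by apply/andP; split; lra.
Qed.

Section weakstar_compactness.
Context {R : realType} {n : nat}.
Notation X := 'rV[R]_n.
Notation mu := (@lebesgue_rV R n).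

Let rat_vec (k : nat) (v : {ffun 'I_n -> int}) : X := \row_i ((v i)%:~R / k.+1%:R).

(** Rounding the corners outwards to the grid of step 1/(k+1) approximates every box in L1 from a
    countable family, enumerated by [unpickle]. Countability is what lets one subsequence serve all
    boxes. *)
Lemma rational_boxes : exists D : nat -> X -> R,
  (forall i, intg mu (D i) /\ forall x, `|D i x| <= 1) /\
  forall (a b : X) (e : R), 0 < e -> exists i, \int[mu]_x `|\1_(cbox a b) x - D i x| < e.
Proof.
pose D (i : nat) : X -> R := if @unpickle (nat * {ffun 'I_n -> int} * {ffun 'I_n -> int})%type i is Some (k, v, w)
  then \1_(cbox (rat_vec k v) (rat_vec k w)) else fun=> 0.
exists D; split.
  move=> i; rewrite /D; case: unpickle => [[[k v] w]|].
    split; first exact: intg_indic_cbox.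
    by move=> x; rewrite ger0_norm ?indicE// lern1; case: (_ \in _).
  by split => [|x]; [exact: intg0|rewrite normr0].
move=> a b e e0.
pose va k : {ffun 'I_n -> int} := [ffun i => Num.floor (k.+1%:R * a 0 i)].
pose vb k : {ffun 'I_n -> int} := [ffun i => Num.ceil (k.+1%:R * b 0 i)].
pose A k := cbox (rat_vec k (va k)) (rat_vec k (vb k)).
have k0 k : 0 < (k.+1%:R : R) by rewrite ltr0n.
have aE k i : a 0 i - k.+1%:R^-1 <= rat_vec k (va k) 0 i <= a 0 i.
  rewrite !mxE ffunE; apply/andP; split.
    rewrite ler_pdivlMr// mulrBl mulVf ?gt_eqF// mulrC lerBlDr ltW//.
    by have := floorD1_gt (k.+1%:R * a 0 i); rewrite intrD.
  by rewrite ler_pdivrMr// mulrC floor_le.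
have bE k i : b 0 i <= rat_vec k (vb k) 0 i <= b 0 i + k.+1%:R^-1.
  rewrite !mxE ffunE; apply/andP; split.
    by rewrite ler_pdivlMr// mulrC ceil_ge.
  rewrite ler_pdivrMr// mulrDl mulVf ?gt_eqF// [b 0 i * _]mulrC.
  by have := ceilB1_lt (k.+1%:R * b 0 i); rewrite intrB ltrBlDr => /ltW.
pose BB : set X := cbox (\row_i (a 0 i - 1)) (\row_i (b 0 i + 1)).
have inv1 k : k.+1%:R^-1 <= 1 :> R by rewrite invf_le1// ler1n.
have [||||_ c _] := @dominated_cvg_int _ _ _ mu (fun k => \1_(A k)) \1_(cbox a b) _ _ _ (@intg_indic_cbox R n (\row_i (a 0 i - 1)) (\row_i (b 0 i + 1))).
- by move=> k; apply: measurable_indic; exact: measurable_cbox.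
- by apply: measurable_indic; exact: measurable_cbox.
- apply: aeW => x; have [xab|xab] := pselect (cbox a b x).
    rewrite indicE mem_set// (_ : (fun k => _) = (fun=> 1)); first exact: cvg_cst.
    apply/funext => k; rewrite indicE mem_set// => i; have /andP[h1 h2] := xab i.
    by have /andP[_ h3] := aE k i; have /andP[h4 _] := bE k i; rewrite (le_trans h3 h1) (le_trans h2 h4).
  rewrite indicE memNset//; apply: cvg_near_cst.
  have /existsNP[i hi] : ~ (forall i, a 0 i <= x 0 i <= b 0 i) by exact: xab.
  have [d d0 hd] : exists2 d : R, 0 < d & (x 0 i < a 0 i - d) \/ (b 0 i + d < x 0 i).
    move: hi => /negP; rewrite negb_and -!ltNge => /orP[h|h].
      by exists ((a 0 i - x 0 i) / 2); [rewrite divr_gt0// subr_gt0|left; lra].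
    by exists ((x 0 i - b 0 i) / 2); [rewrite divr_gt0// subr_gt0|right; lra].
  have [N hN] := exists_natSinv_lt d0.
  exists N => // k/= Nk; rewrite indicE memNset// => /(_ i) /andP[h1 h2].
  have kd : k.+1%:R^-1 < d by apply: le_lt_trans hN; rewrite lef_pV2 ?posrE// ler_nat.
  have /andP[h3 _] := aE k i; have /andP[_ h4] := bE k i.
  by move: kd h3 h4; move: (_^-1) => q kd h3 h4; case: hd => h; lra.
- apply: aeW => x k; rewrite ger0_norm ?indicE// ler_nat.
  have [xA|] := boolP (x \in A k) => //; rewrite (_ : x \in _)//.
  move: xA; rewrite !inE => xA i; rewrite !mxE; have /andP[h1 h2] := xA i.
  have /andP[h3 _] := aE k i; have /andP[_ h4] := bE k i; have := inv1 k.
  by move: h3 h4; move: (_^-1) => q h3 h4 h5; apply/andP; split; lra.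
have := c => /cvgrPdist_lt/(_ _ e0)[N _ /(_ N (leqnn N))].
rewrite /= sub0r normrN => /(le_lt_trans (ler_norm _)) h.
exists (pickle (N, va N, vb N)); rewrite /D pickleK.
by under eq_int do rewrite distrC.
Qed.

(** The limits along an ultrafilter exist for all integrable test functions at once and form a
    functional to which [L1_dual_density] applies. Only then is a subsequence extracted, on the
    countable family of [rational_boxes], and [L1_induction] extends the convergence to all of
    L1. *)
Lemma weakstar_compact (g : nat -> X -> R) (M : R) : 0 <= M ->
  (forall j, measurable_fun setT (g j)) -> (forall j x, 0 <= g j x <= M) ->
  exists (s : nat -> nat) (h : X -> R), [/\ {homo s : i j / (i < j)%N}, measurable_fun setT h,
    forall x, 0 <= h x <= M & forall psi, intg mu psi ->
      \int[mu]_x (psi x * g (s k) x) @[k --> \oo] --> \int[mu]_x (psi x * h x)].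
Proof.
move=> M0 mg gb; have gM j x : `|g j x| <= M by have /andP[g0 g1] := gb j x; rewrite ger0_norm.
have [U [UU ooU]] := @ultraFilterLemma nat \oo _.
have Ig psi j : intg mu psi -> intg mu (fun x => psi x * g j x).
  by move=> Ipsi; under eq_fun do rewrite mulrC; exact: (intgM_bounded Ipsi (mg j) (gM j)).
have bound psi j : intg mu psi -> `|\int[mu]_x (psi x * g j x)| <= M * \int[mu]_x `|psi x|.
  move=> Ipsi; have IN := intg_norm Ipsi; apply: le_trans (int_norm_le (Ig psi j Ipsi)) _.
  rewrite -(RintegralZl _ measurableT IN); apply: int_le; [exact: intg_norm (Ig psi j Ipsi)|exact: intgZ|].
  by move=> x; rewrite normrM mulrC; apply: ler_wpM2r.
have exT psi : exists l : R, intg mu psi -> \int[mu]_x (psi x * g j x) @[j --> U] --> l.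
  have [Ipsi|nI] := pselect (intg mu psi); last by exists 0.
  by have [l hl] := bounded_ultra_cvg UU (fun j => bound psi j Ipsi); exists l.
have [T TP] := choice exT.
have uniq (F : nat -> R) (l l' : R) : F j @[j --> U] --> l -> F j @[j --> U] --> l' -> l = l'.
  by move=> h1 h2; exact: (cvg_unique _ h1 h2).
have [h [mh hb hT]] : exists h : X -> R, [/\ measurable_fun setT h,
  forall x, 0 <= h x <= M & forall psi, intg mu psi -> T psi = \int[mu]_x (psi x * h x)].
  apply: L1_dual_density => //.
  - move=> f1 f2 I1 I2; apply: (uniq _ _ _ (TP _ (intgD I1 I2))).
    rewrite (_ : (fun j => _) = (fun j => \int[mu]_x (f1 x * g j x) + \int[mu]_x (f2 x * g j x))).
      by apply: cvgD; exact: TP.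
    apply/funext => j; rewrite -(RintegralD measurableT (Ig f1 j I1) (Ig f2 j I2)).
    by apply: eq_int => x; rewrite mulrDl.
  - move=> c f1 I1; apply: (uniq _ _ _ (TP _ (intgZ c I1))).
    rewrite (_ : (fun j => _) = (fun j => c * \int[mu]_x (f1 x * g j x))).
      by apply: cvgM; [exact: cvg_cst|exact: TP].
    apply/funext => j; rewrite -(RintegralZl _ measurableT (Ig f1 j I1)).
    by apply: eq_int => x; rewrite mulrA.
  - move=> f1 I1 f0; apply: (ler_cvg_to (cvg_cst (0 : R)) (TP _ I1)); apply: nearW => j.
    by apply: int_ge0 => x; rewrite mulr_ge0//; have /andP[] := gb j x.
  - move=> f1 I1; apply: (ler_cvg_to (cvg_norm (TP _ I1)) (cvg_cst _)); apply: nearW => j.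
    exact: bound.
have [D [DP Dd]] := rational_boxes.
(* At the k-th index the first k + 1 functions of the family are within 1/(k+1) of their ultrafilter
   limits; each requirement holds on a set of the ultrafilter, and finitely many can be
   intersected. *)
have [s smono sP] : exists2 s : nat -> nat, {homo s : i j / (i < j)%N} & forall k,
    forall i, (i <= k)%N -> `|T (D i) - \int[mu]_x (D i x * g (s k) x)| <= k.+1%:R^-1.
  apply: (@ultra_subsequence U UU (fun k j => forall i, (i <= k)%N ->
    `|T (D i) - \int[mu]_x (D i x * g j x)| <= k.+1%:R^-1) ooU) => k.
  have k0 : 0 < (k.+1%:R^-1 : R) by rewrite invr_gt0.
  have close i : U [set j | `|T (D i) - \int[mu]_x (D i x * g j x)| <= k.+1%:R^-1].
    by have := TP _ (DP i).1 => /cvgrPdist_le/(_ _ k0).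
  have all K : U [set j | forall i, (i < K)%N -> `|T (D i) - \int[mu]_x (D i x * g j x)| <= k.+1%:R^-1].
    elim: K => [|K IH]; first by apply: filterE.
    apply: filterS (filterI IH (close K)) => j [h1 h2] i; rewrite ltnS leq_eqVlt => /predU1P[->//|].
    exact: h1.
  by apply: filterS (all k.+1) => j hj i ik; apply: hj.
have hM x : `|h x| <= M by have /andP[h0 h1] := hb x; rewrite ger0_norm.
have Ih psi : intg mu psi -> intg mu (fun x => psi x * h x).
  by move=> Ipsi; under eq_fun do rewrite mulrC; exact: (intgM_bounded Ipsi mh hM).
have small (f1 f2 : X -> R) (e : R) k : 0 < e -> intg mu f1 -> intg mu f2 ->
    \int[mu]_x `|f1 x - f2 x| <= e / (3 * (M + 1)) ->
    `|\int[mu]_x (f1 x * g (s k) x) - \int[mu]_x (f2 x * g (s k) x)| <= e / 3 /\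
    `|\int[mu]_x (f1 x * h x) - \int[mu]_x (f2 x * h x)| <= e / 3.
  move=> e0 I1 I2 hi; have IBd := intgB I1 I2; have IN := intg_norm IBd.
  have h3 : M * \int[mu]_x `|f1 x - f2 x| <= e / 3.
    apply: le_trans (ler_wpM2l M0 hi) _.
    have M1 : M + 1 != 0 by rewrite gt_eqF// ltr_wpDl.
    rewrite (_ : M * _ = M / (M + 1) * (e / 3)); last by field.
    apply: ler_piMl; first by rewrite divr_ge0 ?ltW.
    by rewrite ler_pdivrMr ?mul1r ?lerDl// ltr_wpDl.
  split.
    rewrite -(RintegralB measurableT (Ig f1 (s k) I1) (Ig f2 (s k) I2)).
    rewrite (eq_int (fun x => (f1 x - f2 x) * g (s k) x)); last by move=> x; rewrite mulrBl.
    exact: le_trans (bound _ (s k) IBd) h3.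
  rewrite -(RintegralB measurableT (Ih f1 I1) (Ih f2 I2)).
  rewrite (eq_int (fun x => (f1 x - f2 x) * h x)); last by move=> x; rewrite mulrBl.
  apply: le_trans (int_norm_le (Ih _ IBd)) _; apply: le_trans h3.
  rewrite -(RintegralZl _ measurableT IN); apply: int_le; [exact: intg_norm (Ih _ IBd)|exact: intgZ|].
  by move=> x; rewrite normrM mulrC; apply: ler_wpM2r.
exists s, h; split => //; apply: L1_induction.
- move=> a b; apply/cvgrPdist_le => e e0.
  have e1 : 0 < e / (3 * (M + 1)) by rewrite divr_gt0// mulr_gt0// ltr_wpDl.
  have [i hi] := Dd a b _ e1; have [IDi _] := DP i.
  have Iab : intg mu \1_(cbox a b) by exact: intg_indic_cbox.
  have [N hN] : exists N, N.+1%:R^-1 < e / 3 by apply: exists_natSinv_lt; rewrite divr_gt0.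
  exists (maxn N i) => // k/=; rewrite geq_max => /andP[Nk ik].
  have h1 := sP k i ik; rewrite (hT _ IDi) in h1.
  have h2 : k.+1%:R^-1 < e / 3 by apply: le_lt_trans hN; rewrite lef_pV2 ?posrE ?ltr0n// ler_nat.
  have [h4 h5] := small _ _ e k e0 Iab IDi (ltW hi).
  exact: weakstar_arith h1 (ltW h2) h4 h5.
- move=> f1 f2 I1 I2 P1 P2.
  rewrite (_ : \int[mu]_x ((f1 x + f2 x) * h x) = \int[mu]_x (f1 x * h x) + \int[mu]_x (f2 x * h x)).
    rewrite (_ : (fun k => _) = (fun k => \int[mu]_x (f1 x * g (s k) x) + \int[mu]_x (f2 x * g (s k) x))).
      exact: cvgD.
    apply/funext => k; rewrite -(RintegralD measurableT (Ig f1 (s k) I1) (Ig f2 (s k) I2)).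
    by apply: eq_int => x; rewrite mulrDl.
  rewrite -(RintegralD measurableT (Ih f1 I1) (Ih f2 I2)).
  by apply: eq_int => x; rewrite mulrDl.
- move=> c f1 I1 P1.
  rewrite (_ : \int[mu]_x (c * f1 x * h x) = c * \int[mu]_x (f1 x * h x)).
    rewrite (_ : (fun k => _) = (fun k => c * \int[mu]_x (f1 x * g (s k) x))).
      by apply: cvgM => //; exact: cvg_cst.
    apply/funext => k; rewrite -(RintegralZl _ measurableT (Ig f1 (s k) I1)).
    by apply: eq_int => x; rewrite mulrA.
  rewrite -(RintegralZl _ measurableT (Ih f1 I1)).
  by apply: eq_int => x; rewrite mulrA.
- move=> f1 I1 H; apply/cvgrPdist_le => e e0.
  have e1 : 0 < e / (3 * (M + 1)) by rewrite divr_gt0// mulr_gt0// ltr_wpDl.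
  have [f2 [I2 P2 hi]] := H _ e1.
  have e3 : 0 < e / 3 by rewrite divr_gt0.
  have := P2 => /cvgrPdist_le/(_ _ e3); apply: filterS => k h1.
  have [h4 h5] := small f1 f2 e k e0 I1 I2 (ltW hi).
  exact: weakstar_arith h1 (lexx _) h4 h5.
Qed.

End weakstar_compactness.

Section strong_compactness.
Context {R : realType} {n : nat}.
Notation X := 'rV[R]_n.
Notation XT := ('rV[R]_n * measurableTypeR R)%type.
Notation W := 'rV[R]_n.+1.
Notation nu := (@space_time_measure R n).
Notation om := (@lebesgue_rV R n.+1).

Let uns := @rV_unsnoc R n.
Let muns : measurable_fun setT uns. Proof. exact: measurable_rV_unsnoc. Qed.
Let uns_mp A : measurable A -> om (uns @^-1` A) = nu A. Proof. exact: space_time_unsnoc. Qed.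

Lemma int_unsnoc (F : XT -> R) : measurable_fun setT F -> \int[nu]_z F z = \int[om]_w F (uns w).
Proof. by move=> mF; exact: (Rintegral_mp muns uns_mp mF). Qed.

Lemma intg_unsnoc (F : XT -> R) : intg nu F -> intg om (fun w => F (uns w)).
Proof. by move=> IF; exact: (integrable_mp muns uns_mp IF). Qed.

Lemma intg_snoc (F : W -> R) : intg om F -> intg nu (fun z => F (rV_snoc z)).
Proof.
move=> IF; have mp A (mA : measurable A) : nu (@rV_snoc R n @^-1` A) = om A by exact: space_time_snoc.
have H := @integrable_mp _ _ XT W R nu om _ (@measurable_rV_snoc R n) mp F IF.
exact: H.
Qed.

Lemma weakstar_compact_st (g : nat -> XT -> R) (M : R) : 0 <= M ->
  (forall j, measurable_fun setT (g j)) -> (forall j z, 0 <= g j z <= M) ->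
  exists (s : nat -> nat) (h : XT -> R), [/\ {homo s : i j / (i < j)%N}, measurable_fun setT h,
    forall z, 0 <= h z <= M & forall psi, intg nu psi ->
      \int[nu]_z (psi z * g (s k) z) @[k --> \oo] --> \int[nu]_z (psi z * h z)].
Proof.
move=> M0 mg gb.
have [s [h [smono mh hb hc]]] := @weakstar_compact R n.+1 (fun j w => g j (uns w)) M M0
  (fun j => measurableT_comp (mg j) muns) (fun j w => gb j (uns w)).
exists s, (fun z => h (rV_snoc z)); split => //.
  exact: (measurableT_comp mh (@measurable_rV_snoc R n)).
move=> psi Ipsi; have mpsi := intg_measurable Ipsi.
rewrite (int_unsnoc (F := fun z => psi z * h (rV_snoc z))); last first.
  by apply: measurable_funM => //; exact: (measurableT_comp mh (@measurable_rV_snoc R n)).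
rewrite (eq_int (fun w => psi (uns w) * h w)); last by move=> w; rewrite /uns rV_unsnocK.
rewrite (_ : (fun k => _) = (fun k => \int[om]_w (psi (uns w) * g (s k) (uns w)))).
  by apply: hc; exact: intg_unsnoc.
apply/funext => k; rewrite (int_unsnoc (F := fun z => psi z * g (s k) z))//.
exact: measurable_funM.
Qed.

Let unsD (x y : W) : uns (x + y) = (uns x : X * R) + uns y.
Proof. by congr pair; rewrite /= ?mxE//; apply/rowP => i; rewrite !mxE. Qed.

(* Mollifying turns the weak convergence into a pointwise one, and the
   translation hypothesis makes the mollification error uniform in k. *)
Lemma strong_compact (g : nat -> XT -> R) (p : XT -> R) (M r a b C : R) :
  (forall j, measurable_fun setT (g j)) -> (forall j z, 0 <= g j z <= M) ->
  measurable_fun setT p -> (forall z, 0 <= p z <= M) ->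
  (forall psi, intg nu psi ->
    \int[nu]_z (psi z * g k z) @[k --> \oo] --> \int[nu]_z (psi z * p z)) ->
  0 <= r -> 0 < a -> 0 <= C ->
  (forall k (y : X) (s eps : R), eps <= 1 -> eps <= a / 2 -> `|y| <= eps -> `|s| <= eps ->
    \int[nu]_z (\1_(cylinder r a b) z * `|g k ((z : X * R) + (y, s)) - g k z|) <= eps * C) ->
  \int[nu]_z (\1_(cylinder r a b) z * `|g k z - p z|) @[k --> \oo] --> 0.
Proof.
move=> mg gb mp pb weak r0 a0 C0 htr.
have gM j z : `|g j z| <= M by have /andP[h0 h1] := gb j z; rewrite ger0_norm.
have pM z : `|p z| <= M by have /andP[h0 h1] := pb z; rewrite ger0_norm.
have M0 : 0 <= M by exact: le_trans (pM 0).
pose S := cylinder r a b : set XT; pose S' : set W := uns @^-1` S.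
have mS : measurable S by exact: measurable_cylinder.
have IS : intg nu \1_S by exact: intg_cylinder.
have mS' : measurable S' by rewrite -[X in measurable X]setTI; exact: muns.
have IS' : intg om \1_S' by exact: (intg_unsnoc IS).
pose Rb := r + `|a| + `|b|; have Rb0 : 0 <= Rb by rewrite !addr_ge0.
(* The margin 1 exceeds the translations considered: truncation to this box gives integrable
   functions and leaves the translation differences on S' unchanged. *)
pose Big : set W := ball_box (Rb + 1).
have mBig : measurable Big by exact: measurable_cbox.
have IBig : intg om \1_Big by exact: intg_indic_cbox.
have SB w : S' w -> `|w| <= Rb.
  move=> /(cylinderP _ _ _ r0)[w1 /andP[w2 w3]]; apply: norm_ball_box => //; apply/ball_boxP => i.
  have [j ->|->] := unliftP ord_max i.
    have := le_trans (norm_coor (uns w).1 j) w1; rewrite /= mxE => h.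
    by rewrite (le_trans h)// /Rb -addrA lerDl addr_ge0.
  have h1 := ler_norm b; have h2 := ler_norm (- a); rewrite normrN in h2.
  have h3 := normr_ge0 a; have h4 := normr_ge0 b.
  by move: w2 w3 => /= w2 w3; rewrite /Rb ler_norml; apply/andP; split; lra.
have SBig w y : S' w -> `|y| <= 1 -> Big (w + y).
  by move=> /SB h1 h2; apply: ball_box_norm; rewrite (le_trans (ler_normD _ _))// lerD.
have loc (h : XT -> R) : measurable_fun setT h -> (forall z, `|h z| <= M) ->
    intg om (fun w => h (uns w) * \1_Big w) /\ forall w, `|h (uns w) * \1_Big w| <= M.
  move=> mh hM; split; first by apply: (intgM_bounded IBig (measurableT_comp mh muns)) => w; exact: hM.
  move=> w; rewrite normrM [X in _ * X]ger0_norm ?indicE//.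
  by apply: le_trans (hM (uns w)); rewrite ler_piMr// lern1; case: (_ \in _).
pose fk k (w : W) := g k (uns w) * \1_Big w; pose fp (w : W) := p (uns w) * \1_Big w.
have Ifk k := (loc (g k) (mg k) (gM k)).1; have fkM k := (loc (g k) (mg k) (gM k)).2.
have Ifp := (loc p mp pM).1; have fpM := (loc p mp pM).2.
have [K hK] := @mollifier_family R n.+1.
have aK := mollifier_approximate_identity hK.
have [Imp cmp] := moll_cvg aK Ifp fpM.
have inBig w : S' w -> (\1_Big w : R) = 1.
  by move=> wS; rewrite indicE mem_set// -[w]addr0; apply: SBig => //; rewrite normr0.
have step1 i k : (i.+1%:R^-1 : R) <= a / 2 -> 
    intg om (fun w => \1_S' w * `|moll (K i) (fk k) w - fk k w|) /\
    \int[om]_w (\1_S' w * `|moll (K i) (fk k) w - fk k w|) <= i.+1%:R^-1 * C.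
  move=> ia; have [tK K0 K1 Ks] := hK i.
  apply: (moll_err (test_intg tK) K0 K1 (Ifk k) (fkM k) mS') => y /Ks ye.
  have i1 : i.+1%:R^-1 <= 1 :> R by rewrite invf_le1// ler1n.
  have y1 : `|(uns y).1| <= i.+1%:R^-1.
    apply: le_trans ye; apply: norm_ball_box => //; apply/ball_boxP => j.
    by rewrite /= mxE; exact: norm_coor.
  have y2 : `|(uns y).2| <= i.+1%:R^-1 by apply: le_trans ye; exact: norm_coor.
  have := htr k (uns y).1 (uns y).2 _ i1 ia y1 y2.
  rewrite (int_unsnoc (F := fun z => \1_S z * `|g k ((z : X * R) + ((uns y).1, (uns y).2)) - g k z|)); last first.
    apply: measurable_funM; first exact: measurable_indic.
    apply: measurableT_comp => //; apply: measurable_funB => //.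
    exact: (measurableT_comp (mg k) (measurable_st_translate _)).
  congr (_ <= _); apply: eq_int => w.
  have [wS|wS] := pselect (S' w); last first.
    by rewrite [X in X * _ = _]indicE memNset// [X in _ = X * _]indicE memNset// !mul0r.
  rewrite /fk (inBig w wS) (_ : \1_Big (w + y) = 1) ?mulr1; last first.
    by rewrite indicE mem_set//; apply: SBig => //; exact: le_trans i1.
  by rewrite unsD.
have step3 i : \int[om]_w (\1_S' w * `|moll (K i) (fk k) w - moll (K i) fp w|) @[k --> \oo] --> 0.
  have [tK K0 K1 Ks] := hK i; have IK := test_intg tK; have mK := intg_measurable IK.
  have mm (h : W -> R) : intg om h -> (forall w, `|h w| <= M) -> measurable_fun setT (moll (K i) h).
    by move=> Ih hM; exact: (measurable_moll IK K0 (intg_measurable Ih) hM).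
  have [||||_ _] := @dominated_cvg_int _ _ _ om (fun k w => \1_S' w * `|moll (K i) (fk k) w - moll (K i) fp w|)
    (fun=> 0) _ _ _ (intgZ (M + M) IS').
  - move=> k; apply: measurable_funM; first exact: measurable_indic.
    by apply: measurableT_comp => //; apply: measurable_funB;
      [exact: (mm (fk k) (Ifk k) (fkM k))|exact: (mm fp Ifp fpM)].
  - exact: measurable_cst.
  - apply: aeW => x; rewrite -(mulr0 (\1_S' x)); apply: cvgM; first exact: cvg_cst.
    pose psi (z : XT) := K i (rV_snoc z - x) * \1_Big (rV_snoc z).
    have Ipsi : intg nu psi.
      apply: (@intg_snoc (fun y => K i (y - x) * \1_Big y)).
      under eq_fun do rewrite mulrC.
      apply: (intgM_bounded (intg_translate (- x) IK) (M := 1)); first exact: measurable_indic.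
      by move=> w; rewrite ger0_norm ?indicE// lern1; case: (_ \in _).
    have mE (h : XT -> R) : measurable_fun setT h -> (forall z, `|h z| <= M) ->
        moll (K i) (fun w => h (uns w) * \1_Big w) x = \int[nu]_z (psi z * h z).
      move=> mh hM; have [Ih _] := loc h mh hM.
      rewrite (moll_shift x mK (intg_measurable Ih)) (int_unsnoc (F := fun z => psi z * h z)); last first.
        by apply: measurable_funM => //; exact: intg_measurable Ipsi.
      by apply: eq_int => y; rewrite /psi /uns rV_unsnocK; ring.
    rewrite -(normr0 R) -(subrr (moll (K i) fp x)); apply: cvg_norm; apply: cvgB; last exact: cvg_cst.
    rewrite (_ : (fun k => _) = (fun k => \int[nu]_z (psi z * g k z))); last first.
      by apply/funext => k; exact: mE.
    by rewrite /fp mE//; exact: weak.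
  - apply: aeW => w k; rewrite normrM normr_id mulrC [X in _ * X]ger0_norm ?indicE//.
    apply: ler_wpM2r => //; apply: le_trans (ler_normB _ _) _; apply: lerD.
      exact: (moll_bound w IK (intg_measurable (Ifk k)) K0 K1 (fkM k)).
    exact: (moll_bound w IK (intg_measurable Ifp) K0 K1 fpM).
  by rewrite /Rintegral (integral0 om setT).
apply/cvgrPdist_le => e e0; have e3 : 0 < e / 3 by rewrite divr_gt0.
(* The kernel is fixed first, by bounds that are uniform in k; weak convergence is then used for
   this kernel alone. *)
have [i [ia iC ip]] : exists i, [/\ (i.+1%:R^-1 : R) <= a / 2, i.+1%:R^-1 * C <= e / 3 &
    \int[om]_w `|moll (K i) fp w - fp w| <= e / 3].
  have h1 : 0 < a / 2 by rewrite divr_gt0.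
  have h2 : 0 < e / 3 / (C + 1) by rewrite divr_gt0// ltr_wpDl.
  have [N1 hN1] := exists_natSinv_lt h1; have [N2 hN2] := exists_natSinv_lt h2.
  have := cmp => /cvgrPdist_le/(_ _ e3)[N3 _ hN3].
  pose i := maxn N3 (maxn N1 N2); exists i.
  have le N : (N <= i)%N -> i.+1%:R^-1 <= N.+1%:R^-1 :> R.
    by move=> Ni; rewrite lef_pV2 ?posrE ?ltr0n// ler_nat.
  split.
  - by rewrite (le_trans (le N1 _) (ltW hN1))// /i !leq_max leqnn orbT.
  - apply: le_trans (ler_wpM2r C0 (le_trans (le N2 _) (ltW hN2))) _; first by rewrite /i !leq_max leqnn !orbT.
    rewrite mulrAC -mulrA; apply: ler_piMr; first exact: ltW.
    by rewrite ler_pdivrMr ?mul1r ?lerDl// ltr_wpDl.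
  - by have := hN3 i (leq_maxl _ _); rewrite /= sub0r normrN => /(le_trans (ler_norm _)).
have := step3 i => /cvgrPdist_le/(_ _ e3); apply: filterS => k.
rewrite !sub0r !normrN => /(le_trans (ler_norm _)) h3.
have [I1 h1] := step1 i k ia.
have mD : measurable_fun setT (fun z : XT => \1_S z * `|g k z - p z|).
  apply: measurable_funM; first exact: measurable_indic.
  by apply: measurableT_comp => //; exact: measurable_funB.
rewrite ger0_norm; last by apply: int_ge0 => z; rewrite mulr_ge0// indicE.
rewrite (int_unsnoc mD).
have [tK K0 K1 Ks] := hK i; have IK := test_intg tK.
have Imm : intg om (fun w => \1_S' w * `|moll (K i) (fk k) w - moll (K i) fp w|).
  have mmd : measurable_fun setT (fun w => `|moll (K i) (fk k) w - moll (K i) fp w|).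
    apply: measurableT_comp => //; apply: measurable_funB.
      exact: (measurable_moll IK K0 (intg_measurable (Ifk k)) (fkM k)).
    exact: (measurable_moll IK K0 (intg_measurable Ifp) fpM).
  under eq_fun do rewrite mulrC; apply: (intgM_bounded IS' mmd (M := M + M)) => w.
  rewrite normr_id; apply: le_trans (ler_normB _ _) _; apply: lerD.
    exact: (moll_bound w IK (intg_measurable (Ifk k)) K0 K1 (fkM k)).
  exact: (moll_bound w IK (intg_measurable Ifp) K0 K1 fpM).
have IDw : intg om (fun w => \1_S (uns w) * `|g k (uns w) - p (uns w)|).
  apply: (@intg_unsnoc (fun z => \1_S z * `|g k z - p z|)).
  under eq_fun do rewrite mulrC; apply: (intgM_bounded IS (M := M + M)).
    by apply: measurableT_comp => //; exact: measurable_funB.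
  by move=> z; rewrite normr_id (le_trans (ler_normB _ _))// lerD.
apply: (@le_trans _ _ (\int[om]_w ((\1_S' w * `|moll (K i) (fk k) w - fk k w| +
   \1_S' w * `|moll (K i) (fk k) w - moll (K i) fp w|) + `|moll (K i) fp w - fp w|))).
  apply: int_le => //; first by apply: intgD => //; exact: intgD.
  move=> w; have [wS|wS] := pselect (S' w); last first.
    by rewrite [X in X * _ <= _]indicE memNset// mul0r !addr_ge0// mulr_ge0// indicE.
  rewrite [X in X * _ <= _]indicE mem_set// mul1r !indicE !mem_set// !mul1r.
  have -> : g k (uns w) - p (uns w) = (fk k w - moll (K i) (fk k) w) +
      (moll (K i) (fk k) w - moll (K i) fp w) + (moll (K i) fp w - fp w).
    by rewrite /fk /fp (inBig w wS) !mulr1; ring.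
  apply: le_trans (ler_normD _ _) _; rewrite lerD2r; apply: le_trans (ler_normD _ _) _.
  by rewrite lerD2r distrC.
rewrite (RintegralD measurableT (intgD I1 Imm) (Imp i)) (RintegralD measurableT I1 Imm).
by move: h1 h3 ip iC; move: (_ * C) => q h1 h3 ip iC; lra.
Qed.

End strong_compactness.

Lemma lipschitz_const (R : realType) (f : R -> R) : [lipschitz f x | x in [set: R]] ->
  exists2 L : R, 0 <= L & forall x y, `|f x - f y| <= L * `|x - y|.
Proof.
move=> /pinfty_ex_gt0[L L0 hL]; exists L; first exact: ltW.
by move=> x y; apply: (hL (x, y)).
Qed.

Section family.
Context {R : realType} {n : nat}.
Notation X := 'rV[R]_n.
Notation XT := ('rV[R]_n * measurableTypeR R)%type.
Notation mu := (@lebesgue_rV R n).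
Notation nu := (@space_time_measure R n).
Variables (f : R -> R) (L pM m : R) (rho_in : X -> R) (rho : XT -> R).
Hypothesis (L0 : 0 <= L) (pM0 : 0 < pM) (fpM : f pM <= 0).
Hypothesis f_lip : forall x y, `|f x - f y| <= L * `|x - y|.

Lemma pme_bounded_solution : 1 < m -> {ae mu, forall x, 0 <= rho_in x} -> intg mu rho_in ->
  {ae mu, forall x, pressure m (rho_in x) <= pM} -> pme_solution f m rho_in rho ->
  bounded_solution f pM m rho_in rho.
Proof. by move=> m1 h1 h2 h3 [[mrho _] rho0 _ lim]. Qed.

Hypothesis bs : bounded_solution f pM m rho_in rho.

Lemma initial_subsolution : stationary_pressure_subsolution f (pressure m \o rho_in) ->
  stationary_pressure_subsolution f (initial_pressure m pM rho_in).
Proof.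
have [[m1 in0 in_L1 in_le] mrho rho0 sol] := bs.
move=> sub phi tphi phi0; have := sub phi tphi phi0; congr (0 <= _).
have mrin := intg_measurable in_L1.
have mp1 : measurable_fun setT (pressure m \o rho_in) by exact: measurable_pressure.
have mp2 : measurable_fun setT (initial_pressure m pM rho_in) by exact: measurable_initial_pressure.
have mL : measurable_fun setT (space_laplacian phi).
  apply: measurable_sum => i; apply: continuous_measurable_rV.
  exact: (smooth_continuous (test_smooth (test_derive _ (test_derive _ tphi)))).
have mphi : measurable_fun setT phi.
  by apply: continuous_measurable_rV; exact: (smooth_continuous (test_smooth tphi)).
have mf := lipschitz_measurable f_lip.
have mI (p : X -> R) : measurable_fun setT p -> measurable_fun setT (fun x =>
    p x * space_laplacian phi x + f (p x) * \1_[set y | 0 < p y] x * phi x).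
  move=> mp; apply: measurable_funD; first exact: measurable_funM.
  apply: measurable_funM => //; apply: measurable_funM; first exact: (measurableT_comp mf mp).
  apply: measurable_indic; rewrite [X in measurable X](_ : _ = setT `&` p @^-1` `]0, +oo[).
    exact: mp.
  by rewrite setTI; apply/seteqP; split => x /=; rewrite in_itv/= andbT.
apply: int_eq_ae; [exact: mI|exact: mI|].
apply: filterS (initial_pressureE in_le) => x E.
have E2 : \1_[set y | 0 < (pressure m \o rho_in) y] x = \1_[set y | 0 < initial_pressure m pM rho_in y] x :> R.
  by rewrite !indicE; congr ((nat_of_bool _)%:R); apply/idP/idP; rewrite !inE/= E.
by rewrite E2 E.
Qed.

Lemma pme_nondecreasing : stationary_pressure_subsolution f (pressure m \o rho_in) ->
  nondecreasing_in_time (pressure m \o rho_in) (pressure m \o rho) /\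
  nondecreasing_in_time rho_in rho.
Proof.
move=> /initial_subsolution sub.
have [[m1 in0 in_L1 in_le] mrho rho0 sol] := bs.
have ge := solution_ge_initial m1 L0 pM0 f_lip in0 in_L1 in_le mrho sol sub.
have mono := solution_nondecreasing m1 L0 pM0 f_lip in0 in_L1 in_le mrho sol sub.
split; split => //.
- apply: filterS2 (ae_fst in0) ge => z h1 h2 z0 /=; apply: pressure_le => //; exact: h2.
- move=> h h0; apply: filterS2 rho0 (mono h h0) => z h1 h2 z0 /=.
  by apply: pressure_le => //; [exact: h1|exact: h2].
Qed.

Definition density_cap : R := Num.max 1 pM.

Lemma density_cap_ge1 : 1 <= density_cap. Proof. by rewrite /density_cap le_max lexx. Qed.

Lemma density_le_power : 1 < m -> density m pM <= density_cap `^ (m - 1)^-1.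
Proof.
move=> m1; have m0 : 0 < m by exact: lt_trans m1.
have m10 : 0 < m - 1 by rewrite subr_gt0.
apply: ge0_ler_powR; rewrite ?nnegrE ?invr_ge0 ?(ltW m10)//.
- by rewrite mulr_ge0 ?divr_ge0 ?ltW.
- exact: le_trans density_cap_ge1.
- apply: (@le_trans _ _ pM); last by rewrite /density_cap le_max lexx orbT.
  by apply: ler_piMl; [exact: ltW|rewrite ler_pdivrMr ?mul1r// gerDl lerN10].
Qed.

Lemma density_le_cap : 3 <= m -> density m pM <= density_cap.
Proof.
move=> m3; have m1 : 1 < m by rewrite (lt_le_trans _ m3)// ltr1n.
apply: le_trans (density_le_power m1) _; have c1 := density_cap_ge1.
rewrite -[leRHS]powRr1; last exact: le_trans c1.
apply: ler_powR => //; rewrite invf_le1; first by lra.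
by rewrite subr_gt0.
Qed.

Lemma pme_density_bound : {ae nu, forall z, space_time z -> 0 <= rho z <= density m pM}.
Proof.
have [[m1 in0 in_L1 in_le] mrho rho0 sol] := bs.
have le := solution_le m1 L0 pM0 fpM f_lip in0 in_L1 in_le mrho sol.
by apply: filterS2 rho0 le => z h1 h2 z0; rewrite h1// h2.
Qed.

Lemma initial_density_range : {ae mu, forall x, 0 <= rho_in x <= density m pM}.
Proof.
have [[m1 in0 in_L1 in_le] _ _ _] := bs.
apply: filterS (initial_densityE m1 in0 in_le) => x <-.
exact: initial_density_bound.
Qed.

Definition capped_density (z : XT) : R := Num.min (Num.max (extension rho z) 0) density_cap.

Lemma measurable_capped_density : measurable_fun setT capped_density.
Proof.
have [_ mrho _ _] := bs; apply: measurable_minr; last exact: measurable_cst.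
by apply: measurable_maxr; [exact: measurable_extension|exact: measurable_cst].
Qed.

Lemma capped_density_bound z : 0 <= capped_density z <= density_cap.
Proof.
have c1 := density_cap_ge1.
by rewrite /capped_density le_min le_max lexx orbT ge_min lexx orbT (le_trans _ c1).
Qed.

Lemma capped_densityE : 3 <= m -> {ae nu, forall z, space_time z -> capped_density z = rho z}.
Proof.
move=> m3; apply: filterS pme_density_bound => z h z0; have /andP[h1 h2] := h z0.
rewrite /capped_density extensionE// max_l// min_l//.
exact: le_trans (density_le_cap m3).
Qed.

End family.

Section subsequences.

Lemma subseq_ge (s : nat -> nat) : {homo s : i j / (i < j)%N} -> forall k, (k <= s k)%N.
Proof. by move=> hs; elim=> // k IH; apply: leq_ltn_trans IH _; apply: hs. Qed.

Lemma cvg_subsequence (T : topologicalType) (u : nat -> T) (l : T) (s : nat -> nat) :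
  {homo s : i j / (i < j)%N} -> u k @[k --> \oo] --> l -> u (s k) @[k --> \oo] --> l.
Proof.
move=> hs hu; apply: (@cvg_comp _ _ _ s u _ \oo) => //.
move=> A [N _ hN]; exists N => //= k Nk; apply: hN => /=.
exact: leq_trans Nk (subseq_ge hs k).
Qed.

End subsequences.

Section compact_sets.
Context {R : realType} {n : nat}.
Notation X := 'rV[R]_n.
Notation XT := ('rV[R]_n * measurableTypeR R)%type.

Lemma measurable_compact_st (K : set XT) : compact (K : set (X * R)) -> measurable K.
Proof.
move=> cK; have KE : K = setT `&` (@rV_snoc R n) @^-1` (@rV_unsnoc R n @^-1` K).
  by rewrite setTI; apply/seteqP; split => z /=; rewrite rV_snocK.
rewrite KE; apply: (@measurable_rV_snoc R n) => //.
rewrite -[X in measurable X]setCK; apply: measurableC; apply: open_measurable_rV.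
have oK : open (~` K : set (X * R)).
  by apply: closed_openC; apply: compact_closed => //; exact: norm_hausdorff.
have := open_comp _ oK; apply; move=> w _; exact: rV_unsnoc_continuous.
Qed.

(** The function 1/t is continuous on such a compact set, hence bounded there, which keeps the set
    away from time 0. *)
Lemma compact_in_slab (K : set XT) : compact (K : set (X * R)) -> K `<=` space_time ->
  exists j, K `<=` slab j.
Proof.
move=> cK Kst; have [M [_ hM]] := compact_bounded cK.
have cI : compact ((fun z : X * R => z.2^-1) @` K).
  apply: (@continuous_compact (X * R)%type R) => //.
  apply: continuous_in_subspaceT => z; rewrite inE => /Kst z0.
  apply: (@cvgV R (X * R)%type _ _ (fun z => z.2) z.2); last exact: cvg_snd.
  by rewrite gt_eqF.
have [M' [_ hM']] := compact_bounded cI.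
pose r : R := Num.max (M + 1) 1; pose q : R := Num.max (M' + 1) 1.
have q0 : 0 < q by rewrite lt_max ltr01 orbT.
have qV : 0 < q^-1 by rewrite invr_gt0.
have [j hj] := @in_slab R n r q^-1 r qV.
exists j => z Kz; have z0 : 0 < z.2 := Kst z Kz.
have zr : `|(z : X * R)| <= r.
  by apply: hM => //; rewrite /r lt_max ltrDl ltr01.
have z2q : `|z.2^-1| <= q.
  by apply: hM' => //; [rewrite /q lt_max ltrDl ltr01|exists z].
have [zr1 zr2] : `|z.1| <= r /\ `|z.2| <= r.
  by move: zr; rewrite prod_normE ge_max => /andP.
apply: hj => //; rewrite (le_trans (ler_norm _) zr2) andbT.
rewrite -[leRHS]invrK lef_pV2 ?posrE ?invr_gt0//.
exact: le_trans (ler_norm _) z2q.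
Qed.

End compact_sets.

(** * Extraction of a convergent subsequence *)

Section compactness.
Context {R : realType} {n : nat}.
Notation X := 'rV[R]_n.
Notation XT := ('rV[R]_n * measurableTypeR R)%type.
Notation mu := (@lebesgue_rV R n).
Notation nu := (@space_time_measure R n).
Variables (f : R -> R) (L pM : R).
Hypothesis (L0 : 0 <= L) (pM0 : 0 < pM) (fpM : f pM <= 0).
Hypothesis f_lip : forall x y, `|f x - f y| <= L * `|x - y|.
Variables (mm : nat -> R) (rin : nat -> X -> R) (rh : nat -> XT -> R).
Hypothesis mm3 : forall k, 3 <= mm k.
Hypothesis bs : forall k, bounded_solution f pM (mm k) (rin k) (rh k).
Hypothesis mono : forall k h, 0 < h ->
  {ae nu, forall z, space_time z -> rh k z <= rh k (z.1, z.2 + h)}.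

Let g k := capped_pressure pM (mm k) (rh k).
Let d k := capped_density pM (rh k).

Let mm1 k : 1 < mm k.
Proof. by apply: lt_le_trans (mm3 k); rewrite ltr1n. Qed.

Let mg k : measurable_fun setT (g k).
Proof. by have [_ mr _ _] := bs k; exact: measurable_capped_pressure. Qed.

Let gb k z : 0 <= g k z <= pM.
Proof. exact: capped_pressure_bound. Qed.

(** The pressures converge weakly along a first subsequence, and strongly along the same one by the
    translation estimates; the densities need a second extraction and almost everywhere convergence
    of the pressures a third. *)
Lemma pressures_compact : exists (s : nat -> nat) (p h : XT -> R),
  [/\ {homo s : i j / (i < j)%N},
   [/\ measurable_fun setT p, forall z, 0 <= p z <= pM, measurable_fun setT h &
     forall z, 0 <= h z <= density_cap pM],
   forall j, \int[nu]_z (\1_(slab j) z * `|g (s k) z - p z|) @[k --> \oo] --> 0,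
   {ae nu, forall z, space_time z -> g (s k) z @[k --> \oo] --> p z} &
   forall psi, intg nu psi ->
     \int[nu]_z (psi z * d (s k) z) @[k --> \oo] --> \int[nu]_z (psi z * h z)].
Proof.
have [s1 [p [hs1 mp pb hp]]] := weakstar_compact_st (ltW pM0) mg gb.
have md k : measurable_fun setT (d (s1 k)) by exact: (measurable_capped_density (bs (s1 k))).
have db k z : 0 <= d (s1 k) z <= density_cap pM by exact: capped_density_bound.
have c0 : 0 <= density_cap pM by exact: le_trans (density_cap_ge1 pM).
have [s2 [h [hs2 mh hb hh]]] := weakstar_compact_st c0 md db.
have L1 j : \int[nu]_z (\1_(slab j) z * `|g (s1 k) z - p z|) @[k --> \oo] --> 0.
  have j0 : 0 < j.+1%:R^-1 :> R by rewrite invr_gt0.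
  have [C C0 hC] := @general_translation R n f L pM L0 pM0 fpM f_lip j.+1%:R j.+1%:R^-1 j.+1%:R (ler0n _ _) j0.
  apply: (@strong_compact R n (fun k => g (s1 k)) p pM j.+1%:R j.+1%:R^-1 j.+1%:R C) => //.
  by move=> k y s eps e1 e2 ye se; apply: (hC (mm (s1 k)) (rin (s1 k)) (rh (s1 k))) => //; exact: mono.
have L1' j : \int[nu]_z (\1_(slab j) z * `|g (s1 (s2 k)) z - p z|) @[k --> \oo] --> 0.
  exact: (@cvg_subsequence R (fun k => \int[nu]_z (\1_(slab j) z * `|g (s1 k) z - p z|))).
(* The k-th index is fast on the k-th slab. As the slabs increase, every point of space-time is
   eventually covered, and no further diagonal extraction is needed. *)
have [|s3 hs3 fast] := @fast_subsequence (fun k j =>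
    \int[nu]_z (\1_(slab k) z * `|g (s1 (s2 j)) z - p z|) <= 2^-1 ^+ k).
  move=> k; have e0 : 0 < 2^-1 ^+ k :> R by rewrite exprn_gt0.
  have /cvgr0Pnorm_le/(_ _ e0) [N _ hN] := L1' k.
  by exists N => j Nj; apply: le_trans (ler_norm _) (hN j Nj).
exists (s1 \o s2 \o s3), p, h; split.
- by move=> i j ij /=; apply: hs1; apply: hs2; exact: hs3.
- by split.
- by move=> j; exact: (@cvg_subsequence R (fun k => \int[nu]_z (\1_(slab j) z * `|g (s1 (s2 k)) z - p z|))).
- pose G k z := \1_(slab k) z * `|g (s1 (s2 (s3 k))) z - p z|.
  have IG k : intg nu (G k).
    apply: (@intg_indic_bounded R n _ (fun z => `|g (s1 (s2 (s3 k))) z - p z|) (pM + pM)).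
    + exact: measurable_slab.
    + exact: (@intg_cylinder R n k.+1%:R k.+1%:R^-1 k.+1%:R).
    + by apply: (measurableT_comp (@normr_measurable _ _)); exact: measurable_funB.
    + move=> z; rewrite normr_id; apply: le_trans (ler_normB _ _) _.
      have /andP[g0 g1] := gb (s1 (s2 (s3 k))) z; have /andP[p0 p1] := pb z.
      by rewrite !ger0_norm// lerD.
  have G0 k z : 0 <= G k z by rewrite /G indicE mulr_ge0.
  have := ae_cvg0_fast IG G0 fast; apply: filterS => z Gz zst; have [j0 zj] := bigcup_slab zst.
  apply/cvgrPdist_le => e e0; have /cvgr0Pnorm_le/(_ _ e0) := Gz.
  have : \forall k \near \oo, (j0 <= k)%N by exact: nbhs_infty_ge.
  apply: filterS2 => k jk; rewrite /G indicE mem_set ?mul1r ?normr_id; last exact: slab_mono jk _ zj.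
  by rewrite distrC.
- move=> psi Ipsi.
  exact: (@cvg_subsequence R (fun k => \int[nu]_z (psi z * d (s1 (s2 k)) z)) _ _ hs3 (hh psi Ipsi)).
Qed.

End compactness.

Section convergence.
Context {R : realType} {n : nat}.
Notation X := 'rV[R]_n.
Notation XT := ('rV[R]_n * measurableTypeR R)%type.
Notation mu := (@lebesgue_rV R n).
Notation nu := (@space_time_measure R n).
Variables (f : R -> R) (L pM : R).
Hypothesis (L0 : 0 <= L) (pM0 : 0 < pM) (fpM : f pM <= 0).
Hypothesis f_lip : forall x y, `|f x - f y| <= L * `|x - y|.

Lemma intg_space_time (psi : XT -> R) : nu.-integrable space_time (EFin \o psi) <->
  intg nu (fun z => \1_space_time z * psi z).
Proof. exact: (@intg_indicP _ XT R nu space_time psi measurable_space_time). Qed.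

Section one_solution.
Variables (m : R) (rho_in : X -> R) (rho : XT -> R).
Hypothesis bs : bounded_solution f pM m rho_in rho.

Let m1 : 1 < m. Proof. by have [[]] := bs. Qed.

Lemma solution_Linfty : Linfty nu space_time rho.
Proof.
have [_ mrho _ _] := bs; split=> //; exists (density m pM).
have := pme_density_bound L0 pM0 fpM f_lip bs; apply: filterS => z h zst.
by have /andP[r0 r1] := h zst; rewrite ger0_norm.
Qed.

Lemma measurable_extension_pressure :
  measurable_fun setT (fun z : XT => pressure m (extension rho z)).
Proof.
by have [_ mrho _ _] := bs; apply: measurable_pressure; exact: measurable_extension.
Qed.

Lemma indic_pressureE (K : set XT) z : K `<=` space_time ->
  \1_K z * (pressure m \o rho) z = \1_K z * pressure m (extension rho z).
Proof.
move=> Kst; rewrite indicE; case: (boolP (z \in K)) => [|_]; last by rewrite !mul0r.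
by rewrite inE => /Kst zst; rewrite extensionE.
Qed.

Lemma intg_indic_pressure (K : set XT) : measurable K -> intg nu \1_K -> K `<=` space_time ->
  intg nu (fun z => \1_K z * (pressure m \o rho) z).
Proof.
move=> mK IK Kst; have [_ mrho _ _] := bs.
apply: (@intg_ae _ _ R nu (fun z => \1_K z * capped_pressure pM m rho z)).
- apply: (eq_measurable_fun (fun z => \1_K z * pressure m (extension rho z))).
    by move=> z _; rewrite indic_pressureE.
  by apply: measurable_funM; [exact: measurable_indic|exact: measurable_extension_pressure].
- apply: (@intg_indic_bounded R n K _ pM) => //; first exact: measurable_capped_pressure.
  move=> z; have /andP[g0 g1] := @capped_pressure_bound R n pM pM0 m rho z m1.
  by rewrite ger0_norm.
- have := capped_pressureE L0 pM0 fpM f_lip bs; apply: filterS => z ->.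
  by rewrite indic_pressureE.
Qed.

Lemma int_indic_pressure (K : set XT) (p : XT -> R) : measurable K -> K `<=` space_time ->
  measurable_fun setT (fun z => \1_K z * p z) ->
  \int[nu]_z (\1_K z * `|(pressure m \o rho) z - p z|) =
  \int[nu]_z (\1_K z * `|capped_pressure pM m rho z - p z|).
Proof.
move=> mK Kst mp; have [_ mrho _ _] := bs.
have E (q : XT -> R) z : \1_K z * `|q z - p z| = `|\1_K z * q z - \1_K z * p z|.
  by rewrite -mulrBr normrM indicE; case: (_ \in _); rewrite ?normr1 ?normr0.
apply: int_eq_ae.
- apply: (eq_measurable_fun (fun z => `|\1_K z * pressure m (extension rho z) - \1_K z * p z|)).
    by move=> z _; rewrite E indic_pressureE.
  apply: (measurableT_comp (@normr_measurable _ _)); apply: measurable_funB => //.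
  by apply: measurable_funM; [exact: measurable_indic|exact: measurable_extension_pressure].
- apply: (eq_measurable_fun (fun z => `|\1_K z * capped_pressure pM m rho z - \1_K z * p z|)).
    by move=> z _; rewrite E.
  apply: (measurableT_comp (@normr_measurable _ _)); apply: measurable_funB => //.
  by apply: measurable_funM; [exact: measurable_indic|exact: measurable_capped_pressure].
- have := capped_pressureE L0 pM0 fpM f_lip bs; apply: filterS => z gz.
  by rewrite !E indic_pressureE// gz.
Qed.

Lemma int_density (psi : XT -> R) : 3 <= m -> nu.-integrable space_time (EFin \o psi) ->
  \int[nu]_(z in space_time) (rho z * psi z) =
  \int[nu]_z (\1_space_time z * psi z * capped_density pM rho z).
Proof.
move=> m3 Ipsi; have [_ mrho _ _] := bs; rewrite int_indicE.
have I1 : intg nu (fun z => \1_space_time z * psi z).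
  exact: (iffLR (intg_space_time psi)).
have mp := intg_measurable I1.
have E z : \1_space_time z * (rho z * psi z) = \1_space_time z * psi z * extension rho z.
  by rewrite /extension indicE; case: (_ \in _); rewrite ?mul0r ?mul1r// mulrC.
under eq_int do rewrite E.
apply: int_eq_ae.
- by apply: measurable_funM => //; exact: measurable_extension.
- by apply: measurable_funM => //; exact: (measurable_capped_density bs).
- have := capped_densityE L0 pM0 fpM f_lip bs m3; apply: filterS => z h.
  rewrite indicE; case: (boolP (z \in space_time)) => [|_]; last by rewrite !mul0r.
  by rewrite inE => zst; rewrite h// extensionE.
Qed.

End one_solution.

Lemma compact_indic_intg (K : set XT) : compact (K : set (X * R)) -> K `<=` space_time ->
  intg nu \1_K.
Proof.
move=> cK Kst; have [j hj] := compact_in_slab cK Kst; have mK := measurable_compact_st cK.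
apply: intg_indic => //; apply: (@le_lt_trans _ _ (nu (slab j))).
  by apply: le_measure => //; rewrite inE//; exact: measurable_slab.
exact: (@cylinder_lty R n j.+1%:R j.+1%:R^-1 j.+1%:R).
Qed.

Variables (rho_in : R -> X -> R) (rho : R -> XT -> R) (m0 : R).
Hypothesis bs : forall m, 1 < m -> bounded_solution f pM m (rho_in m) (rho m).
Hypothesis mono : forall m, 1 < m -> m0 <= m -> forall h, 0 < h ->
  {ae nu, forall z, space_time z -> rho m z <= rho m (z.1, z.2 + h)}.

Lemma convergent_subsequence (mm : nat -> R) : (forall k, 1 < mm k) ->
  mm k @[k --> \oo] --> +oo ->
  exists2 s : nat -> nat, {homo s : i j / (i < j)%N} &
  exists p_inf rho_inf : XT -> R,
    [/\ L1loc_cvg (fun k => pressure (mm (s k)) \o rho (mm (s k))) p_inf,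
        ae_cvg nu space_time (fun k => pressure (mm (s k)) \o rho (mm (s k))) p_inf &
        weakstar_cvg nu space_time (fun k => rho (mm (s k))) rho_inf].
Proof.
move=> mm1 mmy.
(* The estimates require m >= 3 and m >= m0, which hold from the index N on; this is the origin of
   the shift by N below. *)
have [N hN] : exists N, forall k, (N <= k)%N -> 3 <= mm k /\ m0 <= mm k.
  have /cvgryPge/(_ (Num.max 3 m0)) [N _ hN] := mmy.
  by exists N => k Nk; have := hN k Nk; rewrite /= ge_max => /andP.
have NN k : (N <= k + N)%N by exact: leq_addl.
have [s [p [h [hs [mp pb mh hb] L1 aec wk]]]] := pressures_compact L0 pM0 fpM f_lip
  (fun k => (hN _ (NN k)).1) (fun k => bs (mm1 (k + N)%N))
  (fun k => mono (mm1 (k + N)%N) (hN _ (NN k)).2).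
exists (fun k => s k + N)%N; first by move=> i j ij; rewrite ltn_add2r hs.
exists p, h; split.
- move=> K cK Kst; have mK := measurable_compact_st cK; have IK := compact_indic_intg cK Kst.
  have mKp : measurable_fun setT (fun z => \1_K z * p z).
    by apply: measurable_funM => //; exact: measurable_indic.
  apply/L1_cvg_indic => //; split.
  + by move=> k; exact: (intg_indic_pressure (bs (mm1 _))).
  + apply: (@intg_indic_bounded R n K p pM) => // z.
    by have /andP[p0 p1] := pb z; rewrite ger0_norm.
  + have [j hj] := compact_in_slab cK Kst.
    under eq_fun do rewrite (int_indic_pressure (bs (mm1 _)))//.
    apply: (@squeeze_cvgr _ _ _ _ (fun=> 0) (fun k => \int[nu]_z (\1_(slab j) z * `|capped_pressure pM (mm (s k + N)%N) (rho (mm (s k + N)%N)) z - p z|))); [|exact: cvg_cst|exact: L1].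
    apply: nearW => k; rewrite int_ge0/=; last by move=> z; rewrite indicE mulr_ge0.
    have mg : measurable_fun setT (capped_pressure pM (mm (s k + N)%N) (rho (mm (s k + N)%N))).
      by have [_ mr _ _] := bs (mm1 (s k + N)%N); exact: measurable_capped_pressure.
    have I (S : set XT) : measurable S -> intg nu \1_S -> intg nu (fun z => \1_S z *
        `|capped_pressure pM (mm (s k + N)%N) (rho (mm (s k + N)%N)) z - p z|).
      move=> mS IS; apply: (@intg_indic_bounded R n S (fun z =>
        `|capped_pressure pM (mm (s k + N)%N) (rho (mm (s k + N)%N)) z - p z|) (pM + pM)) => //.
        by apply: (measurableT_comp (@normr_measurable _ _)); exact: measurable_funB.
      move=> z; rewrite normr_id; apply: le_trans (ler_normB _ _) _.
      have /andP[g0 g1] := @capped_pressure_bound R n pM pM0 _ (rho (mm (s k + N)%N)) z (mm1 (s k + N)%N).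
      by have /andP[p0 p1] := pb z; rewrite !ger0_norm// lerD.
    apply: int_le.
    * exact: I.
    * apply: I; first exact: measurable_slab.
      exact: (@intg_cylinder R n j.+1%:R j.+1%:R^-1 j.+1%:R).
    * move=> z; apply: ler_wpM2r => //; rewrite !indicE ler_nat.
      by case: (boolP (z \in K)) => //; rewrite inE => /hj zj; rewrite mem_set.
- have /ae_foralln E := fun k => capped_pressureE L0 pM0 fpM f_lip (bs (mm1 k)).
  near=> z; move=> zst.
  have E1 : forall k, capped_pressure pM (mm k) (rho (mm k)) z = pressure (mm k) (extension (rho (mm k)) z).
    by near: z; exact: E.
  have A : capped_pressure pM (mm (s k + N)%N) (rho (mm (s k + N)%N)) z @[k --> \oo] --> p z.
    by move: (zst); near: z; exact: aec.
  by apply: cvg_trans A; apply: near_eq_cvg; apply: nearW => k /=; rewrite E1 extensionE.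
- split.
  + by move=> k; exact: (solution_Linfty (bs (mm1 _))).
  + split; first exact: measurable_funTS.
    exists (density_cap pM); apply: aeW => z _.
    by have /andP[h0 h1] := hb z; rewrite ger0_norm.
  + move=> psi Ipsi.
    have I1 : intg nu (fun z => \1_space_time z * psi z).
      exact: (iffLR (intg_space_time psi)).
    under eq_fun do rewrite (int_density (bs (mm1 _)) (hN _ (NN _)).1 Ipsi).
    rewrite int_indicE (eq_int (fun z => \1_space_time z * psi z * h z)); first exact: wk.
    by move=> z; rewrite -mulrA [h z * _]mulrC.
Unshelve. all: by end_near. Qed.

End convergence.

(** * The limit of large exponents *)

Section large_exponent.
Context {R : realType}.

Lemma inv_exponent_cvg0 (mm : nat -> R) : mm k @[k --> \oo] --> +oo ->
  (mm k - 1)^-1 @[k --> \oo] --> (0 : R).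
Proof.
move=> mmy; apply/cvgrPdist_le => e e0.
have /cvgryPge/(_ (1 + e^-1)) := mmy; apply: filterS => k hk.
have eV : 0 < e^-1 by rewrite invr_gt0.
have mk : e^-1 <= mm k - 1 by rewrite lerBrDl.
have mk0 : 0 < mm k - 1 by exact: lt_le_trans mk.
by rewrite sub0r normrN gtr0_norm ?invr_gt0// -[leRHS]invrK lef_pV2.
Qed.

Lemma powR_inv_cvg1 (c : R) (mm : nat -> R) : 1 <= c -> mm k @[k --> \oo] --> +oo ->
  c `^ (mm k - 1)^-1 @[k --> \oo] --> (1 : R).
Proof.
move=> c1 mmy; have c0 : c != 0 by rewrite gt_eqF// (lt_le_trans ltr01).
under eq_fun do rewrite /powR (negbTE c0).
have : (mm k - 1)^-1 * ln c @[k --> \oo] --> 0 * ln c.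
  by apply: cvgM; [exact: inv_exponent_cvg0|exact: cvg_cst].
rewrite mul0r => h; have := @continuous_expR R 0; rewrite /continuous_at expR0 => ce.
exact: cvg_comp h ce.
Qed.

(* The tangent inequality of r^m at 1, read in the pressure variable. *)
Lemma pressure_gap_le (m r : R) : 1 < m -> 0 <= r -> (m - 1) * (pressure m r * (1 - r)) <= 1.
Proof.
move=> m1 r0; have m0 : 0 < m by exact: lt_trans m1.
have m10 : 0 < m - 1 by rewrite subr_gt0.
have := density_convex m1 (pressure_ge0 m1 r) (pressure_ge0 m1 1).
rewrite !pressureK// powR1 mul1r /pressure powR1 -(mulr_powRB1 r0 m0).
set q := r `^ (m - 1) => h.
have q0 : 0 <= q by exact: powR_ge0.
have E x : (m - 1) * (m / (m - 1) * x) = m * x.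
  by rewrite mulrA mulrCA divff ?mulr1// gt_eqF.
have h2 : (m - 1) * (m / (m - 1) * q - m / (m - 1) * 1) <= (m - 1) * (r * q - 1).
  by rewrite ler_pM2l.
rewrite mulrBr !E in h2; rewrite mulrA E.
have : 0 <= r * q by exact: mulr_ge0.
nra.
Qed.

(** Two different reasons for the two signs: for r < 1 the tangent inequality gives 1/(m-1), and for
    r > 1 the excess of the density over 1 is at most e - 1. *)
Lemma pressure_gap (m pM e r : R) : 1 < m -> 0 <= r <= e -> 1 <= e -> pressure m r <= pM ->
  `|pressure m r * (1 - r)| <= (m - 1)^-1 + pM * (e - 1).
Proof.
move=> m1 /andP[r0 re] e1 ppM; have m10 : 0 < m - 1 by rewrite subr_gt0.
have p0 := pressure_ge0 m1 r; have h := pressure_gap_le m1 r0.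
have h2 : pressure m r * (1 - r) <= (m - 1)^-1 by rewrite -(ler_pM2l m10) divff// gt_eqF.
have v0 : 0 <= (m - 1)^-1 by rewrite invr_ge0 ltW.
move: h2 v0; move: (_^-1) => v h2 v0; rewrite ler_norml; nra.
Qed.

Lemma power_pressure (m r : R) : 1 < m -> 0 <= r ->
  r `^ m = (m - 1) / m * (r * pressure m r).
Proof.
move=> m1 r0; have m0 : 0 < m by exact: lt_trans m1.
have m10 : 0 < m - 1 by rewrite subr_gt0.
rewrite /pressure -(mulr_powRB1 r0 m0); move: (_ `^ _) => q; field.
by rewrite !gt_eqF.
Qed.

End large_exponent.

Section weak_limits.
Context {R : realType} {n : nat}.
Notation X := 'rV[R]_n.
Notation XT := ('rV[R]_n * measurableTypeR R)%type.
Notation nu := (@space_time_measure R n).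

Lemma int_st_norm_le (M : R) (u psi : XT -> R) : measurable_fun space_time u ->
  {ae nu, forall z, space_time z -> `|u z| <= M} -> nu.-integrable space_time (EFin \o psi) ->
  intg nu (fun z => \1_space_time z * (u z * psi z)).
Proof.
move=> mu_ ub Ipsi; have I1 := iffLR (intg_space_time psi) Ipsi.
have mu1 := measurable_extension mu_; have mp := intg_measurable I1.
have E z : \1_space_time z * (u z * psi z) = (\1_space_time z * u z) * (\1_space_time z * psi z).
  by rewrite indicE; case: (_ \in _); rewrite ?mul0r ?mul1r.
pose v z := Num.min (Num.max (\1_space_time z * u z) (- `|M|)) `|M|.
apply: (@intg_ae _ _ R nu (fun z => v z * (\1_space_time z * psi z))).
- by apply: (eq_measurable_fun (fun z => (\1_space_time z * u z) * (\1_space_time z * psi z))) =>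
    [z _|]; [rewrite E|exact: measurable_funM].
- apply: (@intgM_bounded _ _ R nu `|M| (fun z => \1_space_time z * psi z) v I1).
    by apply: measurable_minr => //; exact: measurable_maxr.
  move=> z; rewrite ler_norml /v le_min ge_min le_max !lexx !orbT /=.
  by rewrite (le_trans _ (normr_ge0 M))// oppr_le0.
- apply: filterS ub => z h; rewrite E /v indicE; case: (boolP (z \in space_time)) => [|_].
    rewrite inE => /h; rewrite mul1r => /le_trans/(_ (ler_norm M)).
    by rewrite ler_norml => /andP[h1 h2]; rewrite max_l// min_l.
  by rewrite !mul0r mulr0.
Qed.

Lemma ae_bounded_weak_cvg (M : R) (u : nat -> XT -> R) (v : XT -> R) :
  (forall k, measurable_fun space_time (u k)) -> measurable_fun space_time v ->
  {ae nu, forall z, space_time z -> forall k, `|u k z| <= M} ->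
  {ae nu, forall z, space_time z -> u k z @[k --> \oo] --> v z} ->
  forall psi, nu.-integrable space_time (EFin \o psi) ->
  \int[nu]_(z in space_time) (u k z * psi z) @[k --> \oo] -->
  \int[nu]_(z in space_time) (v z * psi z).
Proof.
move=> mu_ mv ub uv psi Ipsi; have I1 := iffLR (intg_space_time psi) Ipsi.
have mp := intg_measurable I1.
have E w z : \1_space_time z * (w * psi z) = (\1_space_time z * w) * (\1_space_time z * psi z).
  by rewrite indicE; case: (_ \in _); rewrite ?mul0r ?mul1r.
have mm (w : XT -> R) : measurable_fun space_time w ->
    measurable_fun setT (fun z => \1_space_time z * (w z * psi z)).
  move=> mw; apply: (eq_measurable_fun (fun z => (\1_space_time z * w z) * (\1_space_time z * psi z))).
    by move=> z _; rewrite E.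
  by apply: measurable_funM => //; exact: measurable_extension.
rewrite int_indicE; under eq_fun do rewrite int_indicE.
have [|||||_ _ H] := @dominated_cvg_int _ _ R nu (fun k z => \1_space_time z * (u k z * psi z))
  (fun z => \1_space_time z * (v z * psi z)) (fun z => `|M| * `|\1_space_time z * psi z|); last exact: H.
- by move=> k; exact: mm.
- exact: mm.
- by apply: intgZ; exact: intg_norm.
- apply: filterS uv => z h; rewrite indicE; case: (boolP (z \in space_time)) => [|_].
    rewrite inE => /h h'; under eq_fun do rewrite mul1r; rewrite mul1r.
    by apply: cvgM => //; exact: cvg_cst.
  by under eq_fun do rewrite mul0r; rewrite mul0r; exact: cvg_cst.
- apply: filterS ub => z h k; rewrite E normrM; apply: ler_wpM2r => //.
  rewrite indicE; case: (boolP (z \in space_time)) => [|_]; last by rewrite mul0r normr0.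
  by rewrite inE mul1r => /h/(_ k) h'; exact: le_trans h' (ler_norm _).
Qed.

(* Test against the negative part of u on a slab. *)
Lemma weak_sign (u : XT -> R) : Linfty nu space_time u ->
  (forall psi, nu.-integrable space_time (EFin \o psi) -> (forall z, 0 <= psi z) ->
    0 <= \int[nu]_(z in space_time) (u z * psi z)) ->
  {ae nu, forall z, space_time z -> 0 <= u z}.
Proof.
move=> [mu_ [M0 ub0]] h.
pose M := `|M0| + 1.
have M_gt0 : 0 < M by rewrite ltr_wpDl.
have ub : {ae nu, forall z, space_time z -> `|u z| <= M}.
  apply: filterS ub0 => z hz /hz h1; apply: le_trans h1 _.
  by apply: le_trans (ler_norm _) _; rewrite lerDl.
apply: ae_slab => j.
pose w z := Num.min (Num.max (- (\1_space_time z * u z)) 0) M.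
have w0 z : 0 <= w z by rewrite /w le_min le_max lexx orbT ltW.
have wM z : w z <= M by rewrite /w ge_min lexx orbT.
have mw : measurable_fun setT w.
  apply: measurable_minr => //; apply: measurable_maxr => //.
  by apply: measurableT_comp => //; exact: measurable_extension.
have IS : intg nu \1_(slab j) by exact: (@intg_cylinder R n j.+1%:R j.+1%:R^-1 j.+1%:R).
have mS := @measurable_slab R n j.
pose psi z := \1_(slab j) z * w z.
have psi0 z : 0 <= psi z by rewrite /psi indicE mulr_ge0.
have Ipsi : intg nu psi.
  by apply: (@intg_indic_bounded R n (slab j) w M) => // z; rewrite ger0_norm.
have stpsi z : \1_space_time z * psi z = psi z.
  rewrite /psi [\1_(slab j) z]indicE; case: (boolP (z \in slab j)) => [|_]; last by rewrite mul0r mulr0.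
  by rewrite inE => /slab_space_time zst; rewrite indicE mem_set// mul1r.
have Ipsi' : nu.-integrable space_time (EFin \o psi).
  by apply: (iffRL (intg_space_time psi)); apply: eq_integrable Ipsi => // z _ /=; rewrite stpsi.
have Iw2 : intg nu (fun z => psi z * psi z).
  apply: (@intgM_bounded _ _ R nu M psi psi Ipsi); first exact: intg_measurable Ipsi.
  move=> z; rewrite ger0_norm// /psi indicE.
  by case: (_ \in _); rewrite ?mul1r ?mul0r ?wM// ltW.
have aeE : {ae nu, forall z, \1_space_time z * (u z * psi z) = - (psi z * psi z)}.
  apply: filterS ub => z hz; rewrite /psi [\1_(slab j) z]indicE.
  case: (boolP (z \in slab j)) => [|_]; last by rewrite !mul0r !mulr0 oppr0.
  rewrite inE => /slab_space_time zst; have := hz zst; rewrite /w !indicE mem_set// !mul1r.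
  rewrite ler_norml => /andP[h1 h2].
  have [u0|u0] := leP 0 (u z); first by rewrite max_r ?oppr_le0// min_l ?mulr0 ?oppr0// ltW.
  by rewrite max_l ?oppr_ge0 ?ltW// min_l ?mulrNN ?mulrN// lerNl.
have := h psi Ipsi' psi0; rewrite int_indicE.
rewrite (int_eq_ae _ _ aeE); first last.
- by apply: measurableT_comp => //; exact: intg_measurable Iw2.
- apply: (eq_measurable_fun (fun z => (\1_space_time z * u z) * psi z)).
    by move=> z _; rewrite -[in RHS](stpsi z) /= indicE; case: (_ \in _); rewrite ?mul0r ?mul1r.
  by apply: measurable_funM; [exact: measurable_extension|exact: intg_measurable Ipsi].
have EN : \int[nu]_z - (psi z * psi z) = - \int[nu]_z (psi z * psi z).
  under eq_int do rewrite -mulN1r; by rewrite (RintegralZl _ measurableT Iw2) mulN1r.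
rewrite EN oppr_ge0 => le0.
have : {ae nu, forall z, psi z * psi z = 0}.
  apply: int_norm0_ae => //.
  under eq_int do rewrite ger0_norm ?mulr_ge0//.
  by apply/eqP; rewrite eq_le le0 int_ge0// => z; rewrite mulr_ge0.
apply: filterS => z /eqP; rewrite mulf_eq0 orbb /psi => /eqP + zj; rewrite indicE mem_set// mul1r.
have zst := slab_space_time zj; rewrite /w indicE mem_set// mul1r => w00.
rewrite leNgt; apply/negP => uz.
by move: w00; rewrite max_l ?oppr_ge0 ?ltW// => /eqP; rewrite gt_eqF// lt_min oppr_gt0 uz.
Qed.

(** The product of a weak and an almost everywhere limit: r (q - q0) tends weakly to 0, since r is
    bounded and q - q0 tends to 0 boundedly, and q0 psi is itself integrable, hence an admissible
    test function for r. *)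
Lemma weak_strong_cvg (C B : R) (r q : nat -> XT -> R) (r0 q0 : XT -> R) :
  (forall k, measurable_fun space_time (r k)) ->
  (forall k, measurable_fun space_time (q k)) -> measurable_fun space_time q0 ->
  {ae nu, forall z, space_time z -> forall k, `|r k z| <= C} ->
  {ae nu, forall z, space_time z -> forall k, `|q k z| <= B} ->
  {ae nu, forall z, space_time z -> `|q0 z| <= B} ->
  {ae nu, forall z, space_time z -> q k z @[k --> \oo] --> q0 z} ->
  (forall psi, nu.-integrable space_time (EFin \o psi) ->
    \int[nu]_(z in space_time) (r k z * psi z) @[k --> \oo] -->
    \int[nu]_(z in space_time) (r0 z * psi z)) ->
  forall psi, nu.-integrable space_time (EFin \o psi) ->
  \int[nu]_(z in space_time) (r k z * q k z * psi z) @[k --> \oo] -->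
  \int[nu]_(z in space_time) (r0 z * q0 z * psi z).
Proof.
move=> mr mq mq0 rb qb q0b qq rr psi Ipsi.
have mst := @measurable_space_time R n.
have Iq : nu.-integrable space_time (EFin \o (fun z => q0 z * psi z)).
  by apply: (iffRL (intg_space_time _)); exact: int_st_norm_le q0b Ipsi.
have A := rr _ Iq.
have qd : {ae nu, forall z, space_time z -> forall k, `|r k z * (q k z - q0 z)| <= C * (B + B)}.
  near=> z => zst k; rewrite normrM; apply: ler_pM => //.
    by move: k; move: (zst); near: z; exact: rb.
  apply: le_trans (ler_normB _ _) _; apply: lerD.
    by move: k; move: (zst); near: z; exact: qb.
  by move: (zst); near: z; exact: q0b.
have mrq k : measurable_fun space_time (fun z => r k z * (q k z - q0 z)).
  by apply: measurable_funM => //; exact: measurable_funB.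
have Z : \int[nu]_(z in space_time) (r k z * (q k z - q0 z) * psi z) @[k --> \oo] -->
    \int[nu]_(z in space_time) (0 * psi z).
  apply: (@ae_bounded_weak_cvg (C * (B + B)) (fun k z => r k z * (q k z - q0 z)) (fun=> 0)) => //.
  near=> z => zst.
  have rC : forall k, `|r k z| <= C by move: (zst); near: z; exact: rb.
  have qc : q k z @[k --> \oo] --> q0 z by move: (zst); near: z; exact: qq.
  have C0 : 0 <= C by exact: le_trans (rC 0%N).
  apply/cvgr0Pnorm_le => e e0.
  have e1 : 0 < e / (C + 1) by rewrite divr_gt0// ltr_wpDl.
  have /cvgrPdist_le/(_ _ e1) := qc; apply: filterS => k hk.
  rewrite normrM distrC; apply: (@le_trans _ _ (C * (e / (C + 1)))); first exact: ler_pM.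
  rewrite mulrCA -[leRHS]mulr1; apply: ler_wpM2l; first exact: ltW.
  by rewrite ler_pdivrMr ?mul1r ?lerDl// ltr_wpDl.
have Z0 : \int[nu]_(z in space_time) (0 * psi z) = 0.
  by rewrite int_indicE; under eq_int do rewrite mul0r mulr0; rewrite /Rintegral integral0.
rewrite Z0 in Z.
have AZ : \int[nu]_(z in space_time) (r k z * (q0 z * psi z)) +
    \int[nu]_(z in space_time) (r k z * (q k z - q0 z) * psi z) @[k --> \oo] -->
    \int[nu]_(z in space_time) (r0 z * (q0 z * psi z)).
  by rewrite -[X in _ --> X]addr0; exact: cvgD.
have E0 : \int[nu]_(z in space_time) (r0 z * q0 z * psi z) = \int[nu]_(z in space_time) (r0 z * (q0 z * psi z)).
  by rewrite [LHS]int_indicE [RHS]int_indicE; apply: eq_int => z; rewrite mulrA.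
rewrite E0; apply: cvg_trans AZ; apply: near_eq_cvg; apply: nearW => k /=.
have I1 : intg nu (fun z => \1_space_time z * (r k z * (q0 z * psi z))).
  apply: (@int_st_norm_le C) => //; apply: filterS rb => z hz zst; exact: hz.
have I2 : intg nu (fun z => \1_space_time z * (r k z * (q k z - q0 z) * psi z)).
  apply: (@int_st_norm_le (C * (B + B))) => //; apply: filterS qd => z hz zst; exact: hz.
rewrite [X in X + _]int_indicE [X in _ + X]int_indicE [RHS]int_indicE -(RintegralD measurableT I1 I2).
by apply: eq_int => z; ring.
Unshelve. all: by end_near. Qed.

End weak_limits.

(** * Weak limits detected by smooth bumps *)

Section box_bump_limit.
Context {R : realType} {n : nat}.
Notation X := 'rV[R]_n.
Notation mu := (@lebesgue_rV R n).

Lemma hump_ge (s : R) : 0 < s -> 1 - s^-1 <= hump s.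
Proof. by move=> s0; rewrite humpE s0 expR_ge1Dx. Qed.

Lemma hump_square (k : nat) (s : R) : k.+1%:R^-1 <= s -> 1 - k.+1%:R^-1 <= hump (k.+1%:R ^+ 2 * s).
Proof.
move=> hs; have k0 : 0 < k.+1%:R :> R by [].
have ks : k.+1%:R <= k.+1%:R ^+ 2 * s.
  have h1 : 1 <= k.+1%:R * s by rewrite -ler_pdivrMl// mulr1.
  by rewrite expr2 -mulrA -[leLHS]mulr1 ler_pM2l.
have s0 : 0 < k.+1%:R ^+ 2 * s by exact: lt_le_trans ks.
by apply: le_trans (hump_ge s0); rewrite lerD2l lerN2 lef_pV2.
Qed.

(** The margin 1/(k+1) and the steepness (k+1)^2 are matched: on the box each hump has an argument
    of at least k + 1, hence a value of at least 1 - 1/(k+1), while the supports shrink to the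
    box. *)
Definition indicator_bump (a b : X) (k : nat) : X -> R :=
  box_bump (k.+1%:R ^+ 2) (a - const_mx k.+1%:R^-1) (b + const_mx k.+1%:R^-1).

Lemma indicator_bump_cvg (a b x : X) :
  indicator_bump a b k x @[k --> \oo] --> (\1_(cbox a b) x : R).
Proof.
have inv0 : k.+1%:R^-1 @[k --> \oo] --> (0 : R) by exact: cvg_harmonic.
have [xab|/existsNP[i xi]] := pselect (cbox a b x); rewrite indicE.
  rewrite mem_set//=; rewrite [X in _ --> X](_ : 1 = \prod_(i < n) 1); last by rewrite big1.
  apply: cvg_big => [|i _]; first exact: mul_continuous.
  rewrite -[X in _ --> X](mulr1 1); have /andP[h1 h2] := xab i.
  have H (s : nat -> R) : (forall k, k.+1%:R^-1 <= s k) ->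
      hump (k.+1%:R ^+ 2 * s k) @[k --> \oo] --> (1 : R).
    move=> hs; apply: (@squeeze_cvgr _ _ _ _ (fun k => 1 - k.+1%:R^-1) (fun=> 1)).
    - by apply: nearW => k; rewrite hump_square// hump_le1.
    - by rewrite -[X in _ --> X]subr0; apply: cvgB => //; exact: cvg_cst.
    - exact: cvg_cst.
  apply: cvgM; apply: H => k; rewrite !mxE.
  - by rewrite opprB addrCA lerDl subr_ge0.
  - by rewrite addrAC lerDr subr_ge0.
rewrite memNset; last by move=> xab; exact: xi (xab i).
rewrite [X in _ --> X]/=.
have [k0 hk0] : exists k, ~~ (a 0 i - k.+1%:R^-1 <= x 0 i <= b 0 i + k.+1%:R^-1).
  move/negP: xi; rewrite negb_and -!ltNge => /orP[h|h].
    have [k hk] := exists_natSinv_lt (e := a 0 i - x 0 i) ltac:(by rewrite subr_gt0).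
    by exists k; rewrite negb_and -!ltNge ltrBrDl -ltrBrDr hk.
  have [k hk] := exists_natSinv_lt (e := x 0 i - b 0 i) ltac:(by rewrite subr_gt0).
  by exists k; rewrite negb_and -!ltNge -ltrBrDl hk orbT.
apply: cvg_near_cst; exists k0 => // k /= kk; apply/eqP/negPn/negP => /box_bump_neq0 h.
have c0 : 0 < k.+1%:R ^+ 2 :> R by rewrite exprn_gt0.
have := h c0 i; rewrite !mxE => /andP[h1 h2]; move/negP: hk0; apply.
have kV : k.+1%:R^-1 <= k0.+1%:R^-1 :> R by rewrite lef_pV2 ?posrE ?ltr0n// ler_nat ltnS.
by rewrite (le_trans _ (ltW h1)) ?lerD2l ?lerN2//= (le_trans (ltW h2))// lerD2l.
Qed.

Lemma indicator_bump_le (a b x : X) (k : nat) :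
  0 <= indicator_bump a b k x <= \1_(cbox (a - const_mx 1) (b + const_mx 1)) x.
Proof.
have c0 : 0 < k.+1%:R ^+ 2 :> R by rewrite exprn_gt0.
rewrite box_bump_ge0 /=; have [->|/(box_bump_neq0 c0) h] := eqVneq (indicator_bump a b k x) 0.
  by rewrite indicE.
have kV : k.+1%:R^-1 <= 1 :> R by rewrite invf_le1// ler1n.
rewrite indicE mem_set; first exact: box_bump_le1.
move=> i; have := h i; rewrite !mxE => /andP[h1 h2].
by rewrite (le_trans _ (ltW h1)) ?lerD2l ?lerN2//= (le_trans (ltW h2))// lerD2l.
Qed.

Lemma indicator_bump_L1 (a b : X) : (forall k, intg mu (indicator_bump a b k)) /\
  \int[mu]_x `|indicator_bump a b k x - \1_(cbox a b) x| @[k --> \oo] --> 0.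
Proof.
have c0 k : 0 < k.+1%:R ^+ 2 :> R by rewrite exprn_gt0.
have I k : intg mu (indicator_bump a b k) by apply: test_intg; exact: test_box_bump.
split=> //.
have [|||||//] := @dominated_cvg_int _ _ R mu (indicator_bump a b) \1_(cbox a b)
  \1_(cbox (a - const_mx 1) (b + const_mx 1)).
- by move=> k; exact: intg_measurable (I k).
- by apply: measurable_indic; exact: measurable_cbox.
- exact: intg_indic_cbox.
- by apply: aeW => x; exact: indicator_bump_cvg.
- by apply: aeW => x k; have /andP[h1 h2] := indicator_bump_le a b x k; rewrite ger0_norm.
Qed.

End box_bump_limit.

Section weak_limit_from_tests.
Context {R : realType} {n : nat}.
Notation X := 'rV[R]_n.
Notation mu := (@lebesgue_rV R n).
Variables (r : nat -> X -> R) (C : R).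
Hypothesis mr : forall k, measurable_fun setT (r k).
Hypothesis rb : forall k x, 0 <= r k x <= C.
Hypothesis r_bumps : forall c (a b : X), 0 < c ->
  cvgn (fun k => \int[mu]_x (box_bump c a b x * r k x)).

Let T k psi := \int[mu]_x (psi x * r k x).

Let C0 : 0 <= C.
Proof. by have /andP[h1 h2] := rb 0%N 0; exact: le_trans h2. Qed.

Let IT k psi : intg mu psi -> intg mu (fun x => psi x * r k x).
Proof.
move=> I; under eq_fun do rewrite mulrC; apply: (intgM_bounded I (mr k)) => x.
by have /andP[h1 h2] := rb k x; rewrite ger0_norm//; exact: h2.
Qed.

Let TD k f g : intg mu f -> intg mu g -> T k (fun x => f x + g x) = T k f + T k g.
Proof.
move=> If Ig; rewrite /T -(RintegralD measurableT (IT k If) (IT k Ig)).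
by apply: eq_int => x; rewrite mulrDl.
Qed.

Let TZ k c f : intg mu f -> T k (fun x => c * f x) = c * T k f.
Proof.
move=> If; rewrite /T -(RintegralZl c measurableT (IT k If)).
by apply: eq_int => x; rewrite mulrA.
Qed.

Let T_bound k f : intg mu f -> `|T k f| <= C * \int[mu]_x `|f x|.
Proof.
move=> If; apply: le_trans (int_norm_le (IT k If)) _.
rewrite -(RintegralZl C measurableT (intg_norm If)); apply: int_le.
- exact: intg_norm (IT k If).
- by apply: intgZ; exact: intg_norm.
- move=> x; have /andP[h1 h2] := rb k x.
  by rewrite normrM mulrC [`|r k x|]ger0_norm// ler_wpM2r.
Qed.

Let T_closed f : intg mu f -> (forall e : R, 0 < e -> exists g,
    [/\ intg mu g, cvgn (fun k => T k g) & \int[mu]_x `|f x - g x| < e]) ->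
  cvgn (fun k => T k f).
Proof.
move=> If h; apply: cauchy_cvg; apply: cauchy_exP => e e0.
have d0 : 0 < e / 2 / (C + 1) by rewrite !divr_gt0// ltr_wpDl.
have [g [Ig cg fg]] := h _ d0; exists (limn (fun k => T k g)).
have e2 : 0 < e / 2 by rewrite divr_gt0.
have /cvgrPdist_lt/(_ _ e2) := cg; apply: filterS => k hk.
rewrite /ball /= -(subrK (T k g) (limn _)) -addrA.
apply: le_lt_trans (ler_normD _ _) _.
have -> : T k g - T k f = T k (fun x => g x + - 1 * f x).
  by rewrite TD ?TZ ?mulN1r//; exact: intgZ.
have IA : intg mu (fun x => g x + - 1 * f x) by apply: intgD => //; exact: intgZ.
have le2 : `|T k (fun x => g x + - 1 * f x)| <= e / 2.
  apply: le_trans (T_bound k IA) _.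
  apply: (@le_trans _ _ (C * (e / 2 / (C + 1)))).
    apply: ler_wpM2l => //; apply: le_trans (ltW fg); rewrite le_eqVlt; apply/orP; left.
    by apply/eqP; apply: eq_int => x; rewrite mulN1r distrC.
  rewrite mulrCA -[leRHS]mulr1; apply: ler_wpM2l; first exact: ltW.
  by rewrite ler_pdivrMr ?mul1r ?lerDl// ltr_wpDl.
by rewrite [ltRHS](splitr e) ltr_leD.
Qed.

Let T_cvg f : intg mu f -> cvgn (fun k => T k f).
Proof.
move: f; apply: (@L1_induction R n (fun f => cvgn (fun k => T k f))).
- move=> a b; apply: T_closed; first exact: intg_indic_cbox.
  move=> e e0; have [Ib hb] := @indicator_bump_L1 R n a b.
  have /cvgr0Pnorm_lt/(_ _ e0) [N _ hN] := hb.
  exists (indicator_bump a b N); split => //.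
    by apply: r_bumps; rewrite exprn_gt0.
  apply: le_lt_trans (hN N (leqnn N)); apply: le_trans (ler_norm _).
  by rewrite le_eqVlt; apply/orP; left; apply/eqP; apply: eq_int => x; rewrite distrC.
- move=> f g If Ig cf cg; under eq_fun do rewrite TD//.
  exact: is_cvgD.
- move=> c f If cf; under eq_fun do rewrite TZ//.
  by apply: is_cvgM => //; exact: is_cvg_cst.
- exact: T_closed.
Qed.

(** The limit equation yields convergence only against smooth test functions, and the limit is not
    known beforehand. Bumps approximate boxes in L1, the Cauchy criterion with the uniform bound C
    extends convergence to all of L1, and [L1_dual_density] represents the limit functional. *)
Lemma weak_limit_from_bumps : exists h : X -> R, [/\ measurable_fun setT h,
  forall x, 0 <= h x <= C & forall psi, intg mu psi ->
  \int[mu]_x (psi x * r k x) @[k --> \oo] --> \int[mu]_x (psi x * h x)].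
Proof.
have [||||h [mh hb hE]] := @L1_dual_density R n (fun psi => limn (fun k => T k psi)) C C0.
- move=> f g If Ig; under eq_fun do rewrite TD//.
  by rewrite limD//; exact: T_cvg.
- move=> c f If; under eq_fun do rewrite TZ//.
  by rewrite limM//; [rewrite lim_cst|exact: is_cvg_cst|exact: T_cvg].
- move=> f If f0; apply: limr_ge; first exact: T_cvg.
  apply: nearW => k; apply: int_ge0 => x.
  by have /andP[h1 h2] := rb k x; exact: mulr_ge0.
- move=> f If; apply/ler_normlP; split.
    rewrite lerNl; apply: limr_ge; first exact: T_cvg.
    by apply: nearW => k; have := T_bound k If; rewrite ler_norml => /andP[].
  apply: limr_le; first exact: T_cvg.
  by apply: nearW => k; have := T_bound k If; rewrite ler_norml => /andP[].
exists h; split => // psi Ipsi; rewrite -hE//; exact: T_cvg.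
Qed.

End weak_limit_from_tests.

(** * Identification of the limit equation and of the graph relation *)

Section incompressible_limit.
Context {R : realType} {n : nat}.
Notation X := 'rV[R]_n.
Notation XT := ('rV[R]_n * measurableTypeR R)%type.
Notation mu := (@lebesgue_rV R n).
Notation nu := (@space_time_measure R n).
Variables (f : R -> R) (L pM : R).
Hypothesis (L0 : 0 <= L) (pM0 : 0 < pM) (fpM : f pM <= 0).
Hypothesis f_lip : forall x y, `|f x - f y| <= L * `|x - y|.
Variables (mm : nat -> R) (rin : nat -> X -> R) (rh : nat -> XT -> R).
Hypothesis mmy : mm k @[k --> \oo] --> +oo.
Hypothesis bs : forall k, bounded_solution f pM (mm k) (rin k) (rh k).
Variables (p_inf rho_inf : XT -> R).
Let P k : XT -> R := pressure (mm k) \o rh k.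
Hypothesis PL1 : L1loc_cvg P p_inf.
Hypothesis Pae : ae_cvg nu space_time P p_inf.
Hypothesis rwk : weakstar_cvg nu space_time rh rho_inf.

Let mm1 k : 1 < mm k. Proof. by have [[]] := bs k. Qed.
Let mm0 k : 0 < mm k. Proof. exact: lt_trans (mm1 k). Qed.
Let mst := @measurable_space_time R n.
(** Upper bound of the k-th density; it tends to 1, which is where the constraint on the limit
    density originates. *)
Let e k := density_cap pM `^ (mm k - 1)^-1.

Let e_cvg : e k @[k --> \oo] --> (1 : R).
Proof. by apply: powR_inv_cvg1 => //; exact: density_cap_ge1. Qed.

Let e1 k : 1 <= e k.
Proof.
rewrite -(powRr0 (density_cap pM)); apply: ler_powR; first exact: density_cap_ge1.
by rewrite invr_ge0 subr_ge0 ltW.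
Qed.

Let eC : exists2 C : R, 1 <= C & forall k, e k <= C.
Proof.
have /cvg_seq_bounded[M [_ hM]] : cvgn e by apply/cvg_ex; exists 1.
have h k : e k <= M + 1.
  apply: le_trans (ler_norm _) _; apply: (hM (M + 1)) => //.
  by rewrite ltrDl.
by exists (M + 1) => //; exact: le_trans (e1 0%N) (h 0%N).
Qed.

Let mrh k : measurable_fun space_time (rh k). Proof. by have [] := bs k. Qed.

Let mP k : measurable_fun space_time (P k).
Proof.
apply: measurable_funM; first exact: measurable_cst.
exact: (measurableT_comp (measurable_powR _) (mrh k)).
Qed.

Let rb : {ae nu, forall z, space_time z -> forall k, 0 <= rh k z <= e k}.
Proof.
have /ae_foralln := fun k => pme_density_bound L0 pM0 fpM f_lip (bs k).
apply: filterS => z h zst k; have /andP[h1 h2] := h k zst; rewrite h1 /=.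
exact: le_trans h2 (density_le_power pM0 (mm1 k)).
Qed.

Let Pb : {ae nu, forall z, space_time z -> forall k, 0 <= P k z <= pM}.
Proof.
have /ae_foralln := fun k => extension_pressure_bound L0 pM0 fpM f_lip (bs k).
by apply: filterS => z h zst k; have := h k; rewrite extensionE.
Qed.

Let pb : {ae nu, forall z, space_time z -> 0 <= p_inf z <= pM}.
Proof.
near=> z => zst.
have c : P k z @[k --> \oo] --> p_inf z by move: (zst); near: z; exact: Pae.
have b : forall k, 0 <= P k z <= pM by move: (zst); near: z; exact: Pb.
rewrite -(cvg_lim _ c)//; apply/andP; split.
- by apply: limr_ge; [apply/cvg_ex; exists (p_inf z)|apply: nearW => k; have /andP[] := b k].
- by apply: limr_le; [apply/cvg_ex; exists (p_inf z)|apply: nearW => k; have /andP[] := b k].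
Unshelve. all: by end_near. Qed.

Let mp : measurable_fun space_time p_inf.
Proof.
have E : @space_time R n = \bigcup_j slab j.
  apply/seteqP; split => z; last by move=> [j _]; exact: slab_space_time.
  by move=> /bigcup_slab[j zj]; exists j.
rewrite E; apply/measurable_fun_bigcup => j; first exact: measurable_slab.
have [_ I _] := PL1 (@compact_slab R n j) (@slab_space_time R n j).
by have [mI _] := integrableP _ _ _ I; exact/measurable_EFinP.
Qed.

Lemma limit_pressure_Linfty : Linfty nu space_time p_inf.
Proof.
split=> //; exists pM; apply: filterS pb => z h zst.
by have /andP[h1 h2] := h zst; rewrite ger0_norm.
Qed.

Let F := `|f 0| + L * pM.

Let fb q : 0 <= q <= pM -> `|f q| <= F.
Proof.
move=> /andP[q0 qM]; have -> : f q = f 0 + (f q - f 0) by rewrite addrC subrK.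
apply: le_trans (ler_normD _ _) _; rewrite lerD2l.
by apply: le_trans (f_lip _ _) _; rewrite subr0 ger0_norm// ler_wpM2l.
Qed.

Let mf (q : XT -> R) : measurable_fun space_time q -> measurable_fun space_time (f \o q).
Proof. exact: (measurableT_comp (lipschitz_measurable f_lip)). Qed.

Let fPb : {ae nu, forall z, space_time z -> forall k, `|f (P k z)| <= F}.
Proof. by apply: filterS Pb => z h zst k; apply: fb; exact: h. Qed.

Let fpb : {ae nu, forall z, space_time z -> `|f (p_inf z)| <= F}.
Proof. by apply: filterS pb => z h zst; apply: fb; exact: h. Qed.

Let fP_cvg : {ae nu, forall z, space_time z -> f (P k z) @[k --> \oo] --> f (p_inf z)}.
Proof.
apply: filterS Pae => z h zst; have cf := @lipschitz_bound_continuous R R R L f f_lip (p_inf z).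
exact: (continuous_cvg _ cf (h zst)).
Qed.

Lemma reaction_weakstar : weakstar_cvg nu space_time (fun k => f \o P k) (f \o p_inf).
Proof.
split.
- move=> k; split; first exact: mf.
  by exists F; apply: filterS fPb => z h zst; exact: h.
- by split; [exact: mf|exists F; exact: fpb].
- apply: (@ae_bounded_weak_cvg R n F (fun k => f \o P k) (f \o p_inf)) => //.
  + by move=> k; exact: mf.
  + exact: mf.
Qed.

Let rC (C : R) : (forall k, e k <= C) ->
  {ae nu, forall z, space_time z -> forall k, `|rh k z| <= C}.
Proof.
move=> hC; apply: filterS rb => z h zst k; have /andP[h1 h2] := h zst k.
by rewrite ger0_norm//; exact: le_trans (hC k).
Qed.

(** [pressure_gap] with the bounds p_M and [e k]: both 1/(m-1) and p_M (e - 1) tend to 0. *)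
Let gap_cvg : {ae nu, forall z, space_time z -> P k z * (1 - rh k z) @[k --> \oo] --> 0}.
Proof.
near=> z => zst.
have r1 : forall k, 0 <= rh k z <= e k by move: (zst); near: z; exact: rb.
have P1 : forall k, 0 <= P k z <= pM by move: (zst); near: z; exact: Pb.
have B : (mm k - 1)^-1 + pM * (e k - 1) @[k --> \oo] --> 0 + pM * (1 - 1).
  apply: cvgD; first exact: inv_exponent_cvg0.
  by apply: cvgM; [exact: cvg_cst|apply: cvgB => //; exact: cvg_cst].
rewrite subrr mulr0 addr0 in B.
apply/cvgr0Pnorm_le => d d0; have /cvgr0Pnorm_le/(_ _ d0) := B.
apply: filterS => k; apply: le_trans; apply: le_trans (ler_norm _).
by apply: pressure_gap => //; have /andP[] := P1 k.
Unshelve. all: by end_near. Qed.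

Let density_pressure_cvg :
  {ae nu, forall z, space_time z -> rh k z * P k z @[k --> \oo] --> p_inf z}.
Proof.
near=> z => zst.
have c : P k z @[k --> \oo] --> p_inf z by move: (zst); near: z; exact: Pae.
have g : P k z * (1 - rh k z) @[k --> \oo] --> 0 by move: (zst); near: z; exact: gap_cvg.
have E k : rh k z * P k z = P k z - P k z * (1 - rh k z) by ring.
rewrite (_ : (fun k => _) = fun k => P k z - P k z * (1 - rh k z)); last exact/funext.
by rewrite -[X in _ --> X]subr0; exact: cvgB.
Unshelve. all: by end_near. Qed.

Let power_cvg :
  {ae nu, forall z, space_time z -> rh k z `^ mm k @[k --> \oo] --> p_inf z}.
Proof.
near=> z => zst.
have c : rh k z * P k z @[k --> \oo] --> p_inf z.
  by move: (zst); near: z; exact: density_pressure_cvg.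
have r1 : forall k, 0 <= rh k z <= e k by move: (zst); near: z; exact: rb.
have iv : (mm k)^-1 @[k --> \oo] --> (0 : R).
  have : (mm k + 1 - 1)^-1 @[k --> \oo] --> (0 : R).
    apply: inv_exponent_cvg0; apply/cvgryPge => A; have /cvgryPge/(_ A) := mmy.
    by apply: filterS => k hk; rewrite ler_wpDr.
  by under eq_fun do rewrite addrK.
have E k : rh k z `^ mm k = (1 - (mm k)^-1) * (rh k z * P k z).
  have /andP[h1 h2] := r1 k; rewrite power_pressure// mulrBl divff; last by rewrite gt_eqF.
  by rewrite mul1r.
rewrite (_ : (fun k => _) = fun k => (1 - (mm k)^-1) * (rh k z * P k z)); last exact/funext.
rewrite -[X in _ --> X]mul1r -[X in X * p_inf z]subr0.
by apply: cvgM => //; apply: cvgB => //; exact: cvg_cst.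
Unshelve. all: by end_near. Qed.

Let power_bound (C : R) : (forall k, e k <= C) ->
  {ae nu, forall z, space_time z -> forall k, `|rh k z `^ mm k| <= C * pM}.
Proof.
move=> hC; near=> z => zst k.
have r1 : forall k, 0 <= rh k z <= e k by move: (zst); near: z; exact: rb.
have P1 : forall k, 0 <= P k z <= pM by move: (zst); near: z; exact: Pb.
have /andP[h1 h2] := r1 k; have /andP[h3 h4] := P1 k.
rewrite power_pressure// normrM; have C0 : 0 <= C := le_trans (le_trans h1 h2) (hC k).
have a1 : `|(mm k - 1) / mm k| <= 1.
  by rewrite ger0_norm ?ler_pdivrMr ?mul1r ?gerDl ?divr_ge0 ?subr_ge0// ltW.
rewrite -[leRHS]mul1r; apply: ler_pM => //.
rewrite normrM !ger0_norm//; apply: ler_pM => //; exact: le_trans (hC k).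
Unshelve. all: by end_near. Qed.

Let reaction_term psi : nu.-integrable space_time (EFin \o psi) ->
  \int[nu]_(z in space_time) (rh k z * f (P k z) * psi z) @[k --> \oo] -->
  \int[nu]_(z in space_time) (rho_inf z * f (p_inf z) * psi z).
Proof.
have [C C1 hC] := eC; have [_ _ wk] := rwk.
apply: (@weak_strong_cvg R n C F rh (fun k => f \o P k) rho_inf (f \o p_inf)) => //.
- by move=> k; exact: mf.
- exact: mf.
- exact: rC.
Qed.

Let diffusion_term psi : nu.-integrable space_time (EFin \o psi) ->
  \int[nu]_(z in space_time) (rh k z `^ mm k * psi z) @[k --> \oo] -->
  \int[nu]_(z in space_time) (p_inf z * psi z).
Proof.
have [C C1 hC] := eC.
apply: (@ae_bounded_weak_cvg R n (C * pM) (fun k z => rh k z `^ mm k) p_inf) => //.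
- by move=> k; exact: (measurableT_comp (measurable_powR _) (mrh k)).
- exact: power_bound.
Qed.

(** The integrals of rho_k p_k psi have two limits: weak times strong convergence gives the product
    of the limits, and almost everywhere convergence of rho_k p_k gives the limit pressure alone.
    Their equality is the relation p (1 - rho) = 0. *)
Let saturation psi : nu.-integrable space_time (EFin \o psi) ->
  \int[nu]_(z in space_time) (rho_inf z * p_inf z * psi z) =
  \int[nu]_(z in space_time) (p_inf z * psi z).
Proof.
move=> Ipsi; have [C C1 hC] := eC; have [_ _ wk] := rwk.
have A : \int[nu]_(z in space_time) (rh k z * P k z * psi z) @[k --> \oo] -->
    \int[nu]_(z in space_time) (rho_inf z * p_inf z * psi z).
  apply: (@weak_strong_cvg R n C pM rh P rho_inf p_inf) => //.
  - exact: rC.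
  - by apply: filterS Pb => z h zst k; have /andP[h1 h2] := h zst k; rewrite ger0_norm.
  - by apply: filterS pb => z h zst; have /andP[h1 h2] := h zst; rewrite ger0_norm.
have B : \int[nu]_(z in space_time) (rh k z * P k z * psi z) @[k --> \oo] -->
    \int[nu]_(z in space_time) (p_inf z * psi z).
  apply: (@ae_bounded_weak_cvg R n (C * pM) (fun k z => rh k z * P k z) p_inf) => //.
  - by move=> k; exact: measurable_funM.
  - near=> z => zst k.
    have r1 : forall k, 0 <= rh k z <= e k by move: (zst); near: z; exact: rb.
    have P1 : forall k, 0 <= P k z <= pM by move: (zst); near: z; exact: Pb.
    have /andP[h1 h2] := r1 k; have /andP[h3 h4] := P1 k.
    by rewrite normrM !ger0_norm//; apply: ler_pM => //; exact: le_trans (hC k).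
exact: (cvg_unique _ A B).
Unshelve. all: by end_near. Qed.

Let intg_Linfty (u psi : XT -> R) : Linfty nu space_time u ->
  nu.-integrable space_time (EFin \o psi) ->
  nu.-integrable space_time (EFin \o (fun z => u z * psi z)).
Proof.
move=> [mu_ [M ub]] Ipsi; apply: (iffRL (intg_space_time _)).
exact: int_st_norm_le ub Ipsi.
Qed.

Let LinftyM (u v : XT -> R) : Linfty nu space_time u -> Linfty nu space_time v ->
  Linfty nu space_time (fun z => u z * v z).
Proof.
move=> [mu_ [M ub]] [mv [N vb]]; split; first exact: measurable_funM.
exists (M * N); apply: filterS2 ub vb => z h1 h2 zst; rewrite normrM.
by apply: ler_pM => //; [exact: h1|exact: h2].
Qed.

Let LinftyB (u v : XT -> R) : Linfty nu space_time u -> Linfty nu space_time v ->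
  Linfty nu space_time (fun z => u z - v z).
Proof.
move=> [mu_ [M ub]] [mv [N vb]]; split; first exact: measurable_funB.
exists (M + N); apply: filterS2 ub vb => z h1 h2 zst; apply: le_trans (ler_normB _ _) _.
by apply: lerD; [exact: h1|exact: h2].
Qed.

Let Linfty1 : Linfty nu space_time (fun=> 1).
Proof. by split; [exact: measurable_cst|exists 1; apply: aeW => z _; rewrite normr1]. Qed.

Let int_stB (u v psi : XT -> R) : Linfty nu space_time u -> Linfty nu space_time v ->
  nu.-integrable space_time (EFin \o psi) ->
  \int[nu]_(z in space_time) ((u z - v z) * psi z) =
  \int[nu]_(z in space_time) (u z * psi z) - \int[nu]_(z in space_time) (v z * psi z).
Proof.
move=> Lu Lv Ipsi.
rewrite -(RintegralB mst (intg_Linfty Lu Ipsi) (intg_Linfty Lv Ipsi)).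
by congr Rintegral; apply/funext => z; rewrite mulrBl.
Qed.

Let Lrho : Linfty nu space_time rho_inf. Proof. by have [] := rwk. Qed.

Let rho_inf_ge0 : {ae nu, forall z, space_time z -> 0 <= rho_inf z}.
Proof.
apply: weak_sign => // psi Ipsi psi0; have [Lk _ wk] := rwk.
rewrite -(cvg_lim _ (wk psi Ipsi))//; apply: limr_ge.
  by apply/cvg_ex; exists (\int[nu]_(z in space_time) (rho_inf z * psi z)); exact: wk.
apply: nearW => k; rewrite int_indicE.
have I : intg nu (fun z => \1_space_time z * (rh k z * psi z)).
  exact: (iffLR (intg_space_time _) (intg_Linfty (Lk k) Ipsi)).
have -> : (0 : R) = \int[nu]_z (0 : R) by rewrite /Rintegral (integral0 nu setT).
apply: int_le_ae => //; first exact: intg0.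
apply: filterS rb => z h; rewrite indicE; case: (boolP (z \in space_time)) => [|_].
  by rewrite inE => /h/(_ k) /andP[h1 _]; rewrite mul1r mulr_ge0.
by rewrite mul0r.
Qed.

(** Before the limit only [rh k <= e k] holds; the inequality passes to weak limits and [e k] tends
    to 1. *)
Let rho_inf_le1 : {ae nu, forall z, space_time z -> rho_inf z <= 1}.
Proof.
have [Lk _ wk] := rwk.
suff : {ae nu, forall z, space_time z -> 0 <= 1 - rho_inf z}.
  by apply: filterS => z h /h; rewrite subr_ge0.
apply: weak_sign => [|psi Ipsi psi0]; first exact: LinftyB.
rewrite int_stB// subr_ge0.
have B : e k * \int[nu]_(z in space_time) (1 * psi z) @[k --> \oo] -->
    1 * \int[nu]_(z in space_time) (1 * psi z).
  by apply: cvgM => //; exact: cvg_cst.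
rewrite [1 * \int[_]_(_ in _) _]mul1r in B.
rewrite -(cvg_lim _ (wk psi Ipsi))// -(cvg_lim _ B)//; apply: ler_lim.
- by apply/cvg_ex; exists (\int[nu]_(z in space_time) (rho_inf z * psi z)); exact: wk.
- by apply/cvg_ex; eexists; exact: B.
apply: nearW => k; rewrite int_indicE [X in _ <= _ * X]int_indicE.
have I : intg nu (fun z => \1_space_time z * (rh k z * psi z)).
  exact: (iffLR (intg_space_time _) (intg_Linfty (Lk k) Ipsi)).
have I1 : intg nu (fun z => \1_space_time z * (1 * psi z)).
  exact: (iffLR (intg_space_time _) (intg_Linfty Linfty1 Ipsi)).
rewrite -(RintegralZl (e k) measurableT I1); apply: int_le_ae => //; first exact: intgZ.
apply: filterS rb => z h; rewrite indicE; case: (boolP (z \in space_time)) => [|_].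
  by rewrite inE => /h/(_ k) /andP[_ h2]; rewrite !mul1r ler_wpM2r.
by rewrite !mul0r mulr0.
Qed.

Lemma limit_in_graph : in_hele_shaw_graph rho_inf p_inf.
Proof.
have Lp := limit_pressure_Linfty; have Lrp := LinftyM Lrho Lp.
have S psi : nu.-integrable space_time (EFin \o psi) ->
    \int[nu]_(z in space_time) (p_inf z * psi z) =
    \int[nu]_(z in space_time) (rho_inf z * p_inf z * psi z) by move=> /saturation ->.
have h1 : {ae nu, forall z, space_time z -> 0 <= p_inf z - rho_inf z * p_inf z}.
  apply: weak_sign => [|psi Ipsi psi0]; first exact: LinftyB.
  by rewrite (int_stB Lp Lrp)// S// subrr.
have h2 : {ae nu, forall z, space_time z -> 0 <= rho_inf z * p_inf z - p_inf z}.
  apply: weak_sign => [|psi Ipsi psi0]; first exact: LinftyB.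
  by rewrite (int_stB Lrp Lp)// S// subrr.
near=> z => zst.
have a1 : 0 <= p_inf z - rho_inf z * p_inf z by move: (zst); near: z; exact: h1.
have a2 : 0 <= rho_inf z * p_inf z - p_inf z by move: (zst); near: z; exact: h2.
have a3 : 0 <= p_inf z <= pM by move: (zst); near: z; exact: pb.
have a4 : 0 <= rho_inf z by move: (zst); near: z; exact: rho_inf_ge0.
have a5 : rho_inf z <= 1 by move: (zst); near: z; exact: rho_inf_le1.
split=> //; apply/hele_shaw_graphP; split => //; first by have /andP[] := a3.
by apply/eqP; rewrite eq_le; apply/andP; split; lra.
Unshelve. all: by end_near. Qed.

Hypothesis sol : forall k, distributional_solution (rin k) (rh k) (fun z => rh k z `^ mm k)
  (fun z => rh k z * f (pressure (mm k) (rh k z))).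

Let intg_st (psi : XT -> R) : intg nu psi -> nu.-integrable space_time (EFin \o psi).
Proof. by move=> I; apply: integrableS I => //; exact: subsetT. Qed.

Let split3 (u1 u2 u3 g1 g2 g3 : XT -> R) : Linfty nu space_time u1 ->
  Linfty nu space_time u2 -> Linfty nu space_time u3 ->
  intg nu g1 -> intg nu g2 -> intg nu g3 ->
  \int[nu]_(z in space_time) (u1 z * g1 z + u2 z * g2 z + u3 z * g3 z) =
  \int[nu]_(z in space_time) (u1 z * g1 z) + \int[nu]_(z in space_time) (u2 z * g2 z) +
  \int[nu]_(z in space_time) (u3 z * g3 z).
Proof.
move=> L1 L2 L3 /intg_st I1 /intg_st I2 /intg_st I3.
have J1 := intg_Linfty L1 I1; have J2 := intg_Linfty L2 I2; have J3 := intg_Linfty L3 I3.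
rewrite -(RintegralD mst J1 J2) -(RintegralD mst (integrableD mst J1 J2) J3).
by [].
Qed.

Let limit_part (phi : XT -> R) := \int[nu]_(z in space_time)
  (rho_inf z * dt phi z + p_inf z * laplacian phi z + rho_inf z * f (p_inf z) * phi z).

(** The equation for each k expresses the initial integral by space-time integrals, all of which
    converge. No convergence of the initial data is assumed. *)
Let initial_cvg (phi : XT -> R) : test_function (phi : X * R -> R) ->
  \int[mu]_x (rin k x * phi (x, 0)) @[k --> \oo] --> - limit_part phi.
Proof.
move=> tphi; have [I1 [I2 I3]] := test_laplacian_intg tphi.
have [C C1 hC] := eC; have [Lk _ wk] := rwk.
have Lpow k : Linfty nu space_time (fun z => rh k z `^ mm k).
  split; first exact: (measurableT_comp (measurable_powR _) (mrh k)).
  by exists (C * pM); apply: filterS (power_bound hC) => z h zst; exact: h.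
have LfP k : Linfty nu space_time (fun z => rh k z * f (P k z)).
  by have [Lr _ _] := reaction_weakstar; exact: (LinftyM (Lk k) (Lr k)).
have E k : \int[mu]_x (rin k x * phi (x, 0)) =
    - (\int[nu]_(z in space_time) (rh k z * dt phi z) +
       \int[nu]_(z in space_time) (rh k z `^ mm k * laplacian phi z) +
       \int[nu]_(z in space_time) (rh k z * f (P k z) * phi z)).
  rewrite -(split3 (Lk k) (Lpow k) (LfP k) I3 I2 I1).
  by apply/eqP; rewrite -addr_eq0 addrC; apply/eqP; exact: (sol k tphi).
under eq_fun do rewrite E.
have Lf : Linfty nu space_time (fun z => rho_inf z * f (p_inf z)).
  by have [_ Lr _] := reaction_weakstar; exact: (LinftyM Lrho Lr).
rewrite /limit_part (split3 Lrho limit_pressure_Linfty Lf I3 I2 I1).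
apply: cvgN; apply: cvgD; first apply: cvgD.
- by apply: wk; exact: intg_st.
- by apply: diffusion_term; exact: intg_st.
- by apply: reaction_term; exact: intg_st.
Qed.

(** The initial datum of the limit is constructed from the limits given by [initial_cvg]; the limit
    equation then follows from the uniqueness of these limits. *)
Lemma limit_initial : exists2 rho_in_inf : X -> R,
  weakstar_cvg mu setT rin rho_in_inf &
  distributional_solution rho_in_inf rho_inf p_inf (fun z => rho_inf z * f (p_inf z)).
Proof.
have [C C1 hC] := eC.
have mrin k : measurable_fun setT (rin k).
  by have [[_ _ I _] _ _ _] := bs k; exact: intg_measurable I.
have inb k : {ae mu, forall x, 0 <= rin k x <= C}.
  have := initial_density_range pM0 (bs k); apply: filterS => x /andP[h1 h2].
  rewrite h1 /= (le_trans h2)// (le_trans _ (hC k))//.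
  exact: density_le_power.
pose r k x := Num.min (Num.max (rin k x) 0) C.
have C0 : 0 <= C by exact: le_trans C1.
have mr k : measurable_fun setT (r k).
  by apply: measurable_minr => //; exact: measurable_maxr.
have rbd k x : 0 <= r k x <= C.
  by rewrite /r le_min le_max lexx orbT C0 ge_min lexx orbT.
have rE k psi : measurable_fun setT psi ->
    \int[mu]_x (rin k x * psi x) = \int[mu]_x (psi x * r k x).
  move=> mpsi; apply: int_eq_ae; [exact: measurable_funM|exact: measurable_funM|].
  apply: filterS (inb k) => x /andP[h1 h2].
  by rewrite /r max_l// min_l// mulrC.
have [|h [mh hb hh]] := @weak_limit_from_bumps R n r C mr rbd.
(* The time factor is positive at time 0, so that the trace of this space-time test function is a
   non-zero multiple of the spatial bump. *)
- move=> c a b c0; pose phi := @space_time_bump R n c a b (- 1) 1.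
  have tphi : test_function phi by exact: test_space_time_bump.
  have t0 : 0 < time_bump c (- 1) 1 0 by apply: time_bump_gt0 => //; rewrite oppr_lt0 ltr01.
  have mb : measurable_fun setT (box_bump c a b).
    by apply: continuous_measurable_rV; exact: (smooth_continuous (smooth_box_bump c a b)).
  have E k : \int[mu]_x (box_bump c a b x * r k x) =
      (time_bump c (- 1) 1 0)^-1 * \int[mu]_x (rin k x * phi (x, 0)).
    rewrite (rE k (fun x => phi (x, 0))); last first.
      apply: (eq_measurable_fun (fun x => box_bump c a b x * time_bump c (- 1) 1 0)) => //.
      by apply: measurable_funM.
    have I : intg mu (fun x => box_bump c a b x * r k x).
      under eq_fun do rewrite mulrC.
      apply: (intgM_bounded (test_intg (test_box_bump a b c0)) (mr k)) => x.
      by have /andP[h1 h2] := rbd k x; rewrite ger0_norm//; exact: h2.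
    have -> : \int[mu]_x (phi (x, 0) * r k x) =
        \int[mu]_x (time_bump c (- 1) 1 0 * (box_bump c a b x * r k x)).
      by apply: eq_int => x; rewrite /phi /space_time_bump /= mulrA [time_bump _ _ _ _ * _]mulrC.
    by rewrite (RintegralZl _ measurableT I) mulKf// gt_eqF.
  under eq_fun do rewrite E.
  apply: is_cvgM; first exact: is_cvg_cst.
  by apply/cvg_ex; exists (- limit_part phi); exact: initial_cvg.
have W (psi : X -> R) : intg mu psi ->
    \int[mu]_x (rin k x * psi x) @[k --> \oo] --> \int[mu]_x (h x * psi x).
  move=> Ipsi; under eq_fun do rewrite (rE _ _ (intg_measurable Ipsi)).
  rewrite (eq_int (fun x => psi x * h x)); first exact: hh.
  by move=> x; rewrite mulrC.
exists h.
  split.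
  - move=> k; split => //; exists C; apply: filterS (inb k) => x /andP[h1 h2] _.
    by rewrite ger0_norm.
  - by split=> //; exists C; apply: aeW => x _; have /andP[h1 h2] := hb x; rewrite ger0_norm.
  - exact: W.
move=> phi tphi.
have tphi' : test_function (phi : X * R -> R) by [].
have Iphi : intg mu (fun x => phi (x, 0)).
  have [B B0 hB] := test_bounded tphi'; have [M M0 hM] := test_support tphi'.
  apply: (intg_supp (measurable_cbox (const_mx (- M)) (const_mx M))
    (lebesgue_cbox_lty (const_mx (- M)) (const_mx M)) _ (fun x : X => hB (x, 0))).
    apply: (measurableT_comp (f := phi) (g := fun x : X => (x, 0) : XT)).
      exact: (continuous_measurable_space_time (smooth_continuous (test_smooth tphi'))).
    by apply: measurable_fun_pair => //; exact: measurable_cst.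
  move=> x nx; apply/eqP; apply: contrapT => /negP /hM xr; apply: nx.
  by apply: ball_box_norm; apply: le_trans (norm_fst_le _) xr.
have A := W _ Iphi; have B := initial_cvg tphi'.
by rewrite (cvg_unique _ A B) // addrN.
Qed.

End incompressible_limit.

Theorem proposition1p3 (R : realType) (n : nat) (hn : (1 <= n)%N)
  (f : R -> R) (f_lip : [lipschitz f x | x in [set: R]])
  (pM : R) (pM_gt0 : 0 < pM) (f_le0 : forall p : R, pM <= p -> f p <= 0)
  (rho_in : R -> 'rV[R]_n -> R)
  (rho_in_ge0 : forall m : R, 1 < m ->
     {ae space_measure, forall x : 'rV[R]_n, 0 <= rho_in m x})
  (rho_in_L1 : forall m : R, 1 < m ->
     space_measure.-integrable [set: 'rV[R]_n] (EFin \o rho_in m))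
  (p_in_le : forall m : R, 1 < m ->
     {ae space_measure, forall x : 'rV[R]_n, pressure m (rho_in m x) <= pM})
  (rho : R -> 'rV[R]_n * measurableTypeR R -> R)
  (rho_sol : forall m : R, 1 < m -> pme_solution f m (rho_in m) (rho m))
  (m0 : R)
  (p_in_sub : forall m : R, 1 < m -> m0 <= m ->
     stationary_pressure_subsolution f (pressure m \o rho_in m)) :
  (forall m : R, 1 < m -> m0 <= m ->
     nondecreasing_in_time (pressure m \o rho_in m) (pressure m \o rho m) /\
     nondecreasing_in_time (rho_in m) (rho m))
  /\
  (forall mm : nat -> R, (forall k, 1 < mm k) -> mm k @[k --> \oo] --> +oo ->
     exists2 s : nat -> nat, {homo s : i j / (i < j)%N} &
     exists p_inf rho_inf : 'rV[R]_n * measurableTypeR R -> R,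
       [/\ L1loc_cvg (fun k => pressure (mm (s k)) \o rho (mm (s k))) p_inf,
           ae_cvg space_time_measure space_time
             (fun k => pressure (mm (s k)) \o rho (mm (s k))) p_inf &
           weakstar_cvg space_time_measure space_time
             (fun k => rho (mm (s k))) rho_inf])
  /\
  (forall (mm : nat -> R) (p_inf rho_inf : 'rV[R]_n * measurableTypeR R -> R),
     (forall k, 1 < mm k) -> mm k @[k --> \oo] --> +oo ->
     L1loc_cvg (fun k => pressure (mm k) \o rho (mm k)) p_inf ->
     ae_cvg space_time_measure space_time
       (fun k => pressure (mm k) \o rho (mm k)) p_inf ->
     weakstar_cvg space_time_measure space_time
       (fun k => rho (mm k)) rho_inf ->
     [/\ Linfty space_time_measure space_time p_inf,
         weakstar_cvg space_time_measure space_time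
           (fun k => f \o (pressure (mm k) \o rho (mm k))) (f \o p_inf),
         (exists2 rho_in_inf : 'rV[R]_n -> R,
            weakstar_cvg space_measure [set: 'rV[R]_n]
              (fun k => rho_in (mm k)) rho_in_inf &
            distributional_solution rho_in_inf rho_inf p_inf
              (fun z => rho_inf z * f (p_inf z))) &
         in_hele_shaw_graph rho_inf p_inf]).
Proof.
have [L L0 Lf] := lipschitz_const f_lip.
have fpM : f pM <= 0 by exact: f_le0.
have bs m : 1 < m -> bounded_solution f pM m (rho_in m) (rho m).
  move=> m1; apply: pme_bounded_solution => //; [exact: rho_in_ge0|exact: rho_in_L1|exact: p_in_le|exact: rho_sol].
have mono m : 1 < m -> m0 <= m ->
    nondecreasing_in_time (pressure m \o rho_in m) (pressure m \o rho m) /\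
    nondecreasing_in_time (rho_in m) (rho m).
  by move=> m1 mm0; apply: (pme_nondecreasing L0 pM_gt0 Lf (bs m m1)); exact: p_in_sub.
split; [exact: mono|split].
  apply: (convergent_subsequence L0 pM_gt0 fpM Lf bs (m0 := m0)).
  by move=> m m1 mm0 h h0; have [_ [_]] := mono m m1 mm0; apply.
move=> mm p_inf rho_inf mm1 mmy PL1 Pae rwk.
have bsk k := bs _ (mm1 k).
have solk k : distributional_solution (rho_in (mm k)) (rho (mm k)) (fun z => rho (mm k) z `^ mm k)
    (fun z => rho (mm k) z * f (pressure (mm k) (rho (mm k) z))).
  by have [] := rho_sol _ (mm1 k).
split.
- exact: (limit_pressure_Linfty L0 pM_gt0 fpM Lf bsk PL1 Pae).
- exact: (reaction_weakstar L0 pM_gt0 fpM Lf bsk PL1 Pae).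
- exact: (limit_initial L0 pM_gt0 fpM Lf mmy bsk PL1 Pae rwk solk).
- exact: (limit_in_graph L0 pM_gt0 fpM Lf mmy bsk PL1 Pae rwk).
Qed.
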